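(* Let $n\ge3$, $s\in(0,n/2)$, and let $P_s$ be the conformally covariant operator of order $2s$ on the round sphere $(\mathbb{S}^n,g_{\mathbb{S}^n})$, $$P_s=\frac{\Gamma\left(B+\frac12+s\right)}{\Gamma\left(B+\frac12-s\right)},\qquad B=\sqrt{-\Delta_{g_{\mathbb{S}^n}}+\left(\tfrac{n-1}{2}\right)^2},$$ and $d_{n,s}=\frac{\Gamma(\frac n2+s)}{\Gamma(\frac n2-s)}=P_s(1)$. Let $f:(0,+\infty)\to\mathbb{R}$ be continuous and consider $$P_su-d_{n,s}u=f(u),\qquad u>0\ \text{ on }\mathbb{S}^n.\qquad(\ast)$$ Assume that $h_s(t):=t^{-\frac{n+2s}{n-2s}}\big(f(t)+d_{n,s}t\big)$ is decreasing on $(0,+\infty)$, and, if $s>1$, that in addition $h_s(t)t^{\frac{n+2s}{n-2s}}$ is nondecreasing on $(0,+\infty)$. Then any continuous solution of $(\ast)$ is constant. In particular, if $f(t)=t^p-\lambda t$ with $p>1$, $\lambda>0$, $p\le\frac{n+2s}{n-2s}$ and $\lambda\le d_{n,s}$, with at least one of these two inequalities strict, then the only positive solution of $(\ast)$ is the constant $u\equiv\lambda^{\frac1{p-1}}$.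
   Context: $\Delta_{g_{\mathbb{S}^n}}$ is the Laplace–Beltrami operator of the round metric; $P_s$ is defined by functional calculus. *)

(* Defs.v *)
From HB Require Import structures.
From mathcomp Require Import all_boot all_order all_algebra.
From mathcomp Require Import all_classical all_reals all_analysis.
Set Implicit Arguments. Unset Strict Implicit. Unset Printing Implicit Defensive.
Import Order.TTheory GRing.Theory Num.Theory.
Import numFieldNormedType.Exports.
Local Open Scope classical_set_scope.
Local Open Scope ring_scope.

Section Defs.
Variable R : realType.

Definition Gamma (x : R) : R :=
  Rintegral lebesgue_measure `]0, +oo[%classic (fun t => t `^ (x - 1) * expR (- t)).

Definition enorm (N : nat) (x : 'rV[R]_N) : R := Num.sqrt (\sum_(i < N) x 0 i ^+ 2).

Definition sphere (n : nat) : set 'rV[R]_(n.+1) := [set x | enorm x = 1].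
Arguments sphere n _ : clear implicits.

Definition normalize (N : nat) (x : 'rV[R]_N) : 'rV[R]_N := (enorm x)^-1 *: x.

Definition ebasis (N : nat) (i : 'I_N) : 'rV[R]_N := delta_mx 0 i.

(* Iterated Lebesgue integral over R^N, coordinate by coordinate
   (agrees with the Lebesgue integral on R^N for the integrable
   integrands used below, by Fubini). *)
Fixpoint iint_aux (N : nat) (k : nat) (g : 'rV[R]_N -> R) (v : 'rV[R]_N) : R :=
  match k with
  | 0 => g v
  | k'.+1 => Rintegral lebesgue_measure setT
      (fun t => iint_aux k' g (\row_j (if nat_of_ord j == k' then t else v 0 j)))
  end.
Definition iint (N : nat) (g : 'rV[R]_N -> R) : R := iint_aux N g 0.

(* Integral over S^n w.r.t. the normalized (rotation invariant) surface
   measure, realized as the push-forward of the Gaussian measure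
   pi^(-(n+1)/2) e^(-|x|^2) dx under x |-> x/|x|.  Only the values of g on
   the sphere matter. *)
Definition sphere_int (n : nat) (g : 'rV[R]_(n.+1) -> R) : R :=
  iint (fun x => g (normalize x) * expR (- (enorm x ^+ 2))) / pi `^ ((n.+1)%:R / 2).

Definition laplacian (N : nat) (F : 'rV[R]_N -> R) (x : 'rV[R]_N) : R :=
  \sum_(i < N) derive (fun y => derive F y (ebasis i)) x (ebasis i).

(* phi (through its values on S^n) is a classical (C^2) eigenfunction of
   -Laplace-Beltrami on S^n with eigenvalue mu.  The Laplace-Beltrami
   operator of a function on S^n is the Euclidean Laplacian of its
   0-homogeneous extension F = phi o normalize, evaluated on S^n; F is
   required to be C^2 on R^(n+1) \ {0}. *)
Definition sph_eigen (n : nat) (phi : 'rV[R]_(n.+1) -> R) (mu : R) : Prop :=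
  let F := fun x => phi (normalize x) in
  (forall x, x != 0 -> forall i, derivable F x (ebasis i)) /\
  (forall x, x != 0 -> forall i j,
      derivable (fun y => derive F y (ebasis i)) x (ebasis j) /\
      {for x, continuous (fun y => derive (fun z => derive F z (ebasis i)) y (ebasis j))}) /\
  (forall x, sphere n x -> - laplacian F x = mu * phi x).

(* Spectral multiplier of P_s = Gamma(B+1/2+s)/Gamma(B+1/2-s),
   B = sqrt(-Delta + ((n-1)/2)^2), on the mu-eigenspace of -Delta. *)
Definition Ps_mult (n : nat) (s mu : R) : R :=
  let b := Num.sqrt (mu + ((n%:R - 1) / 2) ^+ 2) in
  Gamma (b + 2^-1 + s) / Gamma (b + 2^-1 - s).

Definition dns (n : nat) (s : R) : R := Gamma (n%:R / 2 + s) / Gamma (n%:R / 2 - s).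

(* u solves P_s u - d_{n,s} u = f(u) on S^n in the sense of distributions,
   P_s being defined by functional calculus: for every eigenfunction phi of
   -Delta with eigenvalue mu, <P_s u, phi> = Ps_mult mu <u, phi>. *)
Definition is_solution (n : nat) (s : R) (f : R -> R) (u : 'rV[R]_(n.+1) -> R) : Prop :=
  forall (phi : 'rV[R]_(n.+1) -> R) (mu : R), sph_eigen phi mu ->
    Ps_mult n s mu * sphere_int (fun x => u x * phi x)
    = sphere_int (fun x => (dns n s * u x + f (u x)) * phi x).

Arguments is_solution n s f u : clear implicits.

Definition pos_cont_solution (n : nat) (s : R) (f : R -> R) (u : 'rV[R]_(n.+1) -> R) : Prop :=
  {within sphere n, continuous u} /\ (forall x, sphere n x -> 0 < u x) /\ is_solution n s f u.

Arguments pos_cont_solution n s f u : clear implicits.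
End Defs.
Arguments is_solution {R} n s f u.
Arguments pos_cont_solution {R} n s f u.
Arguments sphere {R} n _.

(* Main.v *)
Require Import Defs.
From HB Require Import structures.
From mathcomp Require Import all_boot all_order all_algebra.
From mathcomp Require Import all_classical all_reals all_analysis.
From mathcomp Require Import measurable_realfun.
From mathcomp Require Import ring lra.
Set Implicit Arguments. Unset Strict Implicit. Unset Printing Implicit Defensive.
Import Order.TTheory GRing.Theory Num.Theory.
Import numFieldNormedType.Exports.
Local Open Scope classical_set_scope.
Local Open Scope ring_scope.

(** Write nu = (n-1)/2, p = n/2 - s, beta = n/2 + s, q = beta/p and g(t) = f(t) + d_{n,s} t.

    On spherical harmonics of degree k the operator P_s acts by Gamma(k+beta)/Gamma(k+p). Up to a
    constant this is the inverse of integration against the Riesz kernel |x-y|^(-2p), so a solution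
    satisfies the integral equation u = c1 A(g(u)) with A = [riesz_op] ([green_representation]).
    Only zonal Gegenbauer functions are tested against the weak equation; they determine a
    continuous function ([zonal_determines]).

    This equation is conformally covariant ([riesz_op_inversion]). A unit vector e and a level 0 <=
    l < 1 define a conformal involution Phi of the sphere that fixes the slice e.x = l and exchanges
    the two caps. With rho its conformal factor, put u_l = rho^p u(Phi) and v_l = rho^beta
    g(u(Phi)); then u_l = c1 A(v_l). On the cap e.x > l one has rho >= 1, strictly if l > 0, and
    t^(-q) g(t) decreases, hence v_l >= g(u_l), strictly if l > 0 ([reflect_v_ge]).

    The method of moving planes then shows u <= u_l on the cap for every l. It holds when the cap is
    thin ([narrow_region]), the inequality is strict for l > 0 ([strict_negative]), hence it
    propagates to smaller l by compactness ([good_open], [good_all]) and reaches l = 0 by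
    continuity. At l = 0 the map Phi is a reflection in a hyperplane through the origin. Any two
    distinct points are exchanged by such a reflection, from either side, so u takes the same value
    at both ([reflection_swap]).

    The difference w = u - u_l equals c1 A(g(u) - v_l), and antisymmetry turns this into an integral
    over the cap against a positive kernel ([riesz_op_fold]). For s > 1 the monotonicity of g
    transfers signs through this integral. For s <= 1 its place is taken by a maximum principle for
    antisymmetric potentials ([maximum_principle]): the equation is integrated against bubbles
    concentrating at a maximum point, and the argument rests on |x-y|^(-(n+2-2s)) not being
    integrable when s <= 1 ([blowup]).

    The analysis is built on the Poisson kernel. The surface measure is the law of a normalized
    Gaussian vector, and the Gaussian divergence theorem makes zonal eigenfunctions orthogonal. The
    Gegenbauer expansion of the Poisson kernel gives an approximate identity and the conformal
    change of variables ([E_inversion]). The Riesz kernel is a mixture of Poisson kernels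
    ([riesz_subordination]), so its eigenvalues are Beta integrals.

    For f(t) = t^p - lambda t the profile t^(-q) g(t) is a sum of two nonincreasing powers, one of
    them strictly decreasing; the value of the constant solution comes from testing the equation
    against the eigenfunction 1. *)

(** * Gegenbauer polynomials: recurrences, differential equation, bounds *)

Section Gegenbauer.
Variable R : realType.
Variable nu : R.

(** Two consecutive polynomials are carried along so that the three-term recurrence is a structural
    recursion. The first component is the Gegenbauer polynomial C_k^nu; when n = 2 nu + 1 it is the
    zonal harmonic profile of degree k on the n-sphere. *)
Fixpoint geg_pair (k : nat) : {poly R} * {poly R} :=
  match k with
  | 0 => (1, (2 * nu)%:P * 'X)
  | k'.+1 => let ab := geg_pair k' in
      (ab.2, (k'.+2%:R^-1)%:P *
        ((2 * (k'.+1%:R + nu))%:P * 'X * ab.2 - (k'%:R + 2 * nu)%:P * ab.1))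
  end.

Definition geg (k : nat) : {poly R} := locked (geg_pair k).1.

Lemma geg0 : geg 0 = 1. Proof. by rewrite /geg -lock. Qed.

Lemma geg1 : geg 1 = (2 * nu)%:P * 'X. Proof. by rewrite /geg -lock. Qed.

Lemma geg_rec k : (k.+2%:R)%:P * geg k.+2 =
  (2 * (k.+1%:R + nu))%:P * 'X * geg k.+1 - (k%:R + 2 * nu)%:P * geg k.
Proof.
by rewrite /geg -!lock [in LHS]/= mulrA -polyCM divff ?mul1r // pnatr_eq0.
Qed.

(** The two identities need a joint induction: the second follows from the differentiated recurrence
    and the first at the previous degree, and the first then follows from the recurrence and the
    second. *)
Lemma geg_deriv_rec k :
  (k.+1%:R)%:P * geg k.+1 = 'X * (geg k.+1)^`() - (geg k)^`() /\
  (geg k.+1)^`() = 'X * (geg k)^`() + (k%:R + 2 * nu)%:P * geg k.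
Proof.
elim: k => [|k [IHa IHb]].
  rewrite geg0 geg1 derivM !derivC derivX; split; ring.
have nz : (k.+2%:R : R)%:P != 0 by rewrite polyC_eq0 pnatr_eq0.
have H := geg_rec k.
have H' : (k.+2%:R)%:P * (geg k.+2)^`() = (2 * (k.+1%:R + nu))%:P * (geg k.+1 + 'X * (geg k.+1)^`()) - (k%:R + 2 * nu)%:P * (geg k)^`().
  have := congr1 deriv H; rewrite derivM derivB !derivM !derivC derivX => E; rewrite -[LHS]add0r -[X in X + _](mul0r (geg k.+2)) E; ring.
have Hb : (geg k.+2)^`() = 'X * (geg k.+1)^`() + (k.+1%:R + 2 * nu)%:P * geg k.+1.
  apply: (mulfI nz); rewrite H'.
  have -> : (geg k)^`() = 'X * (geg k.+1)^`() - (k.+1%:R)%:P * geg k.+1 by rewrite IHa; ring.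
  ring.
split=> //.
rewrite H Hb.
have E1 : (geg k)^`() = 'X * (geg k.+1)^`() - (k.+1%:R)%:P * geg k.+1 by rewrite IHa; ring.
have E2 : (geg k.+1)^`() = 'X * ('X * (geg k.+1)^`() - (k.+1%:R)%:P * geg k.+1) + (k%:R + 2 * nu)%:P * geg k by rewrite -E1 IHb.
apply/eqP; rewrite -subr_eq0; apply/eqP.
transitivity ((geg k.+1)^`() - ('X * ('X * (geg k.+1)^`() - (k.+1%:R)%:P * geg k.+1) + (k%:R + 2 * nu)%:P * geg k)).
  ring.
by rewrite -E2 subrr.
Qed.

Lemma geg_deriv1 k : (1 - 'X ^+ 2) * (geg k.+1)^`() =
  - (k.+1%:R)%:P * 'X * geg k.+1 + (k%:R + 2 * nu)%:P * geg k.
Proof.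
have [a b] := geg_deriv_rec k.
have E : (geg k)^`() = 'X * (geg k.+1)^`() - (k.+1%:R)%:P * geg k.+1 by rewrite a; ring.
rewrite mulrBl mul1r {1}b E; ring.
Qed.

(** Differentiating [geg_deriv1] and eliminating the derivative of the lower polynomial gives the
    Gegenbauer equation. It is the eigenvalue equation of the spherical Laplacian on zonal
    functions, with eigenvalue k (k + 2 nu). *)
Lemma geg_ode k : (1 - 'X ^+ 2) * (geg k)^`()^`() =
  (2 * nu + 1)%:P * 'X * (geg k)^`() - (k%:R * (k%:R + 2 * nu))%:P * geg k.
Proof.
case: k => [|k].
  by rewrite geg0 (derivC 1) !deriv0 !mulr0 mul0r mul0r subrr.
have [a b] := geg_deriv_rec k.
have E : (geg k)^`() = 'X * (geg k.+1)^`() - (k.+1%:R)%:P * geg k.+1 by rewrite a; ring.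
have /eqP := congr1 deriv (geg_deriv1 k).
rewrite derivM derivB (derivC 1) derivXn derivD !derivM derivN !derivC derivX E.
by rewrite -subr_eq0 => /eqP D; apply/eqP; rewrite -subr_eq0 -D; apply/eqP; ring.
Qed.

End Gegenbauer.
Section GegenbauerBounds.
Variable R : realType.
Variable nu : R.
Hypothesis nu0 : 0 < nu.
Local Notation C := (geg nu).

Lemma geg_at1 k : (C k.+1).[1] = (k%:R + 2 * nu) / k.+1%:R * (C k).[1].
Proof.
have /(congr1 (fun p => p.[1])) := geg_deriv1 nu k.
rewrite !hornerE /= => H.
have nz : k.+1%:R != 0 :> R by rewrite pnatr_eq0.
apply: (mulfI nz); rewrite !mulrA [k.+1%:R * (_ + _)]mulrC mulfK //; lra.
Qed.

Lemma geg_atN1 k : (C k.+1).[-1] = - ((k%:R + 2 * nu) / k.+1%:R * (C k).[-1]).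
Proof.
have /(congr1 (fun p => p.[-1])) := geg_deriv1 nu k.
rewrite !hornerE /= => H.
have nz : k.+1%:R != 0 :> R by rewrite pnatr_eq0.
apply: (mulfI nz); rewrite mulrN !mulrA [k.+1%:R * (_ + _)]mulrC mulfK //; lra.
Qed.

Lemma geg_at1_gt0 k : 0 < (C k).[1].
Proof.
elim: k => [|k IH]; first by rewrite geg0 hornerE.
rewrite geg_at1 mulr_gt0 // divr_gt0 // ?ltr0n //.
by rewrite ltr_wpDl ?mulr_gt0.
Qed.

Lemma geg_atN1_norm k : `|(C k).[-1]| = (C k).[1].
Proof.
elim: k => [|k IH]; first by rewrite geg0 !hornerE normr1.
rewrite geg_atN1 geg_at1 normrN normrM IH ger0_norm // ltW //.
by rewrite divr_gt0 ?ltr0n // ltr_wpDl ?mulr_gt0.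
Qed.

(* The function C^2 + (1 - t^2) C'^2 / (k (k + 2 nu)) has derivative
   4 nu t C'^2 / (k (k + 2 nu)), so it is largest at t = 1 or t = -1. *)
Lemma geg_norm_le k t : -1 <= t <= 1 -> `|(C k).[t]| <= (C k).[1].
Proof.
case: k => [|k] /andP[t1 t2]; first by rewrite geg0 !hornerE normr1.
pose kap : R := k.+1%:R * (k.+1%:R + 2 * nu).
have kap0 : 0 < kap by rewrite mulr_gt0 ?ltr0n // ltr_wpDl ?mulr_gt0.
pose p := C k.+1.
pose M := p ^+ 2 + (kap^-1)%:P * (1 - 'X ^+ 2) * p^`() ^+ 2.
have dM : M^`() = (4 * nu / kap)%:P * 'X * p^`() ^+ 2.
  have O := geg_ode nu k.+1; rewrite -/p -/kap in O.
  rewrite /M !expr2 derivD !derivM derivB (derivC 1) derivM derivX !derivC.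
  have -> : 4 * nu / kap = kap^-1 * (4 * nu) by rewrite mulrC.
  transitivity (2 * p^`() * ((1 - (kap^-1 * kap)%:P * 1) * p + (kap^-1)%:P * ((1 - 'X ^+ 2) * p^`()^`() + kap%:P * p - 'X * p^`()))).
    rewrite polyCM; ring.
  rewrite mulVf ?gt_eqF // mulr1 subrr mul0r add0r O; ring.
have dMx x : M^`().[x] = 4 * nu / kap * x * p^`().[x] ^+ 2 by rewrite dM !hornerE.
have c4 : 0 <= 4 * nu / kap by rewrite !mulr_ge0 ?invr_ge0 // ltW.
have pM : `|p.[t]| ^+ 2 <= M.[t].
  rewrite real_normK ?num_real // /M !hornerE lerDl; rewrite /= -mulrA -expr2; apply: mulr_ge0; last by rewrite sqr_ge0.
  by apply: mulr_ge0; [rewrite invr_ge0 ltW|nra].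
have M1 : M.[1] = p.[1] ^+ 2 by rewrite /M !hornerE /=; ring.
have MN1 : M.[-1] = p.[1] ^+ 2.
  rewrite /M !hornerE -(geg_atN1_norm k.+1) real_normK ?num_real //=; ring.
have cM (A : set R) : {within A, continuous (horner M)}.
  apply: continuous_subspaceT => x; exact: continuous_horner.
have MM : M.[t] <= p.[1] ^+ 2.
  have [t0|t0] := leP 0 t.
    rewrite -M1.
    apply: (@ger0_derive1_ndecr R (horner M) 0 1) => //.
    move=> x; rewrite in_itv => /andP[x0 x1].
    by rewrite derive1E derive_val dMx; apply: mulr_ge0 (sqr_ge0 _); exact: mulr_ge0 c4 (ltW x0).
  rewrite -MN1.
  apply: (@ler0_derive1_nincr R (horner M) (-1) 0) => //; last by rewrite ltW.
  move=> x; rewrite in_itv => /andP[x0 x1].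
  by rewrite derive1E derive_val dMx; apply: mulr_le0_ge0 (sqr_ge0 _); exact: mulr_ge0_le0 c4 (ltW x1).
rewrite -(@ler_pXn2r _ 2) ?nnegrE ?normr_ge0 ?(ltW (geg_at1_gt0 _)) //.
exact: le_trans pM MM.
Qed.

(** The ratio of consecutive values at 1 is at most (k+1+m)/(k+1), hence at most ((k+2)/(k+1))^m by
    Bernoulli's inequality. Polynomial growth in k is what later makes the series in r^k
    converge. *)
Lemma geg_at1_le m k : 2 * nu <= m.+1%:R -> (C k).[1] <= k.+1%:R ^+ m.
Proof.
move=> hm; elim: k => [|k IH]; first by rewrite geg0 hornerE expr1n.
rewrite geg_at1.
have k0 : 0 < k.+1%:R :> R by rewrite ltr0n.
rewrite mulrAC ler_pdivrMr //.
apply: (@le_trans _ _ ((k.+1%:R + m%:R) * k.+1%:R ^+ m)).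
  apply: ler_pM => //; first by rewrite addr_ge0 // mulr_ge0 // ltW.
    by rewrite ltW // geg_at1_gt0.
  by rewrite -(natr1 k) -addrA lerD2l nat1r.
rewrite -(natr1 k.+1).
move: (k.+1%:R : R) k0 => x x0 {IH hm}.
elim: m => [|m IH]; first by rewrite !expr0 !mulr1 mul1r addr0.
have x1 : 0 < x + 1 by rewrite addr_gt0.
apply: (@le_trans _ _ ((x + 1) * ((x + m%:R) * x ^+ m))); last first.
  by rewrite [(x + 1) ^+ m.+1]exprS -[leRHS]mulrA ler_pM2l.
rewrite exprS !mulrA ler_wpM2r ?exprn_ge0 ?(ltW x0) // -natr1 -subr_ge0.
by rewrite (_ : _ - _ = m%:R) ?ler0n //; ring.
Qed.

End GegenbauerBounds.

(** * Generating function and expansion of the Poisson kernel *)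

Section Generating.
Variable R : realType.

(** One factor k+1 is absorbed by writing r = y rho with rho = (r+1)/2: since (k+1) y^k <= 1 + y +
    ... + y^k <= 1/(1-y), the exponent m drops by one at the larger ratio rho < 1. *)
Lemma natpow_geometric_cvg (m : nat) (r : R) : 0 <= r < 1 ->
  cvgn (series (fun k => k.+1%:R ^+ m * r ^+ k)).
Proof.
elim: m r => [|m IH] r /andP[r0 r1].
  have -> : (fun k => k.+1%:R ^+ 0 * r ^+ k) = geometric 1 r.
    by apply/funext => k; rewrite expr0.
  by apply: is_cvg_geometric_series; rewrite ger0_norm.
pose rho := (r + 1) / 2.
have rho01 : 0 <= rho < 1 by rewrite /rho; lra.
have rho0 : 0 < rho by rewrite /rho; lra.
pose y := r / rho.
have y0 : 0 <= y by rewrite divr_ge0 // ltW.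
have y1 : y < 1 by rewrite ltr_pdivrMr // mul1r /rho; lra.
have Hb k : k.+1%:R * y ^+ k <= (1 - y)^-1.
  have -> : k.+1%:R * y ^+ k = \sum_(j < k.+1) y ^+ k.
    by rewrite sumr_const card_ord mulr_natl.
  apply: (@le_trans _ _ (\sum_(j < k.+1) y ^+ j)).
    by apply: ler_sum => j _; rewrite ler_wiXn2l // ?ltW // -ltnS.
  rewrite -[leRHS]mul1r ler_pdivlMr ?subr_gt0 //.
  have -> : (\sum_(j < k.+1) y ^+ j) * (1 - y) = 1 - y ^+ k.+1.
    by rewrite -opprB mulrN mulrC -subrX1 opprB.
  by rewrite gerBl exprn_ge0.
have := is_cvg_seriesZ (k := (1 - y)^-1) (IH _ rho01).
apply: series_le_cvg => k.
- by rewrite mulr_ge0 ?exprn_ge0.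
- by rewrite !mulr_ge0 ?invr_ge0 ?subr_ge0 1?ltW ?exprn_gt0 ?ltr0n.
apply: (@le_trans _ _ ((1 - y)^-1 * (k.+1%:R ^+ m * rho ^+ k))) => //.
have -> : r = y * rho by rewrite /y divfK // gt_eqF.
have -> : k.+1%:R ^+ m.+1 * (y * rho) ^+ k = (k.+1%:R * y ^+ k) * (k.+1%:R ^+ m * rho ^+ k).
  by rewrite exprMn exprS; ring.
by rewrite ler_wpM2r // mulr_ge0 ?exprn_ge0 // ltW.
Qed.

Variable nu : R.
Hypothesis nu1 : 1 <= nu.
Local Notation C := (geg nu).
Let nu0 : 0 < nu := lt_le_trans ltr01 nu1.

(** |x - r y|^2 for unit vectors with x.y = t. With n = 2 nu + 1, [poisson] below is the Poisson
    kernel of the unit ball of R^(n+1), normalized for a probability measure on the sphere. *)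
Definition qf (r t : R) := 1 - 2 * r * t + r ^+ 2.
Definition poisson (r t : R) := (1 - r ^+ 2) * qf r t `^ (- (nu + 1)).

Lemma qf_ge r t : -1 <= t <= 1 -> 0 <= r -> (1 - r) ^+ 2 <= qf r t.
Proof. by move=> /andP[t1 t2] r0; rewrite /qf; nra. Qed.

Lemma qf_gt0 r t : -1 <= t <= 1 -> 0 <= r < 1 -> 0 < qf r t.
Proof.
move=> t1 /andP[r0 r1]; apply: lt_le_trans (qf_ge t1 r0).
by rewrite exprn_gt0 // subr_gt0.
Qed.

Lemma qf_le r t : -1 <= t <= 1 -> 0 <= r < 1 -> qf r t <= 4.
Proof. by move=> /andP[t1 t2] /andP[r0 r1]; rewrite /qf; nra. Qed.

Definition geg_sum (t : R) (K : nat) : {poly R} := \sum_(k < K.+1) ((C k).[t])%:P * 'X ^+ k.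
Definition geg_rest (t : R) (K : nat) : {poly R} :=
  ((K%:R + 2 * nu) * (C K).[t])%:P * 'X ^+ K.+1 - (K.+1%:R * (C K.+1).[t])%:P * 'X ^+ K.
Definition geg_quad (t : R) : {poly R} := 1 - (2 * t)%:P * 'X + 'X ^+ 2.

Lemma geg_restE t K : geg_rest t K =
  ((K%:R + 2 * nu) * (C K).[t])%:P * 'X ^+ K.+1 - (K.+1%:R * (C K.+1).[t])%:P * 'X ^+ K.
Proof. by []. Qed.

(** By the three-term recurrence the full generating series S solves (1 - 2 t X + X^2) S' = 2 nu (t
    - X) S; truncation at degree K leaves exactly the edge terms collected in [geg_rest]. *)
Lemma geg_sum_ode t K : geg_quad t * (geg_sum t K)^`() =
  (2 * nu)%:P * (t%:P - 'X) * geg_sum t K + geg_rest t K.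
Proof.
elim: K => [|K IH].
  rewrite /geg_sum /geg_rest !big_ord1 geg0 geg1 !hornerE /= ?derivM ?expr0 ?mulr1 ?derivC ?mul1r ?(derivC 1).
  ring.
have -> : geg_sum t K.+1 = geg_sum t K + ((C K.+1).[t])%:P * 'X ^+ K.+1 by rewrite /geg_sum big_ord_recr.
rewrite derivD mulrDr IH derivM derivC derivXn succnK.
have H := congr1 (fun p => p.[t]) (geg_rec nu K).
rewrite !hornerE /= in H.
have {}H : (K.+2%:R * (C K.+2).[t])%:P = (2 * (K.+1%:R + nu) * t * (C K.+1).[t] - (K%:R + 2 * nu) * (C K).[t])%:P :> {poly R} by rewrite H.
have E1 : 'X ^+ K.+1 = 'X * 'X ^+ K :> {poly R} by rewrite exprS.
have E2 : 'X ^+ K.+2 = 'X * ('X * 'X ^+ K) :> {poly R} by rewrite !exprS.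
rewrite !geg_restE H E2 E1 /geg_quad -mulr_natr; move: ('X ^+ K) => Y.
ring.
Qed.

End Generating.
Section GeneratingLimit.
Variable R : realType.
Variable nu : R.
Hypothesis nu1 : 1 <= nu.
Local Notation C := (geg nu).
Let nu0 : 0 < nu := lt_le_trans ltr01 nu1.

Lemma geg_polynomial_bound : exists m : nat,
  forall k t, -1 <= t <= 1 -> `|(C k).[t]| <= k.+1%:R ^+ m.
Proof.
exists (Num.bound (2 * nu)) => k t ht.
apply: le_trans (geg_norm_le nu0 k ht) _.
apply: geg_at1_le => //.
have nn : 0 <= 2 * nu by rewrite mulr_ge0 // ltW.
by have /ltW := archi_boundP nn => /le_trans; apply; rewrite ler_nat.
Qed.

Lemma natpow_geometric_cvg0 (m : nat) (r : R) : 0 <= r < 1 ->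
  k.+1%:R ^+ m * r ^+ k @[k --> \oo] --> (0 : R).
Proof. by move=> hr; have := @cvg_series_cvg_0 R R^o _ (natpow_geometric_cvg (m:=m) hr); apply. Qed.

(** The remainder is O(K^(m+1) r^K), uniformly for c in [0, r]. The uniformity matters because the
    intermediate point of the mean value theorem in [geg_series_cvg] depends on K. *)
Lemma geg_rest_cvg0 (t r : R) : -1 <= t <= 1 -> 0 <= r < 1 ->
  exists2 u : nat -> R, u @ \oo --> (0 : R) &
    forall K (c : R), 0 <= c <= r -> `|(geg_rest nu t K).[c]| <= u K.
Proof.
move=> ht hr; have [m Hm] := geg_polynomial_bound.
have /andP[r0 r1] := hr.
pose M := (2 * nu + 2) * 2 ^+ m.+1.
exists (fun K => M * (K.+1%:R ^+ m.+1 * r ^+ K)).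
  rewrite -[X in _ --> X](mulr0 M).
  by apply: cvgM; [exact: cvg_cst|exact: natpow_geometric_cvg0].
move=> K c /andP[c0 cr].
have c1 : c <= 1 by apply: le_trans cr (ltW r1).
have cK : c ^+ K <= r ^+ K by rewrite lerXn2r ?nnegrE // (le_trans c0).
have K0 : 0 <= K.+1%:R :> R by [].
rewrite !hornerE.
have rK0 : 0 <= r ^+ K by rewrite exprn_ge0.
have cK0 : 0 <= c ^+ K by rewrite exprn_ge0.
have b1 : `|(C K).[t]| <= (2 * K.+1%:R) ^+ m.
  apply: le_trans (Hm _ _ ht) _; rewrite lerXn2r ?nnegrE ?mulr_ge0 //.
  by rewrite ler_peMl // ler1n.
have b2 : `|(C K.+1).[t]| <= (2 * K.+1%:R) ^+ m.
  apply: le_trans (Hm _ _ ht) _; rewrite lerXn2r ?nnegrE ?mulr_ge0 //.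
  by rewrite -natrM ler_nat mul2n -addnn addSn ltnS leq_addl.
have X0 : 0 <= (2 * K.+1%:R : R) ^+ m by rewrite exprn_ge0 // mulr_ge0.
have e1 : `|(K%:R + 2 * nu) * (C K).[t] * c ^+ K.+1| <= (K%:R + 2 * nu) * (2 * K.+1%:R) ^+ m * r ^+ K.
  have a0 : 0 <= K%:R + 2 * nu by rewrite addr_ge0 // mulr_ge0 // ltW.
  rewrite !normrM (ger0_norm a0) normrX (ger0_norm c0) -!mulrA ler_wpM2l // ler_pM //.
    by rewrite exprn_ge0.
  by rewrite exprS; apply: le_trans cK; rewrite ler_piMl.
have e2 : `|K.+1%:R * (C K.+1).[t] * c ^+ K| <= K.+1%:R * (2 * K.+1%:R) ^+ m * r ^+ K.
  by rewrite !normrM (ger0_norm K0) normrX (ger0_norm c0) -!mulrA ler_wpM2l // ler_pM.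
apply: le_trans (ler_normB _ _) _.
apply: le_trans (lerD e1 e2) _.
rewrite -!mulrDl /M exprMn [X in _ <= X](_ : _ = ((2 * nu + 2) * 2 * K.+1%:R) * (2 ^+ m * K.+1%:R ^+ m) * r ^+ K); last first.
  by rewrite ![_ ^+ m.+1]exprS /=; ring.
rewrite ler_wpM2r // ler_wpM2r ?mulr_ge0 ?exprn_ge0 // -natr1.
have k0 := ler0n R K; have := nu0; nra.
Qed.

Lemma geg_sumE t r K :
  (geg_sum nu t K).[r] = series (fun k => (C k).[t] * r ^+ k) K.+1.
Proof.
rewrite /geg_sum /series /= big_mkord horner_sum.
by apply: eq_bigr => k _; rewrite !hornerE.
Qed.

Lemma qf_derive (t x : R) : is_derive x 1 (fun y => qf y t) (2 * x - 2 * t).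
Proof.
rewrite /qf; apply: is_derive_eq.
rewrite /GRing.scale /=; ring.
Qed.

Lemma geg_sum_ode_eval (t c : R) K : qf c t * ((geg_sum nu t K)^`()).[c] =
  2 * nu * (t - c) * (geg_sum nu t K).[c] + (geg_rest nu t K).[c].
Proof.
have O := geg_sum_ode nu t K; move: (geg_rest nu t K) (geg_sum nu t K) O => G S O.
have {}O := congr1 (fun p => p.[c]) O.
rewrite /geg_quad !hornerE /= in O; rewrite -O /qf; ring.
Qed.

(** Multiplication by qf^nu is the integrating factor: the derivative of [H K] is qf^(nu-1) times
    the remainder, so [H K r] tends to [H K 0], which is 1. *)
Lemma geg_series_cvg (t r : R) : -1 <= t <= 1 -> 0 <= r < 1 ->
  series (fun k => (C k).[t] * r ^+ k) @ \oo --> qf r t `^ (- nu).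
Proof.
move=> ht hr; have /andP[r0 r1] := hr.
have [u u0 Hu] := geg_rest_cvg0 ht hr.
pose H K x := (geg_sum nu t K).[x] * qf x t `^ nu.
have in01 (c : R) : 0 <= c <= r -> 0 <= c < 1 by move=> /andP[-> /le_lt_trans ->].
have dH K (c : R) : 0 <= c <= r ->
    is_derive c 1 (H K) (qf c t `^ (nu - 1) * (geg_rest nu t K).[c]).
  move=> hc; have q0 := qf_gt0 ht (in01 _ hc).
  have d1 := is_derive_poly (geg_sum nu t K) c.
  have d2 := @is_derive1_comp R (fun y => y `^ nu) (fun y => qf y t) c _ _
    (is_derive1_powR nu q0) (qf_derive t c).
  have D : is_derive c 1 (H K) _ := is_deriveM d1 d2.
  apply: is_derive_eq D _.
  have pE : qf c t `^ nu = qf c t * qf c t `^ (nu - 1).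
    by rewrite -{2}[qf c t]powRr1 ?ltW // -powRD ?subrKC // gt_eqF ?implybT.
  rewrite /GRing.scale /= pE.
  transitivity (qf c t `^ (nu - 1) * ((qf c t * ((geg_sum nu t K)^`()).[c]) + nu * (2 * c - 2 * t) * (geg_sum nu t K).[c])); first by ring.
  by rewrite geg_sum_ode_eval; ring.
(* The exponent nu - 1 is nonnegative because 1 <= nu, and qf is at most 4. *)
have bq (c : R) : 0 <= c <= r -> qf c t `^ (nu - 1) <= 4 `^ nu.
  move=> /in01 hc; apply: (@le_trans _ _ (4 `^ (nu - 1))).
    by rewrite ge0_ler_powR ?subr_ge0 ?nnegrE ?qf_le // ltW // qf_gt0.
  by rewrite ler_powR ?gerBl // ler1n.
have H0 K : H K 0 = 1.
  rewrite /H geg_sumE /qf mulr0 mul0r subr0 expr0n /= addr0 powR1 mulr1.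
  rewrite /series /= big_nat_recl //= geg0 hornerC expr0 mulr1 big1 ?addr0 // => k _.
  by rewrite exprS mul0r mulr0.
have Hc : H ^~ r @ \oo --> (1 : R).
  apply/cvgrPdist_le => e e0.
  have e4 : 0 < e / 4 `^ nu by rewrite divr_gt0 // powR_gt0.
  have /cvgrPdist_le /(_ _ e4) := u0.
  apply: filterS => K uK.
  have [||c hc] := @MVT_segment _ (H K) (fun c => qf c t `^ (nu - 1) * (geg_rest nu t K).[c]) 0 r r0.
  - by move=> c /subset_itv_oo_cc; rewrite in_itv => /dH.
  - by apply: derivable_within_continuous => c; rewrite in_itv => /dH d; exact: ex_derive.
  rewrite H0 subr0 => E.
  rewrite distrC E normrM (ger0_norm r0).
  rewrite in_itv in hc.
  apply: (@le_trans _ _ (4 `^ nu * (e / 4 `^ nu))); last by rewrite mulrC divfK // gt_eqF // powR_gt0.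
  have A : qf c t `^ (nu - 1) * `|(geg_rest nu t K).[c]| <= 4 `^ nu * (e / 4 `^ nu).
    apply: ler_pM => //; [exact: powR_ge0|exact: bq|].
    apply: le_trans (Hu K _ hc) _.
    by move: uK; rewrite sub0r normrN; apply: le_trans; exact: ler_norm.
  apply: le_trans A; rewrite normrM (ger0_norm (powR_ge0 _ _)) ler_piMr ?(ltW r1) //.
  by rewrite mulr_ge0 // powR_ge0.
have q0 := qf_gt0 ht hr.
rewrite -(@cvg_shiftS R).
rewrite (_ : (fun n => _) = (fun K => H K r * qf r t `^ (- nu))); last first.
  apply/funext => K; rewrite /H geg_sumE -mulrA -powRD ?subrr ?powRr0 ?mulr1 //.
  by apply/implyP => _; rewrite gt_eqF.
have := cvgM Hc (@cvg_cst _ (qf r t `^ (- nu)) _ \oo _).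
by rewrite mul1r; apply.
Qed.

(** The weight (k+nu)/nu turns the generating function S into S + (r/nu) S'. The differential
    equation eliminates S', and 1 + 2 r (t - r)/qf = (1 - r^2)/qf gives the Poisson kernel. *)
Lemma poisson_series (t r : R) : -1 <= t <= 1 -> 0 <= r < 1 ->
  series (fun k => (k%:R + nu) / nu * (C k).[t] * r ^+ k) @ \oo --> poisson nu r t.
Proof.
move=> ht hr; have q0 := qf_gt0 ht hr.
have [u u0 Hu] := geg_rest_cvg0 ht hr.
have /andP[r0 r1] := hr.
have Sc := geg_series_cvg ht hr; rewrite -(@cvg_shiftS R) in Sc.
have Rc : (geg_rest nu t K).[r] @[K --> \oo] --> (0 : R).
  apply/norm_cvg0P; apply: (@squeeze_cvgr _ _ _ _ (cst 0) u) => //; last exact: cvg_cst.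
  by near=> K; rewrite normr_ge0 Hu // r0 lexx.
rewrite -(@cvg_shiftS R).
rewrite (_ : (fun n => _) = (fun K => (1 + 2 * r * (t - r) / qf r t) * series (fun k => (C k).[t] * r ^+ k) K.+1
   + r / nu / qf r t * (geg_rest nu t K).[r])); last first.
  apply/funext => K.
  have Se : series (fun k => (k%:R + nu) / nu * (C k).[t] * r ^+ k) K.+1 =
     series (fun k => (C k).[t] * r ^+ k) K.+1 + r / nu * ((geg_sum nu t K)^`()).[r].
    rewrite /geg_sum (raddf_sum (@deriv R)) horner_sum /series /= !big_mkord mulr_sumr -big_split.
    apply: eq_bigr => -[k _] _ /=; rewrite derivM derivC derivXn mul0r add0r !hornerE hornerMn hornerXn.
    case: k => [|k]; first by rewrite mulr0n /= ?mulr0 ?addr0; field; rewrite gt_eqF.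
    rewrite /= exprS -mulr_natl; field.
    by rewrite gt_eqF.
  rewrite Se; have -> : ((geg_sum nu t K)^`()).[r] = (2 * nu * (t - r) * (geg_sum nu t K).[r] + (geg_rest nu t K).[r]) / qf r t.
    by rewrite -geg_sum_ode_eval mulrC mulKf // gt_eqF.
  rewrite geg_sumE; field.
  by rewrite !gt_eqF.
have -> : poisson nu r t = (1 + 2 * r * (t - r) / qf r t) * qf r t `^ (- nu) + r / nu / qf r t * 0.
  rewrite /poisson opprD powRD ?(gt_eqF q0) ?implybT // powR_inv1 ?(ltW q0) // mulr0 addr0.
  move: (_ `^ _) => y; move: (q0); rewrite /qf => q0'.
  by field; rewrite gt_eqF.
by apply: cvgD; apply: cvgM => //; exact: cvg_cst.
Unshelve. all: by end_near. Qed.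

End GeneratingLimit.

(** * Directional derivatives, the dot product and radial projection *)

Section DirectionalChainRule.
Variables (R : realType) (V : normedModType R).

(** Restricting to the line h |-> h v + x brings the one-variable chain rule to bear on functions of
    several variables. *)
Lemma is_derive_lineP (f : V -> R) (x v : V) (df : R) :
  is_derive x v f df <-> is_derive (0 : R) 1 (fun h : R => f (h *: v + x)) df.
Proof.
have E : (fun h : R => h^-1 *: ((fun h : R => f (h *: v + x)) (h *: 1 + 0) -
     (fun h : R => f (h *: v + x)) 0)) = (fun h : R => h^-1 *: (f (h *: v + x) - f x)).
  by apply/funext => h; rewrite addr0 scale0r add0r /GRing.scale /= mulr1.
split=> -[d e]; apply: DeriveDef.
- by rewrite /derivable E.
- by rewrite /derive E.
- by move: d; rewrite /derivable E.
- by move: e; rewrite /derive E.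
Qed.

Lemma is_derive_chain (f : V -> R) (g : R -> R) (x v : V) (df dg : R) :
  is_derive x v f df -> is_derive (f x) 1 g dg ->
  is_derive x v (fun y => g (f y)) (dg * df).
Proof.
move=> /is_derive_lineP df1 dg1; apply/is_derive_lineP.
apply: (@is_derive1_comp R g (fun h : R => f (h *: v + x))) => //.
by rewrite scale0r add0r.
Qed.

End DirectionalChainRule.

Section Dot.
Variables (R : realType) (N : nat).
Implicit Types x y z : 'rV[R]_N.

Definition dot x y : R := \sum_(i < N) x 0 i * y 0 i.

Lemma dotC x y : dot x y = dot y x.
Proof. by apply: eq_bigr => i _; rewrite mulrC. Qed.

Lemma dotDl x y z : dot (x + y) z = dot x z + dot y z.
Proof. by rewrite /dot -big_split; apply: eq_bigr => i _; rewrite mxE mulrDl. Qed.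

Lemma dotZl a x y : dot (a *: x) y = a * dot x y.
Proof. by rewrite /dot mulr_sumr; apply: eq_bigr => i _; rewrite mxE mulrA. Qed.

Lemma dotNl x y : dot (- x) y = - dot x y.
Proof. by rewrite -scaleN1r dotZl mulN1r. Qed.

Lemma dotBl x y z : dot (x - y) z = dot x z - dot y z.
Proof. by rewrite dotDl dotNl. Qed.

Lemma dotDr x y z : dot x (y + z) = dot x y + dot x z.
Proof. by rewrite dotC dotDl !(dotC x). Qed.

Lemma dotZr a x y : dot x (a *: y) = a * dot x y.
Proof. by rewrite dotC dotZl dotC. Qed.

Lemma dotBr x y z : dot x (y - z) = dot x y - dot x z.
Proof. by rewrite dotC dotBl !(dotC x). Qed.

Lemma dot_ge0 x : 0 <= dot x x.
Proof. by apply: sumr_ge0 => i _; rewrite -expr2 sqr_ge0. Qed.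

Lemma dot_eq0 x : (dot x x == 0) = (x == 0).
Proof.
apply/eqP/eqP => [|->]; last by rewrite /dot big1 // => i _; rewrite mxE mul0r.
move=> /psumr_eq0P H; apply/rowP => i; rewrite mxE.
have /H/(_ i isT)/eqP : forall i : 'I_N, true -> 0 <= x 0 i * x 0 i.
  by move=> j _; rewrite -expr2 sqr_ge0.
by rewrite mulf_eq0 orbb => /eqP.
Qed.

Lemma dot_gt0 x : x != 0 -> 0 < dot x x.
Proof. by move=> x0; rewrite lt_neqAle dot_ge0 eq_sym dot_eq0 x0. Qed.

Lemma enormE x : enorm x = Num.sqrt (dot x x).
Proof. by congr Num.sqrt; apply: eq_bigr => i _; rewrite expr2. Qed.

Lemma enorm_ge0 x : 0 <= enorm x. Proof. exact: sqrtr_ge0. Qed.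

Lemma enorm_gt0 x : x != 0 -> 0 < enorm x.
Proof. by move=> x0; rewrite enormE sqrtr_gt0 dot_gt0. Qed.

Lemma enorm_sqr x : enorm x ^+ 2 = dot x x.
Proof. by rewrite enormE sqr_sqrtr // dot_ge0. Qed.

Lemma enorm0 : enorm (0 : 'rV[R]_N) = 0.
Proof.
by rewrite enormE (_ : dot 0 0 = 0) ?sqrtr0 //; apply/eqP; rewrite dot_eq0.
Qed.

Lemma normalize0 : normalize (0 : 'rV[R]_N) = 0.
Proof. by rewrite /normalize scaler0. Qed.

Lemma dot_normalize x y : dot x (normalize y) = dot x y / enorm y.
Proof. by rewrite /normalize dotZr mulrC. Qed.

Lemma normalizeE x i : normalize x 0 i = x 0 i / enorm x.
Proof. by rewrite /normalize mxE mulrC. Qed.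

Lemma dot_normalize_self x : x != 0 -> dot (normalize x) (normalize x) = 1.
Proof.
move=> x0; rewrite /normalize dotZl dotZr -enorm_sqr.
by move: (enorm_gt0 x0) => n0; field; rewrite gt_eqF.
Qed.

Lemma dot_le x y : dot x x = 1 -> dot y y = 1 -> -1 <= dot x y <= 1.
Proof.
move=> x1 y1; apply/andP; split.
  have := dot_ge0 (x + y); rewrite !(dotDl, dotDr) x1 y1 (dotC y x); lra.
have := dot_ge0 (x - y); rewrite !(dotBl, dotBr) x1 y1 (dotC y x); lra.
Qed.

Lemma dot_eq1 x y : dot x x = 1 -> dot y y = 1 -> dot x y = 1 -> x = y.
Proof.
move=> x1 y1 xy; apply/eqP; rewrite -subr_eq0 -dot_eq0.
by rewrite !(dotBl, dotBr) x1 y1 (dotC y x) xy !subrr.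
Qed.

Lemma dot_ebasisl i y : dot (ebasis R i) y = y 0 i.
Proof.
rewrite /dot (bigD1 i) //= big1 ?addr0 => [|j ji]; first by rewrite mxE !eqxx mul1r.
by rewrite mxE (negbTE ji) andbF mul0r.
Qed.

Lemma dot_ebasis i : dot (ebasis R i) (ebasis R i) = 1.
Proof. by rewrite dot_ebasisl mxE !eqxx. Qed.

(** Includes x = 0, where [normalize] returns 0, so bounds on zonal functions hold on the whole
    space without a case distinction. *)
Lemma dot_normalize_le z x : dot z z = 1 -> -1 <= dot z (normalize x) <= 1.
Proof.
move=> z1; have [->|x0] := eqVneq x 0; last by apply: dot_le => //; exact: dot_normalize_self.
by rewrite normalize0 dotC -(scale0r z) dotZl mul0r; lra.
Qed.

Lemma dot_continuous z : continuous (dot z).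
Proof.
have cadd : continuous (fun x : R * R => x.1 + x.2) by exact: (@add_continuous R^o).
apply: (continuous_big cadd) => i _.
by move=> x; apply: (@continuousM R _ (cst (z 0 i)) (fun x => x 0 i)); [exact: cst_continuous|exact: coord_continuous].
Qed.

Lemma dotxx_continuous : continuous (fun x => dot x x).
Proof.
have cadd : continuous (fun x : R * R => x.1 + x.2) by exact: (@add_continuous R^o).
apply: (continuous_big cadd) => i _.
by move=> x; apply: (@continuousM R _ (fun x => x 0 i) (fun x => x 0 i)); exact: coord_continuous.
Qed.

Lemma enorm_continuous : continuous (@enorm R N).
Proof.
move=> x; rewrite (_ : @enorm R N = fun y => Num.sqrt (dot y y)); last first.
  by apply/funext => y; rewrite enormE.
apply: (@continuous_comp _ _ _ (fun y => dot y y) (@Num.sqrt R)).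
  exact: dotxx_continuous.
exact: sqrt_continuous.
Qed.

Lemma dot_normalize_continuous z x : x != 0 -> {for x, continuous (fun y => dot z (normalize y))}.
Proof.
move=> x0; rewrite (_ : (fun y => _) = (fun y => dot z y / enorm y)); last first.
  by apply/funext => y; rewrite dot_normalize.
apply: (@continuousM R _ (dot z) (fun y => (enorm y)^-1)); first exact: dot_continuous.
by apply: continuousV; [rewrite gt_eqF // enorm_gt0|exact: enorm_continuous].
Qed.

Lemma is_derive_dot z x i : is_derive x (ebasis R i) (dot z) (z 0 i).
Proof.
apply/is_derive_lineP.
rewrite (_ : (fun h : R => _) = (fun h : R => h * z 0 i + dot z x)); last first.
  by apply/funext => h; rewrite dotDr dotZr dotC dot_ebasisl.
apply: is_derive_eq; rewrite /GRing.scale /=; ring.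
Qed.

Lemma is_derive_dotxx x i : is_derive x (ebasis R i) (fun y => dot y y) (2 * x 0 i).
Proof.
apply/is_derive_lineP.
rewrite (_ : (fun h : R => _) = (fun h : R => h ^+ 2 + 2 * h * x 0 i + dot x x)); last first.
  apply/funext => h; rewrite !(dotDl, dotDr, dotZl, dotZr) dot_ebasis (dotC x) dot_ebasisl; ring.
apply: is_derive_eq; rewrite /GRing.scale /=; ring.
Qed.

Lemma is_derive_enorm x i : x != 0 ->
  is_derive x (ebasis R i) (@enorm R N) (normalize x 0 i).
Proof.
move=> x0; have n0 := enorm_gt0 x0.
rewrite (_ : @enorm R N = fun y => Num.sqrt (dot y y)); last first.
  by apply/funext => y; rewrite enormE.
apply: is_derive_eq (is_derive_chain (is_derive_dotxx x i) (is_derive1_sqrt (dot_gt0 x0))) _.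
rewrite -enormE normalizeE; field; by rewrite gt_eqF.
Qed.

Lemma is_derive_enormV x i : x != 0 ->
  is_derive x (ebasis R i) (fun y => (enorm y)^-1) (- normalize x 0 i / enorm x ^+ 2).
Proof.
move=> x0; have n0 := enorm_gt0 x0.
have d : is_derive (enorm x) 1 (fun r : R => r^-1) (- (enorm x) ^- 2).
  have D : is_derive (enorm x) (1 : R) (fun r : R => r^-1) _ :=
    @is_deriveV R id (enorm x) _ 1 (lt0r_neq0 n0) (is_derive_id _ _).
  by apply: is_derive_eq D _; rewrite /GRing.scale /= mulr1.
apply: is_derive_eq (is_derive_chain (is_derive_enorm i x0) d) _.
by rewrite mulNr mulrC mulNr.
Qed.

Lemma is_derive_dot_normalize z x i : x != 0 ->
  is_derive x (ebasis R i) (fun y => dot z (normalize y))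
    ((z 0 i - dot z (normalize x) * normalize x 0 i) / enorm x).
Proof.
move=> x0; have n0 := enorm_gt0 x0.
rewrite (_ : (fun y => _) = (dot z * (fun y => (enorm y)^-1))); last first.
  by apply/funext => y; rewrite dot_normalize.
apply: is_derive_eq (is_deriveM (is_derive_dot z x i) (is_derive_enormV i x0)) _.
rewrite dot_normalize /GRing.scale /=; field; by rewrite gt_eqF.
Qed.

Lemma is_derive_normalize x i j : x != 0 ->
  is_derive x (ebasis R i) (fun y => normalize y 0 j)
    (((i == j)%:R - normalize x 0 j * normalize x 0 i) / enorm x).
Proof.
move=> x0; have := is_derive_dot_normalize (ebasis R j) i x0.
rewrite dot_ebasisl mxE eqxx /=.
rewrite (_ : (fun y => _) = (fun y => normalize y 0 j)) //.
by apply/funext => y; rewrite dot_ebasisl.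
Qed.

End Dot.

(** * Zonal eigenfunctions of the Laplace-Beltrami operator *)

Section ZonalEigenfunction.
Variables (R : realType) (n : nat).
Local Notation vec := 'rV[R]_n.+1.

Lemma near_neq0 (N : nat) (x : 'rV[R]_N) : x != 0 -> \forall y \near x, y != 0.
Proof.
move=> x0; have := @dotxx_continuous R N x.
move=> /cvgr_gt /(_ 0 (dot_gt0 x0)); apply: filterS => y.
by apply: contraTneq => ->; rewrite (_ : dot 0 0 = 0) ?ltxx //; apply/eqP; rewrite dot_eq0.
Qed.

Variables (z : vec) (p : {poly R}).
Implicit Types x y : vec.

Definition zonal x : R := p.[dot z (normalize x)].

(** The gradient of x |-> z.x/|x|: the part of z orthogonal to x, divided by |x|. *)
Definition zonal_grad (i : 'I_n.+1) x : R :=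
  (z 0 i - dot z (normalize x) * normalize x 0 i) / enorm x.

Definition zonal_hess (i j : 'I_n.+1) x : R :=
  p^`()^`().[dot z (normalize x)] * zonal_grad j x * zonal_grad i x +
  p^`().[dot z (normalize x)] *
  (- (zonal_grad j x * normalize x 0 i
      + dot z (normalize x) * ((j == i)%:R - normalize x 0 i * normalize x 0 j) / enorm x) / enorm x
   - zonal_grad i x * normalize x 0 j / enorm x).

Lemma is_derive_zonal i x : x != 0 -> is_derive x (ebasis R i) zonal
  (p^`().[dot z (normalize x)] * zonal_grad i x).
Proof.
move=> x0.
exact: (is_derive_chain (is_derive_dot_normalize z i x0) (is_derive_poly p _)).
Qed.

Lemma is_derive_zonal_grad i j x : x != 0 -> is_derive x (ebasis R j) (zonal_grad i)
  (- (zonal_grad j x * normalize x 0 i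
      + dot z (normalize x) * ((j == i)%:R - normalize x 0 i * normalize x 0 j) / enorm x) / enorm x
   - zonal_grad i x * normalize x 0 j / enorm x).
Proof.
move=> x0; have n0 := enorm_gt0 x0.
have d1 := is_derive_dot_normalize z j x0.
have d2 := is_derive_normalize j i x0.
have d3 := is_derive_enormV j x0.
have d4 := is_deriveM d1 d2.
have d5 := is_deriveB (is_derive_cst (z 0 i) x (ebasis R j)) d4.
have D : is_derive x (ebasis R j) (zonal_grad i) _ := is_deriveM d5 d3.
apply: is_derive_eq D _.
rewrite /zonal_grad /GRing.scale /= sub0r.
rewrite !fctE; field.
by rewrite gt_eqF.
Qed.

Lemma is_derive_zonal2 i j x : x != 0 ->
  is_derive x (ebasis R j) (fun y => 'D_(ebasis R i) zonal y) (zonal_hess i j x).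
Proof.
move=> x0.
apply: (@near_eq_is_derive _ _ _ (fun y => p^`().[dot z (normalize y)] * zonal_grad i y)).
  have := near_neq0 x0; apply: filterS => y y0.
  by rewrite (@derive_val _ _ _ _ _ _ _ (is_derive_zonal i y0)).
have d1 := is_derive_chain (is_derive_dot_normalize z j x0) (is_derive_poly p^`() _).
have D := is_deriveM d1 (is_derive_zonal_grad i j x0).
apply: is_derive_eq D _.
rewrite /zonal_hess -/(zonal_grad j x) /GRing.scale /=; ring.
Qed.

Lemma zonal_grad_continuous i x : x != 0 -> {for x, continuous (zonal_grad i)}.
Proof.
move=> x0.
have ct := @dot_normalize_continuous R n.+1 z x x0.
have ci : {for x, continuous (fun y => normalize y 0 i)}.
  have := @dot_normalize_continuous R n.+1 (ebasis R i) x x0.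
  rewrite (_ : (fun y => _) = (fun y => normalize y 0 i)) //.
  by apply/funext => y; rewrite dot_ebasisl.
have cn : {for x, continuous (fun y => (enorm y)^-1)}.
  by apply: continuousV; [rewrite gt_eqF // enorm_gt0|exact: enorm_continuous].
apply: (continuousM _ cn).
apply: continuousB; first exact: cst_continuous.
exact: (continuousM ct ci).
Qed.

Lemma zonal_hess_continuous i j x : x != 0 -> {for x, continuous (zonal_hess i j)}.
Proof.
move=> x0.
have ct := @dot_normalize_continuous R n.+1 z x x0.
have cp (q : {poly R}) : {for x, continuous (fun y => q.[dot z (normalize y)])}.
  by apply: (@continuous_comp _ _ _ (fun y => dot z (normalize y)) (horner q)) => //; exact: continuous_horner.
have ci k : {for x, continuous (fun y => normalize y 0 k)}.
  have := @dot_normalize_continuous R n.+1 (ebasis R k) x x0.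
  rewrite (_ : (fun y => _) = (fun y => normalize y 0 k)) //.
  by apply/funext => y; rewrite dot_ebasisl.
have cn : {for x, continuous (fun y => (enorm y)^-1)}.
  by apply: continuousV; [rewrite gt_eqF // enorm_gt0|exact: enorm_continuous].
have cg k : {for x, continuous (zonal_grad k)} by exact: zonal_grad_continuous.
apply: continuousD.
  exact: (continuousM (continuousM (cp _) (cg j)) (cg i)).
apply: (continuousM (cp _)).
apply: continuousB; last exact: (continuousM (continuousM (cg i) (ci j)) cn).
apply: (continuousM _ cn); apply: continuousN; apply: continuousD.
  exact: (continuousM (cg j) (ci i)).
apply: (continuousM _ cn); apply: (continuousM ct).
apply: continuousB; first exact: cst_continuous.
exact: (continuousM (ci i) (ci j)).
Qed.

(** Summing the diagonal second derivatives, |z| = |x| = 1 collapses the sum to the Gegenbauer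
    operator in t = z.x. *)
Lemma laplacian_zonal x : dot z z = 1 -> x != 0 -> enorm x = 1 ->
  laplacian zonal x = (1 - dot z x ^+ 2) * p^`()^`().[dot z x] - n%:R * dot z x * p^`().[dot z x].
Proof.
move=> z1 x0 n1.
have nx : normalize x = x by rewrite /normalize n1 invr1 scale1r.
have x1 : dot x x = 1 by rewrite -enorm_sqr n1 expr1n.
rewrite /laplacian.
under eq_bigr => i _ do rewrite (@derive_val _ _ _ _ _ _ _ (is_derive_zonal2 i i x0)).
rewrite /zonal_hess /zonal_grad nx n1.
set t := dot z x; set a := _.[t]; set b := _.[t].
transitivity (\sum_(i < n.+1) (a * (z 0 i * z 0 i) + (-(2 * a * t) - 2 * b) * (z 0 i * x 0 i)
   + (a * t ^+ 2 + 3 * b * t) * (x 0 i * x 0 i) - b * t)).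
  by apply: eq_bigr => i _; rewrite eqxx !divr1 /= mulr1n; ring.
rewrite sumrB !big_split /= -!mulr_sumr sumr_const card_ord -/(dot z z) -/(dot z x) -/(dot x x) -/t z1 x1.
rewrite -mulr_natr; ring.
Qed.

End ZonalEigenfunction.

(** These are the test functions used against the weak equation. Their eigenvalue satisfies k (k + 2
    nu) + nu^2 = (k + nu)^2, so the operator B acts on them as k + nu. *)
Lemma geg_sph_eigen (R : realType) (n k : nat) (nu : R) (z : 'rV[R]_n.+1) :
  n%:R = 2 * nu + 1 -> dot z z = 1 ->
  sph_eigen (fun x => (geg nu k).[dot z x]) (k%:R * (k%:R + 2 * nu)).
Proof.
move=> nE z1; set p := geg nu k.
split; [|split].
- by move=> x x0 i; have [] := is_derive_zonal z p i x0.
- move=> x x0 i j; split; first by have [] := is_derive_zonal2 z p i j x0.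
  change (('D_(ebasis R j) (fun v => 'D_(ebasis R i) (zonal z p) v) y) @[y --> x]
    --> 'D_(ebasis R j) (fun v => 'D_(ebasis R i) (zonal z p) v) x).
  rewrite (@derive_val _ _ _ _ _ _ _ (is_derive_zonal2 z p i j x0)).
  apply: (@cvg_trans _ (zonal_hess z p i j y @[y --> x])); last exact: zonal_hess_continuous.
  apply: near_eq_cvg; first exact: (@nbhs_filter _ x).
  apply: filterS (near_neq0 x0) => y y0.
  by rewrite (@derive_val _ _ _ _ _ _ _ (is_derive_zonal2 z p i j y0)).
- move=> x /= x1.
  have x0 : x != 0.
    by apply: contra_eq_neq x1 => ->; rewrite enorm0 eq_sym oner_neq0.
  rewrite -/(zonal z p) laplacian_zonal //.
  have H := congr1 (fun q => q.[dot z x]) (geg_ode nu k).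
  rewrite !hornerE -/p /= in H.
  by rewrite nE H /=; ring.
Qed.

(** * The Gaussian measure on the line, integrability and Fubini *)

Section GaussLine.
Variable R : realType.
Local Notation leb := (@lebesgue_measure R).

(** Variance 1/2 gives the density pi^(-1/2) e^(-x^2), the one-dimensional factor of the weight in
    [sphere_int]. *)
Definition gauss_line : probability (measurableTypeR R) R :=
  normal_prob 0 (Num.sqrt (2^-1 : R)).

Let sigma0 : Num.sqrt (2^-1 : R) != 0.
Proof. by rewrite gt_eqF // sqrtr_gt0 invr_gt0. Qed.

Lemma gauss_line_pdf (x : R) :
  normal_pdf 0 (Num.sqrt 2^-1) x = (Num.sqrt pi)^-1 * expR (- x ^+ 2).
Proof.
rewrite normal_pdfE // /normal_peak /normal_fun sqr_sqrtr ?invr_ge0 //.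
have -> : 2^-1 * pi *+ 2 = pi :> R by rewrite mulr2n; field.
have -> : 2^-1 *+ 2 = 1 :> R by rewrite mulr2n; field.
by rewrite subr0 divr1.
Qed.

Lemma ge0_integral_gauss_line (f : measurableTypeR R -> \bar R) : measurable_fun setT f ->
  (forall x, 0 <= f x)%E ->
  (\int[gauss_line]_x f x = \int[leb]_x (f x * ((Num.sqrt pi)^-1 * expR (- x ^+ 2))%:E))%E.
Proof.
move=> mf f0.
have dom := @normal_prob_dominates R 0 (Num.sqrt 2^-1).
rewrite -(Radon_Nikodym_SigmaFinite.change_of_variables dom) //.
have Fi := Radon_Nikodym_SigmaFinite.f_integrable dom.
have mpdf : measurable_fun setT (fun x : measurableTypeR R => (normal_pdf 0 (Num.sqrt 2^-1) x)%:E).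
  by apply/measurable_EFinP; exact: measurable_normal_pdf.
under [RHS]eq_integral do rewrite -gauss_line_pdf.
apply: ae_eq_integral => //.
- by apply: emeasurable_funM => //; exact: measurable_int Fi.
- exact: emeasurable_funM.
apply: ae_eqe_mul2l => /=.
apply: integral_ae_eq => // E _ mE.
by rewrite -(Radon_Nikodym_SigmaFinite.f_integral dom).
Qed.

Lemma integrable_gauss_line (f : measurableTypeR R -> R) : measurable_fun setT f ->
  (gauss_line.-integrable setT (EFin \o f) <->
   leb.-integrable setT (EFin \o (fun t => f t * expR (- t ^+ 2)))).
Proof.
move=> mf.
have me : measurable_fun setT (fun t : measurableTypeR R => expR (- t ^+ 2)) by exact: measurable_gauss_fun.
have p0 : 0 < (Num.sqrt pi : R)^-1 by rewrite invr_gt0 sqrtr_gt0 pi_gt0.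
have E : (\int[gauss_line]_x `|(f x)%:E| =
  ((Num.sqrt pi)^-1)%:E * \int[leb]_x `|(f x * expR (- x ^+ 2))%:E|)%E.
  rewrite ge0_integral_gauss_line //; last exact/measurableT_comp/measurable_EFinP.
  rewrite -ge0_integralZl ?lee_fin ?(ltW p0) //; last first.
    by apply: measurableT_comp => //; apply/measurable_EFinP; exact: measurable_funM.
  apply: eq_integral => x _; rewrite /= -!EFinM; congr EFin.
  by rewrite normrM (ger0_norm (expR_ge0 _)) mulrCA.
split=> /integrableP[m fin]; apply/integrableP; split.
- by apply/measurable_EFinP; exact: measurable_funM.
- have : (0 <= \int[leb]_x `|(f x * expR (- x ^+ 2))%:E|)%E by exact: integral_ge0.
  move: fin; rewrite /= E; move: (integral _ _ _) => [r _ _|+ _|_ //].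
    by rewrite ltry.
  by rewrite gt0_muley ?lte_fin.
- exact/measurable_EFinP.
- rewrite /= E; apply: lte_mul_pinfty => //; by rewrite lee_fin ltW.
Qed.

Lemma Rintegral_gauss_line (f : measurableTypeR R -> R) : gauss_line.-integrable setT (EFin \o f) ->
  Rintegral leb setT (fun t => f t * expR (- t ^+ 2)) =
  Num.sqrt pi * Rintegral gauss_line setT f.
Proof.
move=> fi.
have mf : measurable_fun setT f by apply/measurable_EFinP; exact: measurable_int fi.
have fl := (integrable_gauss_line mf).1 fi.
have p0 : 0 < (Num.sqrt pi : R) by rewrite sqrtr_gt0 pi_gt0.
have dom := @normal_prob_dominates R 0 (Num.sqrt 2^-1).
have E : (\int[gauss_line]_x (f x)%:E = \int[leb]_x ((Num.sqrt pi)^-1 * (f x * expR (- x ^+ 2)))%:E)%E.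
  have me : measurable_fun setT (fun t : measurableTypeR R => expR (- t ^+ 2)) by exact: measurable_gauss_fun.
  rewrite [LHS]integralE [RHS]integralE; congr (_ - _)%E.
  - rewrite ge0_integral_gauss_line //; last exact/measurable_funepos/measurable_EFinP.
    apply: eq_integral => x _; rewrite !funeposE /=.
    rewrite maxe_pMl ?lee_fin ?mulr_ge0 ?expR_ge0 ?invr_ge0 1?ltW // mul0e.
    by rewrite -EFinM; congr (maxe _ _); congr EFin; ring.
  - rewrite ge0_integral_gauss_line //; last exact/measurable_funeneg/measurable_EFinP.
    apply: eq_integral => x _; rewrite !funenegE /=.
    rewrite maxe_pMl ?lee_fin ?mulr_ge0 ?expR_ge0 ?invr_ge0 1?ltW // mul0e.
    by rewrite -EFinM; congr (maxe _ _); congr EFin; ring.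
rewrite {2}/Rintegral E -/(Rintegral leb setT (fun x => (Num.sqrt pi)^-1 * (f x * expR (- x ^+ 2)))).
by rewrite RintegralZl // mulrA mulfV ?mul1r // gt_eqF.
Qed.

(** With a = x^2/2, the inequality 1 + a <= e^a gives x^2 e^(-x^2) <= 2 e^(-x^2/2), a multiple of
    the standard normal density. *)
Lemma integrable_gauss_sqr : gauss_line.-integrable setT (EFin \o (fun t : measurableTypeR R => t ^+ 2)).
Proof.
have mf : measurable_fun setT (fun t : measurableTypeR R => t ^+ 2) by exact: measurable_funX.
apply/(integrable_gauss_line mf).
have I1 := integrable_normal_pdf (0 : R) 1.
have c0 : normal_peak (1 : R) != 0 by rewrite gt_eqF // normal_peak_gt0 // oner_neq0.
have := integrableZl measurableT (2 / normal_peak (1 : R)) I1.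
apply: le_integrable => //.
  by apply/measurable_EFinP; apply: measurable_funM => //; exact: measurable_gauss_fun.
move=> x _ /=; rewrite lee_fin (ger0_norm (mulr_ge0 (sqr_ge0 _) (expR_ge0 _))).
apply: le_trans (ler_norm _).
rewrite normal_pdfE ?oner_neq0 // mulrA divfK // /normal_fun subr0 expr1n.
have -> : expR (- x ^+ 2) = expR (- x ^+ 2 / (1 *+ 2)) * expR (- x ^+ 2 / (1 *+ 2)).
  by rewrite -expRD; congr expR; rewrite mulr2n; field.
rewrite mulrA ler_wpM2r ?expR_ge0 // -ler_pdivlMr ?expR_gt0 // -expRN mulNr opprK.
move: (expR (x ^+ 2 / (1 *+ 2))) (expR_ge1Dx (x ^+ 2 / (1 *+ 2))) => e He.
have H2 : 2 * (x ^+ 2 / (1 *+ 2)) = x ^+ 2 by rewrite mulr2n; field.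
by move: He H2; move: (x ^+ 2) (x ^+ 2 / _) => a b He H2; lra.
Qed.

(** The fundamental theorem of calculus on [-(m+1), m+1] and dominated convergence; the boundary
    terms are only followed along integers. *)
Lemma Rintegral_derivative_eq0 (F f : R -> R) :
  (forall t : R, is_derive t 1 F (f t)) -> continuous f ->
  leb.-integrable setT (EFin \o f) ->
  F m.+1%:R @[m --> \oo] --> (0 : R) -> F (- m.+1%:R) @[m --> \oo] --> (0 : R) ->
  Rintegral leb setT f = 0.
Proof.
move=> dF cf fi F1 F2.
have mf : measurable_fun setT f by apply/measurable_EFinP; exact: measurable_int fi.
pose A (m : nat) : set R := `[- m.+1%:R, m.+1%:R]%classic.
have FTC m : (\int[leb]_(x in A m) (f x)%:E = (F m.+1%:R - F (- m.+1%:R))%:E)%E.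
  rewrite /A (@continuous_FTC2 _ f F) ?EFinB //.
  - by rewrite -subr_gt0 opprK addr_gt0.
  - exact: continuous_subspaceT.
  - split; first by move=> x _; have [] := dF x.
    + apply: cvg_at_right_filter; apply: differentiable_continuous; apply/derivable1_diffP.
      by have [] := dF (- m.+1%:R).
    + apply: cvg_at_left_filter; apply: differentiable_continuous; apply/derivable1_diffP.
      by have [] := dF m.+1%:R.
  - by move=> x _; rewrite derive1E; have [_] := dF x.
have C1 : (\int[leb]_x (((f \_ (A m)) x)%:E) @[m --> \oo] --> \int[leb]_x (f x)%:E)%E.
  apply: (@dominated_cvg _ _ _ leb setT _ (fun m x => ((f \_ (A m)) x)%:E) (fun x => (f x)%:E) (fun x => `|(f x)%:E|)%E) => //.
  - move=> m; apply/measurable_EFinP; exact: ((measurable_restrictT f (measurable_itv _)).1 (measurable_funTS mf)).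
  - move=> x _; apply: cvg_near_cst; exists (Num.bound `|x|) => // m /= hm.
    rewrite patchE mem_set // /A /= in_itv /=.
    have : `|x| <= m.+1%:R.
      have /ltW := archi_boundP (normr_ge0 x) => /le_trans; apply.
      by rewrite ler_nat leqW.
    by rewrite ler_norml.
  - exact: integrable_abse.
  - move=> m x _; rewrite patchE; case: ifPn => // _.
    by rewrite abse0 abse_ge0.
have C2 : (F m.+1%:R - F (- m.+1%:R))%:E @[m --> \oo] --> 0%:E.
  by apply: cvg_EFin; [exact: nearW|rewrite -(subr0 0); exact: cvgB].
have : (\int[leb]_x (f x)%:E = 0%:E)%E.
  apply: (cvg_unique _ C1) => //.
  apply: cvg_trans C2; apply: near_eq_cvg; apply: nearW => m.
  by rewrite -FTC integral_mkcond /=; apply: eq_integral => x _; rewrite restrict_EFin.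
by rewrite /Rintegral => ->.
Qed.

End GaussLine.

Section RealFubini.
Context d1 d2 (T1 : measurableType d1) (T2 : measurableType d2) (R : realType).
Variables (P1 : probability T1 R) (P2 : probability T2 R) (f : T1 * T2 -> R).
Hypothesis fi : (P1 \x P2)%E.-integrable setT (EFin \o f).

Lemma Rintegral_prod12 : Rintegral (P1 \x P2)%E setT f =
  Rintegral P1 setT (fun x => Rintegral P2 setT (fun y => f (x, y))).
Proof.
rewrite /Rintegral -integral12_prod_meas1 //; congr fine.
apply: ae_eq_integral => //.
- exact: (measurable_fubini_F fi).
- apply/measurable_EFinP; apply: (measurableT_comp (@fine_measurable R setT measurableT)); exact: (measurable_fubini_F fi).
have := ae_integrable1 fi; apply: filterS => x ix _ /=.
by rewrite /fubini_F fineK //; exact: (integrable_fin_num measurableT ix).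
Qed.

Lemma Rintegral_prod21 : Rintegral (P1 \x P2)%E setT f =
  Rintegral P2 setT (fun y => Rintegral P1 setT (fun x => f (x, y))).
Proof.
rewrite /Rintegral -integral21_prod_meas1 //; congr fine.
apply: ae_eq_integral => //.
- exact: (measurable_fubini_G fi).
- apply/measurable_EFinP; apply: (measurableT_comp (@fine_measurable R setT measurableT)); exact: (measurable_fubini_G fi).
have := ae_integrable2 fi; apply: filterS => x ix _ /=.
by rewrite /fubini_G fineK //; exact: (integrable_fin_num measurableT ix).
Qed.

End RealFubini.

Section ProbabilityIntegrable.
Context d (T : measurableType d) (R : realType) (P : probability T R).

Lemma bounded_integrable (f : T -> R) (M : R) : measurable_fun setT f ->
  (forall x, `|f x| <= M) -> P.-integrable setT (EFin \o f).
Proof.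
move=> mf fM; apply: measurable_bounded_integrable => //.
  by move: (probability_setT P) => /= ->; rewrite ltry.
exists M; split; first exact: num_real.
by move=> y My x _; exact: le_trans (fM x) (ltW My).
Qed.

Lemma le_integrableR (f g : T -> R) : measurable_fun setT f ->
  P.-integrable setT (EFin \o g) -> (forall x, `|f x| <= g x) ->
  P.-integrable setT (EFin \o f).
Proof.
move=> mf gi fg; apply: le_integrable gi => //; first exact/measurable_EFinP.
by move=> x _; rewrite lee_fin; apply: le_trans (fg x) (ler_norm _).
Qed.

Lemma integrable_sumR (I : finType) (h : I -> T -> R) :
  (forall i, P.-integrable setT (EFin \o h i)) ->
  P.-integrable setT (EFin \o (fun w => \sum_i h i w)).
Proof.
move=> hi; rewrite (_ : _ \o _ = (fun w => \sum_(i <- index_enum I) (h i w)%:E)%E); last first.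
  by apply/funext => w; rewrite /= sumEFin.
apply: (@integrable_sum _ _ _ P setT measurableT _ (index_enum I) xpredT (fun i w => (h i w)%:E)) => i _; exact: hi.
Qed.

Lemma integrable_cstR (r : R) : P.-integrable setT (EFin \o (fun _ : T => r)).
Proof. by apply: (@bounded_integrable _ `|r|). Qed.

Lemma integrableZR (r : R) (f : T -> R) : P.-integrable setT (EFin \o f) ->
  P.-integrable setT (EFin \o (fun w => r * f w)).
Proof. by move=> fi; have := integrableZl measurableT r fi. Qed.

Lemma integrableDR (f g : T -> R) : P.-integrable setT (EFin \o f) ->
  P.-integrable setT (EFin \o g) -> P.-integrable setT (EFin \o (fun w => f w + g w)).
Proof. by move=> fi gi; have := integrableD measurableT fi gi. Qed.

End ProbabilityIntegrable.

(** * Gaussian random vectors and the Gaussian divergence theorem *)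

Section GaussianVector.
Variable R : realType.
Variable N : nat.
Local Notation vec := 'rV[R]_N.
Local Notation leb := (@lebesgue_measure R).

(** Measurability is tested by composing with every random vector whose coordinates are measurable,
    so only real-valued measurability is involved. *)
Definition coord_measurable (g : vec -> R) : Prop :=
  forall d (T : measurableType d) (Y : T -> vec),
    (forall j, measurable_fun setT (fun w => Y w 0 j)) ->
    measurable_fun setT (fun w => g (Y w)).

Definition upd (k : nat) (t : R) (v : vec) : vec :=
  \row_j (if nat_of_ord j == k then t else v 0 j).

Definition head_from (k : nat) (c : 'I_N -> R) (v : vec) : vec :=
  \row_j (if (j < k)%N then c j else v 0 j).

Lemma coord_measurableM (f g : vec -> R) :
  coord_measurable f -> coord_measurable g -> coord_measurable (fun x => f x * g x).
Proof.
by move=> mf mg d T Y mY; apply: measurable_funM; [exact: mf|exact: mg].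
Qed.

Lemma coord_measurable_comp (h : R -> R) (j : 'I_N) : continuous h ->
  coord_measurable (fun x => h (x 0 j)).
Proof.
move=> ch d T Y mY.
exact: (@measurableT_comp _ _ _ _ _ _ h _ (fun w => Y w 0 j) (continuous_measurable_fun ch) (mY j)).
Qed.

Lemma integrable_gauss_upd (i : 'I_N) (V : vec -> R) (C : R) (x : vec) :
  coord_measurable V -> (forall x, `|V x| <= C * (1 + \sum_(j < N) x 0 j ^+ 2)) ->
  (gauss_line R).-integrable setT (EFin \o (fun t => V (upd i t x))).
Proof.
move=> mV bV.
apply: (@le_integrableR _ (measurableTypeR R) R (gauss_line R) (fun t => V (upd i t x))
  (fun t => C * (1 + \sum_(j < N) upd i t x 0 j ^+ 2))) => //.
  apply: mV => j; rewrite (_ : (fun w => _) = (fun t => if j == i then t else x 0 j)).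
    by case: (j == i).
  by apply/funext => t; rewrite mxE.
apply: integrableZR; apply: integrableDR; first exact: integrable_cstR.
apply: integrable_sumR => j; have [->|ji] := eqVneq j i.
  by apply: eq_integrable (integrable_gauss_sqr R) => // t _; rewrite /= mxE eqxx.
apply: eq_integrable (integrable_cstR _ (x 0 j ^+ 2)) => // t _.
by rewrite /= [upd _ _ _ _ _]mxE ifN.
Qed.

(* The first k coordinates of a standard Gaussian vector of variance 1/2; the
   last clause is the divergence theorem for the Gaussian weight. *)
Lemma gaussian_vector (k : nat) : (k <= N)%N ->
  exists (d : measure_display) (T : measurableType d) (P : probability T R)
    (c : T -> 'I_N -> R),
  [/\ forall j, measurable_fun setT (fun w => c w j),
      forall (j : 'I_N), (j < k)%N -> P.-integrable setT (EFin \o (fun w => c w j ^+ 2)),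
      forall (g : vec -> R) (M : R) (v : vec), coord_measurable g -> (forall x, `|g x| <= M) ->
        iint_aux k (fun x => g x * expR (- \sum_(j < N | (j < k)%N) x 0 j ^+ 2)) v =
        Num.sqrt pi ^+ k * Rintegral P setT (fun w => g (head_from k (c w) v)) &
      forall (i : 'I_N) (V : vec -> R) (C : R) (v : vec), (i < k)%N -> coord_measurable V ->
        (forall x, `|V x| <= C * (1 + \sum_(j < N) x 0 j ^+ 2)) ->
        (forall x, Rintegral leb setT (fun t => V (upd i t x) * expR (- t ^+ 2)) = 0) ->
        Rintegral P setT (fun w => V (head_from k (c w) v)) = 0].
Proof.
elim: k => [|k IH] kN.
  exists _, unit, (\d_tt : probability unit R), (fun _ _ => 0); split => //.
  - move=> g M v mg gM /=; rewrite big_pred0 // oppr0 expR0 mulr1 expr0 mul1r.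
    rewrite /Rintegral integral_dirac // diracT mul1e /=.
    by congr g; apply/rowP => j; rewrite mxE.
have [d [T [P [c [mc c2 H1 H2]]]]] := IH (ltnW kN).
pose k' : 'I_N := Ordinal kN.
(* The new coordinate, of index k, is an independent Gaussian variable: the space is multiplied by
   the Gaussian line. *)
pose c' (w : measurableTypeR R * T) (j : 'I_N) : R := if j == k' then w.1 else c w.2 j.
pose P' : probability (measurableTypeR R * T)%type R := (gauss_line R \x P)%E.
have hE t w v : head_from k.+1 (c' (t, w)) v = head_from k (c w) (upd k t v).
  apply/rowP => j; rewrite !mxE /c' ltnS leq_eqVlt.
  rewrite (_ : (j == k') = (nat_of_ord j == k)) //=.
  by have [->|] := eqVneq (nat_of_ord j) k; rewrite /= ?ltnn.
have hE' t w v : head_from k (c w) (upd k t v) = upd k t (head_from k (c w) v).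
  apply/rowP => j; rewrite !mxE.
  by have [->|] := eqVneq (nat_of_ord j) k; rewrite /= ?ltnn.
have mc' j : measurable_fun setT (fun w => c' w j).
  rewrite /c'; case: (j == k'); first exact: measurable_fst.
  exact: measurableT_comp (mc j) measurable_snd.
have mhead v j : measurable_fun setT (fun w => head_from k.+1 (c' w) v 0 j).
  rewrite (_ : (fun w => _) = (fun w => if (j < k.+1)%N then c' w j else v 0 j)).
    by case: (j < k.+1)%N.
  by apply/funext => w; rewrite mxE.
have c2' (j : 'I_N) : (j < k.+1)%N -> P'.-integrable setT (EFin \o (fun w => c' w j ^+ 2)).
  move=> jk; have m2 : measurable_fun setT (EFin \o (fun w => c' w j ^+ 2)).
    by apply/measurable_EFinP; exact: measurable_funX.
  have HH := @integrable12ltyP _ _ _ _ R (gauss_line R) P _ m2; apply: HH.2.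
  have [jk'|jk'] := eqVneq j k'.
    have /integrableP[_] := integrable_gauss_sqr R.
    have E x y : c' (x, y) j = x by rewrite /c' jk' eqxx.
    rewrite (_ : (fun x => _) = (fun x => (\int[P]_y `|(EFin \o (fun w => (c' w j ^+ 2)%R)) (x, y)|)%E)) //.
    apply/funext => x; rewrite (_ : (fun y => _) = (fun=> `|(x ^+ 2)%:E|%E)); last first.
      by apply/funext => y /=; rewrite E.
    by rewrite integral_cst //; move: (probability_setT P) => /= ->; rewrite mule1.
  have jk2 : (j < k)%N.
    rewrite ltn_neqAle -ltnS jk andbT; apply: contra_neq jk' => jk'; exact/val_inj.
  have E x y : c' (x, y) j = c y j by rewrite /c' (negbTE jk').
  rewrite (_ : (fun x => _) = (fun=> (\int[P]_y `|(EFin \o (fun w => (c w j ^+ 2)%R)) y|)%E)); last first.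
    by apply/funext => x; apply: eq_integral => y _ /=; rewrite E.
  rewrite integral_cst //; move: (probability_setT (gauss_line R)) => /= ->; rewrite mule1.
  by have /integrableP[_] := c2 j jk2.
exists _, _, P', c'; split => //.
- move=> g M v mg gM /=.
  have M0 : 0 <= M by apply: le_trans (gM 0).
  (* The Gaussian factor of coordinate k is moved into the integrand, which stays bounded by M, so
     the induction hypothesis applies to it. *)
  pose g' (x : vec) := g x * expR (- x 0 k' ^+ 2).
  have mg' : coord_measurable g'.
    apply: coord_measurableM => //.
    by apply: (@coord_measurable_comp (fun t => expR (- t ^+ 2))); exact: continuous_gauss_fun.
  have bg' x : `|g' x| <= M.
    rewrite normrM (ger0_norm (expR_ge0 _)) -[leRHS]mulr1 ler_pM ?expR_ge0 //.
    exact: gauss_fun_le1.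
  have fi : P'.-integrable setT (EFin \o (fun w => g (head_from k.+1 (c' w) v))).
    by apply: (@bounded_integrable _ _ _ _ _ M) => //; apply: mg => j; exact: mhead.
  have gi t : P.-integrable setT (EFin \o (fun w => g (head_from k.+1 (c' (t, w)) v))).
    apply: (@bounded_integrable _ _ _ _ _ M) => //; apply: mg => j.
    exact: measurableT_comp (mhead v j) (pair1_measurable t).
  have Hi : (gauss_line R).-integrable setT
      (EFin \o (fun t => Rintegral P setT (fun w => g (head_from k.+1 (c' (t, w)) v)))).
    have := integrable_fubini_F fi.
    apply: eq_integrable => // t _ /=; rewrite /fubini_F fineK //.
    exact: (integrable_fin_num measurableT (gi t)).
  have mH := (measurable_EFinP _ _).1 (measurable_int _ Hi).
  rewrite (Rintegral_prod12 fi) exprSr -mulrA -Rintegral_gauss_line // -RintegralZl //; last first.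
    exact/(integrable_gauss_line mH).
  apply: eq_Rintegral => t _.
  rewrite (_ : (fun x => g x * _) = (fun x => g' x * expR (- (\sum_(j < N | (j < k)%N) x 0 j ^+ 2)))); last first.
    apply/funext => x; rewrite /g' -mulrA -expRD; congr (_ * expR _).
    rewrite (bigD1 k') //= opprD; congr (_ - _); apply: eq_bigl => j.
    rewrite ltnS ltn_neqAle andbC; congr (_ && _).
  rewrite (H1 g' M) //; congr (_ * _).
  rewrite [RHS]mulrC -(RintegralZl _ measurableT (gi t)).
  by apply: eq_Rintegral => w _; rewrite hE /g' !mxE /= eqxx ltnn mulrC.
- move=> i V C v ik mV bV V0.
  have fi : P'.-integrable setT (EFin \o (fun w => V (head_from k.+1 (c' w) v))).
    apply: (@le_integrableR _ _ _ _ _ (fun w => C * (1 + \sum_(j < N) head_from k.+1 (c' w) v 0 j ^+ 2))) => //.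
      by apply: mV => j; exact: mhead.
    apply: integrableZR; apply: integrableDR; first exact: integrable_cstR.
    apply: integrable_sumR => j; have [jk|jk] := boolP (j < k.+1)%N.
      by apply: eq_integrable (c2' j jk) => // w _; rewrite /= mxE jk.
    apply: eq_integrable (integrable_cstR _ (v 0 j ^+ 2)) => // w _.
    by rewrite /= mxE (negbTE jk).
  (* If i is the new coordinate, it is integrated first and the line integral vanishes; otherwise
     the inner expectation vanishes by induction. *)
  have [ik'|ik'] := eqVneq i k'.
    rewrite (Rintegral_prod21 fi).
    rewrite (_ : (fun w => _) = (fun=> 0)) ?Rintegral_cst ?mul0r //.
    apply/funext => w.
    set x := head_from k (c w) v.
    rewrite (_ : (fun t => _) = (fun t => V (upd i t x))); last first.
      by apply/funext => t; rewrite hE hE' ik'.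
    have ti := integrable_gauss_upd i x mV bV.
    have := Rintegral_gauss_line ti; rewrite V0 => /esym/eqP.
    by rewrite mulf_eq0 sqrtr_eq0 leNgt pi_gt0 /= => /eqP.
  have ik2 : (i < k)%N.
    rewrite ltn_neqAle -ltnS ik andbT; apply: contra_neq ik' => ik'; exact/val_inj.
  rewrite (Rintegral_prod12 fi).
  under eq_Rintegral.
    move=> t _.
    under eq_Rintegral do rewrite hE.
    rewrite (H2 i V C) //; over.
  by rewrite Rintegral_cst // mul0r.
Qed.

End GaussianVector.

(** * Measurability of functions continuous away from the origin *)

Section MeasurabilityOffZero.
Variables (R : realType) (N : nat).
Local Notation vec := 'rV[R]_N.

Lemma measurable_countable_range d (T : measurableType d) (I : countType)
    (k : T -> I) (h : I -> R) :
  (forall v, measurable [set w | k w = v]) -> measurable_fun setT (fun w => h (k w)).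
Proof.
move=> mk _ B mB; rewrite setTI.
rewrite (_ : _ @^-1` B = \bigcup_v [set w | k w = v /\ B (h v)]); last first.
  apply/seteqP; split=> w /=; first by move=> Bw; exists (k w).
  by move=> [v _ [-> ]].
apply: countable_bigcupT_measurable => [|v]; first exact: countableP.
have [Bv|nBv] := pselect (B (h v)).
  rewrite (_ : [set _ | _] = [set w | k w = v]); first exact: mk.
  by apply/seteqP; split=> w /= => [[]|].
rewrite (_ : [set _ | _] = set0); first exact: measurable0.
by apply/seteqP; split=> w /= => [[]|].
Qed.

(** g(Y) is the pointwise limit of g at Y rounded down to the lattice of mesh 1/(m+1), and the
    rounded vector takes countably many values. *)
Lemma coord_measurable_off0 (g : vec -> R) :
  (forall x, x != 0 -> {for x, continuous g}) -> coord_measurable g.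
Proof.
move=> cg d T Y mY.
pose k (m : nat) (w : T) : 'rV[int]_N := \row_j Num.floor (m.+1%:R * Y w 0 j).
pose r (m : nat) (v : 'rV[int]_N) : vec := \row_j ((v 0 j)%:~R / m.+1%:R).
apply: (@measurable_fun_cvg _ _ _ _ (fun m w => g (r m (k m w)))).
  move=> m; apply: (@measurable_countable_range _ _ _ (k m) (fun v => g (r m v))) => v.
  rewrite (_ : [set w | k m w = v] =
    [set w | all (fun j => Num.floor (m.+1%:R * Y w 0 j) == v 0 j) (enum 'I_N)]); last first.
    apply/seteqP; split=> w /=.
      by move=> <-; apply/allP => j _; rewrite mxE.
    by move=> /allP H; apply/rowP => j; rewrite mxE; apply/eqP; apply: H; rewrite mem_enum.
  elim: (enum 'I_N) => [|j s IH].
    rewrite (_ : [set w | _] = setT); first exact: measurableT.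
    exact/seteqP.
  rewrite (_ : [set w | _] = [set w | Num.floor (m.+1%:R * Y w 0 j) == v 0 j] `&`
     [set w | all (fun j => Num.floor (m.+1%:R * Y w 0 j) == v 0 j) s]); last first.
    by apply/seteqP; split=> w /= => [/andP|[-> ->]].
  apply: measurableI => //.
  rewrite (_ : [set w | _] = (fun w => m.+1%:R * Y w 0 j) @^-1`
      `[(v 0 j)%:~R, (v 0 j + 1)%:~R[%classic).
    rewrite -[X in measurable X]setTI.
    by apply: measurable_funM => //; exact: measurable_itv.
  by apply/seteqP; split=> w /=; rewrite in_itv /= floor_eq.
move=> w _.
(* At the origin rounding is exact, so the sequence is constant; elsewhere continuity of g
   applies. *)
have [Y0|Y0] := eqVneq (Y w) 0.
  apply: cvg_near_cst; apply: nearW => m; congr g.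
  by rewrite /r /k Y0; apply/rowP => j; rewrite !mxE mulr0 floor0 mul0r.
apply: (@cvg_comp _ _ _ (fun m => r m (k m w)) g _ (nbhs (Y w))); last exact: cg.
apply/cvg_ballP => e e0; near=> m.
split => // i j; rewrite ord1 /ball /= /r /k !mxE.
have m0 : 0 < m.+1%:R :> R by [].
have /andP[f1 f2] := floor_itv (m.+1%:R * Y w 0 j).
rewrite intrD in f2.
have em : m.+1%:R^-1 < e.
  near: m; have /cvgr_lt /(_ e e0) := @cvg_harmonic R; apply: filterS => m /=.
  by rewrite /harmonic.
apply: le_lt_trans em.
rewrite -[X in `|X - _|](mulKf (lt0r_neq0 m0)) [_^-1 * _]mulrC -mulrBl normrM.
rewrite [X in _ * X]ger0_norm ?invr_ge0 ?ler0n // ler_piMl ?invr_ge0 ?ler0n //.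
by rewrite ler_norml; lra.
Unshelve. all: by end_near. Qed.

End MeasurabilityOffZero.

(** * Topology of the sphere and continuous functions on it *)

Section SphereTopology.
Variables (R : realType) (n : nat).
Local Notation vec := 'rV[R]_n.+1.

Lemma sphereP (x : vec) : sphere n x <-> dot x x = 1.
Proof.
split; first by rewrite -enorm_sqr => ->; rewrite expr1n.
by move=> x1; rewrite /sphere /= enormE x1 sqrtr1.
Qed.

Lemma sphere_neq0 (x : vec) : dot x x = 1 -> x != 0.
Proof.
move=> x1; apply: contra_eq_neq x1 => ->.
by rewrite (_ : dot 0 0 = 0) 1?eq_sym ?oner_neq0 //; apply/eqP; rewrite dot_eq0.
Qed.

Lemma normalize_id (x : vec) : dot x x = 1 -> normalize x = x.
Proof. by move=> x1; rewrite /normalize enormE x1 sqrtr1 invr1 scale1r. Qed.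

Lemma coord_normalize_continuous (x : vec) i : x != 0 ->
  {for x, continuous (fun y => normalize y 0 i)}.
Proof.
move=> x0; have := @dot_normalize_continuous R n.+1 (ebasis R i) x x0.
rewrite (_ : (fun y => _) = (fun y => normalize y 0 i)) //.
by apply/funext => y; rewrite dot_ebasisl.
Qed.

Lemma normalize_continuous (x : vec) : x != 0 -> {for x, continuous (@normalize R n.+1)}.
Proof.
move=> x0; have FF : Filter (nbhs x) := nbhs_filter x; apply/cvg_ballP => e e0.
have H i : \forall y \near x, `|normalize x 0 i - normalize y 0 i| < e.
  by have /cvgrPdist_lt /(_ e e0) := @coord_normalize_continuous x i x0.
have : \forall y \near x, forall i, `|normalize x 0 i - normalize y 0 i| < e.
  exact: (@filter_forall _ _ (fun i y => `|normalize x 0 i - normalize y 0 i| < e) (nbhs x) FF H).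
by apply: filterS => y Hy; split => // i j; rewrite ord1; exact: Hy.
Qed.

(* Continuity on the sphere, phrased through the 0-homogeneous extension. *)
Definition sph_continuous (F : vec -> R) : Prop :=
  forall x, x != 0 -> {for x, continuous (fun y => F (normalize y))}.

Lemma within_sph_continuous (F : vec -> R) :
  {within sphere n, continuous F} -> sph_continuous F.
Proof.
move=> /subspace_continuousP cF x x0.
have Sx : sphere n (normalize x) by apply/sphereP; exact: dot_normalize_self.
have := cF _ Sx; apply: cvg_comp => A; rewrite /= nbhs_simpl /within /= => H.
have H2 : nbhs x [set y | sphere n (normalize y) -> A (normalize y)].
  exact: normalize_continuous x0 _ H.
have FF : Filter (nbhs x) := nbhs_filter x.
have := @filterI _ (nbhs x) FF _ _ (near_neq0 x0) H2; apply: (@filterS _ (nbhs x) FF) => y [y0].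
by apply; apply/sphereP; exact: dot_normalize_self.
Qed.

Lemma sphere_compact : compact (sphere n : set vec).
Proof.
apply: bounded_closed_compact.
  exists 1; split; first exact: num_real.
  move=> M M1 x /sphereP x1; apply: le_trans (ltW M1).
  rewrite /Num.norm /= mx_normrE; apply: bigmax_le => // -[i j] _ /=; rewrite ord1.
  rewrite -(@ler_pXn2r _ 2) ?nnegrE // expr1n real_normK ?num_real //.
  by rewrite -x1 /dot (bigD1 j) //= -expr2 lerDl sumr_ge0 // => k _; rewrite -expr2 sqr_ge0.
rewrite (_ : sphere n = (fun x => dot x x) @^-1` [set 1]); last first.
  by apply/seteqP; split=> x /sphereP.
apply: closed_comp; last exact: closed_eq.
by move=> x _; exact: dotxx_continuous.
Qed.

Lemma sph_continuous_within (F : vec -> R) :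
  sph_continuous F -> {within sphere n, continuous F}.
Proof.
move=> cF; apply/subspace_continuousP => x /sphereP x1.
have H := cF x (sphere_neq0 x1).
rewrite /prop_for /continuous_at /= (normalize_id x1) in H.
have FF : Filter (nbhs x) := nbhs_filter x.
move=> A FA; have := H A FA; rewrite /= !nbhs_simpl /within /=.
apply: (@filterS _ (nbhs x) FF) => y Ay /sphereP y1.
by move: Ay; rewrite /= (normalize_id y1).
Qed.

Lemma sph_continuous_max (F : vec -> R) : sph_continuous F ->
  exists2 c, dot c c = 1 & forall x, dot x x = 1 -> F x <= F c.
Proof.
move=> /sph_continuous_within cF.
have [|c] := compact_EVT_max _ sphere_compact cF.
  by exists (ebasis R 0); apply/sphereP; exact: dot_ebasis.
by rewrite inE => /sphereP c1 H; exists c => // x /sphereP x1; apply: H; rewrite inE.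
Qed.

Lemma sph_continuous_bounded (F : vec -> R) : sph_continuous F ->
  exists2 M, 0 <= M & forall x, dot x x = 1 -> `|F x| <= M.
Proof.
move=> cF.
have [|c c1 H] := @sph_continuous_max (fun x => `|F x|).
  by move=> x x0; apply: (@continuous_comp _ _ _ _ (@Num.norm R R)); [exact: cF|exact: norm_continuous].
by exists `|F c|.
Qed.

End SphereTopology.

(** * Integration by parts for zonal functions *)

Lemma horner_bounded (R : realType) (p : {poly R}) :
  exists2 M : R, 0 <= M & forall t, -1 <= t <= 1 -> `|p.[t]| <= M.
Proof.
exists (\sum_(i < size p) `|p`_i|); first by apply: sumr_ge0.
move=> t /andP[t1 t2]; rewrite horner_coef; apply: le_trans (ler_norm_sum _ _ _) _.
apply: ler_sum => i _; rewrite normrM ler_piMr // normrX exprn_ile1 //.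
by rewrite ler_norml t1.
Qed.

Section ZonalOrthogonality.
Variables (R : realType) (n : nat).
Local Notation vec := 'rV[R]_n.+1.
Local Notation leb := (@lebesgue_measure R).
Variables (a b : vec).
Hypotheses (a1 : dot a a = 1) (b1 : dot b b = 1).
Variables (p q : {poly R}).

(** |x| times the gradient of z.x/|x|; as a vector it is orthogonal to x. *)
Definition tang (z : vec) (i : 'I_n.+1) (x : vec) : R :=
  z 0 i - dot z (normalize x) * normalize x 0 i.

(* p(a.x/|x|) |x|^2 grad (q(b.x/|x|)) / |x| ^ 0: its Gaussian divergence below
   only involves the values of zonal functions. *)
Definition zfield (i : 'I_n.+1) (x : vec) : R :=
  p.[dot a (normalize x)] * (q^`().[dot b (normalize x)] * (enorm x * tang b i x)).

(** The Gaussian divergence of component i: multiplied by e^(-|x|^2), it is the i-th partial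
    derivative of [zfield i x] times e^(-|x|^2). *)
Definition zfield_div (i : 'I_n.+1) (x : vec) : R :=
  p^`().[dot a (normalize x)] * q^`().[dot b (normalize x)] * (tang a i x * tang b i x) +
  p.[dot a (normalize x)] * (q^`()^`().[dot b (normalize x)] * tang b i x ^+ 2) -
  p.[dot a (normalize x)] * (q^`().[dot b (normalize x)] *
    (dot b (normalize x) * (1 - normalize x 0 i ^+ 2))) - 2 * x 0 i * zfield i x.

Lemma normalize_coord_le (x : vec) i : `|normalize x 0 i : R| <= 1.
Proof.
have := dot_normalize_le x (dot_ebasis R i); rewrite dot_ebasisl.
by rewrite ler_norml.
Qed.

Lemma tang_le (z : vec) i x : dot z z = 1 -> `|tang z i x| <= 2.
Proof.
move=> z1; apply: le_trans (ler_normB _ _) _.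
have h1 : `|z 0 i| <= 1 by have := dot_le (dot_ebasis R i) z1; rewrite dot_ebasisl ler_norml.
have h2 : `|dot z (normalize x) * normalize x 0 i| <= 1.
  rewrite normrM -[leRHS]mulr1 ler_pM ?normalize_coord_le //.
  by rewrite ler_norml dot_normalize_le.
by rewrite -[leRHS]/(1 + 1); exact: lerD.
Qed.

Lemma is_derive_zfield i x : x != 0 ->
  is_derive x (ebasis R i) (zfield i) (zfield_div i x + 2 * x 0 i * zfield i x).
Proof.
move=> x0; have n0 := enorm_gt0 x0.
have d1 := is_derive_chain (is_derive_dot_normalize a i x0) (is_derive_poly p _).
have d2 := is_derive_chain (is_derive_dot_normalize b i x0) (is_derive_poly q^`() _).
have d3 := is_deriveM (is_derive_enorm i x0)
  (is_deriveB (is_derive_cst (b 0 i) x (ebasis R i))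
    (is_deriveM (is_derive_dot_normalize b i x0) (is_derive_normalize i i x0))).
have D : is_derive x (ebasis R i) (zfield i) _ := is_deriveM d1 (is_deriveM d2 d3).
apply: is_derive_eq D _.
rewrite /zfield_div subrK /zfield /tang !fctE /GRing.scale /= eqxx /= mulr1n.
by field; rewrite gt_eqF.
Qed.

(** The field is orthogonal to x, so the terms 2 x_i [zfield i x] cancel in the sum, and it is
    homogeneous of degree 1, so its divergence depends on x/|x| only. What remains is grad P . grad
    Q + P Lap Q on the sphere, for P = p(a.x) and Q = q(b.x). *)
Lemma zfield_div_sum x : x != 0 -> \sum_(i < n.+1) zfield_div i x =
  p^`().[dot a (normalize x)] * q^`().[dot b (normalize x)] *
    (dot a b - dot a (normalize x) * dot b (normalize x)) +
  p.[dot a (normalize x)] * ((1 - dot b (normalize x) ^+ 2) * q^`()^`().[dot b (normalize x)]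
    - n%:R * dot b (normalize x) * q^`().[dot b (normalize x)]).
Proof.
move=> x0; have n0 := enorm_gt0 x0.
rewrite /zfield_div /zfield /tang.
set y := normalize x.
have yy : dot y y = 1 by exact: dot_normalize_self.
have xE i : x 0 i = enorm x * y 0 i by rewrite /y normalizeE mulrC divfK // gt_eqF.
set t := dot a y; set u := dot b y.
set p0 := p.[t]; set p1 := p^`().[t]; set q1 := q^`().[u]; set q2 := q^`()^`().[u].
set r := enorm x.
transitivity (\sum_(i < n.+1) (p1 * q1 * (a 0 i * b 0 i) - p1 * q1 * u * (a 0 i * y 0 i)
  + (- (p1 * q1 * t) - 2 * p0 * q2 * u - 2 * r ^+ 2 * p0 * q1) * (b 0 i * y 0 i)
  + (p1 * q1 * t * u + p0 * q2 * u ^+ 2 + p0 * q1 * u + 2 * r ^+ 2 * p0 * q1 * u) * (y 0 i * y 0 i)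
  + p0 * q2 * (b 0 i * b 0 i) - p0 * q1 * u)).
  by apply: eq_bigr => i _; rewrite xE -/r; ring.
rewrite sumrB !big_split /= sumrN -!mulr_sumr sumr_const card_ord.
rewrite -/(dot a b) -/(dot a y) -/(dot b y) -/(dot y y) -/(dot b b) -/t -/u yy b1.
rewrite -mulr_natr; ring.
Qed.

Lemma zfield_continuous i x : x != 0 -> {for x, continuous (zfield i)}.
Proof.
move=> x0.
have ct z : {for x, continuous (fun y => dot z (normalize y))}.
  exact: dot_normalize_continuous.
have cp z (s : {poly R}) : {for x, continuous (fun y => s.[dot z (normalize y)])}.
  by apply: (@continuous_comp _ _ _ (fun y => dot z (normalize y)) (horner s)) => //; exact: continuous_horner.
have cg : {for x, continuous (tang b i)}.
  apply: continuousB; first exact: cst_continuous.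
  by apply: (continuousM (ct b)); exact: coord_normalize_continuous.
apply: (continuousM (cp a p)); apply: (continuousM (cp b _)).
by apply: (continuousM _ cg); exact: enorm_continuous.
Qed.

Lemma zfield_div_continuous i x : x != 0 -> {for x, continuous (zfield_div i)}.
Proof.
move=> x0.
have ct z : {for x, continuous (fun y => dot z (normalize y))}.
  exact: dot_normalize_continuous.
have cp z (s : {poly R}) : {for x, continuous (fun y => s.[dot z (normalize y)])}.
  by apply: (@continuous_comp _ _ _ (fun y => dot z (normalize y)) (horner s)) => //; exact: continuous_horner.
have ci : {for x, continuous (fun y => normalize y 0 i)} by exact: coord_normalize_continuous.
have cg z : {for x, continuous (tang z i)}.
  by apply: continuousB; [exact: cst_continuous|exact: (continuousM (ct z) ci)].
have cW : {for x, continuous (zfield i)} by exact: zfield_continuous.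
apply: continuousB; last first.
  apply: (continuousM _ cW).
  apply: (@continuousM R _ (cst 2)); first exact: cst_continuous.
  exact: coord_continuous.
apply: continuousB; last first.
  apply: (continuousM (cp a p)); apply: (continuousM (cp b _)); apply: (continuousM (ct b)).
  apply: continuousB; first exact: cst_continuous.
  exact: (continuousM ci ci).
apply: continuousD.
  apply: (continuousM (continuousM (cp a _) (cp b _))); exact: (continuousM (cg a) (cg b)).
apply: (continuousM (cp a _)); apply: (continuousM (cp b _)).
exact: (continuousM (cg b) (cg b)).
Qed.

Lemma zfield_bounds : exists2 C : R, 0 <= C &
  forall i x, `|zfield i x| <= C * enorm x /\ `|zfield_div i x| <= C * (1 + dot x x).
Proof.
have [M0 M00 H0] := horner_bounded p.
have [M1 M10 H1] := horner_bounded p^`().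
have [N1 N10 K1] := horner_bounded q^`().
have [N2 N20 K2] := horner_bounded q^`()^`().
pose C := 4 * (M1 * N1 + M0 * N2 + M0 * N1).
have MN10 : 0 <= M1 * N1 by exact: mulr_ge0.
have MN02 : 0 <= M0 * N2 by exact: mulr_ge0.
have MN01 : 0 <= M0 * N1 by exact: mulr_ge0.
exists C; first by rewrite /C; lra.
move=> i x.
have ta := dot_normalize_le x a1; have tb := dot_normalize_le x b1.
have pa := H0 _ ta; have p1a := H1 _ ta; have q1b := K1 _ tb; have q2b := K2 _ tb.
have ga := @tang_le a i x a1; have gb := @tang_le b i x b1.
have nx := enorm_ge0 x.
have Wb : `|zfield i x| <= M0 * N1 * 2 * enorm x.
  rewrite /zfield 3!normrM (ger0_norm nx) -!mulrA ler_pM ?mulr_ge0 //.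
  by rewrite ler_pM ?mulr_ge0 // mulrC ler_wpM2r.
split.
  apply: le_trans Wb _; rewrite ler_wpM2r // /C; lra.
have xi : `|x 0 i| <= enorm x.
  have [->|x0] := eqVneq x 0; first by rewrite mxE normr0 enorm0.
  have := normalize_coord_le x i; rewrite normalizeE normrM normfV (ger0_norm nx).
  by rewrite ler_pdivrMr ?mul1r // enorm_gt0.
have e4 : `|2 * x 0 i * zfield i x| <= 4 * (M0 * N1) * dot x x.
  rewrite -enorm_sqr 2!normrM (ger0_norm (ler0n R 2)).
  rewrite [leRHS](_ : _ = 2 * enorm x * (M0 * N1 * 2 * enorm x)); last by ring.
  by apply: ler_pM => //; rewrite ?mulr_ge0 ?ler_wpM2l.
have e1 : `|p^`().[dot a (normalize x)] * q^`().[dot b (normalize x)] * (tang a i x * tang b i x)| <= M1 * N1 * 4.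
  rewrite !normrM ler_pM ?mulr_ge0 //; first by rewrite ler_pM.
  by rewrite (_ : 4 = 2 * 2 :> R) ?ler_pM //; ring.
have e2 : `|p.[dot a (normalize x)] * (q^`()^`().[dot b (normalize x)] * tang b i x ^+ 2)| <= M0 * N2 * 4.
  rewrite 2!normrM normrX -mulrA; apply: ler_pM => //.
  apply: ler_pM => //.
  by rewrite (_ : 4 = 2 ^+ 2 :> R) ?lerXn2r ?nnegrE //; ring.
have e3 : `|p.[dot a (normalize x)] * (q^`().[dot b (normalize x)] *
    (dot b (normalize x) * (1 - normalize x 0 i ^+ 2)))| <= M0 * N1 * 1.
  rewrite 3!normrM -mulrA; apply: ler_pM => //; apply: ler_pM => //.
  rewrite -[leRHS]mulr1; apply: ler_pM => //; first by rewrite ler_norml.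
  have := normalize_coord_le x i; rewrite !ler_norml => /andP[? ?]; apply/andP; split; nra.
have D0 := dot_ge0 x.
apply: le_trans (ler_normB _ _) _.
apply: le_trans (lerD (ler_normB _ _) (lexx _)) _.
apply: le_trans (lerD (lerD (ler_normD _ _) (lexx _)) (lexx _)) _.
apply: le_trans (lerD (lerD (lerD e1 e2) e3) e4) _.
rewrite /C; nra.
Qed.

End ZonalOrthogonality.

Section LineIntegral.
Variables (R : realType) (n : nat).
Local Notation vec := 'rV[R]_n.+1.
Local Notation leb := (@lebesgue_measure R).

Lemma Rintegral_off0 (f : R -> R) : (forall t, t != 0 -> f t = 0) ->
  Rintegral leb setT f = 0.
Proof.
move=> f0; rewrite (_ : f = f \_ [set 0]); last first.
  apply/funext => t; rewrite patchE; case: ifPn => //; rewrite notin_setE /= => /eqP.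
  exact: f0.
by rewrite -Rintegral_mkcond Rintegral_set1.
Qed.

Lemma upd_line (i : 'I_n.+1) (h s : R) (x : vec) :
  upd i (h + s) x = h *: ebasis R i + upd i s x.
Proof.
apply/rowP => j; rewrite !mxE eqxx /=.
rewrite (_ : (nat_of_ord j == i) = (j == i)) //.
by have [_|_] := eqVneq j i; rewrite /= ?mulr1 ?mulr0 ?add0r.
Qed.

Lemma dot_upd (i : 'I_n.+1) (s : R) (x : vec) :
  dot (upd i s x) (upd i s x) = s ^+ 2 + \sum_(j < n.+1 | j != i) x 0 j ^+ 2.
Proof.
rewrite /dot (bigD1 i) //= !mxE eqxx -expr2; congr (_ + _).
by apply: eq_bigr => j ji; rewrite !mxE ifN // expr2.
Qed.

Lemma expR_sqr_decay (K : R) (m : nat) : 0 <= K ->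
  (1 + (m.+1%:R ^+ 2 + K)) * expR (- m.+1%:R ^+ 2) <= 4 * (1 + K) * harmonic m.
Proof.
move=> K0; rewrite /harmonic; set x : R := m.+1%:R.
have x1 : 1 <= x by rewrite ler1n.
have e0 := expR_gt0 (x ^+ 2).
have e1 : (1 + x ^+ 2 / 2) ^+ 2 <= expR (x ^+ 2).
  have -> : expR (x ^+ 2) = expR (x ^+ 2 / 2) ^+ 2.
    by rewrite [RHS]expr2 -expRD; congr expR; field.
  by rewrite lerXn2r ?nnegrE ?expR_ge0 ?expR_ge1Dx //; nra.
rewrite expRN ler_pdivrMr // mulrAC ler_pdivlMr; last by lra.
apply: (@le_trans _ _ (4 * (1 + K) * (1 + x ^+ 2 / 2) ^+ 2)); last first.
  by rewrite ler_wpM2l //; lra.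
have y0 : 0 <= x ^+ 2 by nra.
apply: (@le_trans _ _ ((1 + K) * (1 + x ^+ 2) * x)).
  by apply: ler_wpM2r; [lra|move: (x ^+ 2) y0 => y y0; nra].
have -> : 4 * (1 + K) * (1 + x ^+ 2 / 2) ^+ 2 = (1 + K) * ((2 + x ^+ 2) * (2 + x ^+ 2)) by field.
rewrite -mulrA ler_wpM2l //; first by lra.
by apply: ler_pM; nra.
Qed.

Variables (a b : vec).
Hypotheses (a1 : dot a a = 1) (b1 : dot b b = 1).
Variables (p q : {poly R}).

(** A line parallel to the i-th axis that misses the origin carries an integrand that is the
    derivative of a smooth function decaying at both ends. *)
Lemma zfield_div_line (i : 'I_n.+1) (x : vec) :
  Rintegral leb setT (fun s => zfield_div a b p q i (upd i s x) * expR (- s ^+ 2)) = 0.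
Proof.
set K := \sum_(j < n.+1 | j != i) x 0 j ^+ 2.
have K0 : 0 <= K by apply: sumr_ge0 => j _; exact: sqr_ge0.
have [C C0 HC] := zfield_bounds a1 b1 p q.
(* The axis itself runs through the singular point 0, but there x/|x| is plus or minus the basis
   vector: all tangential factors vanish and so does the integrand. *)
have [Kz|Kz] := eqVneq K 0.
  apply: Rintegral_off0 => s s0.
  have du := dot_upd i s x; rewrite -/K Kz addr0 in du.
  have xj j : j != i -> upd i s x 0 j = 0.
    move=> ji; rewrite mxE ifN //; apply/eqP; rewrite -sqrf_eq0; apply/eqP.
    move: j ji; apply/psumr_eq0P; last exact: Kz.
    by move=> j _; exact: sqr_ge0.
  set y := normalize (upd i s x).
  have yj j : j != i -> y 0 j = 0 by move=> ji; rewrite normalizeE xj // mul0r.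
  have y1 : dot y y = 1.
    apply: dot_normalize_self; apply: contra_eq_neq du => ->.
    rewrite (_ : dot 0 0 = 0) 1?eq_sym ?sqrf_eq0 //; apply/eqP; by rewrite dot_eq0.
  have dy z : dot z y = z 0 i * y 0 i.
    rewrite /dot (bigD1 i) //= big1 ?addr0 // => j ji; by rewrite yj // mulr0.
  have yi : y 0 i * y 0 i = 1 by rewrite -y1 dy.
  have tz z : tang z i (upd i s x) = 0.
    by rewrite /tang -/y dy -mulrA yi mulr1 subrr.
  by rewrite /zfield_div /zfield !tz -/y (_ : y 0 i ^+ 2 = 1) ?expr2 // subrr; ring.
have Kp : 0 < K by rewrite lt_neqAle eq_sym Kz.
have y0 s : upd i s x != 0.
  rewrite -dot_eq0 dot_upd -/K gt_eqF //; have := sqr_ge0 s; lra.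
pose F s := zfield a b p q i (upd i s x) * expR (- s ^+ 2).
have cu s : {for s, continuous (fun s : R => upd i s x)}.
  apply/cvg_ballP => e e0; near=> s'; split => // i' j; rewrite ord1 !mxE /ball /=.
  case: ifP => _; last by rewrite subrr normr0.
  by near: s'; apply: (@cvgr_dist_lt _ _ _ (nbhs s) _ id s) => //; exact: cvg_id.
have ce : continuous (fun s : R => expR (- s ^+ 2)) := @continuous_gauss_fun R.
have mV : coord_measurable (zfield_div a b p q i).
  by apply: coord_measurable_off0 => z z0; exact: zfield_div_continuous.
have bV z : `|zfield_div a b p q i z| <= C * (1 + \sum_(j < n.+1) z 0 j ^+ 2).
  have <- : dot z z = \sum_(j < n.+1) z 0 j ^+ 2 by apply: eq_bigr => j _; rewrite expr2.
  exact: (HC i z).2.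
have bF s : `|F s| <= C * ((1 + (s ^+ 2 + K)) * expR (- s ^+ 2)).
  rewrite /F normrM (ger0_norm (expR_ge0 _)) mulrA ler_wpM2r ?expR_ge0 //.
  apply: le_trans (HC i _).1 _; rewrite ler_wpM2l //.
  have := enorm_sqr (upd i s x); rewrite dot_upd -/K => <-.
  have := enorm_ge0 (upd i s x); set r := enorm _ => r0; nra.
have Flim (sg : R) : sg ^+ 2 = 1 -> F (sg * m.+1%:R) @[m --> \oo] --> (0 : R).
  move=> sg1; apply/norm_cvg0P.
  apply: (@squeeze_cvgr _ _ _ _ (cst 0) (fun m => C * (4 * (1 + K) * harmonic m))).
  - near=> m; rewrite normr_ge0 /=; apply: le_trans (bF _) _.
    by rewrite ler_wpM2l // exprMn sg1 mul1r expR_sqr_decay.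
  - exact: cvg_cst.
  - have -> : (0 : R) = C * (4 * (1 + K) * 0) by rewrite !mulr0.
    apply: cvgM; first exact: cvg_cst.
    by apply: cvgM; [exact: cvg_cst|exact: cvg_harmonic].
apply: (@Rintegral_derivative_eq0 _ F).
- move=> s.
  have dz := is_derive_zfield a b p q i (y0 s).
  have dl : is_derive (s - s) (1 : R) (fun h : R => zfield a b p q i (h *: ebasis R i + upd i s x))
      (zfield_div a b p q i (upd i s x) + 2 * upd i s x 0 i * zfield a b p q i (upd i s x)).
    by rewrite subrr; exact: (is_derive_lineP _ _ _ _).1 dz.
  have ds : is_derive s (1 : R) (fun s' : R => s' - s) 1.
    by have := is_deriveB (is_derive_id s (1 : R)) (is_derive_cst s s (1 : R)); rewrite subr0.
  have d1 := @is_derive1_comp R (fun h : R => zfield a b p q i (h *: ebasis R i + upd i s x)) (fun s' : R => s' - s) s _ _ dl ds.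
  have e1 : is_derive s (1 : R) (fun s : R => - s ^+ 2) (- (2 * s)).
    by apply: is_derive_eq; rewrite /GRing.scale /=; ring.
  have d2 := @is_derive1_comp R expR _ s _ _ (is_derive_expR _) e1.
  have -> : F = ((fun h : R => zfield a b p q i (h *: ebasis R i + upd i s x)) \o (fun s' => s' - s)) *
    (expR \o (fun s : R => - s ^+ 2)).
    apply/funext => s'; rewrite /F.
    by rewrite -[RHS]/(zfield a b p q i ((s' - s) *: ebasis R i + upd i s x) * expR (- s' ^+ 2)) -upd_line subrK.
  apply: is_derive_eq (is_deriveM d1 d2) _.
  rewrite /= -upd_line subrK /GRing.scale /=.
  have -> : upd i s x 0 i = s by rewrite mxE eqxx.
  by ring.
- move=> s; apply: (@continuousM R _ (fun s => zfield_div a b p q i (upd i s x))); last exact: ce.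
  apply: (@continuous_comp _ _ _ (fun s => upd i s x) (zfield_div a b p q i)); first exact: cu.
  exact: zfield_div_continuous.
- have ti := integrable_gauss_upd i x mV bV.
  apply/(integrable_gauss_line _) => //.
  by apply/measurable_EFinP; exact: measurable_int ti.
- by have := Flim 1 (expr1n _ _); under eq_fun do rewrite mul1r.
- by have := Flim (-1) (sqrr_sign _ 1); under eq_fun do rewrite mulN1r.
Unshelve. all: by end_near. Qed.

End LineIntegral.

(** * The surface measure as the law of a random unit vector *)

Section SphereProbability.
Variables (R : realType) (n : nat).
Local Notation vec := 'rV[R]_n.+1.
Local Notation leb := (@lebesgue_measure R).

(** Already the innermost integrand is supported at the single point t = 0. Consequence: the
    Gaussian vector is almost surely nonzero. *)
Lemma iint_aux_indicator0 (k : nat) (v : vec) (h : vec -> R) : (k <= n)%N ->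
  iint_aux k.+1 (fun x => (x == 0)%:R * h x) v = 0.
Proof.
elim: k v => [|k IH] v kn /=.
  apply: Rintegral_off0 => t t0; rewrite (_ : (_ == 0) = false) ?mul0r //.
  apply/negbTE; apply/eqP => /rowP /(_ ord0); rewrite !mxE /= => /eqP.
  by rewrite (negbTE t0).
rewrite (_ : (fun t => _) = (fun=> 0)).
  by rewrite /Rintegral integral0.
by apply/funext => t; exact: IH (ltnW kn).
Qed.

Definition zonal_eigen (p : {poly R}) (l : R) : Prop :=
  forall t, (1 - t ^+ 2) * p^`()^`().[t] - n%:R * t * p^`().[t] = - l * p.[t].

(* The normalized surface measure as the law of a random point of the sphere. *)
Lemma sphere_probability : exists (d : measure_display) (T : measurableType d)
    (P : probability T R) (X : T -> vec),
  [/\ forall w, dot (X w) (X w) = 1,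
      forall F, sph_continuous F -> measurable_fun setT (fun w => F (X w)),
      forall F, sph_continuous F -> sphere_int F = Rintegral P setT (fun w => F (X w)) &
      forall a b p q lp lq, dot a a = 1 -> dot b b = 1 ->
        zonal_eigen p lp -> zonal_eigen q lq -> lp != lq ->
        Rintegral P setT (fun w => p.[dot a (X w)] * q.[dot b (X w)]) = 0].
Proof.
have [d [T [P [c [mc c2 H1 H2]]]]] := @gaussian_vector R n.+1 n.+1 (leqnn _).
pose Y w : vec := head_from n.+1 (c w) 0.
pose e0 : vec := ebasis R 0.
(* On the null event Y = 0 an arbitrary unit vector is used, so that X is a unit vector at every
   outcome. *)
pose X w : vec := if Y w == 0 then e0 else normalize (Y w).
have mY j : measurable_fun setT (fun w => Y w 0 j).
  rewrite (_ : (fun w => _) = (fun w => c w j)) //.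
  by apply/funext => w; rewrite mxE ltn_ord.
have pi0 : 0 < Num.sqrt pi ^+ n.+1 :> R by rewrite exprn_gt0 // sqrtr_gt0 pi_gt0.
have iintE (g : vec -> R) M : coord_measurable g -> (forall x, `|g x| <= M) ->
    iint (fun x => g x * expR (- (enorm x ^+ 2))) =
    Num.sqrt pi ^+ n.+1 * Rintegral P setT (fun w => g (Y w)).
  move=> mg gM; rewrite -(H1 g M 0) //; congr (iint_aux _ _ _).
  apply/funext => x; congr (_ * expR (- _)); rewrite enorm_sqr.
  by apply: eq_big => [j|j _]; rewrite ?ltn_ord ?expr2.
pose dl (x : vec) : R := (x == 0)%:R.
have mdl : coord_measurable dl.
  apply: coord_measurable_off0 => x x0; have FF : Filter (nbhs x) := nbhs_filter x.
  apply: cvg_near_cst.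
  have := near_neq0 x0; apply: (@filterS _ (nbhs x) FF) => y y0.
  by rewrite /dl (negbTE x0) (negbTE y0).
pose A := [set w | Y w = 0].
have mA : measurable A.
  have := mdl _ _ Y mY measurableT [set 1] (measurable_set1 _); rewrite setTI.
  rewrite (_ : _ @^-1` _ = A) //; apply/seteqP; split=> w /=; rewrite /dl.
    by have [//|_ /eqP] := eqVneq (Y w) 0; rewrite eq_sym oner_eq0.
  by move=> ->; rewrite eqxx.
have PA : P A = 0%E.
  have E : Rintegral P setT (fun w => dl (Y w)) = 0.
    have := @iintE dl 1 mdl; rewrite /iint (iint_aux_indicator0 _ _ (leqnn n)).
    move=> /(_ _)/esym/eqP; rewrite mulf_eq0 gt_eqF //= => H; apply/eqP/H.
    by move=> x; rewrite /dl; case: (_ == _); rewrite ?normr1 ?normr0.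
  have : (\int[P]_w (dl (Y w))%:E)%E = P A.
    rewrite -[A in RHS]setIT -integral_indic //; apply: eq_integral => w _.
    by congr EFin; rewrite indicE /dl; congr (nat_of_bool _)%:R; apply/eqP/idP; rewrite inE.
  move: E; rewrite /Rintegral => + E; rewrite E.
  have : P A \is a fin_num by exact: fin_num_measure.
  by case: (P A) => // r _ /= ->.
have aeY : {ae P, forall w, Y w != 0}.
  exists A; split => // w /=; rewrite /A /= => /negP; rewrite negbK => /eqP //.
have X1 w : dot (X w) (X w) = 1.
  rewrite /X; case: ifPn => Yw; first exact: dot_ebasis.
  exact: dot_normalize_self.
have mX F : sph_continuous F -> measurable_fun setT (fun w => F (X w)).
  move=> cF; pose g (x : vec) := if x == 0 then F e0 else F (normalize x).
  have mg : coord_measurable g.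
    apply: coord_measurable_off0 => x x0.
    have FF : Filter (nbhs x) := nbhs_filter x.
    have := cF x x0; rewrite /prop_for /continuous_at /g (negbTE x0).
    apply: cvg_trans; apply: near_eq_cvg.
    have := near_neq0 x0; apply: (@filterS _ (nbhs x) FF) => y y0.
    by rewrite (negbTE y0).
  rewrite (_ : (fun w => _) = (fun w => g (Y w))); first exact: mg.
  by apply/funext => w; rewrite /g /X; case: ifP.
have sE F : sph_continuous F -> sphere_int F = Rintegral P setT (fun w => F (X w)).
  move=> cF; have [M M0 HM] := sph_continuous_bounded cF.
  pose g x := F (normalize x).
  have mg : coord_measurable g by exact: coord_measurable_off0.
  have bg x : `|g x| <= M + `|F 0|.
    have [->|x0] := eqVneq x 0; first by rewrite /g normalize0 lerDr.
    by apply: le_trans (HM _ (dot_normalize_self x0)) _; rewrite lerDl.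
  rewrite /sphere_int (iintE g _ mg bg).
  rewrite (_ : pi `^ (n.+1%:R / 2) = Num.sqrt pi ^+ n.+1); last first.
    by rewrite mulrC powRrM powR12_sqrt ?pi_ge0 // powR_mulrn // sqrtr_ge0.
  rewrite [X in X / _]mulrC mulfK ?gt_eqF // /Rintegral; congr fine.
  apply: ae_eq_integral => //.
  - by apply/measurable_EFinP; exact: mg.
  - by apply/measurable_EFinP; exact: mX.
  - by move: aeY; apply: filterS => w Yw _; rewrite /g /X (negbTE Yw).
exists d, T, P, X; split => // a b p q lp lq a1 b1 op oq lpq.
(* Green's identity: the expected divergence vanishes, so E(grad P . grad Q) = lq E(P Q). The left
   side is symmetric under exchanging the two functions, which gives (lp - lq) E(P Q) = 0. *)
have key p' q' lq' a' b' : dot a' a' = 1 -> dot b' b' = 1 -> zonal_eigen q' lq' ->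
    Rintegral P setT (fun w => p'^`().[dot a' (X w)] * q'^`().[dot b' (X w)] *
      (dot a' b' - dot a' (X w) * dot b' (X w))) =
    lq' * Rintegral P setT (fun w => p'.[dot a' (X w)] * q'.[dot b' (X w)]).
  move=> a1' b1' oq'.
  have [C C0 HC] := zfield_bounds a1' b1' p' q'.
  have cz (z : vec) (s : {poly R}) : sph_continuous (fun x => s.[dot z x]).
    move=> x x0; apply: (@continuous_comp _ _ _ (fun y => dot z (normalize y)) (horner s)).
      exact: dot_normalize_continuous.
    exact: continuous_horner.
  have cz1 (z : vec) : sph_continuous (dot z) by move=> x x0; exact: dot_normalize_continuous.
  have intb (f : vec -> R) : sph_continuous f -> P.-integrable setT (EFin \o (fun w => f (X w))).
    move=> cf; have [M M0 HM] := sph_continuous_bounded cf.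
    by apply: (@bounded_integrable _ _ _ _ _ M); [exact: mX|move=> w; exact: HM].
  have mV i : coord_measurable (zfield_div a' b' p' q' i).
    by apply: coord_measurable_off0 => z z0; exact: zfield_div_continuous.
  have bV i (z : vec) : `|zfield_div a' b' p' q' i z| <= C * (1 + \sum_(j < n.+1) z 0 j ^+ 2).
    have <- : dot z z = \sum_(j < n.+1) z 0 j ^+ 2 by apply: eq_bigr => j _; rewrite expr2.
    exact: (HC i z).2.
  have int0 i : Rintegral P setT (fun w => zfield_div a' b' p' q' i (Y w)) = 0.
    apply: (H2 i _ C) => // x; exact: zfield_div_line.
  have intV i : P.-integrable setT (EFin \o (fun w => zfield_div a' b' p' q' i (Y w))).
    apply: (@le_integrableR _ _ _ _ _ (fun w => C * (1 + \sum_(j < n.+1) Y w 0 j ^+ 2))) => //.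
      exact: mV.
    apply: integrableZR; apply: integrableDR; first exact: integrable_cstR.
    apply: integrable_sumR => j; apply: eq_integrable (c2 j (ltn_ord j)) => // w _.
    by rewrite /= mxE ltn_ord.
  have [sum0 sumi] : Rintegral P setT (fun w => \sum_(i < n.+1) zfield_div a' b' p' q' i (Y w)) = 0 /\
      P.-integrable setT (EFin \o (fun w => \sum_(i < n.+1) zfield_div a' b' p' q' i (Y w))).
    have H (s : seq 'I_n.+1) : Rintegral P setT (fun w => \sum_(i <- s) zfield_div a' b' p' q' i (Y w)) = 0 /\
        P.-integrable setT (EFin \o (fun w => \sum_(i <- s) zfield_div a' b' p' q' i (Y w))).
      elim: s => [|i s [IH1 IH2]].
        rewrite (_ : (fun w => _) = (fun=> 0)); last by apply/funext => w; rewrite big_nil.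
        by split; [rewrite Rintegral_cst // mul0r|exact: integrable_cstR].
      rewrite (_ : (fun w => _) = (fun w => zfield_div a' b' p' q' i (Y w) +
        \sum_(i <- s) zfield_div a' b' p' q' i (Y w))); last first.
        by apply/funext => w; rewrite big_cons.
      by split; [rewrite RintegralD // int0 IH1 addr0|exact: integrableDR].
    exact: H.
  have cx (f g : vec -> R) : sph_continuous f -> sph_continuous g -> sph_continuous (fun x => f x * g x).
    by move=> cf cg x x0; apply: continuousM; [exact: cf|exact: cg].
  have cB : sph_continuous (fun x => dot a' b' - dot a' x * dot b' x).
    move=> x x0.
    change ({for x, continuous (fun y : vec => dot a' b' - dot a' (normalize y) * dot b' (normalize y))}).
    have h := continuousM (cz1 a' x x0) (cz1 b' x x0).
    by apply: continuousB; [exact: cst_continuous|exact: h].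
  have i1 := intb _ (cx _ _ (cx _ _ (cz a' p'^`()) (cz b' q'^`())) cB).
  have i2 := intb _ (cx _ _ (cz a' p') (cz b' q')).
  rewrite -(RintegralZl _ measurableT i2); apply/eqP; rewrite -subr_eq0.
  rewrite -(RintegralB measurableT i1 (integrableZR _ i2)) -sum0; apply/eqP.
  rewrite /Rintegral; congr fine; apply: ae_eq_integral => //.
  - by apply/measurable_EFinP; apply: (measurable_funB ((measurable_EFinP _ _).1 (measurable_int _ i1)));
       exact: (measurable_EFinP _ _).1 (measurable_int _ (integrableZR lq' i2)).
  - exact: measurable_int sumi.
  - move: aeY; apply: filterS => w Yw _; congr EFin.
    rewrite zfield_div_sum // /X (negbTE Yw) oq'; ring.
have E1 := key p q lq a b a1 b1 oq.
have E2 := key q p lp b a b1 a1 op.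
have : (lp - lq) * Rintegral P setT (fun w => p.[dot a (X w)] * q.[dot b (X w)]) = 0.
  rewrite mulrBl -E1; apply/eqP; rewrite subr_eq0; apply/eqP.
  transitivity (lp * Rintegral P setT (fun w => q.[dot b (X w)] * p.[dot a (X w)])).
    by congr (_ * _); apply: eq_Rintegral => w _; rewrite mulrC.
  rewrite -E2; apply: eq_Rintegral => w _.
  by rewrite (dotC b a); ring.
by move=> /eqP; rewrite mulf_eq0 subr_eq0 (negbTE lpq) => /eqP.
Qed.

End SphereProbability.

(** * Integration on the half-line: substitution and primitives *)

Section HalfLine.
Variable R : realType.
Local Notation leb := (@lebesgue_measure R).
Local Notation hl := (`]0, +oo[%classic : set R).

Lemma hlP (t : R) : hl t <-> 0 < t.
Proof. by rewrite /= in_itv /= andbT. Qed.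

Lemma measurable_hl : measurable hl. Proof. exact: measurable_itv. Qed.

Lemma hl_continuous_measurable (f : R -> R) :
  (forall t : R, 0 < t -> {for t, continuous f}) -> measurable_fun hl f.
Proof.
move=> cf; apply: open_continuous_measurable_fun; first exact: interval_open.
by move=> t /set_mem /hlP; exact: cf.
Qed.

Lemma hl_integral_limit (f : R -> R) (a : nat -> R) :
  measurable_fun hl f -> (forall t : R, 0 < t -> 0 <= f t) ->
  (forall m, 0 < a m) -> (forall m p, (m <= p)%N -> a p <= a m) -> a @ \oo --> (0 : R) ->
  (\int[leb]_(t in `[a m, +oo[) (f t)%:E @[m --> \oo] --> \int[leb]_(t in hl) (f t)%:E)%E.
Proof.
move=> mf f0 a0 ad alim.
pose g m t := if a m <= t then (f t)%:E else 0%E.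
have E m : (\int[leb]_(t in `[a m, +oo[) (f t)%:E = \int[leb]_(t in hl) g m t)%E.
  rewrite [LHS]integral_mkcond [RHS]integral_mkcond; apply: eq_integral => t _.
  rewrite !patchE /g; case: ifPn => h1; case: ifPn => h2.
  - by move: h1; rewrite inE /= in_itv /= andbT => ->.
  - move: h1 h2; rewrite inE notin_setE /= !in_itv /= !andbT => h1 /negP.
    by rewrite (lt_le_trans (a0 m) h1).
  - by move: h1; rewrite notin_setE /= in_itv /= andbT => /negP /negbTE ->.
  - by [].
under eq_cvg do rewrite E.
have L t : hl t -> limn (g^~ t) = (f t)%:E.
  move=> /hlP t0; apply: cvg_lim => //; apply: cvg_near_cst.
  by have /cvgr_lt /(_ t t0) := alim; apply: filterS => m /= am; rewrite /g ltW.
rewrite (_ : (\int[leb]_(t in hl) (f t)%:E = \int[leb]_(t in hl) limn (g^~ t))%E); last first.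
  by apply: eq_integral => t; rewrite inE => /L ->.
apply: cvg_monotone_convergence => //.
- move=> m; rewrite /g; apply: measurable_fun_if => //.
  + by apply: measurable_fun_ler => //; exact: measurable_id.
  + by apply: (measurable_funS measurable_hl) => //; exact/measurable_EFinP.
- by move=> m t /hlP t0; rewrite /g; case: ifP => // _; rewrite lee_fin f0.
- move=> t /hlP t0 m p mp; rewrite /g; case: ifPn => h1.
    by rewrite (le_trans (ad _ _ mp) h1).
  by case: ifP => // _; rewrite lee_fin f0.
Qed.

Lemma harmonic_noninc (m p : nat) : (m <= p)%N -> (harmonic p : R) <= harmonic m.
Proof. by move=> mp; rewrite /harmonic lef_pV2 ?posrE ?ltr0n // ler_nat. Qed.

(** The substitution is made on [1/(m+1), +oo), where F is regular up to the endpoint; monotone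
    convergence on both sides then lets m tend to infinity. *)
Lemma hl_substitution (F F' G : R -> R) :
  (forall t : R, 0 < t -> is_derive t 1 F (F' t)) -> (forall t : R, 0 < t -> 0 < F' t) ->
  (forall t : R, 0 < t -> {for t, continuous F'}) -> cvg (F' x @[x --> +oo]) ->
  (forall t : R, 0 < t -> 0 < F t) -> F (harmonic m) @[m --> \oo] --> (0 : R) ->
  F x @[x --> +oo] --> +oo ->
  (forall t : R, 0 < t -> {for t, continuous G}) -> (forall t : R, 0 < t -> 0 <= G t) ->
  (\int[leb]_(t in hl) (G t)%:E = \int[leb]_(t in hl) (G (F t) * F' t)%:E)%E.
Proof.
move=> dF F'0 cF' cvF' F0 Flim Foo cG G0.
have cF t : 0 < t -> {for t, continuous F}.
  move=> t0; apply: differentiable_continuous; apply/derivable1_diffP.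
  by have [] := dF t t0.
have dFE t : 0 < t -> F^`()%classic t = F' t.
  by move=> t0; rewrite derive1E; have [_] := dF t t0.
have incF (x y : R) : 0 < x -> x < y -> F x < F y.
  move=> x0 xy.
  have [||c cxy] := @MVT _ F F' x y xy.
  - by move=> c; rewrite in_itv /= => /andP[xc _]; apply: dF; exact: lt_trans xc.
  - apply: continuous_in_subspaceT => c /set_mem /=; rewrite in_itv /= => /andP[xc _].
    exact/cF/(lt_le_trans x0).
  - move=> E; rewrite -subr_gt0 E mulr_gt0 ?subr_gt0 // F'0 //.
    by move: cxy; rewrite in_itv /= => /andP[xc _]; exact: lt_trans xc.
have h0 m : 0 < (harmonic m : R) by rewrite /harmonic invr_gt0 ltr0n.
have mG : measurable_fun hl G by exact: hl_continuous_measurable.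
have cGF t : 0 < t -> {for t, continuous (fun t => G (F t) * F' t)}.
  move=> t0; apply: continuousM; last exact: cF'.
  by apply: (@continuous_comp _ _ _ F G); [exact: cF|apply: cG; exact: F0].
have L1 := @hl_integral_limit G (fun m => F (harmonic m)) mG G0 (fun m => F0 _ (h0 m)).
have L2 := @hl_integral_limit (fun t => G (F t) * F' t) harmonic
  (hl_continuous_measurable cGF).
have {}L2 := L2 (fun t t0 => mulr_ge0 (G0 _ (F0 _ t0)) (ltW (F'0 _ t0))) h0 harmonic_noninc (@cvg_harmonic R).
have {}L1 : (\int[leb]_(t in `[F (harmonic m), +oo[) (G t)%:E @[m --> \oo] --> \int[leb]_(t in hl) (G t)%:E)%E.
  apply: L1 => // m p mp; have := harmonic_noninc mp; rewrite le_eqVlt => /orP[/eqP->//|lt].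
  by apply: ltW; exact: incF.
apply: (cvg_unique _ L1) => //; apply: cvg_trans L2; apply: near_eq_cvg; apply: nearW => m.
have hm := h0 m.
rewrite (@increasing_ge0_integration_by_substitutiony _ F G (harmonic m)).
- apply: eq_integral => t; rewrite inE /= in_itv /= andbT => mt.
  by rewrite [in RHS]/GRing.mul /= dFE // (lt_le_trans hm).
- move=> x y; rewrite !in_itv /= !andbT => mx _; apply: incF; exact: lt_le_trans mx.
- move=> x; rewrite in_itv /= andbT => mx; have x0 := lt_trans hm mx.
  rewrite /continuous_at dFE //; apply: cvg_trans (cF' x x0).
  apply: near_eq_cvg; near=> y; rewrite dFE //; near: y; exact: lt_nbhsr.
- apply/cvg_ex; exists (F' (harmonic m)).
  apply: cvg_trans (cvg_at_right_filter (cF' _ hm)).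
  apply: near_eq_cvg; near=> y; rewrite dFE //; apply: lt_trans hm _; near: y; exact: nbhs_right_gt.
- move: cvF' => /cvg_ex[l hl]; apply/cvg_ex; exists l; apply: cvg_trans hl.
  apply: near_eq_cvg; near=> y; rewrite dFE //; near: y; exact: nbhs_pinfty_gt.
- split; first by move=> x; rewrite in_itv /= andbT => mx; have [] := dF x (lt_trans hm mx).
  exact: cvg_at_right_filter (cF _ hm).
- exact: Foo.
- apply: continuous_in_subspaceT => x /set_mem /=; rewrite in_itv /= andbT => mx.
  by apply: cG; exact: lt_le_trans (F0 _ hm) mx.
- by move=> x; rewrite in_itv /= andbT => mx; apply: G0; exact: lt_trans (F0 _ hm) mx.
Unshelve. all: by end_near. Qed.

Lemma hl_scale (c : R) (G : R -> R) : 0 < c ->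
  (forall t : R, 0 < t -> {for t, continuous G}) -> (forall t : R, 0 < t -> 0 <= G t) ->
  (\int[leb]_(t in hl) (G t)%:E = \int[leb]_(t in hl) (G (c * t) * c)%:E)%E.
Proof.
move=> c0 cG G0; apply: hl_substitution => //.
- move=> t _; apply: is_derive_eq; rewrite /GRing.scale /=; ring.
- by move=> t _; exact: cst_continuous.
- exact: is_cvg_cst.
- by move=> t t0; exact: mulr_gt0.
- by rewrite -[X in _ --> X](mulr0 c); apply: cvgM; [exact: cvg_cst|exact: cvg_harmonic].
- exact: gt0_cvgMry.
Qed.

Lemma hl_FTC (f F : R -> R) (l0 l : R) :
  (forall t : R, 0 < t -> is_derive t 1 F (f t)) -> (forall t : R, 0 < t -> 0 <= f t) ->
  (forall t : R, 0 < t -> {for t, continuous f}) ->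
  F (harmonic m) @[m --> \oo] --> l0 -> F x @[x --> +oo] --> l ->
  (\int[leb]_(t in hl) (f t)%:E = (l - l0)%:E)%E.
Proof.
move=> dF f0 cf Fl0 Fl.
have h0 m : 0 < (harmonic m : R) by rewrite /harmonic invr_gt0 ltr0n.
have L := @hl_integral_limit f harmonic (hl_continuous_measurable cf) f0 h0 harmonic_noninc (@cvg_harmonic R).
apply: (cvg_unique _ L) => //.
have L2 : (l - F (harmonic m))%:E @[m --> \oo] --> (l - l0)%:E.
  by apply: cvg_EFin; [exact: nearW|apply: cvgB => //; exact: cvg_cst].
apply: cvg_trans L2; apply: near_eq_cvg; apply: nearW => m.
rewrite (@ge0_continuous_FTC2y _ f F (harmonic m) l) //.
- by move=> x mx; apply: f0; exact: lt_le_trans mx.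
- apply: continuous_in_subspaceT => x /set_mem /=; rewrite in_itv /= andbT => mx.
  by apply: cf; exact: lt_le_trans mx.
- by move=> x mx; have [] := dF x (lt_trans (h0 m) mx).
- apply: cvg_at_right_filter; apply: differentiable_continuous; apply/derivable1_diffP.
  by have [] := dF _ (h0 m).
- move=> x; rewrite in_itv /= andbT => mx.
  by rewrite derive1E; have [_] := dF x (lt_trans (h0 m) mx).
Qed.

Lemma powR_continuous (r t : R) : 0 < t -> {for t, continuous (fun t : R => t `^ r)}.
Proof.
move=> t0; apply: differentiable_continuous; apply/derivable1_diffP.
by have [] := is_derive1_powR r t0.
Qed.

End HalfLine.

(** * Gamma and Beta integrals *)

Section GammaBeta.
Variable R : realType.
Local Notation leb := (@lebesgue_measure R).
Local Notation hl := (`]0, +oo[%classic : set R).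

Lemma powRE (x p : R) : 0 < x -> x `^ p = expR (p * ln x).
Proof. by move=> x0; rewrite /powR gt_eqF. Qed.

Lemma mem_hl (t : R) : (t \in hl) = (0 < t).
Proof. by apply/idP/idP => [/set_mem/hlP//|/hlP/mem_set]. Qed.

(** Extended-real version of [Gamma], so that Tonelli's theorem can be used before finiteness is
    known. *)
Definition eGamma (a : R) : \bar R :=
  (\int[leb]_(t in hl) (t `^ (a - 1) * expR (- t))%:E)%E.

(** Euler's Beta integral over (0,1) after the substitution t = (1-x)/x. *)
Definition eBeta (a b : R) : \bar R :=
  (\int[leb]_(t in hl) (t `^ (b - 1) * (1 + t) `^ (- (a + b)))%:E)%E.

Lemma add1_powR_continuous (r t : R) : 0 < t -> {for t, continuous (fun t : R => (1 + t) `^ r)}.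
Proof.
move=> t0; apply: (@continuous_comp R R R (fun t => 1 + t) (fun t => t `^ r) t).
  by apply: continuousD; [exact: cst_continuous|exact: cvg_id].
by apply: powR_continuous; rewrite ltr_pwDl // ltW.
Qed.

Lemma gamma_integrand_continuous (a t : R) : 0 < t ->
  {for t, continuous (fun t : R => t `^ (a - 1) * expR (- t))}.
Proof.
move=> t0; apply: continuousM; first exact: powR_continuous.
apply: (@continuous_comp R R R (fun t => - t) expR); last exact: continuous_expR.
by apply: continuousN; exact: cvg_id.
Qed.

Lemma beta_integrand_continuous (a b t : R) : 0 < t ->
  {for t, continuous (fun t : R => t `^ (b - 1) * (1 + t) `^ (- (a + b)))}.
Proof.
move=> t0; apply: continuousM; first exact: powR_continuous.
exact: add1_powR_continuous.
Qed.

Lemma hl_integral_gt0 (f : R -> R) :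
  (forall t : R, 0 < t -> {for t, continuous f}) -> (forall t : R, 0 < t -> 0 < f t) ->
  (0 < \int[leb]_(t in hl) (f t)%:E)%E.
Proof.
move=> cf f0.
rewrite lt_neqAle integral_ge0 ?andbT; last by move=> t /hlP /f0 /ltW; rewrite lee_fin.
apply/eqP => E.
have H : (\int[leb]_(t in hl) `|(f t)%:E| = 0)%E.
  rewrite E; apply: eq_integral => t /[!inE] /hlP /f0 /ltW t0.
  by rewrite gee0_abs // lee_fin.
have mf : measurable_fun hl (EFin \o f).
  by apply/measurable_EFinP; exact: hl_continuous_measurable.
have [N [mN N0 sN]] := (ae_eq_integral_abs leb (@measurable_hl R) mf).1 H.
have S : hl `<=` N.
  move=> t ht; apply: sN => /= /(_ ht) [] ft0.
  by have := f0 t ((hlP t).1 ht); rewrite ft0 ltxx.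
have /= := le_measure leb (mem_set (@measurable_hl R)) (mem_set mN) S.
by rewrite N0 lebesgue_measure_itv /= ltry.
Qed.

Lemma ratio_cvg1 : (x / (1 + x) : R) @[x --> +oo] --> (1 : R).
Proof.
have L : (1 - (1 + x)^-1 : R) @[x --> +oo] --> (1 - 0 : R).
  apply: cvgB; first exact: cvg_cst.
  apply/gtr0_cvgV0; first by near=> x; rewrite ltr_pwDl //; near: x; exact: nbhs_pinfty_ge.
  apply/cvgryPge => A; near=> x; rewrite ler_wpDl //; near: x; exact: nbhs_pinfty_ge.
rewrite subr0 in L; apply: cvg_trans L; apply: near_eq_cvg; near=> x.
have x0 : 0 <= x by near: x; exact: nbhs_pinfty_ge.
by field; rewrite gt_eqF // ltr_pwDl.
Unshelve. all: by end_near. Qed.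

(** The integrand has the explicit primitive (t/(1+t))^a / a. Together with [gamma_exp_bound] it
    dominates the Gamma integrand. *)
Lemma gamma_majorant (a : R) : 0 < a ->
  (\int[leb]_(t in hl) (t `^ (a - 1) * (1 + t) `^ (- (1 + a)))%:E = (a^-1)%:E)%E.
Proof.
move=> a0.
have -> : (a^-1)%:E = (a^-1 - 0)%:E by rewrite subr0.
apply: (@hl_FTC R _ (fun t => a^-1 * (t / (1 + t)) `^ a) 0 (a^-1)).
- move=> t t0.
  have t1 : 0 < 1 + t by rewrite ltr_pwDl // ltW.
  have d1 : is_derive t 1 (fun t : R => 1 + t) 1.
    have D := @is_deriveD R R R (fun _ => 1) id t 1 _ _ (is_derive_cst _ _ _) (is_derive_id _ _).
    by apply: is_derive_eq D _; rewrite add0r.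
  have d2 : is_derive t (1 : R) (fun t : R => (1 + t)^-1) (- (1 + t) ^- 2).
    have D := @is_deriveV R (fun t => 1 + t) t 1 1 (lt0r_neq0 t1) d1.
    by apply: is_derive_eq D _; rewrite /GRing.scale /= mulr1.
  have d3 : is_derive t (1 : R) (fun t : R => t / (1 + t)) ((1 + t) ^- 2).
    have D := @is_deriveM R R id (fun t : R => (1 + t)^-1) t 1 _ _ (is_derive_id _ _) d2.
    apply: is_derive_eq D _; rewrite /GRing.scale /=; field; exact: lt0r_neq0.
  have p0 : 0 < t / (1 + t) by rewrite divr_gt0.
  have d4 := @is_derive1_comp R (fun x => x `^ a) (fun t => t / (1 + t)) t _ _ (is_derive1_powR a p0) d3.
  have d5 := @is_deriveM R R (fun _ => a^-1) _ t 1 _ _ (is_derive_cst _ _ _) d4.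
  apply: is_derive_eq d5 _; rewrite /GRing.scale /= mulr0 addr0.
  rewrite powRM ?invr_ge0 ?ltW // !mulrA mulVf ?gt_eqF // mul1r -mulrA; congr (_ * _).
  rewrite -(powR_inv1 (ltW t1)) -powRrM -[_ ^+ 2]powR_mulrn ?(ltW t1) // -powRN -powRD; last first.
    by rewrite (lt0r_neq0 t1) implybT.
  by congr (_ `^ _); ring.
- by move=> t _; rewrite mulr_ge0 ?powR_ge0.
- by move=> t t0; exact: beta_integrand_continuous.
- rewrite -(mulr0 a^-1); apply: cvgM; first exact: cvg_cst.
  have L := powR_cvg0 a0.
  apply: (@cvg_comp _ _ _ (fun m => harmonic m / (1 + harmonic m)) (fun x : R => x `^ a) _ _ _ _ L).
  have H0 : (harmonic m / (1 + harmonic m) : R) @[m --> \oo] --> (0 : R).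
    have := @cvgM _ _ _ _ _ _ 0 ((1 + 0)^-1) (@cvg_harmonic R) _.
    rewrite mul0r; apply; apply: cvgV; first by rewrite addr0 oner_neq0.
    by apply: cvgD; [exact: cvg_cst|exact: cvg_harmonic].
  move=> A [e /= e0 eA]; have /cvgrPdist_lt /(_ e e0) := H0; apply: filterS => m /= B.
  by apply: eA => //=.
- have L : {for (1 : R), continuous (fun t : R => t `^ a)} by exact: powR_continuous.
  have := @cvgM _ _ _ _ _ _ _ _ (cvg_cst a^-1) (cvg_comp _ _ ratio_cvg1 L).
  by rewrite powR1 mulr1; exact.
Qed.

(** With k = a + 1, raise 1 + t <= k e^((1+t)/k) to the power k. *)
Lemma gamma_exp_bound (a t : R) : 0 < a -> 0 < t ->
  expR (- t) <= ((a + 1) `^ (a + 1) * expR 1) * (1 + t) `^ (- (1 + a)).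
Proof.
move=> a0 t0; rewrite (addrC 1 a); set k := a + 1; have k0 : 0 < k by rewrite addr_gt0.
have t1 : 0 < 1 + t by rewrite ltr_pwDl // ltW.
have H : 1 + t <= k * expR ((1 + t) / k).
  rewrite -ler_pdivrMl // mulrC; apply: le_trans (expR_ge1Dx _); by rewrite lerDr.
have H2 : (1 + t) `^ k <= k `^ k * expR (1 + t).
  apply: le_trans (ge0_ler_powR (ltW k0) _ _ H) _; rewrite ?nnegrE ?(ltW t1) //.
    by rewrite mulr_ge0 ?expR_ge0 ?(ltW k0).
  rewrite powRM ?expR_ge0 ?(ltW k0) // [expR _ `^ k]powRE ?expR_gt0 // expRK.
  by rewrite mulrCA mulfV ?gt_eqF // mulr1.
rewrite powRN -ler_pdivrMr ?invr_gt0 ?powR_gt0 // invrK.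
apply: le_trans (ler_wpM2l (expR_ge0 _) H2) _.
rewrite mulrCA -expRD (_ : - t + (1 + t) = 1) //; ring.
Qed.

Lemma eGamma_gt0 (a : R) : (0 < eGamma a)%E.
Proof.
apply: hl_integral_gt0; first exact: gamma_integrand_continuous.
by move=> t t0; rewrite mulr_gt0 ?expR_gt0 ?powR_gt0.
Qed.

Lemma eGamma_lty (a : R) : 0 < a -> (eGamma a < +oo)%E.
Proof.
move=> a0; pose C := (a + 1) `^ (a + 1) * expR 1.
have C0 : 0 <= C by rewrite mulr_ge0 ?powR_ge0 ?expR_ge0.
have mb : measurable_fun hl (fun t => (t `^ (a - 1) * (1 + t) `^ (- (1 + a)))%:E).
  apply/measurable_EFinP; apply: hl_continuous_measurable.
  by move=> t t0; exact: beta_integrand_continuous.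
apply: (@le_lt_trans _ _ (\int[leb]_(t in hl) (C%:E * (t `^ (a - 1) * (1 + t) `^ (- (1 + a)))%:E))%E).
  apply: ge0_le_integral => //.
  - by move=> t _; rewrite lee_fin mulr_ge0 ?powR_ge0 ?expR_ge0.
  - apply/measurable_EFinP; apply: hl_continuous_measurable; exact: gamma_integrand_continuous.
  - exact: measurable_funeM.
  - move=> t /hlP t0; rewrite -EFinM lee_fin mulrCA; apply: ler_wpM2l; first exact: powR_ge0.
    exact: gamma_exp_bound.
rewrite ge0_integralZl ?lee_fin //; last by move=> t _; rewrite lee_fin mulr_ge0 ?powR_ge0.
by rewrite gamma_majorant // -EFinM ltry.
Qed.

Lemma GammaE (a : R) : 0 < a -> eGamma a = (Gamma a)%:E.
Proof.
move=> a0; rewrite /Gamma /Rintegral fineK //.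
by rewrite ge0_fin_numE ?ltW ?eGamma_gt0 //; exact: eGamma_lty.
Qed.

Lemma Gamma_gt0 (a : R) : 0 < a -> 0 < Gamma a.
Proof. by move=> a0; rewrite -lte_fin -GammaE // eGamma_gt0. Qed.

Lemma measurable_pos : measurable_fun setT (fun t : R => (0 < t)%R%:R : R).
Proof.
rewrite (_ : (fun _ => _) = \1_hl); first exact: measurable_indic.
by apply/funext => t; rewrite indicE mem_hl.
Qed.

(** Tonelli for x^(a+b-1) y^(b-1) e^(-x(1+y)): integrating in y first gives x^(a-1) e^(-x) Gamma(b),
    integrating in x first gives Gamma(a+b) times the Beta integrand. *)
Lemma eGamma_mul (a b : R) : 0 < a -> 0 < b ->
  (eGamma a * eGamma b = eGamma (a + b) * eBeta a b)%E.
Proof.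
move=> a0 b0.
pose K (z : R * R) : R := (0 < z.1)%R%:R * ((0 < z.2)%R%:R *
  (z.1 `^ (a + b - 1) * (z.2 `^ (b - 1) * expR (- (z.1 * (1 + z.2)))))).
have mK : measurable_fun setT (EFin \o K).
  apply/measurable_EFinP.
  have m1 : measurable_fun setT (fun z : R * R => z.1) := measurable_fst.
  have m2 : measurable_fun setT (fun z : R * R => z.2) := measurable_snd.
  apply: measurable_funM; first exact: (measurableT_comp measurable_pos m1).
  apply: measurable_funM; first exact: (measurableT_comp measurable_pos m2).
  apply: measurable_funM; first exact: (measurableT_comp (measurable_powR _) m1).
  apply: measurable_funM; first exact: (measurableT_comp (measurable_powR _) m2).
  apply: (measurableT_comp (@measurable_expR R)); apply: measurableT_comp => //.
  by apply: measurable_funM => //; apply: measurable_funD.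
have K0 z : (0 <= (EFin \o K) z)%E.
  by rewrite lee_fin !mulr_ge0 ?powR_ge0 ?expR_ge0.
have := @fubini_tonelli _ _ _ _ R leb leb (EFin \o K) mK K0.
have gaf (c : R) t : hl t -> (0 <= (t `^ (c - 1) * expR (- t))%:E)%E.
  by rewrite lee_fin mulr_ge0 ?powR_ge0 ?expR_ge0.
have mga (c : R) : measurable_fun hl (fun t => (t `^ (c - 1) * expR (- t))%:E).
  by apply/measurable_EFinP; apply: hl_continuous_measurable; exact: gamma_integrand_continuous.
have -> : (\int[leb]_x \int[leb]_y (EFin \o K) (x, y) = eGamma a * eGamma b)%E.
  transitivity (\int[leb]_(x in hl) ((x `^ (a - 1) * expR (- x))%:E * eGamma b))%E; last first.
    by rewrite ge0_integralZr //; first [exact: mga|exact: gaf|exact/ltW/eGamma_gt0].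
  rewrite [RHS]integral_mkcond; apply: eq_integral => x _; rewrite patchE mem_hl; case: ifPn; last first.
    move=> /negbTE x0.
    under eq_integral do rewrite /= /K /= x0 mul0r.
    by rewrite integral0.
  move=> x0.
  rewrite /eGamma (hl_scale x0); [|exact: gamma_integrand_continuous|by move=> t _; rewrite mulr_ge0 ?powR_ge0 ?expR_ge0].
  rewrite -ge0_integralZl //; last 3 first.
  - apply/measurable_EFinP; apply: hl_continuous_measurable => t t0.
    apply: continuousM; last exact: cst_continuous.
    apply: (@continuous_comp R R R (fun t => x * t) (fun t => t `^ (b - 1) * expR (- t))).
      by apply: continuousM; [exact: cst_continuous|exact: cvg_id].
    by apply: gamma_integrand_continuous; rewrite mulr_gt0.
  - by move=> t _; rewrite lee_fin !mulr_ge0 ?powR_ge0 ?expR_ge0 ?(ltW x0).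
  - by rewrite lee_fin mulr_ge0 ?powR_ge0 ?expR_ge0.
  rewrite integral_mkcond; apply: eq_integral => y _; rewrite patchE mem_hl; case: ifPn; last first.
    move=> /negbTE y0.
    by rewrite /= /K /= y0 mul0r mulr0.
  move=> y0; rewrite /= /K /= x0 y0 !mul1r -EFinM; congr EFin.
  have xy : 0 < x * y by rewrite mulr_gt0.
  have -> : expR (- (x * (1 + y))) = expR (- x) * expR (- (x * y)).
    by rewrite -expRD; congr expR; ring.
  have -> : x `^ (a + b - 1) = x `^ (a - 1) * x `^ (b - 1) * x.
    rewrite -[X in _ = _ * X](powRr1 (ltW x0)) -!powRD ?(lt0r_neq0 x0) ?implybT //.
    by congr (_ `^ _); ring.
  by rewrite powRM ?(ltW x0) ?(ltW y0) //; ring.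
have -> : (\int[leb]_y \int[leb]_x (EFin \o K) (x, y) = eGamma (a + b) * eBeta a b)%E.
  transitivity (\int[leb]_(y in hl) (eGamma (a + b) * (y `^ (b - 1) * (1 + y) `^ (- (a + b)))%:E))%E; last first.
    rewrite ge0_integralZl //; first [exact/ltW/eGamma_gt0|by move=> t _; rewrite lee_fin mulr_ge0 ?powR_ge0|idtac].
    by apply/measurable_EFinP; apply: hl_continuous_measurable => t; exact: beta_integrand_continuous.
  rewrite [RHS]integral_mkcond; apply: eq_integral => y _; rewrite patchE mem_hl; case: ifPn; last first.
    move=> /negbTE y0.
    under eq_integral do rewrite /= /K /= y0 mul0r mulr0.
    by rewrite integral0.
  move=> y0; have y1 : 0 < 1 + y by rewrite ltr_pwDl // ltW.
  rewrite /eGamma (hl_scale y1); [|exact: gamma_integrand_continuous|by move=> t _; rewrite mulr_ge0 ?powR_ge0 ?expR_ge0].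
  rewrite -ge0_integralZr //; last 3 first.
  - apply/measurable_EFinP; apply: hl_continuous_measurable => t t0.
    apply: continuousM; last exact: cst_continuous.
    apply: (@continuous_comp R R R (fun t => (1 + y) * t) (fun t => t `^ (a + b - 1) * expR (- t))).
      by apply: continuousM; [exact: cst_continuous|exact: cvg_id].
    by apply: gamma_integrand_continuous; rewrite mulr_gt0.
  - by move=> t _; rewrite lee_fin !mulr_ge0 ?powR_ge0 ?expR_ge0 ?(ltW y1).
  - by rewrite lee_fin mulr_ge0 ?powR_ge0.
  rewrite integral_mkcond; apply: eq_integral => x _; rewrite patchE mem_hl; case: ifPn; last first.
    move=> /negbTE x0.
    by rewrite /= /K /= x0 mul0r.
  move=> x0; rewrite /= /K /= x0 y0 !mul1r -EFinM; congr EFin.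
  have xy : 0 < (1 + y) * x by rewrite mulr_gt0.
  rewrite [(1 + y) * x in RHS]mulrC in xy *.
  have -> : (x * (1 + y)) `^ (a + b - 1) * expR (- (x * (1 + y))) * (1 + y) *
     (y `^ (b - 1) * (1 + y) `^ (- (a + b))) = x `^ (a + b - 1) * ((1 + y) `^ (a + b - 1) * (1 + y) `^ 1 * (1 + y) `^ (- (a + b))) * (y `^ (b - 1) * expR (- (x * (1 + y)))).
    by rewrite powRM ?(ltW x0) ?(ltW y1) // powRr1 ?(ltW y1) //; ring.
  rewrite -!powRD ?(lt0r_neq0 y1) ?implybT //.
  by rewrite (_ : a + b - 1 + 1 + - (a + b) = 0) ?powRr0 ?mulr1 ?mulrA //; ring.
by [].
Qed.

Lemma eBeta_gt0 (a b : R) : (0 < eBeta a b)%E.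
Proof.
apply: hl_integral_gt0; first by move=> t; exact: beta_integrand_continuous.
by move=> t t0; rewrite mulr_gt0 ?powR_gt0 ?ltr_pwDl ?(ltW t0).
Qed.

Lemma eBetaE (a b : R) : 0 < a -> 0 < b ->
  eBeta a b = (Gamma a * Gamma b / Gamma (a + b))%:E.
Proof.
move=> a0 b0; have ab0 : 0 < a + b by rewrite addr_gt0.
have := eGamma_mul a0 b0; rewrite (GammaE a0) (GammaE b0) (GammaE ab0).
have := eBeta_gt0 a b; have := Gamma_gt0 ab0.
move: (eBeta a b) (Gamma a) (Gamma b) (Gamma (a + b)) => B ga gb gab gab0.
case: B => [x| |] // _.
  by rewrite -!EFinM => -[->]; congr EFin; rewrite mulrC mulKf // gt_eqF.
by rewrite gt0_muley ?lte_fin.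
Qed.

End GammaBeta.

(** * The Riesz kernel as a mixture of Poisson kernels *)

Section Subordination.
Variables (R : realType) (nu s : R).
Hypotheses (s0 : 0 < s) (sn : 2 * s < 2 * nu + 1).
Local Notation leb := (@lebesgue_measure R).
Local Notation hl := (`]0, +oo[%classic : set R).
Local Notation hN := (nu + 2^-1).

(** Density, in the parameter u, of the Poisson radius r = 1/(1+u). It makes the mixture of Poisson
    kernels a pure power of 2 - 2t, and the moments of r are Beta integrals. [hN] stands for n/2. *)
Definition riesz_weight (t : R) : R := t `^ (2 * s - 1) * (1 + t) `^ (- (hN + s)).

Definition riesz_const : R := Gamma (hN - s) * Gamma (s + 2^-1) / Gamma (nu + 1).

Lemma riesz_const_gt0 : 0 < riesz_const.
Proof. by apply: divr_gt0; [apply: mulr_gt0|]; apply: Gamma_gt0; move: s0 sn; lra. Qed.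

Let y (t : R) := t / (1 + t).

Lemma ratio_derive (t : R) : 0 < t -> is_derive t 1 y ((1 + t) ^- 2).
Proof.
move=> t0; have t1 : 0 < 1 + t by rewrite ltr_pwDl // ltW.
have d1 := @is_deriveD R R R (fun _ => 1) id t 1 _ _ (is_derive_cst _ _ _) (is_derive_id _ _).
have d2 := @is_deriveV R (fun t => 1 + t) t (0 + 1) 1 (lt0r_neq0 t1) d1.
have D := @is_deriveM R R id (fun t : R => (1 + t)^-1) t 1 _ _ (is_derive_id _ _) d2.
apply: is_derive_eq D _; rewrite /GRing.scale /=; field; exact: lt0r_neq0.
Qed.

Lemma ratio_continuous (t : R) : 0 < t -> {for t, continuous y}.
Proof.
move=> t0; apply: differentiable_continuous; apply/derivable1_diffP.
by have [] := ratio_derive t0.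
Qed.

Lemma riesz_subst (d : R) : 0 < d ->
  (\int[leb]_(q in hl) (q `^ (s - 2^-1) * (q + d) `^ (- (nu + 1)))%:E =
   (riesz_const * d `^ (- (hN - s)))%:E)%E.
Proof.
move=> d0.
have cG (t : R) : 0 < t -> {for t, continuous (fun q : R => q `^ (s - 2^-1) * (q + d) `^ (- (nu + 1)))}.
  move=> t0; apply: continuousM; first exact: powR_continuous.
  apply: (@continuous_comp R R R (fun t => t + d) (fun t => t `^ _) t).
    by apply: continuousD; [exact: cvg_id|exact: cst_continuous].
  by apply: powR_continuous; rewrite addr_gt0.
rewrite (hl_scale d0) //; last by move=> t _; rewrite mulr_ge0 ?powR_ge0.
transitivity (\int[leb]_(t in hl) ((d `^ (- (hN - s)))%:E *
    (t `^ ((s + 2^-1) - 1) * (1 + t) `^ (- ((hN - s) + (s + 2^-1))))%:E))%E.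
  apply: eq_integral => t /[!mem_hl] t0; rewrite -EFinM; congr EFin.
  have t1 : 0 < 1 + t by rewrite ltr_pwDl // ltW.
  rewrite (_ : d * t + d = d * (1 + t)); last by ring.
  rewrite !powRM ?ltW // (_ : s + 2^-1 - 1 = s - 2^-1); last by field.
  rewrite (_ : - (hN - s + (s + 2^-1)) = - (nu + 1)); last by field.
  have -> : d `^ (- (hN - s)) = d `^ (s - 2^-1) * d `^ (- (nu + 1)) * d.
    rewrite -[X in _ = _ * X](powRr1 (ltW d0)) -!powRD ?(lt0r_neq0 d0) ?implybT //.
    by congr (_ `^ _); field.
  ring.
rewrite ge0_integralZl ?lee_fin ?powR_ge0 //.
- rewrite -/(eBeta (hN - s) (s + 2^-1)) eBetaE; [|move: s0 sn; lra|move: s0 sn; lra].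
  rewrite -EFinM mulrC /riesz_const; congr (_ / Gamma _ * _)%:E; field.
- by [].
- by apply/measurable_EFinP; apply: hl_continuous_measurable => t; exact: beta_integrand_continuous.
- by move=> t _; rewrite lee_fin mulr_ge0 ?powR_ge0.
Qed.

(** Put r = 1/(1+u), d = 2 - 2t and q = u^2/(1+u). Then qf = (q+d)/(1+u) and 1 - r^2 is exactly
    dq/du, so the substitution u |-> q leads to the Beta integral of [riesz_subst]. *)
Lemma riesz_subordination (t : R) : -1 <= t < 1 ->
  (\int[leb]_(u in hl) (riesz_weight u * poisson nu (1 + u)^-1 t)%:E =
   (riesz_const * (2 - 2 * t) `^ (- (hN - s)))%:E)%E.
Proof.
move=> /andP[t1 t2]; have d0 : 0 < 2 - 2 * t by lra.
rewrite -riesz_subst //; set d := 2 - 2 * t in d0 *.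
pose F (u : R) := u * y u; pose F' (u : R) := y u * (2 - y u).
pose G (q : R) := q `^ (s - 2^-1) * (q + d) `^ (- (nu + 1)).
transitivity (\int[leb]_(u in hl) (G (F u) * F' u)%:E)%E; last first.
  apply/esym; apply: (@hl_substitution R F F' G); rewrite /F /F' /G.
- move=> u u0; have D := @is_deriveM R R id y u 1 _ _ (is_derive_id _ _) (ratio_derive u0).
  apply: is_derive_eq D _; rewrite /GRing.scale /= /y; field; apply: lt0r_neq0.
  by rewrite ltr_pwDl // ltW.
- move=> u u0; have u1 : 0 < 1 + u by rewrite ltr_pwDl // ltW.
  rewrite mulr_gt0 ?divr_gt0 // subr_gt0 /y ltr_pdivrMr //; lra.
- move=> u u0; have cy := ratio_continuous u0.
  have c2 : {for u, continuous (fun _ : R => 2 : R)} by exact: cst_continuous.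
  exact: (continuousM cy (continuousB c2 cy)).
- apply/cvg_ex; exists (1 * (2 - 1)).
  by apply: (cvgM (@ratio_cvg1 R)); apply: cvgB; [exact: cvg_cst|exact: ratio_cvg1].
- by move=> u u0; rewrite mulr_gt0 // divr_gt0 // ltr_pwDl // ltW.
- have := @cvgM _ _ _ _ _ _ _ _ (@cvg_harmonic R)
    (@cvgM _ _ _ _ _ _ 0 ((1 + 0)^-1) (@cvg_harmonic R) _).
  rewrite !mul0r; apply; apply: cvgV; first by rewrite addr0 oner_neq0.
  by apply: cvgD; [exact: cvg_cst|exact: cvg_harmonic].
- apply/cvgryPge => A; near=> u.
  have u0 : 0 <= u by near: u; exact: nbhs_pinfty_ge.
  have u1 : 0 < 1 + u by rewrite ltr_pwDl.
  have uA : A + 1 <= u by near: u; apply: nbhs_pinfty_ge; exact: num_real.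
  apply: (@le_trans _ _ (u - 1)); first by lra.
  rewrite /y mulrA ler_pdivlMr //; nra.
- move=> u u0; apply: continuousM; first exact: powR_continuous.
  apply: (@continuous_comp R R R (fun t => t + d) (fun t => t `^ _) u).
    by apply: continuousD; [exact: cvg_id|exact: cst_continuous].
  by apply: powR_continuous; rewrite addr_gt0.
- by move=> u _; rewrite mulr_ge0 ?powR_ge0.
apply: eq_integral => u /[!mem_hl] u0; congr EFin; rewrite /G /F /F'.
have u1 : 0 < 1 + u by rewrite ltr_pwDl // ltW.
have qf0 : 0 < u * y u + d by rewrite addr_gt0 // mulr_gt0 // divr_gt0.
have E : qf (1 + u)^-1 t = (u * y u + d) * (1 + u)^-1.
  by rewrite /qf /y /d; field; exact: lt0r_neq0.
rewrite /poisson E /riesz_weight.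
have -> : 1 - (1 + u)^-1 ^+ 2 = y u * (2 - y u).
  by rewrite /y; field; exact: lt0r_neq0.
rewrite (powRM _ (ltW qf0)) ?invr_ge0 ?ltW // [u * y u](_ : _ = u `^ 2 * (1 + u)^-1); last first.
  by rewrite powR_mulrn ?ltW // /y; field; exact: lt0r_neq0.
rewrite [(u `^ 2 * _) `^ _]powRM ?powR_ge0 ?invr_ge0 ?ltW // -powRrM.
rewrite -(powR_inv1 (ltW u1)) -!powRrM.
have -> : 2 * s - 1 = 2 * (s - 2^-1) by field.
have -> : (1 + u) `^ (-1 * (s - 2^-1)) = (1 + u) `^ (- (hN + s)) * (1 + u) `^ (-1 * - (nu + 1)).
  rewrite -powRD ?(lt0r_neq0 u1) ?implybT //; congr (_ `^ _).
  by field.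
ring.
Unshelve. all: by end_near. Qed.

(** A Poisson kernel multiplies degree k by r^k, so this moment will be the eigenvalue of the Riesz
    operator in degree k, up to [riesz_const]. *)
Lemma riesz_weight_integral (k : nat) :
  (\int[leb]_(u in hl) (riesz_weight u * ((1 + u)^-1) ^+ k)%:E =
   (Gamma (2 * s) * (Gamma (k%:R + hN - s) / Gamma (k%:R + hN + s)))%:E)%E.
Proof.
have k0 : 0 <= k%:R :> R by rewrite ler0n.
transitivity (eBeta (k%:R + hN - s) (2 * s)).
  apply: eq_integral => u /[!mem_hl] u0; congr EFin; rewrite /riesz_weight -mulrA; congr (_ * _).
  have u1 : 0 < 1 + u by rewrite ltr_pwDl // ltW.
  rewrite -powR_mulrn ?invr_ge0 ?ltW // -(powR_inv1 (ltW u1)) -powRrM.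
  by rewrite -powRD ?(lt0r_neq0 u1) ?implybT //; congr (_ `^ _); ring.
rewrite eBetaE; [|move: s0 sn k0; lra|move: s0 sn; lra].
by congr EFin; rewrite mulrCA mulrA; congr (_ * _ / Gamma _); ring.
Qed.

End Subordination.

(** * Expectation with respect to the uniform measure on the sphere *)

Section Expectation.
Variables (R : realType) (n : nat).
Local Notation vec := 'rV[R]_n.+1.

(** Interface to the surface measure: from here on the Gaussian construction enters only through
    these four properties. *)
Record uniform_point := UniformPoint {
  up_disp : measure_display;
  up_space : measurableType up_disp;
  up_prob : probability up_space R;
  up_fun : up_space -> vec;
  up_unit : forall w, dot (up_fun w) (up_fun w) = 1;
  up_measurable : forall F, sph_continuous F -> measurable_fun setT (fun w => F (up_fun w));
  up_int : forall F, sph_continuous F -> sphere_int F = Rintegral up_prob setT (fun w => F (up_fun w));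
  up_orth : forall (a b : vec) p q lp lq, dot a a = 1 -> dot b b = 1 ->
    zonal_eigen n p lp -> zonal_eigen n q lq -> lp != lq ->
    Rintegral up_prob setT (fun w => p.[dot a (up_fun w)] * q.[dot b (up_fun w)]) = 0 }.

Lemma uniform_point_exists : exists M : uniform_point, True.
Proof.
have [d [T [P [X [h1 h2 h3 h4]]]]] := sphere_probability R n.
by exists (UniformPoint h1 h2 h3 h4).
Qed.

Variable M : uniform_point.
Local Notation X := (@up_fun M).
Local Notation P := (@up_prob M).

Definition E (F : vec -> R) : R := Rintegral P setT (fun w => F (X w)).
Definition mes (F : vec -> R) : Prop := measurable_fun setT (fun w => F (X w)).
Definition itg (F : vec -> R) : Prop := P.-integrable setT (EFin \o (fun w => F (X w))).

Lemma mes_cont F : sph_continuous F -> mes F. Proof. exact: up_measurable. Qed.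

Lemma mes_eq F H : (forall x, dot x x = 1 -> F x = H x) -> mes F -> mes H.
Proof.
by move=> FH; rewrite /mes (_ : (fun w => F (X w)) = (fun w => H (X w))) //; apply/funext => w; apply: FH; exact: up_unit.
Qed.

Lemma mesM F H : mes F -> mes H -> mes (fun x => F x * H x).
Proof. exact: measurable_funM. Qed.

Lemma mesD F H : mes F -> mes H -> mes (fun x => F x + H x).
Proof. exact: measurable_funD. Qed.

Lemma mesB F H : mes F -> mes H -> mes (fun x => F x - H x).
Proof. exact: measurable_funB. Qed.

Lemma mes_cst (c : R) : mes (fun _ => c). Proof. exact: measurable_cst. Qed.

Lemma mes_dot (z : vec) : mes (dot z).
Proof. by apply: mes_cont => x x0; exact: dot_normalize_continuous. Qed.

Lemma itg_mes F : itg F -> mes F.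
Proof. by move=> /(measurable_int P) /measurable_EFinP. Qed.

Lemma itg_bounded F (c : R) : mes F -> (forall x, dot x x = 1 -> `|F x| <= c) -> itg F.
Proof. by move=> mF b; apply: (bounded_integrable P (M := c) mF) => w; apply: b; exact: up_unit. Qed.

Lemma itg_cont F : sph_continuous F -> itg F.
Proof. by move=> cF; have [c _] := sph_continuous_bounded cF; apply: itg_bounded; exact: mes_cont. Qed.

Lemma itg_cst (c : R) : itg (fun _ => c).
Proof. exact: integrable_cstR. Qed.

Lemma itg_le F G : mes F -> itg G -> (forall x, dot x x = 1 -> `|F x| <= G x) -> itg F.
Proof. by move=> mF iG b; apply: (le_integrableR mF iG) => w; apply: b; exact: up_unit. Qed.

Lemma itgD F G : itg F -> itg G -> itg (fun x => F x + G x).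
Proof. exact: integrableDR. Qed.

Lemma itgZ (c : R) F : itg F -> itg (fun x => c * F x).
Proof. exact: integrableZR. Qed.

Lemma itgB F G : itg F -> itg G -> itg (fun x => F x - G x).
Proof. by move=> iF iG; have := integrableB measurableT iF iG. Qed.

Lemma itg_norm F : itg F -> itg (fun x => `|F x|).
Proof. by move=> iF; have := integrable_norm iF. Qed.

Lemma itgM F H (c : R) : itg F -> mes H -> (forall x, dot x x = 1 -> `|H x| <= c) ->
  itg (fun x => F x * H x).
Proof.
move=> iF mH b; apply: (itg_le (G := fun x => c * `|F x|)).
- by apply: mesM => //; exact: itg_mes.
- by apply: itgZ; exact: itg_norm.
- by move=> x x1; rewrite normrM mulrC ler_wpM2r ?b.
Qed.

Lemma ED F G : itg F -> itg G -> E (fun x => F x + G x) = E F + E G.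
Proof. by move=> iF iG; rewrite /E RintegralD. Qed.

Lemma EB F G : itg F -> itg G -> E (fun x => F x - G x) = E F - E G.
Proof. by move=> iF iG; rewrite /E RintegralB. Qed.

Lemma EZ (c : R) F : itg F -> E (fun x => c * F x) = c * E F.
Proof. by move=> iF; rewrite /E RintegralZl. Qed.

Lemma E_eq F G : (forall x, dot x x = 1 -> F x = G x) -> E F = E G.
Proof. by move=> FG; apply: eq_Rintegral => w _; apply: FG; exact: up_unit. Qed.

Lemma E_cst (c : R) : E (fun _ => c) = c.
Proof. by rewrite /E Rintegral_cst // -[LHS]/(c * fine (P setT)) probability_setT mulr1. Qed.

Lemma E_le F G : itg F -> itg G -> (forall x, dot x x = 1 -> F x <= G x) -> E F <= E G.
Proof. by move=> iF iG FG; apply: le_Rintegral => // w _; apply: FG; exact: up_unit. Qed.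

Lemma E_ge0 F : (forall x, dot x x = 1 -> 0 <= F x) -> 0 <= E F.
Proof. by move=> F0; apply: Rintegral_ge0 => w _; apply: F0; exact: up_unit. Qed.

Lemma E_abs_le F G : itg F -> itg G -> (forall x, dot x x = 1 -> `|F x| <= G x) -> `|E F| <= E G.
Proof.
move=> iF iG FG; apply: le_trans (le_normr_Rintegral _ _) _ => //.
by apply: (E_le (itg_norm iF) iG).
Qed.

Lemma E_dct (f : nat -> vec -> R) F G : (forall k, mes (f k)) ->
  (forall x, dot x x = 1 -> f k x @[k --> \oo] --> F x) -> itg G ->
  (forall k x, dot x x = 1 -> `|f k x| <= G x) ->
  itg F /\ E (f k) @[k --> \oo] --> E F.
Proof.
move=> mf fF iG fG.
have mF : mes F.
  apply: (measurable_fun_cvg (h := fun k w => f k (X w))) => // w _.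
  by apply: fF; exact: up_unit.
have [] := @dominated_convergence _ _ _ P setT measurableT (fun k w => (f k (X w))%:E)
  (fun w => (F (X w))%:E) (fun w => (G (X w))%:E).
- by move=> k; apply/measurable_EFinP; exact: mf.
- by apply/measurable_EFinP.
- apply: aeW => w _; apply: cvg_EFin; first exact: nearW.
  by apply: fF; exact: up_unit.
- exact: iG.
- by apply: aeW => w k _; rewrite lee_fin fG // up_unit.
move=> iF _ L; split; first exact: iF.
by apply: fine_cvg; rewrite fineK // integrable_fin_num.
Qed.

Lemma E_sum (f : nat -> vec -> R) K : (forall k, itg (f k)) ->
  itg (fun x => \sum_(0 <= k < K) f k x) /\
  E (fun x => \sum_(0 <= k < K) f k x) = \sum_(0 <= k < K) E (f k).
Proof.
move=> fi; elim: K => [|K [iK IH]].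
  rewrite big_geq // (_ : (fun x => _) = (fun _ => 0)); last by apply/funext => x; rewrite big_geq.
  by rewrite E_cst; split => //; exact: itg_cst.
rewrite (_ : (fun x => _) = (fun x => \sum_(0 <= k < K) f k x + f K x)); last first.
  by apply/funext => x; rewrite big_nat_recr.
by rewrite ED // IH big_nat_recr //; split => //; exact: itgD.
Qed.

Lemma E_eq0_ae F : mes F -> (forall x, dot x x = 1 -> 0 <= F x) -> itg F -> E F = 0 ->
  exists2 N, measurable N & P N = 0%E /\ forall w, F (X w) != 0 -> N w.
Proof.
move=> mF F0 iF EF.
have F0' w : 0 <= F (X w) by apply: F0; exact: up_unit.
have H : (\int[P]_w `|(F (X w))%:E| = 0)%E.
  under eq_integral do rewrite gee0_abs ?lee_fin ?F0' //.
  by rewrite -(fineK (integrable_fin_num measurableT iF)) -[fine _]/(E F) EF.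
have mF' : measurable_fun setT (EFin \o (fun w => F (X w))) by apply/measurable_EFinP.
have [N [mN N0 sN]] := (ae_eq_integral_abs P measurableT mF').1 H.
exists N => //; split => // w Fw; apply: sN => /= /(_ I) [] F00.
by rewrite F00 eqxx in Fw.
Qed.

End Expectation.
Arguments E {R n} M F.
Arguments mes {R n} M F.
Arguments itg {R n} M F.

(** * The Poisson kernel as an approximate identity on the sphere *)

Section PoissonKernel.
Variables (R : realType) (n : nat) (M : uniform_point R n) (nu : R).
Hypotheses (hn : n%:R = 2 * nu + 1) (nu1 : 1 <= nu).
Local Notation vec := 'rV[R]_n.+1.
Local Notation C := (geg nu).

Lemma dotM_le (z x : vec) : dot z z = 1 -> dot x x = 1 -> -1 <= dot z x <= 1.
Proof. exact: dot_le. Qed.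

Lemma zonal_eigen_geg k : zonal_eigen n (C k) (k%:R * (k%:R + 2 * nu)).
Proof.
move=> t; have H := congr1 (fun p : {poly R} => p.[t]) (geg_ode nu k).
move: H; rewrite !hornerE /= hn => ->; ring.
Qed.

Lemma E_geg_eq0 k (z : vec) : dot z z = 1 -> (0 < k)%N -> E M (fun x => (C k).[dot z x]) = 0.
Proof.
move=> z1 k0.
rewrite -(up_orth M z1 z1 (zonal_eigen_geg k) (zonal_eigen_geg 0)).
  by apply: eq_Rintegral => w _; rewrite geg0 hornerC mulr1.
have kr : 0 < k%:R :> R by rewrite ltr0n.
rewrite mul0r mulf_neq0 //; first exact: lt0r_neq0.
by apply: lt0r_neq0; move: nu1; lra.
Qed.

Lemma mes_zonal (h : R -> R) (z : vec) : measurable_fun setT h -> mes M (fun x => h (dot z x)).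
Proof. by move=> mh; apply: (measurableT_comp mh); exact: mes_dot. Qed.

Lemma mes_geg k (z : vec) : mes M (fun x => (C k).[dot z x]).
Proof.
apply: (@mes_zonal (fun t => (C k).[t])).
by apply: continuous_measurable_fun => t; exact: continuous_horner.
Qed.

(** Dominated convergence: all partial sums are bounded by B times the convergent series of
    (k+1)^(m+m') r^k. *)
Lemma zonal_series_exchange (a : nat -> R) (S : R -> R) m (r : R) (z : vec) (f : vec -> R) (B : R) :
  dot z z = 1 -> 0 <= r < 1 -> (forall k, `|a k| <= k.+1%:R ^+ m) ->
  (forall t : R, -1 <= t <= 1 -> series (fun k => a k * (C k).[t] * r ^+ k) @ \oo --> S t) ->
  mes M f -> (forall x, dot x x = 1 -> `|f x| <= B) ->
  series (fun k => a k * r ^+ k * E M (fun x => f x * (C k).[dot z x])) @ \oo -->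
    E M (fun x => f x * S (dot z x)).
Proof.
move=> z1 r01 am Sl mf fB; have [m' Cm] := geg_polynomial_bound nu1.
have r0 : 0 <= r by case/andP: r01.
have B0 : 0 <= B by apply: le_trans (fB _ z1).
have T0 k x : dot x x = 1 -> `|a k * (C k).[dot z x] * r ^+ k| <= k.+1%:R ^+ (m + m') * r ^+ k.
  move=> x1; rewrite normrM [`|r ^+ k|]ger0_norm ?exprn_ge0 // ler_wpM2r ?exprn_ge0 //.
  by rewrite normrM exprD ler_pM ?normr_ge0 // Cm // dotM_le.
have cv := natpow_geometric_cvg (m := m + m') r01.
set D := limn (series (fun k => k.+1%:R ^+ (m + m') * r ^+ k)) in cv.
have sD K : \sum_(0 <= k < K) k.+1%:R ^+ (m + m') * r ^+ k <= D.
  apply: (nondecreasing_cvgn_le (u_ := series (fun k => k.+1%:R ^+ (m + m') * r ^+ k))) => //.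
  apply: nondecreasing_series => k _ _; by rewrite mulr_ge0 ?exprn_ge0.
pose F K x := f x * \sum_(0 <= k < K) a k * (C k).[dot z x] * r ^+ k.
have ig k : itg M (fun x => f x * (C k).[dot z x]).
  have := @itg_bounded R n M (fun x => f x * (C k).[dot z x]) (B * k.+1%:R ^+ m').
  apply; first by apply: mesM => //; exact: mes_geg.
  by move=> x x1; rewrite normrM ler_pM ?normr_ge0 ?fB // Cm // dotM_le.
have FE K x : F K x = \sum_(0 <= k < K) (a k * r ^+ k) * (f x * (C k).[dot z x]).
  by rewrite /F mulr_sumr; apply: eq_bigr => k _; ring.
have [||||_] := @E_dct R n M F (fun x => f x * S (dot z x)) (fun _ => B * D).
- move=> K; apply: itg_mes; rewrite (_ : F K = (fun x => \sum_(0 <= k < K) (a k * r ^+ k) * (f x * (C k).[dot z x]))); last first.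
    by apply/funext => x; exact: FE.
  by apply: (E_sum (f := fun k x => (a k * r ^+ k) * (f x * (C k).[dot z x])) K _).1 => k; exact: itgZ.
- move=> x x1; apply: cvgM; first exact: cvg_cst.
  by apply: Sl; exact: dotM_le.
- exact: itg_cst.
- move=> K x x1; rewrite /F normrM ler_pM ?normr_ge0 ?fB //.
  apply: le_trans (sD K); apply: le_trans (ler_norm_sum _ _ _) _.
  by apply: ler_sum => k _; exact: T0.
have -> : (fun K => E M (F K)) = series (fun k => a k * r ^+ k * E M (fun x => f x * (C k).[dot z x])).
  apply/funext => K; rewrite /series /=.
  rewrite (@E_eq R n M (F K) (fun x => \sum_(0 <= k < K) (a k * r ^+ k) * (f x * (C k).[dot z x]))); last by move=> x _; exact: FE.
  have -> := (E_sum (f := fun k x => (a k * r ^+ k) * (f x * (C k).[dot z x])) K (fun k => itgZ _ (ig k))).2.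
  by apply: eq_bigr => k _; rewrite EZ.
by [].
Qed.

(** Every zonal term of positive degree is orthogonal to constants, so only the coefficient of
    degree 0 survives. *)
Lemma zonal_series_mean (a : nat -> R) (S : R -> R) m (r : R) (z : vec) :
  dot z z = 1 -> 0 <= r < 1 -> (forall k, `|a k| <= k.+1%:R ^+ m) ->
  (forall t : R, -1 <= t <= 1 -> series (fun k => a k * (C k).[t] * r ^+ k) @ \oo --> S t) ->
  E M (fun x => S (dot z x)) = a 0%N.
Proof.
move=> z1 r01 am Sl.
have b1 (x : vec) : dot x x = 1 -> `|1 : R| <= 1 by rewrite normr1.
have L := @zonal_series_exchange a S m r z (fun _ => 1) 1 z1 r01 am Sl (@mes_cst R n M 1) b1.
have L2 : series (fun k => a k * r ^+ k * E M (fun x => 1 * (C k).[dot z x])) @ \oo --> a 0%N.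
  apply: cvg_near_cst; exists 1%N => // -[|K] //= _; rewrite /series /= big_nat_recl // big1 ?addr0.
    under E_eq => x _ do rewrite geg0 hornerC mulr1.
    by rewrite E_cst expr0 !mulr1.
  move=> k _; under E_eq => x _ do rewrite mul1r.
  by rewrite E_geg_eq0 // mulr0.
have := cvg_unique _ L L2 => /(_ (@Rhausdorff R)) <-.
by apply: E_eq => x _; rewrite mul1r.
Qed.

Lemma poisson_coef_le k : `|(k%:R + nu) / nu| <= k.+1%:R ^+ 1.
Proof.
have nu0 : 0 < nu by apply: lt_le_trans nu1.
have k0 : 0 <= k%:R :> R by rewrite ler0n.
rewrite ger0_norm ?divr_ge0 ?addr_ge0 ?(ltW nu0) // expr1 ler_pdivrMr // -natr1.
by rewrite mulrDl mul1r lerD2r ler_peMr.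
Qed.

Lemma E_poisson (r : R) (z : vec) : dot z z = 1 -> 0 <= r < 1 ->
  E M (fun x => poisson nu r (dot z x)) = 1.
Proof.
move=> z1 r01.
rewrite (zonal_series_mean (a := fun k => (k%:R + nu) / nu) (m := 1) z1 r01 poisson_coef_le).
  by rewrite add0r mulfV // gt_eqF // (lt_le_trans _ nu1).
by move=> t t1; exact: poisson_series.
Qed.

Lemma E_qf (r : R) (z : vec) : dot z z = 1 -> 0 <= r < 1 ->
  E M (fun x => qf r (dot z x) `^ (- nu)) = 1.
Proof.
move=> z1 r01.
rewrite (zonal_series_mean (a := fun _ => 1) (S := fun t => qf r t `^ (- nu)) (m := 0) z1 r01) //.
  by move=> k; rewrite normr1 expr0.
move=> t t1; have -> : (fun k => 1 * (C k).[t] * r ^+ k) = (fun k => (C k).[t] * r ^+ k) by apply/funext => k; rewrite mul1r.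
exact: geg_series_cvg.
Qed.

Lemma mes_qf_powR (r p : R) (z : vec) : mes M (fun x => qf r (dot z x) `^ p).
Proof.
apply: (@mes_zonal (fun t => qf r t `^ p)).
apply: (measurableT_comp (measurable_powR p)).
apply: measurable_funD; last exact: measurable_cst.
by apply: measurable_funB; [exact: measurable_cst|exact: measurable_funM].
Qed.

Lemma mes_poisson (r : R) (z : vec) : mes M (fun x => poisson nu r (dot z x)).
Proof. by apply: mesM; [exact: mes_cst|exact: mes_qf_powR]. Qed.

Lemma poisson_ge0 (r t : R) : 0 <= r < 1 -> 0 <= poisson nu r t.
Proof. by move=> r1; rewrite mulr_ge0 ?powR_ge0 // subr_ge0 expr2; nra. Qed.

Lemma qf_powR_le (r t p : R) : -1 <= t <= 1 -> 0 <= r < 1 -> 0 <= p ->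
  qf r t `^ (- p) <= ((1 - r) ^+ 2) `^ (- p).
Proof.
move=> t1 r1 p0; have /andP[r0 r2] := r1.
have a0 : 0 < (1 - r) ^+ 2 by rewrite exprn_gt0 // subr_gt0.
rewrite !powRN lef_pV2 ?posrE ?powR_gt0 //; last by apply: lt_le_trans (qf_ge _ _).
apply: ge0_ler_powR; rewrite ?nnegrE ?(ltW a0) //; last exact: qf_ge.
by apply: le_trans (qf_ge _ _); rewrite ?(ltW a0).
Qed.

Lemma itg_qf_powR (r p : R) (z : vec) : dot z z = 1 -> 0 <= r < 1 -> 0 <= p ->
  itg M (fun x => qf r (dot z x) `^ (- p)).
Proof.
move=> z1 r01 p0; apply: (itg_bounded (c := ((1 - r) ^+ 2) `^ (- p))); first exact: mes_qf_powR.
by move=> x x1; rewrite ger0_norm ?powR_ge0 // qf_powR_le // dotM_le.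
Qed.

Lemma poisson_le (r t : R) : -1 <= t <= 1 -> 0 <= r < 1 ->
  `|poisson nu r t| <= ((1 - r) ^+ 2) `^ (- (nu + 1)).
Proof.
move=> t1 r1; rewrite ger0_norm ?poisson_ge0 // /poisson.
apply: le_trans (ler_piMl (powR_ge0 _ _) _) _; first by rewrite gerBl sqr_ge0.
by apply: qf_powR_le => //; move: nu1; lra.
Qed.

Lemma itg_poisson (r : R) (z : vec) : dot z z = 1 -> 0 <= r < 1 ->
  itg M (fun x => poisson nu r (dot z x)).
Proof.
move=> z1 r01; apply: (itg_bounded _ (fun x x1 => poisson_le (dotM_le z1 x1) r01)).
exact: mes_poisson.
Qed.

(** From 2 r (1-t) = qf - (1-r)^2 the integrand is a combination of qf^(-nu) and the Poisson kernel,
    both of mean 1. The kernel therefore concentrates at its pole, in first moment, as r tends to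
    1. *)
Lemma E_poisson_deviation (r : R) (z : vec) : dot z z = 1 -> 0 < r < 1 ->
  E M (fun x => (1 - dot z x) * poisson nu r (dot z x)) = 1 - r.
Proof.
move=> z1 /andP[r0 r1]; have r01 : 0 <= r < 1 by rewrite ltW.
have nu0 : 0 <= nu by apply: le_trans nu1.
transitivity ((2 * r)^-1 * ((1 - r ^+ 2) * E M (fun x => qf r (dot z x) `^ (- nu))
   - (1 - r) ^+ 2 * E M (fun x => poisson nu r (dot z x)))).
  rewrite -!EZ; [|exact: itg_poisson|exact: itg_qf_powR].
  rewrite -EB; [|exact/itgZ/itg_qf_powR|exact/itgZ/itg_poisson].
  rewrite -EZ; last by apply: itgB; [exact/itgZ/itg_qf_powR|exact/itgZ/itg_poisson].
  apply: E_eq => x x1; rewrite /poisson.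
  have q0 : 0 < qf r (dot z x) by rewrite qf_gt0 // dotM_le.
  have -> : qf r (dot z x) `^ (- nu) = qf r (dot z x) `^ (- (nu + 1)) * qf r (dot z x).
    rewrite -[X in _ = _ * X](powRr1 (ltW q0)) -powRD ?(lt0r_neq0 q0) ?implybT //.
    by congr (_ `^ _); ring.
  by rewrite /qf; field; exact: lt0r_neq0.
rewrite E_qf // E_poisson //; field; exact: lt0r_neq0.
Qed.

(** At the pole the Poisson kernel is at least 1/(1-r) while its mean is 1. If the point had mass e
    > 0, the radius r = 1 - e/2 would give 2 <= 1. *)
Lemma point_null (z : vec) : dot z z = 1 -> E M (fun x => (dot z x == 1)%:R) = 0.
Proof.
move=> z1; set e := E M _.
have mi : mes M (fun x => (dot z x == 1)%:R : R).
  apply: (@mes_zonal (fun t : R => (t == 1)%:R)).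
  rewrite (_ : (fun t : R => (t == 1)%:R : R) = \1_[set 1]); first exact: measurable_indic.
  by apply/funext => t; rewrite indicE; congr ((nat_of_bool _)%:R); apply/eqP/idP => [->|/set_mem //]; exact/mem_set.
have bi x : `|(dot z x == 1)%:R : R| <= 1 by case: eqP; rewrite ?normr1 ?normr0.
have ii : itg M (fun x => (dot z x == 1)%:R) := itg_bounded mi (fun x _ => bi x).
have e0 : 0 <= e by apply: E_ge0 => x _; rewrite ler0n.
have e1 : e <= 1.
  rewrite -(E_cst M 1); apply: E_le => //; first exact: itg_cst.
  by move=> x _; apply: le_trans (bi x); exact: ler_norm.
apply/eqP; rewrite eq_le e0 andbT leNgt; apply/negP => ep.
pose r := 1 - e / 2; have r01 : 0 <= r < 1 by apply/andP; rewrite /r; split; lra.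
have /andP[r0 r1] := r01.
have L : (1 - r)^-1 * e <= 1.
  rewrite -[leRHS](E_poisson z1 r01) -EZ //; apply: E_le; [exact: itgZ|exact: itg_poisson|].
  move=> x x1; case: eqP => [->|_]; last by rewrite mulr0 poisson_ge0.
  rewrite /= mulr1n mulr1 /poisson (_ : qf r 1 = (1 - r) ^+ 2); last by rewrite /qf; ring.
  have a0 : 0 < 1 - r by rewrite subr_gt0.
  apply: (@le_trans _ _ ((1 - r ^+ 2) * ((1 - r) ^+ 2) `^ (- 1))); last first.
    apply: ler_wpM2l; first by rewrite expr2; nra.
    apply: ger_powR; last by move: nu1; lra.
    by rewrite exprn_gt0 //= expr_le1 ?(ltW a0) //; lra.
  have -> : (1 - r ^+ 2) * ((1 - r) ^+ 2) `^ (- 1) = (1 - r)^-1 * (1 + r).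
    by rewrite powR_inv1 ?sqr_ge0 //; field; exact: lt0r_neq0.
  have i0 : 0 < (1 - r)^-1 by rewrite invr_gt0.
  have i1 : (1 - r)^-1 <= (1 - r)^-1 * (1 + r) by rewrite mulrDr mulr1 lerDl mulr_ge0 // ltW.
  exact: i1.
have h : 1 - r = e / 2 by rewrite /r; ring.
rewrite h invfM invrK mulrC mulrA mulfV ?gt_eqF // mul1r in L; lra.
Qed.

Lemma sph_continuous_near (F : vec -> R) (z : vec) (e : R) : sph_continuous F -> dot z z = 1 -> 0 < e ->
  exists2 del, 0 < del & forall x, dot x x = 1 -> 2 - 2 * dot z x < del -> `|F x - F z| < e.
Proof.
move=> cF z1 e0.
have /cvgrPdist_lt /(_ e e0) := cF z (sphere_neq0 z1).
rewrite (normalize_id z1) => /nbhs_ballP[a /= a0 H].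
exists (a ^+ 2); first by rewrite exprn_gt0.
move=> x x1 xz; rewrite distrC -[X in F z - F X](normalize_id x1); apply: H; split => // i j; rewrite ord1.
rewrite /ball /= -(@ltr_pXn2r _ 2) ?nnegrE ?(ltW a0) // real_normK ?num_real //.
apply: le_lt_trans xz.
have -> : 2 - 2 * dot z x = dot (z - x) (z - x).
  by rewrite !(dotBl, dotBr) z1 x1 (dotC x z); ring.
rewrite /dot (bigD1 j) //= !mxE -expr2 lerDl sumr_ge0 // => k _.
by rewrite -expr2 sqr_ge0.
Qed.

(** Radii tending to 1; starting at 1/2 keeps them away from 0. *)
Definition rad (j : nat) : R := 1 - j.+2%:R^-1.

Lemma rad_bounds j : 2^-1 <= rad j < 1.
Proof.
rewrite /rad; have h : j.+2%:R^-1 <= 2^-1 :> R by rewrite lef_pV2 ?posrE ?ltr0n // ler_nat.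
have h2 : 0 < j.+2%:R^-1 :> R by rewrite invr_gt0 ltr0n.
move: h h2; set a : R := _^-1; move: a => a h h2.
by apply/andP; split; lra.
Qed.

Lemma rad_cvg : rad @ \oo --> (1 : R).
Proof.
rewrite -[X in _ --> X](subr0 1); apply: cvgB; first exact: cvg_cst.
by have := @cvg_harmonic R; rewrite -(cvg_shiftS (harmonic : R^nat)).
Qed.

(** Continuity and boundedness give |F(x) - F(z)| <= e/2 + K (1 - z.x); integrating this against the
    kernel leaves e/2 + K (1-r), by [E_poisson_deviation]. *)
Lemma poisson_approx (F : vec -> R) (z : vec) : sph_continuous F -> dot z z = 1 ->
  E M (fun x => F x * poisson nu (rad j) (dot z x)) @[j --> \oo] --> F z.
Proof.
move=> cF z1; apply/cvgrPdist_le => e e0.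
have e20 : 0 < e / 2 by rewrite divr_gt0.
have [del del0 Hd] := sph_continuous_near cF z1 e20.
have [B B0 FB] := sph_continuous_bounded cF.
pose K := 4 * B / del; have K0 : 0 <= K by rewrite divr_ge0 ?mulr_ge0 // ltW.
have bd x : dot x x = 1 -> `|F x - F z| <= e / 2 + K * (1 - dot z x).
  move=> x1; have /andP[_ t1] := dotM_le z1 x1.
  have [lt|ge] := ltP (2 - 2 * dot z x) del.
    apply: le_trans (ltW (Hd x x1 lt)) _; rewrite lerDl mulr_ge0 //; lra.
  apply: (@le_trans _ _ (2 * B)).
    apply: le_trans (ler_normB _ _) _; have := FB x x1; have := FB z z1; lra.
  apply: (@le_trans _ _ (K * (del / 2))).
    by rewrite /K le_eqVlt; apply/orP; left; apply/eqP; field; exact: lt0r_neq0.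
  have : K * (del / 2) <= K * (1 - dot z x) by apply: ler_wpM2l => //; lra.
  lra.
have rlim : \forall j \near \oo, K * (1 - rad j) <= e / 2.
  have L : K * (1 - rad j) @[j --> \oo] --> K * (1 - 1).
    by apply: cvgM; [exact: cvg_cst|apply: cvgB; [exact: cvg_cst|exact: rad_cvg]].
  rewrite subrr mulr0 in L.
  by have /cvgr_le := L; apply.
apply: filterS rlim => j Hj; have /andP[r2 r1] := rad_bounds j.
have r01 : 0 <= rad j < 1 by apply/andP; split => //; apply: le_trans r2; rewrite invr_ge0.
have rp : 0 < rad j < 1 by rewrite r1 andbT; apply: lt_le_trans r2; rewrite invr_gt0.
have ip := itg_poisson z1 r01; have mp := mes_poisson (rad j) z.
have iF : itg M (fun x => poisson nu (rad j) (dot z x) * F x) := itgM ip (@mes_cont R n M F cF) FB.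
have iF' : itg M (fun x => F x * poisson nu (rad j) (dot z x)).
  by apply: (itg_le (G := fun x => `|poisson nu (rad j) (dot z x) * F x|)); [apply: mesM => //; exact: mes_cont|exact: itg_norm|move=> x _; rewrite mulrC].
have id : itg M (fun x => (1 - dot z x) * poisson nu (rad j) (dot z x)).
  apply: (itg_le (G := fun x => 2 * poisson nu (rad j) (dot z x))); last 1 first.
  - move=> x x1; have p0 := poisson_ge0 (dot z x) r01; have /andP[t0 t1] := dotM_le z1 x1.
    by rewrite normrM (ger0_norm p0) ger0_norm; [apply: ler_wpM2r => //; lra|lra].
  - by apply: mesM => //; apply: mesB; [exact: mes_cst|exact: mes_dot].
  - exact: itgZ.
have -> : F z - E M (fun x => F x * poisson nu (rad j) (dot z x)) =
   E M (fun x => F z * poisson nu (rad j) (dot z x) - F x * poisson nu (rad j) (dot z x)).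
  by rewrite EB; [|exact: itgZ|exact: iF']; rewrite EZ // E_poisson // mulr1.
apply: le_trans (E_abs_le (G := fun x => e / 2 * poisson nu (rad j) (dot z x) + K * ((1 - dot z x) * poisson nu (rad j) (dot z x))) _ _ _) _.
- by apply: itgB => //; exact: itgZ.
- by apply: itgD; exact: itgZ.
- move=> x x1; have p0 := poisson_ge0 (dot z x) r01.
  rewrite -mulrBl normrM (ger0_norm p0) distrC.
  rewrite [leRHS](_ : _ = (e / 2 + K * (1 - dot z x)) * poisson nu (rad j) (dot z x)); last by ring.
  apply: ler_wpM2r => //.
  exact: bd.
rewrite ED; [|exact: itgZ|exact: itgZ]; rewrite (EZ _ ip) (EZ _ id) E_poisson // E_poisson_deviation //; lra.
Qed.

(** The measure has full support: for a fixed radius the Poisson average of F is at most a constant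
    times its mean, so a zero mean would force F(z) <= 0 in the limit. *)
Lemma E_gt0 (F : vec -> R) (z : vec) : sph_continuous F -> dot z z = 1 ->
  (forall x, dot x x = 1 -> 0 <= F x) -> 0 < F z -> 0 < E M F.
Proof.
move=> cF z1 F0 Fz; rewrite lt_neqAle E_ge0 // andbT; apply/eqP => EF.
have L := poisson_approx cF z1.
have iF := itg_cont M cF.
have Z j : E M (fun x => F x * poisson nu (rad j) (dot z x)) <= 0.
  have /andP[r2 r1] := rad_bounds j.
  have r01 : 0 <= rad j < 1 by apply/andP; split => //; apply: le_trans r2; rewrite invr_ge0.
  set c := ((1 - rad j) ^+ 2) `^ (- (nu + 1)).
  have : E M (fun x => F x * poisson nu (rad j) (dot z x)) <= E M (fun x => c * F x).
    apply: E_le; [|exact: itgZ|].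
      apply: (itgM (c := c) iF (mes_poisson _ _)) => x x1; apply: poisson_le => //; exact: dotM_le.
    move=> x x1; rewrite mulrC; apply: ler_wpM2r; first exact: F0.
    by apply: le_trans (ler_norm _) (poisson_le _ _) => //; exact: dotM_le.
  by rewrite EZ // -EF mulr0.
have : limn (fun j => E M (fun x => F x * poisson nu (rad j) (dot z x))) <= 0.
  by apply: limr_le; [exact: cvgP L|exact: nearW].
rewrite (cvg_lim _ L) //; lra.
Qed.

End PoissonKernel.

(** * Calculus of continuous functions and conformal inversions of the sphere *)

Section SphContinuous.
Variables (R : realType) (n : nat).
Local Notation vec := 'rV[R]_n.+1.
Implicit Types F G : vec -> R.

Lemma sph_continuous_cst (c : R) : sph_continuous (fun _ : vec => c).
Proof. by move=> x x0; exact: cst_continuous. Qed.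

Lemma sph_continuousD F G : sph_continuous F -> sph_continuous G -> sph_continuous (fun x => F x + G x).
Proof. by move=> cF cG x x0; exact: (continuousD (cF x x0) (cG x x0)). Qed.

Lemma sph_continuousB F G : sph_continuous F -> sph_continuous G -> sph_continuous (fun x => F x - G x).
Proof. by move=> cF cG x x0; exact: (continuousB (cF x x0) (cG x x0)). Qed.

Lemma sph_continuousM F G : sph_continuous F -> sph_continuous G -> sph_continuous (fun x => F x * G x).
Proof. by move=> cF cG x x0; exact: (continuousM (cF x x0) (cG x x0)). Qed.

Lemma sph_continuous_app (h : R -> R) F : sph_continuous F ->
  (forall x, dot x x = 1 -> {for F x, continuous h}) -> sph_continuous (fun x => h (F x)).
Proof.
move=> cF ch x x0; apply: (@continuous_comp _ _ _ (fun y => F (normalize y)) h); first exact: cF.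
by apply: ch; exact: dot_normalize_self.
Qed.

Lemma sph_continuousV F : sph_continuous F -> (forall x, dot x x = 1 -> F x != 0) ->
  sph_continuous (fun x => (F x)^-1).
Proof. by move=> cF F0; apply: sph_continuous_app => // x x1; apply: inv_continuous; exact: F0. Qed.

Lemma sph_continuous_powR F (p : R) : sph_continuous F -> (forall x, dot x x = 1 -> 0 < F x) ->
  sph_continuous (fun x => F x `^ p).
Proof.
by move=> cF F0; apply: (sph_continuous_app (h := fun t => t `^ p) cF) => x x1; apply: powR_continuous; exact: F0.
Qed.

Lemma sph_continuous_max2 F G : sph_continuous F -> sph_continuous G ->
  sph_continuous (fun x => Num.max (F x) (G x)).
Proof. by move=> cF cG x x0; exact: (continuous_max (cF x x0) (cG x x0)). Qed.

Lemma sph_continuous_dot (z : vec) : sph_continuous (dot z).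
Proof. by move=> x x0; exact: dot_normalize_continuous. Qed.

End SphContinuous.

Section Inversion.
Variables (R : realType) (n : nat).
Local Notation vec := 'rV[R]_n.+1.
Variables (e : vec) (l : R).

Definition inv_q (x : vec) : R := 1 - 2 * l * dot e x + l ^+ 2.
Definition inv_rho (x : vec) : R := (1 - l ^+ 2) / inv_q x.
Definition height (x : vec) : R := dot e x - l.
(** For 0 < l < 1 this is, on the unit sphere, the inversion in the sphere centred at e/l that meets
    the unit sphere orthogonally along the slice e.x = l; for l = 0 it is the reflection in the
    hyperplane orthogonal to e. [inv_rho] is its conformal factor. *)
Definition inversion (x : vec) : vec := inv_rho x *: x - (2 * height x / inv_q x) *: e.

Hypotheses (e1 : dot e e = 1) (l01 : 0 <= l < 1).

Lemma inv_q_gt0 (x : vec) : dot x x = 1 -> 0 < inv_q x.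
Proof.
move=> x1; have /andP[l0 l1] := l01; have /andP[c0 c1] := dot_le e1 x1.
rewrite /inv_q; have : 0 < (1 - l) ^+ 2 by rewrite exprn_gt0 // subr_gt0.
by rewrite !expr2; nra.
Qed.

Lemma one_sub_sqr_gt0 : 0 < 1 - l ^+ 2.
Proof. by have /andP[l0 l1] := l01; rewrite expr2; nra. Qed.

Lemma inv_rho_gt0 (x : vec) : dot x x = 1 -> 0 < inv_rho x.
Proof. by move=> x1; rewrite divr_gt0 ?inv_q_gt0 // one_sub_sqr_gt0. Qed.

Lemma inv_q_neq0 (x : vec) : dot x x = 1 -> 1 - 2 * l * dot e x + l ^+ 2 != 0.
Proof. by move=> x1; apply: lt0r_neq0; exact: inv_q_gt0. Qed.

Lemma inversion_unit (x : vec) : dot x x = 1 -> dot (inversion x) (inversion x) = 1.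
Proof.
move=> x1; have q0 := inv_q_neq0 x1.
rewrite /inversion !(dotBl, dotBr, dotZl, dotZr) x1 e1 (dotC x e) /inv_rho /height /inv_q.
by move: (dot e x) q0 => c q0; field.
Qed.

Lemma height_inversion (x : vec) : dot x x = 1 -> height (inversion x) = - inv_rho x * height x.
Proof.
move=> x1; have q0 := inv_q_neq0 x1.
rewrite {1}/height /inversion !(dotBr, dotZr) e1 /inv_rho /height /inv_q.
by move: (dot e x) q0 => c q0; field.
Qed.

Lemma inv_q_inversion (x : vec) : dot x x = 1 -> inv_q (inversion x) = (1 - l ^+ 2) * inv_rho x.
Proof.
move=> x1; have q0 := inv_q_neq0 x1.
rewrite {1}/inv_q /inversion !(dotBr, dotZr) e1 /inv_rho /height /inv_q.
by move: (dot e x) q0 => c q0; field.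
Qed.

Lemma inv_rho_inversion (x : vec) : dot x x = 1 -> inv_rho (inversion x) = (inv_rho x)^-1.
Proof.
move=> x1; rewrite {1}/inv_rho inv_q_inversion //.
have r0 := lt0r_neq0 (inv_rho_gt0 x1); have l0 := lt0r_neq0 one_sub_sqr_gt0.
by field; rewrite r0 l0.
Qed.

Lemma inversionK (x : vec) : dot x x = 1 -> inversion (inversion x) = x.
Proof.
move=> x1; rewrite {1}/inversion height_inversion // inv_q_inversion // inv_rho_inversion //.
have r0 := lt0r_neq0 (inv_rho_gt0 x1); have l0 := lt0r_neq0 one_sub_sqr_gt0.
have q0 := inv_q_neq0 x1.
rewrite /inversion scalerBr !scalerA mulVf // scale1r -addrA -opprD -scalerDl.
rewrite [X in X *: e](_ : _ = 0) ?scale0r ?subr0 //.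
rewrite /inv_rho /inv_q in r0 *.
move: (height x) (dot e x) q0 r0 => h c q0 r0; field.
by rewrite l0 q0.
Qed.

(** Conformality in terms of squared chords, since |x - y|^2 = 2 - 2 x.y on the sphere. *)
Lemma dot_inversion2 (x y : vec) : dot x x = 1 -> dot y y = 1 ->
  2 - 2 * dot (inversion x) (inversion y) = inv_rho x * inv_rho y * (2 - 2 * dot x y).
Proof.
move=> x1 y1; have q0 := inv_q_neq0 x1; have q0' := inv_q_neq0 y1.
rewrite /inversion !(dotBl, dotBr, dotZl, dotZr) e1 (dotC x e) /inv_rho /height /inv_q.
by move: (dot e x) (dot e y) (dot x y) q0 q0' => c c' t q0 q0'; field; rewrite q0 q0'.
Qed.

(** Up to the conformal factor, moving y to its image increases the squared chord to x by an
    explicit amount, positive when x and y lie in the same cap. This is what makes the folded kernel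
    positive. *)
Lemma dot_inversion (x y : vec) : dot x x = 1 -> dot y y = 1 ->
  2 - 2 * dot x (inversion y) =
  inv_rho y * (2 - 2 * dot x y + 4 * height x * height y / (1 - l ^+ 2)).
Proof.
move=> x1 y1; have q0 := inv_q_neq0 y1; have l0 := lt0r_neq0 one_sub_sqr_gt0.
rewrite /inversion !(dotBl, dotBr, dotZl, dotZr) (dotC x e) /inv_rho /height /inv_q.
by move: (dot e x) (dot e y) (dot x y) q0 => c c' t q0; field; rewrite q0 l0.
Qed.

Lemma inv_rho_gt1 (x : vec) : dot x x = 1 -> 0 < l -> 0 < height x -> 1 < inv_rho x.
Proof.
move=> x1 l0; rewrite /height => h; rewrite /inv_rho ltr_pdivlMr ?inv_q_gt0 // mul1r /inv_q.
by rewrite !expr2; nra.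
Qed.

Lemma inv_rho_ge1 (x : vec) : dot x x = 1 -> 0 < height x -> 1 <= inv_rho x.
Proof.
have /andP[l0 l1] := l01.
move=> x1; rewrite /height => h; rewrite /inv_rho ler_pdivlMr ?inv_q_gt0 // mul1r /inv_q.
by rewrite !expr2; nra.
Qed.

Lemma inversion_fix (x : vec) : dot x x = 1 -> height x = 0 -> inversion x = x /\ inv_rho x = 1.
Proof.
move=> x1 h; have q0 := inv_q_neq0 x1.
have r1 : inv_rho x = 1.
  have c : dot e x = l by move: h; rewrite /height => /eqP; rewrite subr_eq0 => /eqP.
  rewrite /inv_rho /inv_q c in q0 *.
  have -> : 1 - 2 * l * l + l ^+ 2 = 1 - l ^+ 2 by ring.
  by rewrite mulfV // lt0r_neq0 // one_sub_sqr_gt0.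
by rewrite /inversion r1 h mulr0 mul0r scale0r subr0 scale1r.
Qed.

Lemma sph_continuous_inv_q : sph_continuous inv_q.
Proof.
apply: sph_continuousD; last exact: sph_continuous_cst.
apply: sph_continuousB; first exact: sph_continuous_cst.
by apply: sph_continuousM; [exact: sph_continuous_cst|exact: sph_continuous_dot].
Qed.

Lemma sph_continuous_height : sph_continuous height.
Proof. by apply: sph_continuousB; [exact: sph_continuous_dot|exact: sph_continuous_cst]. Qed.

Lemma sph_continuous_inv_rho : sph_continuous inv_rho.
Proof.
apply: sph_continuousM; first exact: sph_continuous_cst.
apply: sph_continuousV; first exact: sph_continuous_inv_q.
by move=> x x1; apply: lt0r_neq0; exact: inv_q_gt0.
Qed.

Lemma inversion_normalize_continuous (x : vec) : x != 0 ->
  {for x, continuous (fun y => inversion (normalize y))}.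
Proof.
move=> x0.
have c1 : sph_continuous (fun x => 2 * height x / inv_q x).
  apply: sph_continuousM.
    by apply: sph_continuousM; [exact: sph_continuous_cst|exact: sph_continuous_height].
  apply: sph_continuousV; first exact: sph_continuous_inv_q.
  by move=> y y1; apply: lt0r_neq0; exact: inv_q_gt0.
have c2 : {for x, continuous (fun _ : vec => e)} by exact: cst_continuous.
exact: (continuousB (continuousZ (sph_continuous_inv_rho x0) (normalize_continuous x0)) (continuousZ (c1 x x0) c2)).
Qed.

Lemma sph_continuous_comp (F : vec -> R) (psi : vec -> vec) : sph_continuous F ->
  (forall x, dot x x = 1 -> dot (psi x) (psi x) = 1) ->
  (forall x, x != 0 -> {for x, continuous (fun y => psi (normalize y))}) ->
  sph_continuous (fun x => F (psi x)).
Proof.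
move=> cF psi1 cpsi x x0.
have px : dot (psi (normalize x)) (psi (normalize x)) = 1 by apply: psi1; exact: dot_normalize_self.
have H : {for x, continuous (fun y => F (normalize (psi (normalize y))))}.
  apply: (@continuous_comp _ _ _ (fun y => psi (normalize y)) (fun y => F (normalize y))); first exact: cpsi.
  by apply: cF; exact: sphere_neq0.
rewrite /prop_for /continuous_at /= normalize_id // in H.
have FF : Filter (nbhs x) := nbhs_filter x.
have E0 : \forall y \near x, F (normalize (psi (normalize y))) = F (psi (normalize y)).
  have := near_neq0 x0; apply: (@filterS _ (nbhs x) FF) => y y0.
  by rewrite normalize_id //; apply: psi1; exact: dot_normalize_self.
by apply: cvg_trans H; apply: near_eq_cvg; exact: E0.
Qed.

Lemma sph_continuous_inversion (F : vec -> R) : sph_continuous F ->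
  sph_continuous (fun x => F (inversion x)).
Proof.
move=> cF; apply: sph_continuous_comp => //; first exact: inversion_unit.
exact: inversion_normalize_continuous.
Qed.

Lemma sph_continuous_rhoX (p : R) : sph_continuous (fun x => inv_rho x `^ p).
Proof. by apply: sph_continuous_powR; [exact: sph_continuous_inv_rho|exact: inv_rho_gt0]. Qed.

(* Composing the harmonic Poisson kernel with the inversion moves its pole. *)
Lemma qf_inversion (r : R) (w : vec) : dot w w = 1 -> 0 <= r < 1 ->
  exists m2 r1 (v : vec), [/\ 0 < m2, 0 <= r1 < 1, dot v v = 1 &
    [/\ 1 - r1 ^+ 2 = (1 - l ^+ 2) * (1 - r ^+ 2) / m2,
        1 - 2 * (r1 * l) * dot v e + (r1 * l) ^+ 2 = (1 - l ^+ 2) ^+ 2 / m2 &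
        forall y, dot y y = 1 -> qf r (dot w (inversion y)) = m2 * qf r1 (dot v y) / inv_q y]].
Proof.
move=> w1 /andP[r0 r1]; have /andP[l0 l1] := l01; have /andP[c0 c1] := dot_le w1 e1.
set c := dot w e in c0 c1.
(* m2 = |e - l r w|^2 and k2 = |l e - r w|^2; the new radius is the square root of k2/m2. *)
pose m2 := 1 - 2 * (r * l * c) + (l * r) ^+ 2; pose k2 := l ^+ 2 + r ^+ 2 - 2 * (r * l * c).
have rl0 : 0 <= r * l by rewrite mulr_ge0.
have rl1 : r * l < 1 by nra.
have rlc : r * l * c <= r * l by nra.
have m20 : 0 < m2.
  have : 0 < (1 - r * l) ^+ 2 by rewrite exprn_gt0 // subr_gt0.
  rewrite /m2 !expr2; lra.
have k20 : 0 <= k2.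
  have : 0 <= (l - r) ^+ 2 by rewrite sqr_ge0.
  rewrite /k2 !expr2; lra.
have mk : m2 - k2 = (1 - l ^+ 2) * (1 - r ^+ 2) by rewrite /m2 /k2; ring.
have mk0 : 0 < m2 - k2 by rewrite mk mulr_gt0 ?one_sub_sqr_gt0 // expr2; nra.
pose m := Num.sqrt m2; pose k := Num.sqrt k2.
have m0 : 0 < m by rewrite sqrtr_gt0.
have mE : m ^+ 2 = m2 by rewrite sqr_sqrtr // ltW.
have kE : k ^+ 2 = k2 by rewrite sqr_sqrtr.
have k0 : 0 <= k by exact: sqrtr_ge0.
pose v : vec := (l * (1 + r ^+ 2) - 2 * (r * c)) *: e + (r * (1 - l ^+ 2)) *: w.
have vv : dot v v = k2 * m2.
  rewrite /v !(dotDl, dotDr, dotZl, dotZr) w1 e1 (dotC e w) -/c /k2 /m2; ring.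
have [u u1 vu] : exists2 u : vec, dot u u = 1 & v = (k * m) *: u.
  (* If k = 0 the new pole is the centre and its direction is arbitrary. *)
  have [k00|kn0] := eqVneq k 0.
    exists e => //; rewrite k00 mul0r scale0r; apply/eqP; rewrite -dot_eq0 vv -kE k00.
    by rewrite expr0n mul0r.
  exists ((k * m)^-1 *: v).
    rewrite !(dotZl, dotZr) vv -kE -mE; field; by rewrite kn0 lt0r_neq0.
  by rewrite scalerA mulfV ?scale1r // mulf_neq0 // lt0r_neq0.
have mn := lt0r_neq0 m0.
exists m2, (k / m), u; split => //.
  rewrite divr_ge0 ?(ltW m0) //= ltr_pdivrMr // mul1r -(@ltr_pXn2r _ 2) ?nnegrE ?(ltW m0) //.
  by rewrite kE mE -subr_gt0.
split.
- by rewrite -mk -mE -kE; field.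
- have ve : k * m * dot u e = l * (1 + r ^+ 2) - 2 * (r * c) + r * (1 - l ^+ 2) * c.
    by rewrite -[k * m * _]dotZl -vu /v !(dotDl, dotZl) e1 -/c mulr1.
  have -> : 1 - 2 * (k / m * l) * dot u e + (k / m * l) ^+ 2 =
    (m2 - 2 * l * (k * m * dot u e) + l ^+ 2 * k2) / m2.
    by rewrite -mE -kE; field.
  rewrite ve; congr (_ / _); rewrite /m2 /k2; ring.
- move=> y y1; have q0 := inv_q_neq0 y1.
  have vy : k * m * dot u y = (l * (1 + r ^+ 2) - 2 * (r * c)) * dot e y + r * (1 - l ^+ 2) * dot w y.
    by rewrite -[k * m * _]dotZl -vu /v !(dotDl, dotZl).
  have -> : m2 * qf (k / m) (dot u y) / inv_q y = (m2 - 2 * (k * m * dot u y) + k2) / inv_q y.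
    congr (_ / _); rewrite /qf -mE -kE; field; exact: mn.
  rewrite vy /inversion !(dotBr, dotZr) -/c /qf /inv_rho /height /m2 /k2 /inv_q.
  by move: (dot e y) (dot w y) c q0 {vy v vv vu c0 c1 mk mk0 k20 m20 m k m0 mE kE k0 mn k2 m2 rlc} => a b c q0; field.
Qed.

End Inversion.

(** * Double expectations and the conformal change of variables *)

Section DoubleExpectation.
Variables (R : realType) (n : nat) (M : uniform_point R n).
Local Notation vec := 'rV[R]_n.+1.
Local Notation X := (@up_fun R n M).
Local Notation P := (@up_prob R n M).

Definition mes2 (K : vec -> vec -> R) : Prop :=
  measurable_fun setT (fun p : up_space M * up_space M => K (X p.1) (X p.2)).

Lemma mes2_l (F : vec -> R) : mes M F -> mes2 (fun x _ => F x).
Proof. by move=> mF; exact: (measurableT_comp mF measurable_fst). Qed.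

Lemma mes2_r (F : vec -> R) : mes M F -> mes2 (fun _ y => F y).
Proof. by move=> mF; exact: (measurableT_comp mF measurable_snd). Qed.

Lemma mes2M K L : mes2 K -> mes2 L -> mes2 (fun x y => K x y * L x y).
Proof. exact: measurable_funM. Qed.

Lemma mes2_dot : mes2 (fun x y => dot x y).
Proof.
have mc i : mes M (fun x => x 0 i).
  by apply: mes_cont => x x0; exact: coord_normalize_continuous.
apply: measurable_sum => i.
by apply: measurable_funM; [exact: (mes2_l (mc i))|exact: (mes2_r (mc i))].
Qed.

Lemma E_fubini K (c : R) : mes2 K ->
  (forall x y, dot x x = 1 -> dot y y = 1 -> `|K x y| <= c) ->
  mes M (fun x => E M (K x)) /\
  E M (fun x => E M (fun y => K x y)) = E M (fun y => E M (fun x => K x y)).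
Proof.
move=> mK bK.
have ik : (P \x P)%E.-integrable setT (EFin \o (fun p => K (X p.1) (X p.2))).
  apply: (bounded_integrable (P \x P)%E (M := c) mK) => p.
  by apply: bK; exact: up_unit.
split; last exact: (etrans (esym (Rintegral_prod12 ik)) (Rintegral_prod21 ik)).
have mF := measurable_fubini_F ik.
exact: (measurableT_comp (@fine_measurable R setT measurableT) mF).
Qed.

End DoubleExpectation.

Lemma series_single (R : realType) (u : nat -> R) (k : nat) :
  (forall i, i != k -> u i = 0) -> series u @ \oo --> u k.
Proof.
move=> u0; apply: cvg_near_cst; exists k.+1 => // K /= kK.
rewrite /series /= big_mkord (bigD1 (Ordinal kK)) //= big1 ?addr0 // => i ik.
by apply: u0; apply: contra ik => /eqP ik; apply/eqP/val_inj.
Qed.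

Lemma powR_expR (R : realType) (x p : R) : expR x `^ p = expR (p * x).
Proof. by rewrite powRE ?expR_gt0 // expRK. Qed.

Lemma gt0_expR (R : realType) (x : R) : 0 < x -> exists a, x = expR a.
Proof. by move=> x0; exists (ln x); rewrite lnK ?posrE. Qed.

(** Writing the positive quantities as exponentials turns the identity into linear algebra on
    exponents. *)
Lemma inversion_weight (R : realType) (nu m2 L q q1 : R) : 0 < m2 -> 0 < L -> 0 < q -> 0 < q1 ->
  m2 / L * (m2 * q1 / q) `^ (- (nu + 1)) * (L / q) `^ (2 * nu + 1) =
  (L ^+ 2 / m2) `^ nu * q `^ (- nu) * q1 `^ (- (nu + 1)).
Proof.
move=> /gt0_expR[a ->] /gt0_expR[b ->] /gt0_expR[c ->] /gt0_expR[d ->].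
by rewrite expr2 -!expRN -!expRD !powR_expR -!expRD; congr expR; ring.
Qed.

Section ChangeOfVariables.
Variables (R : realType) (n : nat) (M : uniform_point R n) (nu : R).
Hypotheses (hn : n%:R = 2 * nu + 1) (nu1 : 1 <= nu).
Local Notation vec := 'rV[R]_n.+1.
Local Notation C := (geg nu).

Lemma E_geg_orth k j (a b : vec) : dot a a = 1 -> dot b b = 1 -> k != j ->
  E M (fun x => (C k).[dot a x] * (C j).[dot b x]) = 0.
Proof.
move=> a1 b1 kj; apply: (up_orth M a1 b1 (zonal_eigen_geg hn k) (zonal_eigen_geg hn j)).
rewrite -subr_eq0.
have -> : k%:R * (k%:R + 2 * nu) - j%:R * (j%:R + 2 * nu) = (k%:R - j%:R) * (k%:R + j%:R + 2 * nu) by ring.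
rewrite mulf_neq0 ?subr_eq0 ?eqr_nat //; apply: lt0r_neq0.
by rewrite ltr_wpDl ?addr_ge0 // mulr_gt0 //; apply: lt_le_trans nu1.
Qed.

Lemma geg_bounded k : exists c : R, forall (z x : vec), dot z z = 1 -> dot x x = 1 -> `|(C k).[dot z x]| <= c.
Proof.
have [m Cm] := geg_polynomial_bound nu1.
by exists (k.+1%:R ^+ m) => z x z1 x1; apply: Cm; exact: dot_le.
Qed.

Lemma rad_ge0_lt1 j : 0 <= rad R j < 1.
Proof.
have /andP[r2 r1] := rad_bounds R j.
by apply/andP; split => //; apply: le_trans r2; rewrite invr_ge0.
Qed.

(** The reproducing property of zonal harmonics. In the Poisson average of C_k(b.x) only degree k
    survives, so it is a constant times r^k; its limit as r tends to 1 identifies the constant. *)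
Lemma E_geg_geg k (a b : vec) : dot a a = 1 -> dot b b = 1 ->
  (k%:R + nu) / nu * E M (fun x => (C k).[dot b x] * (C k).[dot a x]) = (C k).[dot b a].
Proof.
move=> a1 b1; have [c Cc] := geg_bounded k.
set I := E M _.
have cF : sph_continuous (fun x => (C k).[dot b x]).
  by apply: sph_continuous_app; [exact: sph_continuous_dot|move=> x _; exact: continuous_horner].
have L := poisson_approx M hn nu1 cF a1.
have Ej j : E M (fun x => (C k).[dot b x] * poisson nu (rad R j) (dot a x)) = (k%:R + nu) / nu * I * rad R j ^+ k.
  have S1 := @zonal_series_exchange R n M nu nu1 (fun k => (k%:R + nu) / nu) (poisson nu (rad R j)) 1
    (rad R j) a (fun x => (C k).[dot b x]) c a1 (rad_ge0_lt1 j) (poisson_coef_le nu1)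
    (fun t t1 => poisson_series nu1 t1 (rad_ge0_lt1 j)) (@mes_geg R n M nu k b) (fun x x1 => Cc b x b1 x1).
  have S2 := @series_single R (fun i => (i%:R + nu) / nu * rad R j ^+ i * E M (fun x => (C k).[dot b x] * (C i).[dot a x])) k.
  have {}S2 : series (fun i => (i%:R + nu) / nu * rad R j ^+ i * E M (fun x => (C k).[dot b x] * (C i).[dot a x])) @ \oo -->
     (k%:R + nu) / nu * rad R j ^+ k * I.
    by apply: S2 => i ik; rewrite E_geg_orth ?mulr0 // eq_sym.
  have := cvg_unique _ S1 S2 => /(_ (@Rhausdorff R)) ->; ring.
have L2 : (k%:R + nu) / nu * I * rad R j ^+ k @[j --> \oo] --> (k%:R + nu) / nu * I * 1 ^+ k.
  apply: cvgM; first exact: cvg_cst.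
  have cX : {for (1 : R), continuous (fun x : R => x ^+ k)} by exact: exprn_continuous.
  exact: (cvg_comp _ _ (@rad_cvg R) cX).
rewrite expr1n mulr1 in L2.
have LE : (fun j => E M (fun x => (C k).[dot b x] * poisson nu (rad R j) (dot a x))) = (fun j => (k%:R + nu) / nu * I * rad R j ^+ k).
  by apply/funext => j; exact: Ej.
rewrite LE in L.
exact: (cvg_unique (@Rhausdorff R) L2 L).
Qed.

(** The function qf^(-nu) is the Newton kernel, whose restriction to the sphere the Poisson integral
    extends harmonically. The proof compares Gegenbauer coefficients degree by degree. *)
Lemma E_poisson_harmonic (r b : R) (z z' : vec) : dot z z = 1 -> dot z' z' = 1 ->
  0 <= r < 1 -> 0 <= b < 1 ->
  E M (fun x => qf b (dot z' x) `^ (- nu) * poisson nu r (dot z x)) = qf (r * b) (dot z' z) `^ (- nu).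
Proof.
move=> z1 z1' r01 b01; have nu0 : 0 <= nu by apply: le_trans nu1.
pose f := fun x : vec => qf b (dot z' x) `^ (- nu).
have fB x : dot x x = 1 -> `|f x| <= ((1 - b) ^+ 2) `^ (- nu).
  by move=> x1; rewrite ger0_norm ?powR_ge0 // qf_powR_le // dot_le.
have S1 := @zonal_series_exchange R n M nu nu1 (fun k => (k%:R + nu) / nu) (poisson nu r) 1
    r z f _ z1 r01 (poisson_coef_le nu1)
    (fun t t1 => poisson_series nu1 t1 r01) (@mes_qf_powR R n M b _ z') fB.
have Ek k : E M (fun x => f x * (C k).[dot z x]) = b ^+ k * E M (fun x => (C k).[dot z' x] * (C k).[dot z x]).
  have [c Cc] := geg_bounded k.
  have a1 i : `|1 : R| <= i.+1%:R ^+ 0 by rewrite normr1 expr0.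
  have Sl (t : R) : -1 <= t <= 1 -> series (fun k => 1 * (C k).[t] * b ^+ k) @ \oo --> qf b t `^ (- nu).
    move=> t1; have -> : (fun k => 1 * (C k).[t] * b ^+ k) = (fun k => (C k).[t] * b ^+ k) by apply/funext => i; rewrite mul1r.
    exact: geg_series_cvg.
  have S2 := @zonal_series_exchange R n M nu nu1 (fun _ => 1) (fun t => qf b t `^ (- nu)) 0
    b z' (fun x => (C k).[dot z x]) c z1' b01 a1 Sl (@mes_geg R n M nu k z) (fun x x1 => Cc z x z1 x1).
  have S3 : series (fun i => 1 * b ^+ i * E M (fun x => (C k).[dot z x] * (C i).[dot z' x])) @ \oo -->
     1 * b ^+ k * E M (fun x => (C k).[dot z x] * (C k).[dot z' x]).
    apply: (@series_single R (fun i => 1 * b ^+ i * E M (fun x => (C k).[dot z x] * (C i).[dot z' x]))) => i ik.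
    by rewrite E_geg_orth ?mulr0 // eq_sym.
  have := cvg_unique _ S2 S3 => /(_ (@Rhausdorff R)); rewrite mul1r => H.
  transitivity (E M (fun x => (C k).[dot z x] * qf b (dot z' x) `^ (- nu))).
    by apply: E_eq => x _; rewrite mulrC.
  by rewrite H; congr (_ * _); apply: E_eq => x _; rewrite mulrC.
have rb : 0 <= r * b < 1 by move: r01 b01 => /andP[? ?] /andP[? ?]; apply/andP; split; nra.
have S4 := geg_series_cvg nu1 (dot_le z1' z1) rb.
have TE : (fun k => (k%:R + nu) / nu * r ^+ k * E M (fun x => f x * (C k).[dot z x])) =
  (fun k => (C k).[dot z' z] * (r * b) ^+ k).
  by apply/funext => k; rewrite Ek -(E_geg_geg k z1 z1') exprMn; ring.
rewrite TE in S1.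
exact: (cvg_unique (@Rhausdorff R) S1 S4).
Qed.

Variables (e : vec) (l : R).
Hypotheses (e1 : dot e e = 1) (l01 : 0 <= l < 1).
Local Notation rho := (inv_rho e l).
Local Notation Phi := (inversion e l).

(** By [qf_inversion] the integrand is a constant times a Newton kernel with pole l e times a
    Poisson kernel with a new pole. [E_poisson_harmonic] evaluates its mean, and the relation
    between the poles makes the result 1. *)
Lemma E_poisson_inversion (r : R) (w : vec) : dot w w = 1 -> 0 <= r < 1 ->
  E M (fun y => poisson nu r (dot w (Phi y)) * rho y `^ (2 * nu + 1)) = 1.
Proof.
move=> w1 r01; have [m2 [r1 [v [m20 r101 v1 [H1 H2 H3]]]]] := qf_inversion e1 l01 w1 r01.
have L0 := one_sub_sqr_gt0 l01; set L := 1 - l ^+ 2 in L0 H1 H2.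
have nu0 : 0 <= nu by apply: le_trans nu1.
transitivity (E M (fun y => (L ^+ 2 / m2) `^ nu * (qf l (dot e y) `^ (- nu) * poisson nu r1 (dot v y)))).
  apply: E_eq => y y1; have q0 := inv_q_gt0 e1 l01 y1.
  have q10 : 0 < qf r1 (dot v y) by rewrite qf_gt0 // dot_le.
  rewrite /poisson H3 // /inv_rho -/L.
  have -> : qf l (dot e y) = inv_q e l y by [].
  have -> : 1 - r ^+ 2 = (1 - r1 ^+ 2) * (m2 / L) by rewrite H1; field; rewrite !lt0r_neq0.
  move: (qf r1 _) (inv_q e l y) q10 q0 => q1 q q10 q0.
  transitivity ((1 - r1 ^+ 2) * (m2 / L * (m2 * q1 / q) `^ (- (nu + 1)) * (L / q) `^ (2 * nu + 1))).
    by ring.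
  by rewrite inversion_weight //; ring.
rewrite EZ; last first.
  apply: (itgM (c := ((1 - r1) ^+ 2) `^ (- (nu + 1))) (@itg_qf_powR R n M _ _ _ e1 l01 nu0) (@mes_poisson R n M nu r1 v)) => x x1.
  by apply: poisson_le => //; exact: dot_le.
rewrite E_poisson_harmonic //.
have -> : qf (r1 * l) (dot e v) = L ^+ 2 / m2 by rewrite /qf (dotC e v) -mulrA [2 * _]mulrA H2.
by rewrite powRN mulfV // gt_eqF // powR_gt0 // divr_gt0 // exprn_gt0.
Qed.

(** Replace F(Phi y) by its Poisson average and exchange the integrals: the integral in y is then 1
    by [E_poisson_inversion]. Let the radius tend to 1. The Jacobian rho^(2 nu + 1) is rho^n. *)
Lemma E_inversion (F : vec -> R) : sph_continuous F ->
  E M (fun y => F (Phi y) * rho y `^ (2 * nu + 1)) = E M F.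
Proof.
move=> cF; have [B B0 FB] := sph_continuous_bounded cF.
have crho : sph_continuous (fun x => rho x `^ (2 * nu + 1)) by exact: sph_continuous_rhoX.
have [D D0 rD] := sph_continuous_bounded crho.
have mrho : mes M (fun y => rho y `^ (2 * nu + 1)) by apply: mes_cont; exact: sph_continuous_rhoX.
have irho : itg M (fun y => rho y `^ (2 * nu + 1)) by apply: itg_cont; exact: sph_continuous_rhoX.
have mF := @mes_cont R n M F cF.
have Phi1 y (y1 : dot y y = 1) := inversion_unit e1 l01 y1.
pose K j y w := F w * poisson nu (rad R j) (dot w (Phi y)) * rho y `^ (2 * nu + 1).
have mK j : mes2 M (K j).
  have mdot : mes2 M (fun y w => dot w (Phi y)).
    apply: (@eq_measurable_fun _ _ _ _ _ (fun p => inv_rho e l (up_fun p.1) * dot (up_fun p.1) (up_fun p.2) -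
       2 * height e l (up_fun p.1) / inv_q e l (up_fun p.1) * dot e (up_fun p.2))).
      by move=> p _; rewrite /inversion dotBr !dotZr (dotC (up_fun p.2)) (dotC (up_fun p.2) e).
    apply: measurable_funB; apply: measurable_funM.
    - by apply: (mes2_l (M := M)); apply: mes_cont; exact: sph_continuous_inv_rho.
    - exact: mes2_dot.
    - apply: (mes2_l (M := M) (F := fun x => 2 * height e l x / inv_q e l x)); apply: mes_cont.
      apply: sph_continuousM; first by apply: sph_continuousM; [exact: sph_continuous_cst|exact: sph_continuous_height].
      apply: sph_continuousV; first exact: sph_continuous_inv_q.
      by move=> y y1; apply: lt0r_neq0; exact: inv_q_gt0.
    - by apply: (mes2_r (M := M)); exact: mes_dot.
  apply: mes2M; last exact: mes2_l.
  apply: mes2M; first exact: mes2_r.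
  apply: measurable_funM; first exact: measurable_cst.
  apply: (measurableT_comp (measurable_powR _)).
  apply: measurable_funD; last exact: measurable_cst.
  by apply: measurable_funB; [exact: measurable_cst|apply: measurable_funM => //; exact: measurable_cst].
have bK j y w : dot y y = 1 -> dot w w = 1 -> `|K j y w| <= B * ((1 - rad R j) ^+ 2) `^ (- (nu + 1)) * D.
  move=> y1 w1; rewrite /K normrM; apply: ler_pM; rewrite ?normr_ge0 ?rD //.
  rewrite normrM; apply: ler_pM; rewrite ?normr_ge0 ?FB //.
  by apply: poisson_le; [exact: nu1|apply: dot_le => //; exact: Phi1|exact: rad_ge0_lt1].
have iFP j (z : vec) : dot z z = 1 -> itg M (fun w => F w * poisson nu (rad R j) (dot z w)).
  move=> z1; apply: (itg_le (G := fun x => B * poisson nu (rad R j) (dot z x))).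
  - by apply: mesM => //; exact: mes_poisson.
  - by apply: itgZ; apply: itg_poisson => //; exact: rad_ge0_lt1.
  - by move=> x x1; rewrite normrM (ger0_norm (poisson_ge0 _ _ (rad_ge0_lt1 j))) ler_wpM2r ?poisson_ge0 ?rad_ge0_lt1 ?FB.
have EK j y : dot y y = 1 -> E M (K j y) = E M (fun w => F w * poisson nu (rad R j) (dot (Phi y) w)) * rho y `^ (2 * nu + 1).
  move=> y1; rewrite mulrC -EZ; last by apply: iFP; exact: Phi1.
  by apply: E_eq => w _; rewrite /K (dotC w) mulrC.
have bE j (z : vec) : dot z z = 1 -> `|E M (fun w => F w * poisson nu (rad R j) (dot z w))| <= B.
  move=> z1; have ip := itg_poisson M nu1 z1 (rad_ge0_lt1 j).
  rewrite -[leRHS]mulr1 -(E_poisson M hn nu1 z1 (rad_ge0_lt1 j)) -(EZ B ip).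
  apply: E_abs_le; [exact: iFP|exact: itgZ|].
  by move=> x x1; rewrite normrM (ger0_norm (poisson_ge0 _ _ (rad_ge0_lt1 j))) ler_wpM2r ?poisson_ge0 ?rad_ge0_lt1 ?FB.
have [||||_ L] := @E_dct R n M (fun j y => E M (K j y)) (fun y => F (Phi y) * rho y `^ (2 * nu + 1)) (fun y => B * rho y `^ (2 * nu + 1)).
- by move=> j; exact: (E_fubini (mK j) (bK j)).1.
- move=> y y1; have LL := poisson_approx M hn nu1 cF (Phi1 y y1).
  have -> : (fun j => E M (K j y)) = (fun j => E M (fun w => F w * poisson nu (rad R j) (dot (Phi y) w)) * rho y `^ (2 * nu + 1)).
    by apply/funext => j; exact: EK.
  by apply: cvgM LL _; exact: cvg_cst.
- exact: itgZ.
- move=> j y y1; rewrite EK // normrM (ger0_norm (powR_ge0 _ _)) ler_wpM2r ?powR_ge0 //.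
  by apply: bE; exact: Phi1.
have Ec j : E M (fun y => E M (K j y)) = E M F.
  rewrite (E_fubini (mK j) (bK j)).2; apply: E_eq => w w1.
  have iw : itg M (fun y => poisson nu (rad R j) (dot w (Phi y)) * rho y `^ (2 * nu + 1)).
    have cP : sph_continuous (fun y => poisson nu (rad R j) (dot w (Phi y))).
      apply: (sph_continuous_inversion e1 l01 (F := fun y => poisson nu (rad R j) (dot w y))).
      apply: sph_continuousM; first exact: sph_continuous_cst.
      apply: sph_continuous_powR; last by move=> x x1; rewrite qf_gt0 ?rad_ge0_lt1 // dot_le.
      apply: sph_continuousD; last exact: sph_continuous_cst.
      apply: sph_continuousB; first exact: sph_continuous_cst.
      by apply: sph_continuousM; [exact: sph_continuous_cst|exact: sph_continuous_dot].
    by apply: itg_cont; apply: sph_continuousM => //; exact: sph_continuous_rhoX.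
  transitivity (F w * E M (fun y => poisson nu (rad R j) (dot w (Phi y)) * rho y `^ (2 * nu + 1))).
    by rewrite -EZ //; apply: E_eq => y _; rewrite mulrA.
  by rewrite E_poisson_inversion ?rad_ge0_lt1 // mulr1.
have {}L : (fun _ : nat => E M F) @ \oo --> E M (fun y => F (Phi y) * rho y `^ (2 * nu + 1)).
  by move: L; under eq_fun do rewrite Ec.
exact: (cvg_unique (@Rhausdorff R) L (cvg_cst _)).
Qed.

End ChangeOfVariables.

(** * Integrability and mean of the Riesz kernel *)

Section RieszPotential.
Variables (R : realType) (n : nat) (M : uniform_point R n) (nu s : R).
Hypotheses (hn : n%:R = 2 * nu + 1) (nu1 : 1 <= nu) (s0 : 0 < s) (sn : 2 * s < 2 * nu + 1).
Local Notation vec := 'rV[R]_n.+1.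
Local Notation leb := (@lebesgue_measure R).
Local Notation hl := (`]0, +oo[%classic : set R).
Local Notation p := (nu + 2^-1 - s).
Local Notation beta := (nu + 2^-1 + s).

(* On the diagonal the kernel takes the junk value [0 `^ (- p) = 0]; the diagonal is negligible. *)
Definition riesz (t : R) : R := (2 - 2 * t) `^ (- p).

(** The value of the Riesz operator on the constant 1. *)
Definition riesz_mean : R := Gamma (2 * s) * (Gamma p / Gamma beta) / riesz_const nu s.

Let p0 : 0 < p. Proof. by move: sn; lra. Qed.

Lemma riesz_ge0 t : 0 <= riesz t. Proof. exact: powR_ge0. Qed.

Lemma mes_riesz (z : vec) : mes M (fun x => riesz (dot z x)).
Proof.
apply: (@mes_zonal R n M riesz); apply: (measurableT_comp (measurable_powR _)).
by apply: measurable_funB; [exact: measurable_cst|apply: measurable_funM => //; exact: measurable_cst].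
Qed.

Lemma riesz_weight_ge0 u : 0 <= riesz_weight nu s u.
Proof. by rewrite mulr_ge0 ?powR_ge0. Qed.

Lemma riesz_weight_measurable : measurable_fun hl (riesz_weight nu s).
Proof.
apply: hl_continuous_measurable => t t0; apply: continuousM; first exact: powR_continuous.
exact: add1_powR_continuous.
Qed.

Lemma hl_radius (u : R) : 0 < u -> 0 <= (1 + u)^-1 < 1.
Proof.
by move=> u0; have u1 : 0 < 1 + u; [by rewrite ltr_pwDl // ltW|rewrite invr_ge0 ltW //= invf_lt1 // ltrDl].
Qed.

Lemma riesz_weight_mass : (\int[leb]_(u in hl) (riesz_weight nu s u)%:E = (riesz_const nu s * riesz_mean)%:E)%E.
Proof.
have := riesz_weight_integral s0 sn 0.
under eq_integral do rewrite expr0 mulr1.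
move=> ->; congr EFin; rewrite add0r /riesz_mean [RHS]mulrC divfK //.
by apply: lt0r_neq0; exact: riesz_const_gt0.
Qed.

Let W2 (z : vec) (w : up_space M) (u : R) : R :=
  (0 < u)%R%:R * (riesz_weight nu s u * poisson nu (1 + u)^-1 (dot z (up_fun w))).

Let mW2 (z : vec) : measurable_fun setT (fun q : up_space M * R => W2 z q.1 q.2).
Proof.
have m1 : measurable_fun setT (fun q : up_space M * R => dot z (up_fun q.1)).
  have md : measurable_fun setT (fun w : up_space M => dot z (up_fun w)) := @mes_dot R n M z.
  exact: (measurableT_comp md measurable_fst).
have m2 : measurable_fun setT (fun q : up_space M * R => q.2) := measurable_snd.
have m3 : measurable_fun setT (fun q : up_space M * R => 1 + q.2).
  by apply: measurable_funD => //; exact: measurable_cst.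
rewrite (_ : (fun q => _) = (fun q : up_space M * R => (0 < q.2)%R%:R *
    (riesz_weight nu s q.2 * poisson nu ((1 + q.2) `^ (-1)) (dot z (up_fun q.1))))); last first.
  apply/funext => q; rewrite /W2; case: (ltP 0 q.2) => q0; last by rewrite !mul0r.
  by rewrite powR_inv1 // addr_ge0 // ltW.
have m4 : measurable_fun setT (fun q : up_space M * R => (1 + q.2) `^ (-1)).
  exact: (measurableT_comp (measurable_powR _) m3).
apply: measurable_funM; first exact: (measurableT_comp (@measurable_pos R) m2).
apply: measurable_funM.
  apply: measurable_funM; first exact: (measurableT_comp (measurable_powR _) m2).
  exact: (measurableT_comp (measurable_powR _) m3).
apply: measurable_funM.
  by apply: measurable_funB; [exact: measurable_cst|exact: measurable_funX].
apply: (measurableT_comp (measurable_powR _)).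
apply: measurable_funD; last exact: measurable_funX.
apply: measurable_funB; first exact: measurable_cst.
by apply: measurable_funM => //; apply: measurable_funM => //; exact: measurable_cst.
Qed.

Lemma ge0_hl_integral_mkcond (f : R -> R) :
  (\int[leb]_(u in hl) (f u)%:E = \int[leb]_u ((0 < u)%R%:R * f u)%:E)%E.
Proof.
rewrite integral_mkcond; apply: eq_integral => u _; rewrite patchE mem_hl.
by case: (0 < u); rewrite ?mul1r ?mul0r.
Qed.

Lemma point_ae (z : vec) : dot z z = 1 ->
  exists2 N, measurable N & up_prob M N = 0%E /\ forall w, dot z (up_fun w) = 1 -> N w.
Proof.
move=> z1; have mi : mes M (fun x => (dot z x == 1)%:R : R).
  apply: (@mes_zonal R n M (fun t : R => (t == 1)%:R)).
  rewrite (_ : (fun t : R => (t == 1)%:R : R) = \1_[set 1]); first exact: measurable_indic.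
  by apply/funext => t; rewrite indicE; congr ((nat_of_bool _)%:R); apply/eqP/idP => [->|/set_mem //]; exact/mem_set.
have ii : itg M (fun x => (dot z x == 1)%:R).
  by apply: (itg_bounded (c := 1) mi) => x _; case: eqP; rewrite ?normr1 ?normr0.
have [N mN [N0 sN]] := E_eq0_ae mi (fun x _ => ler0n _ _) ii (point_null M hn nu1 z1).
exists N => //; split => // w h; apply: sN; by rewrite h eqxx oner_neq0.
Qed.

(* The Riesz kernel is a superposition of Poisson kernels, weighted by [riesz_weight]. *)
Lemma E_riesz_ge0 (z : vec) (f : vec -> R) (c : R) : dot z z = 1 -> mes M f ->
  (forall x, dot x x = 1 -> 0 <= f x <= c) ->
  (\int[up_prob M]_w ((riesz_const nu s)%:E * (riesz (dot z (up_fun w)) * f (up_fun w))%:E) =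
   \int[leb]_(u in hl) (riesz_weight nu s u * E M (fun x => poisson nu (1 + u)^-1 (dot z x) * f x))%:E)%E.
Proof.
move=> z1 mf fc; have [N mN [N0 sN]] := point_ae z1.
pose K (q : up_space M * R) : R := W2 z q.1 q.2 * f (up_fun q.1).
have mK : measurable_fun setT (EFin \o K).
  by apply/measurable_EFinP; apply: measurable_funM; [exact: mW2|exact: (measurableT_comp mf measurable_fst)].
have f0 (w : up_space M) : 0 <= f (up_fun w) by have /andP[] := fc _ (@up_unit R n M w).
have W0 w u : 0 <= W2 z w u.
  rewrite /W2; case: (ltP 0 u) => u0; last by rewrite mul0r.
  by rewrite mul1r mulr_ge0 ?riesz_weight_ge0 // poisson_ge0 // hl_radius.
have K0 q : (0 <= (EFin \o K) q)%E by rewrite lee_fin mulr_ge0.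
have T := @fubini_tonelli _ _ _ _ R (up_prob M) leb (EFin \o K) mK K0.
transitivity (\int[up_prob M]_w \int[leb]_u (EFin \o K) (w, u))%E.
  have h1 : measurable_fun setT (fun w => ((riesz_const nu s)%:E * (riesz (dot z (up_fun (u := M) w)) * f (up_fun w))%:E)%E).
    by apply: measurable_funeM; apply/measurable_EFinP; apply: measurable_funM => //; exact: mes_riesz.
  have h2 : measurable_fun setT (fun w => (\int[leb]_u (EFin \o K) (w, u))%E).
    exact: (@measurable_fun_fubini_tonelli_F _ _ _ _ R leb _ mK K0).
  have h3 w : setT w -> (0 <= (riesz_const nu s)%:E * (riesz (dot z (up_fun (u := M) w)) * f (up_fun w))%:E)%E.
    by move=> _; rewrite -EFinM lee_fin; apply: mulr_ge0; [apply/ltW; exact: riesz_const_gt0|apply: mulr_ge0; [exact: riesz_ge0|exact: f0]].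
  have h4 w : setT w -> (0 <= \int[leb]_u (EFin \o K) (w, u))%E.
    by move=> _; apply: integral_ge0 => u _; exact: K0.
  apply: (ge0_ae_eq_integral measurableT h1 h2 h3 h4).
  (* Subordination holds off the pole z.x = 1, whose outcomes lie in the null set N. *)
  exists N; split => // w; apply: contra_notP => Nw _; rewrite /= /K /=.
  have zw : -1 <= dot z (up_fun w) < 1.
    have /andP[-> h] := dot_le z1 (@up_unit R n M w); rewrite lt_neqAle h andbT.
    by apply/eqP => hd1; apply: Nw; exact: sN.
  have -> : (fun u : R => (W2 z w u * f (up_fun w))%:E) = (fun u => (f (up_fun w))%:E * ((0 < u)%R%:R * (riesz_weight nu s u * poisson nu (1 + u)^-1 (dot z (up_fun w))))%:E)%E.
    by apply/funext => u; rewrite -EFinM mulrC.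
  rewrite ge0_integralZl ?lee_fin //; last 2 first.
  - by apply/measurable_EFinP; exact: (measurableT_comp (mW2 z) (pair1_measurable w)).
  - by move=> u _; rewrite lee_fin; exact: W0.
  rewrite -ge0_hl_integral_mkcond riesz_subordination // -!EFinM; congr EFin.
  by rewrite /riesz; ring.
rewrite T ge0_hl_integral_mkcond; apply: eq_integral => u _ /=.
rewrite /K /W2 /=; case: (ltP 0 u) => u0; last first.
  by rewrite mul0r; under eq_integral do rewrite !mul0r; rewrite integral0.
rewrite mul1r; under eq_integral do rewrite mul1r -mulrA EFinM.
have r01 := hl_radius u0.
have ip : itg M (fun x => poisson nu (1 + u)^-1 (dot z x) * f x).
  apply: (itgM (c := c) (itg_poisson M nu1 z1 r01) mf) => x x1.
  by have /andP[h1 h2] := fc x x1; rewrite ger0_norm.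
rewrite ge0_integralZl ?lee_fin ?riesz_weight_ge0 //.
- by rewrite [RHS]EFinM; congr (_ * _)%E; rewrite /E /Rintegral fineK // (integrable_fin_num measurableT ip).
- exact: (measurable_int _ ip).
- by move=> w _; rewrite lee_fin mulr_ge0 // poisson_ge0.
Qed.

Lemma itg_riesz (z : vec) : dot z z = 1 -> itg M (fun x => riesz (dot z x)) /\ E M (fun x => riesz (dot z x)) = riesz_mean.
Proof.
move=> z1; have H := @E_riesz_ge0 z (fun _ => 1) 1 z1 (@mes_cst R n M 1).
have c0 := riesz_const_gt0 s0 sn.
have {}H : (\int[up_prob M]_w ((riesz_const nu s)%:E * (riesz (dot z (up_fun w)))%:E) = (riesz_const nu s * riesz_mean)%:E)%E.
  rewrite -riesz_weight_mass.
  transitivity (\int[up_prob M]_w ((riesz_const nu s)%:E * (riesz (dot z (up_fun w)) * 1)%:E))%E.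
    by apply: eq_integral => w _; rewrite mulr1.
  rewrite H; last by move=> x _; rewrite ler01 lexx.
  apply: eq_integral => u /[!mem_hl] u0; congr EFin.
  rewrite (@E_eq R n M (fun x => poisson nu (1 + u)^-1 (dot z x) * 1) (fun x => poisson nu (1 + u)^-1 (dot z x))); last by move=> x _; rewrite mulr1.
  by rewrite E_poisson ?hl_radius // mulr1.
have mr : measurable_fun setT (EFin \o (fun w => riesz (dot z (up_fun (u := M) w)))).
  by apply/measurable_EFinP; exact: mes_riesz.
rewrite ge0_integralZl ?lee_fin ?(ltW c0) // in H; last by move=> w _; rewrite lee_fin riesz_ge0.
have {}H : (\int[up_prob M]_w (riesz (dot z (up_fun w)))%:E = riesz_mean%:E)%E.
  move: H; case: (\int[up_prob M]_w _)%E => [x| |].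
  - by rewrite -EFinM => -[/(mulfI (lt0r_neq0 c0)) ->].
  - by rewrite gt0_muley ?lte_fin.
  - by rewrite gt0_muleNy ?lte_fin.
split; last by rewrite /E /Rintegral H.
apply/integrableP; split => //.
under eq_integral do rewrite /= ger0_norm ?riesz_ge0 //.
by rewrite H ltry.
Qed.

Lemma itg_rieszM (z : vec) (f : vec -> R) (c : R) : dot z z = 1 -> mes M f ->
  (forall x, dot x x = 1 -> `|f x| <= c) -> itg M (fun x => riesz (dot z x) * f x).
Proof. by move=> z1 mf fc; exact: (itgM (c := c) (itg_riesz z1).1 mf fc). Qed.

End RieszPotential.

(** * Differences of negative powers *)

Section PowerGap.
Variable R : realType.

Lemma min1_powR_le (x gam : R) : 0 < x -> 0 <= gam <= 1 -> Num.min 1 x <= x `^ gam.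
Proof.
move=> x0 /andP[g0 g1]; have [x1|x1] := leP x 1.
  have x01 : 0 < x <= 1 by rewrite x0.
  by have := ger_powR x01 g1; rewrite powRr1 // ltW.
by have := ler_powR (ltW x1) g0; rewrite powRr0.
Qed.

Lemma bernoulli_powR (x m : R) : 0 <= x -> 0 <= m -> 1 - (1 + x) `^ (- m) <= m * x.
Proof.
move=> x0 m0; have x1 : 0 < 1 + x by rewrite ltr_pwDl.
have := expR_ge1Dx (- m * ln (1 + x)); rewrite -powRE // => H.
have L : ln (1 + x) <= x by apply: le_ln1Dx; lra.
have : m * ln (1 + x) <= m * x by rewrite ler_wpM2l.
lra.
Qed.

(** Interpolates between Bernoulli's inequality for small x and the trivial bound 1 for large x. *)
Lemma pow_gap (x m gam : R) : 0 < x -> 0 <= m -> 0 <= gam <= 1 ->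
  1 - (1 + x) `^ (- m) <= (m + 1) * x `^ gam.
Proof.
move=> x0 m0 g01; have H := min1_powR_le x0 g01.
have B := bernoulli_powR (ltW x0) m0.
have P : 0 <= (1 + x) `^ (- m) by exact: powR_ge0.
have H2 : 1 - (1 + x) `^ (- m) <= (m + 1) * Num.min 1 x.
  have [x1|x1] := leP x 1; nra.
by apply: le_trans H2 _; rewrite ler_wpM2l // addr_ge0.
Qed.

(** A shift of the argument by h costs h^gam, at the price of a singularity stronger by the exponent
    gam. *)
Lemma pow_gap_kernel (a h m gam : R) : 0 < a -> 0 < h -> 0 <= m -> 0 <= gam <= 1 ->
  a `^ (- m) - (a + h) `^ (- m) <= (m + 1) * h `^ gam * a `^ (- (m + gam)).
Proof.
move=> a0 h0 m0 g01; have x0 : 0 < h / a by rewrite divr_gt0.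
have E : a + h = a * (1 + h / a) by field; exact: lt0r_neq0.
have -> : a `^ (- m) - (a + h) `^ (- m) = a `^ (- m) * (1 - (1 + h / a) `^ (- m)).
  by rewrite {1}E powRM ?ltW // ?addr_gt0 //; ring.
have -> : (m + 1) * h `^ gam * a `^ (- (m + gam)) = a `^ (- m) * ((m + 1) * (h / a) `^ gam).
  rewrite powRM ?invr_ge0 ?ltW // -(powR_inv1 (ltW a0)) -powRrM opprD powRD ?(lt0r_neq0 a0) ?implybT //.
  by rewrite mulN1r; ring.
by rewrite ler_wpM2l ?powR_ge0 // pow_gap.
Qed.

Lemma powR_small (B e g : R) : 0 < e -> 0 < g -> exists2 eps, 0 < eps & B * eps `^ g <= e.
Proof.
move=> e0 g0; have [B1|B1] := leP B 0.
  by exists 1 => //; rewrite powR1 mulr1; lra.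
have eB : 0 < e / B by rewrite divr_gt0.
exists ((e / B) `^ (g^-1)); first by rewrite powR_gt0.
by rewrite -powRrM mulVf ?lt0r_neq0 // powRr1 ?(ltW eB) // mulrC divfK ?lt0r_neq0.
Qed.

End PowerGap.

(** * The Riesz operator: continuity, symmetry, eigenvalues *)

Section RieszOperator.
Variables (R : realType) (n : nat) (M : uniform_point R n) (nu s : R).
Hypotheses (hn : n%:R = 2 * nu + 1) (nu1 : 1 <= nu) (s0 : 0 < s) (sn : 2 * s < 2 * nu + 1).
Local Notation vec := 'rV[R]_n.+1.
Local Notation leb := (@lebesgue_measure R).
Local Notation hl := (`]0, +oo[%classic : set R).
Local Notation p := (nu + 2^-1 - s).
Local Notation beta := (nu + 2^-1 + s).
Local Notation G := (riesz nu s).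
Local Notation C := (geg nu).

Let p0 : 0 < p. Proof. by move: sn; lra. Qed.

Definition riesz_op (f : vec -> R) (z : vec) : R := E M (fun x => G (dot z x) * f x).
(** An exponent in (0, 1] smaller than s, so that the more singular kernel of order s - gap_exp is
    still integrable. *)
Definition gap_exp : R := s / (1 + s).
(** A Lipschitz regularization from below. The factor 2 - 2t makes it vanish on the diagonal, in
    agreement with the convention by which [riesz] is 0 there. *)
Definition riesz_reg (eps t : R) : R := (2 - 2 * t) * (2 - 2 * t + eps) `^ (- (p + 1)).
Definition gap_mean : R := riesz_mean nu (s - gap_exp).

Lemma gap_exp_bounds : 0 < gap_exp <= 1 /\ 0 < s - gap_exp.
Proof.
have s1 : 0 < 1 + s by rewrite addr_gt0.
split; first by rewrite divr_gt0 //= ler_pdivrMr //; move: s0; lra.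
have -> : s - gap_exp = s ^+ 2 / (1 + s) by rewrite /gap_exp; field; exact: lt0r_neq0.
by rewrite divr_gt0 // exprn_gt0.
Qed.

Lemma itg_gap (z : vec) : dot z z = 1 ->
  itg M (fun x => riesz nu (s - gap_exp) (dot z x)) /\ E M (fun x => riesz nu (s - gap_exp) (dot z x)) = gap_mean.
Proof.
move=> z1; have [/andP[g0 g1] sg] := gap_exp_bounds.
by apply: itg_riesz => //; move: sn g0; lra.
Qed.

Lemma riesz_reg_gap (eps t : R) : -1 <= t <= 1 -> 0 < eps ->
  0 <= riesz_reg eps t /\ 0 <= G t - riesz_reg eps t <= (p + 2) * eps `^ gap_exp * riesz nu (s - gap_exp) t.
Proof.
move=> /andP[t0 t1] e0; have [/andP[g0 g1] sg] := gap_exp_bounds.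
have a0 : 0 <= 2 - 2 * t by lra.
rewrite /riesz_reg /riesz; move: (2 - 2 * t) a0 => a; rewrite le_eqVlt => /orP[/eqP <-|a0].
  rewrite !mul0r !powR0 ?subrr ?mulr0 ?lexx // oppr_eq0 lt0r_neq0 //.
  by move: p0 g0; lra.
split; first by rewrite mulr_ge0 ?powR_ge0 ?ltW.
have E1 : a `^ (- p) = a * a `^ (- (p + 1)).
  rewrite -{2}(powRr1 (ltW a0)) -powRD ?(lt0r_neq0 a0) ?implybT //.
  by congr (_ `^ _); ring.
rewrite E1 -mulrBr; apply/andP; split.
  rewrite mulr_ge0 ?(ltW a0) // subr_ge0 !powRN lef_pV2 ?posrE ?powR_gt0 ?addr_gt0 //.
  have p1 : 0 <= p + 1 by move: p0; lra.
  by apply: (ge0_ler_powR p1); rewrite ?nnegrE ?(ltW a0) ?addr_ge0 ?(ltW a0) ?(ltW e0) // lerDl ltW.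
have p1 : 0 <= p + 1 by move: p0; lra.
have g01 : 0 <= gap_exp <= 1 by rewrite ltW.
have := pow_gap_kernel a0 e0 p1 g01 => H.
have {}H := ler_wpM2l (ltW a0) H; apply: le_trans H _.
have -> : a `^ (- (nu + 2^-1 - (s - gap_exp))) = a * a `^ (- (p + 1 + gap_exp)).
  rewrite -{2}(powRr1 (ltW a0)) -powRD ?(lt0r_neq0 a0) ?implybT //.
  by congr (_ `^ _); ring.
by rewrite le_eqVlt; apply/orP; left; apply/eqP; ring.
Qed.

Lemma riesz_reg_lipschitz (eps : R) : 0 < eps -> exists2 L, 0 <= L & forall t t', -1 <= t <= 1 -> -1 <= t' <= 1 ->
  `|riesz_reg eps t - riesz_reg eps t'| <= L * `|t - t'|.
Proof.
move=> e0; have p1 : 0 <= p + 1 by move: p0; lra.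
pose c := eps `^ (- (p + 1)); pose L0 := c + 4 * (p + 2) * (c / eps).
have c0 : 0 <= c by exact: powR_ge0.
have ce0 : 0 <= c / eps by rewrite divr_ge0 // ltW.
have p2 : 0 <= p + 2 by move: p0; lra.
have L00 : 0 <= L0 by apply: addr_ge0 => //; apply: mulr_ge0 => //; exact: mulr_ge0.
exists (2 * L0); first exact: mulr_ge0.
pose phi a := a * (a + eps) `^ (- (p + 1)).
suff H a b : 0 <= a -> a <= b -> b <= 4 -> `|phi a - phi b| <= L0 * (b - a).
  move=> t t' /andP[h1 h2] /andP[h3 h4].
  have [tt|tt] := leP t t'.
    rewrite distrC; apply: le_trans (H (2 - 2 * t') (2 - 2 * t) _ _ _) _; try lra.
    rewrite ler0_norm; [|lra]; rewrite le_eqVlt; apply/orP; left; apply/eqP; ring.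
  apply: le_trans (H (2 - 2 * t) (2 - 2 * t') _ _ _) _; try lra.
  rewrite ger0_norm; [|lra]; rewrite le_eqVlt; apply/orP; left; apply/eqP; ring.
move=> a0 ab b4; have ae : 0 < a + eps by rewrite ltr_wpDl.
have be : 0 < b + eps by rewrite ltr_wpDl // (le_trans a0).
have A1 : (a + eps) `^ (- (p + 1)) <= c.
  rewrite /c !powRN lef_pV2 ?posrE ?powR_gt0 //.
  by apply: (ge0_ler_powR p1); rewrite ?nnegrE ?(ltW ae) ?(ltW e0) ?lerDr.
have A2 : (b + eps) `^ (- (p + 1)) <= (a + eps) `^ (- (p + 1)).
  rewrite !powRN lef_pV2 ?posrE ?powR_gt0 //.
  by apply: (ge0_ler_powR p1); rewrite ?nnegrE ?(ltW ae) ?(ltW be) ?lerD2r.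
have A3 : (a + eps) `^ (- (p + 1)) - (b + eps) `^ (- (p + 1)) <= (p + 2) * (c / eps) * (b - a).
  move: ab; rewrite le_eqVlt => /orP[/eqP ->|ab]; first by rewrite !subrr mulr0.
  have h0 : 0 < b - a by rewrite subr_gt0.
  have := pow_gap_kernel ae h0 p1 (gam := 1); rewrite ler01 lexx => /(_ isT).
  rewrite (_ : a + eps + (b - a) = b + eps); last by ring.
  rewrite (powRr1 (ltW h0)) => H; apply: le_trans H _.
  have : (a + eps) `^ (- (p + 1 + 1)) <= c / eps.
    rewrite (_ : - (p + 1 + 1) = - (p + 1) + -1); last by ring.
    rewrite powRD ?(lt0r_neq0 ae) ?implybT // powR_inv1 ?(ltW ae) //.
    by rewrite ler_pM ?powR_ge0 ?invr_ge0 ?(ltW ae) // lef_pV2 ?posrE // lerDr.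
  move: (_ `^ _) => y yc; have : 0 <= (p + 2) * (b - a) by rewrite mulr_ge0 // ltW.
  rewrite (_ : p + 1 + 1 = p + 2); last by ring.
  move: (p + 2) (c / eps) (b - a) yc => u v w yc; nra.
have A0 : 0 <= (a + eps) `^ (- (p + 1)) by exact: powR_ge0.
have B0 : 0 <= (b + eps) `^ (- (p + 1)) by exact: powR_ge0.
rewrite /phi /L0; set A := (a + eps) `^ _ in A0 A1 A2 A3 *; set B := (b + eps) `^ _ in B0 A2 A3 *.
have -> : a * A - b * B = b * (A - B) - (b - a) * A by ring.
apply: le_trans (ler_normB _ _) _; rewrite !normrM (ger0_norm A0) !ger0_norm; try lra.
have h1 : (b - a) * A <= c * (b - a) by rewrite mulrC ler_wpM2r // subr_ge0.
have h2 : b * (A - B) <= 4 * ((p + 2) * (c / eps) * (b - a)).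
  by apply: ler_pM => //; [exact: le_trans ab|rewrite subr_ge0].
move: h1 h2; set X := (p + 2) * (c / eps); rewrite (_ : 4 * (p + 2) * (c / eps) = 4 * X); last by rewrite /X; ring.
by rewrite mulrDl !mulrA; lra.
Qed.

Lemma sph_continuousI (F : vec -> R) :
  (forall z e, dot z z = 1 -> 0 < e -> exists2 del, 0 < del & forall x, dot x x = 1 ->
      2 - 2 * dot z x < del -> `|F z - F x| < e) -> sph_continuous F.
Proof.
move=> H x x0; have FF : Filter (nbhs x) := nbhs_filter x; apply/cvgrPdist_lt => e e0.
have z1 := dot_normalize_self x0.
have [del d0 Hd] := H _ e z1 e0.
have cd : {for x, continuous (fun y => dot (normalize x) (normalize y))} by exact: dot_normalize_continuous.
have d20 : 0 < del / 2 by rewrite divr_gt0.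
have /cvgrPdist_lt /(_ _ d20) := cd; rewrite z1 => N1.
have N2 := near_neq0 x0.
apply: (@filterS2 _ (nbhs x) FF _ _ _ _ N1 N2) => y y1 y0.
apply: Hd; first exact: dot_normalize_self.
by move: y1; have := ler_norm (1 - dot (normalize x) (normalize y)); lra.
Qed.

Lemma dot_diff_le (z z' x : vec) : dot z z = 1 -> dot z' z' = 1 -> dot x x = 1 ->
  `|dot z x - dot z' x| <= Num.sqrt (2 - 2 * dot z z').
Proof.
move=> z1 z1' x1; rewrite -sqrtr_sqr ler_sqrt; last first.
  by have /andP[_ h] := dot_le z1 z1'; lra.
(* Cauchy-Schwarz, as nonnegativity of the squared distance from z - z' to the line of x. *)
have := dot_ge0 ((z - z') - (dot z x - dot z' x) *: x).
rewrite !(dotBl, dotBr, dotZl, dotZr) z1 z1' x1 (dotC z' z) (dotC x z) (dotC x z') expr2.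
nra.
Qed.

Section Bounded.
Variables (f : vec -> R) (c : R).
Hypotheses (mf : mes M f) (fc : forall x, dot x x = 1 -> `|f x| <= c).

Let c0 : 0 <= c.
Proof. by apply: le_trans (normr_ge0 _) (fc (dot_ebasis R ord0)). Qed.

Lemma mes_riesz_reg eps (z : vec) : mes M (fun x => riesz_reg eps (dot z x)).
Proof.
have m1 : measurable_fun setT (fun t : R => 2 - 2 * t).
  by apply: measurable_funB; [exact: measurable_cst|apply: measurable_funM => //; exact: measurable_cst].
apply: (@mes_zonal R n M (riesz_reg eps)); apply: measurable_funM => //.
apply: (measurableT_comp (measurable_powR _)).
by apply: measurable_funD => //; exact: measurable_cst.
Qed.

Lemma itg_riesz_op (z : vec) : dot z z = 1 -> itg M (fun x => G (dot z x) * f x).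
Proof. by move=> z1; exact: (itg_rieszM hn nu1 s0 sn z1 mf fc). Qed.

Lemma itg_riesz_reg eps (z : vec) : dot z z = 1 -> 0 < eps -> itg M (fun x => riesz_reg eps (dot z x) * f x).
Proof.
move=> z1 e0; apply: (itgM (c := c) _ mf fc).
apply: (@itg_le R n M (fun x => riesz_reg eps (dot z x)) (fun x => G (dot z x)) (mes_riesz_reg eps z) (itg_riesz M hn nu1 s0 sn z1).1) => x x1.
have [h1 /andP[h2 _]] := riesz_reg_gap (dot_le z1 x1) e0.
by rewrite ger0_norm // -subr_ge0.
Qed.

Lemma riesz_op_gap eps (z : vec) : dot z z = 1 -> 0 < eps ->
  `|riesz_op f z - E M (fun x => riesz_reg eps (dot z x) * f x)| <= c * ((p + 2) * eps `^ gap_exp * gap_mean).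
Proof.
move=> z1 e0; have [ig Eg] := itg_gap z1.
rewrite /riesz_op -EB; [|exact: itg_riesz_op|exact: itg_riesz_reg].
rewrite -Eg -!EZ //; last exact: itgZ.
apply: E_abs_le.
- by apply: itgB; [exact: itg_riesz_op|exact: itg_riesz_reg].
- by do 2 apply: itgZ.
move=> x x1; rewrite -mulrBl normrM mulrC.
have [h1 /andP[h2 h3]] := riesz_reg_gap (dot_le z1 x1) e0.
by rewrite (ger0_norm h2) ler_pM // fc.
Qed.

(** The operator is a uniform limit of operators with Lipschitz kernels, by [riesz_op_gap]. *)
Lemma sph_continuous_riesz_op : sph_continuous (riesz_op f).
Proof.
apply: sph_continuousI => z e z1 e0.
have [/andP[g0 g1] _] := gap_exp_bounds.
pose B := c * (p + 2) * gap_mean.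
have e40 : 0 < e / 4 by rewrite divr_gt0.
(* First eps bounds the two regularization errors by e/4 each, then D bounds the Lipschitz variation
   by e/4. *)
have [eps eps0 He] := powR_small B e40 g0.
have [L L0 HL] := riesz_reg_lipschitz eps0.
pose D := e / (4 * (c * L + 1)); have cL : 0 < c * L + 1 by rewrite ltr_wpDl // mulr_ge0.
have D0 : 0 < D by rewrite divr_gt0 // mulr_gt0.
exists (D ^+ 2); first by rewrite exprn_gt0.
move=> x x1 xz.
have zx : Num.sqrt (2 - 2 * dot z x) <= D.
  by rewrite -[leRHS](ger0_norm (ltW D0)) -sqrtr_sqr ler_sqrt ?sqr_ge0 // ltW.
have G1 := riesz_op_gap z1 eps0; have G2 := riesz_op_gap x1 eps0.
have G3 : `|E M (fun y => riesz_reg eps (dot z y) * f y) - E M (fun y => riesz_reg eps (dot x y) * f y)| <= L * D * c.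
  rewrite -EB; [|exact: itg_riesz_reg|exact: itg_riesz_reg].
  rewrite -(E_cst M (L * D * c)); apply: E_abs_le; [|exact: itg_cst|].
    by apply: itgB; exact: itg_riesz_reg.
  move=> y y1; rewrite -mulrBl normrM ler_pM ?fc //.
  apply: le_trans (HL _ _ (dot_le z1 y1) (dot_le x1 y1)) _; rewrite ler_wpM2l //.
  by apply: le_trans (dot_diff_le z1 x1 y1) zx.
have G4 : L * D * c <= e / 4.
  rewrite /D (_ : L * (e / (4 * (c * L + 1))) * c = (e / 4) * ((c * L) / (c * L + 1))); last first.
    by field; exact: lt0r_neq0.
  by apply: ler_piMr; [exact: ltW|rewrite ler_pdivrMr // mul1r lerDl].
have {}He : c * ((p + 2) * eps `^ gap_exp * gap_mean) <= e / 4.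
  by apply: le_trans He; rewrite /B le_eqVlt; apply/orP; left; apply/eqP; ring.
move: (riesz_op f z) (riesz_op f x) (E M (fun y => riesz_reg eps (dot z y) * f y))
  (E M (fun y => riesz_reg eps (dot x y) * f y)) (c * ((p + 2) * eps `^ gap_exp * gap_mean))
  (L * D * c) He G1 G2 G3 G4 => a1 a2 b1 b2 d d' He G1 G2 G3 G4.
have T : `|a1 - a2| <= `|a1 - b1| + `|b1 - b2| + `|a2 - b2|.
  rewrite (_ : a1 - a2 = (a1 - b1) + (b1 - b2) - (a2 - b2)); last by ring.
  by apply: le_trans (ler_normB _ _) _; rewrite lerD2r ler_normD.
lra.
Qed.

End Bounded.

Lemma riesz_reg_bounded eps : 0 < eps -> exists2 D, 0 <= D & forall x y : vec,
  dot x x = 1 -> dot y y = 1 -> `|riesz_reg eps (dot x y)| <= D.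
Proof.
move=> e0; have [L L0 HL] := riesz_reg_lipschitz e0.
exists (L * 2); first exact: mulr_ge0.
move=> x y x1 y1; have xy := dot_le x1 y1.
have := HL (dot x y) 1 xy; rewrite {2}/riesz_reg mulr1 subrr mul0r subr0.
move=> H; apply: le_trans (H _) _; first by apply/andP; split; lra.
rewrite ler_wpM2l // ler_norml; move: xy => /andP[? ?]; apply/andP; split; lra.
Qed.

(** Fubini is applied to the bounded regularized kernel; the error on either side is made
    arbitrarily small by [riesz_op_gap]. *)
Lemma riesz_op_sym (f a : vec -> R) (c c' : R) : mes M f -> mes M a ->
  (forall x, dot x x = 1 -> `|f x| <= c) -> (forall x, dot x x = 1 -> `|a x| <= c') ->
  E M (fun x => a x * riesz_op f x) = E M (fun x => f x * riesz_op a x).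
Proof.
move=> mf ma fc ac.
have [/andP[g0 g1] _] := gap_exp_bounds.
have key f1 a1 c1 c2 eps : mes M f1 -> mes M a1 -> (forall x, dot x x = 1 -> `|f1 x| <= c1) ->
    (forall x, dot x x = 1 -> `|a1 x| <= c2) -> 0 < eps ->
  `|E M (fun x => a1 x * riesz_op f1 x) - E M (fun x => E M (fun y => a1 x * (riesz_reg eps (dot x y) * f1 y)))|
    <= c2 * (c1 * ((p + 2) * eps `^ gap_exp * gap_mean)).
  move=> mf1 ma1 fc1 ac2 e0.
  have [D D0 HD] := riesz_reg_bounded e0.
  have mreg : mes2 M (fun x y => riesz_reg eps (dot x y) * f1 y).
    apply: mes2M; last exact: mes2_r.
    have m1 : measurable_fun setT (fun t : R => 2 - 2 * t).
      by apply: measurable_funB; [exact: measurable_cst|apply: measurable_funM => //; exact: measurable_cst].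
    have mr : measurable_fun setT (riesz_reg eps).
      apply: measurable_funM => //; apply: (measurableT_comp (measurable_powR _)).
      by apply: measurable_funD => //; exact: measurable_cst.
    by apply: (measurableT_comp mr); exact: mes2_dot.
  have [mE _] := @E_fubini R n M (fun x y => riesz_reg eps (dot x y) * f1 y) (D * c1) mreg
    (fun x y x1 y1 => eq_ind_r (fun t => t <= D * c1) (ler_pM (normr_ge0 _) (normr_ge0 _) (HD x y x1 y1) (fc1 y y1)) (normrM _ _)).
  have co := sph_continuous_riesz_op mf1 fc1.
  have [Bo Bo0 HBo] := sph_continuous_bounded co.
  have i1 : itg M (fun x => a1 x * riesz_op f1 x).
    by apply: (itgM (itg_bounded ma1 ac2) (@mes_cont R n M _ co) HBo).
  have iE : itg M (fun x => E M (fun y => riesz_reg eps (dot x y) * f1 y)).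
    apply: (itg_bounded (c := Bo + c1 * ((p + 2) * eps `^ gap_exp * gap_mean)) mE) => x x1.
    have := riesz_op_gap mf1 fc1 x1 e0; have := HBo x x1.
    rewrite !ler_norml => /andP[? ?] /andP[? ?]; apply/andP; split; lra.
  have i2 : itg M (fun x => a1 x * E M (fun y => riesz_reg eps (dot x y) * f1 y)).
    apply: (itg_le (G := fun x => `|E M (fun y => riesz_reg eps (dot x y) * f1 y) * a1 x|)).
    - exact: mesM.
    - by apply: itg_norm; exact: (itgM (c := c2)).
    - by move=> x _; rewrite mulrC.
  rewrite (@E_eq R n M (fun x => E M (fun y => a1 x * (riesz_reg eps (dot x y) * f1 y)))
    (fun x => a1 x * E M (fun y => riesz_reg eps (dot x y) * f1 y))); last first.
    by move=> x x1; rewrite EZ //; exact: (itg_riesz_reg mf1 fc1).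
  rewrite -EB // -[leRHS](E_cst M); apply: E_abs_le; [exact: itgB|exact: itg_cst|].
  move=> x x1; rewrite -mulrBr normrM ler_pM ?ac2 //.
  exact: riesz_op_gap.
apply/eqP; rewrite -subr_eq0 -normr_le0; apply/ler_addgt0Pr => e e0; rewrite add0r.
have e20 : 0 < e / 2 by rewrite divr_gt0.
have [eps eps0 He] := powR_small (c' * c * (p + 2) * gap_mean) e20 g0.
have K1 := key f a c c' eps mf ma fc ac eps0; have K2 := key a f c' c eps ma mf ac fc eps0.
have [D D0 HD] := riesz_reg_bounded eps0.
have EqK : E M (fun x => E M (fun y => a x * (riesz_reg eps (dot x y) * f y))) =
   E M (fun x => E M (fun y => f x * (riesz_reg eps (dot x y) * a y))).
  have mK : mes2 M (fun x y => a x * (riesz_reg eps (dot x y) * f y)).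
    apply: mes2M; first exact: mes2_l.
    apply: mes2M; last exact: mes2_r.
    have m1 : measurable_fun setT (fun t : R => 2 - 2 * t).
      by apply: measurable_funB; [exact: measurable_cst|apply: measurable_funM => //; exact: measurable_cst].
    have mr : measurable_fun setT (riesz_reg eps).
      apply: measurable_funM => //; apply: (measurableT_comp (measurable_powR _)).
      by apply: measurable_funD => //; exact: measurable_cst.
    by apply: (measurableT_comp mr); exact: mes2_dot.
  have bK x y : dot x x = 1 -> dot y y = 1 -> `|a x * (riesz_reg eps (dot x y) * f y)| <= c' * (D * c).
    by move=> x1 y1; rewrite normrM ler_pM ?ac // normrM ler_pM ?HD ?fc.
  rewrite (E_fubini mK bK).2; apply: E_eq => x x1; apply: E_eq => y y1.
  by rewrite (dotC y x); ring.
rewrite EqK in K1.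
have h1 : c' * (c * ((p + 2) * eps `^ gap_exp * gap_mean)) <= e / 2.
  by apply: le_trans He; rewrite le_eqVlt; apply/orP; left; apply/eqP; ring.
have h2 : c * (c' * ((p + 2) * eps `^ gap_exp * gap_mean)) <= e / 2.
  by apply: le_trans He; rewrite le_eqVlt; apply/orP; left; apply/eqP; ring.
move: K1 K2; rewrite !ler_norml => /andP[? ?] /andP[? ?]; apply/andP; split; lra.
Qed.

Lemma E_geg_poisson k (r : R) (y z : vec) : dot y y = 1 -> dot z z = 1 -> 0 <= r < 1 ->
  E M (fun x => (C k).[dot y x] * poisson nu r (dot z x)) = r ^+ k * (C k).[dot y z].
Proof.
move=> y1 z1 r01; have [c Cc] := geg_bounded n nu1 k.
have S1 := @zonal_series_exchange R n M nu nu1 (fun k => (k%:R + nu) / nu) (poisson nu r) 1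
  r z (fun x => (C k).[dot y x]) c z1 r01 (poisson_coef_le nu1)
  (fun t t1 => poisson_series nu1 t1 r01) (@mes_geg R n M nu k y) (fun x x1 => Cc y x y1 x1).
have S2 : series (fun i => (i%:R + nu) / nu * r ^+ i * E M (fun x => (C k).[dot y x] * (C i).[dot z x])) @ \oo -->
   (k%:R + nu) / nu * r ^+ k * E M (fun x => (C k).[dot y x] * (C k).[dot z x]).
  apply: (@series_single R (fun i => (i%:R + nu) / nu * r ^+ i * E M (fun x => (C k).[dot y x] * (C i).[dot z x]))) => i ik.
  by rewrite (E_geg_orth M hn nu1) ?mulr0 // eq_sym.
have := cvg_unique _ S1 S2 => /(_ (@Rhausdorff R)) ->.
by rewrite -(E_geg_geg M hn nu1 k z1 y1); ring.
Qed.

Lemma hl_weight_integrable k : leb.-integrable hl (EFin \o (fun u => riesz_weight nu s u * ((1 + u)^-1) ^+ k)) /\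
  Rintegral leb hl (fun u => riesz_weight nu s u * ((1 + u)^-1) ^+ k) =
  Gamma (2 * s) * (Gamma (k%:R + p) / Gamma (k%:R + beta)).
Proof.
have H := riesz_weight_integral s0 sn k.
have w0 (u : R) : hl u -> 0 <= riesz_weight nu s u * ((1 + u)^-1) ^+ k.
  by move=> /hlP u0; apply: mulr_ge0; [exact: riesz_weight_ge0|apply: exprn_ge0; rewrite invr_ge0 addr_ge0 // ltW].
split; last by rewrite /Rintegral H /= !addrA.
apply/integrableP; split.
  apply/measurable_EFinP; apply: measurable_funM; first exact: riesz_weight_measurable.
  apply: hl_continuous_measurable => t t0.
  apply: (@continuous_comp R R R (fun t => (1 + t)^-1) (fun t => t ^+ k) t); last exact: exprn_continuous.
  have t1 : 1 + t != 0 by rewrite lt0r_neq0 // ltr_pwDl // ltW.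
  apply: (continuousV (s := fun t : R => 1 + t) t1).
  by apply: (@continuousD R R R (fun _ => 1) id t); [exact: cst_continuous|exact: cvg_id].
rewrite (_ : (\int[leb]_(x in hl) _)%E = (\int[leb]_(u in hl) (riesz_weight nu s u * ((1 + u)^-1) ^+ k)%:E)%E).
  by rewrite H ltry.
by apply: eq_integral => u /set_mem hu; rewrite /= ger0_norm // w0.
Qed.

(** By subordination the eigenvalue is the integral of [riesz_weight] against (1+u)^(-k), the action
    of the Poisson kernel of radius 1/(1+u) in degree k. *)
Lemma riesz_op_geg k (y z : vec) : dot y y = 1 -> dot z z = 1 ->
  riesz_op (fun x => (C k).[dot y x]) z =
  Gamma (2 * s) / riesz_const nu s * (Gamma (k%:R + p) / Gamma (k%:R + beta)) * (C k).[dot y z].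
Proof.
move=> y1 z1; have [c Cc] := geg_bounded n nu1 k.
have B0 := riesz_const_gt0 s0 sn.
(* Adding the bound c makes the function nonnegative, as [E_riesz_ge0] requires; the constant is
   subtracted again at the end. *)
pose f x := (C k).[dot y x] + c.
have mC : mes M (fun x => (C k).[dot y x]) := @mes_geg R n M nu k y.
have mf : mes M f by apply: mesD => //; exact: mes_cst.
have fc x : dot x x = 1 -> 0 <= f x <= c + c.
  by move=> x1; have := Cc y x y1 x1; rewrite ler_norml /f => /andP[? ?]; apply/andP; split; lra.
have fc' x : dot x x = 1 -> `|f x| <= c + c.
  by move=> x1; have /andP[f0 f1] := fc x x1; rewrite ger0_norm.
have H := E_riesz_ge0 hn nu1 s0 sn z1 mf fc.
have iGf := itg_riesz_op mf fc' z1.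
have LHS : (\int[up_prob M]_w ((riesz_const nu s)%:E * (G (dot z (up_fun w)) * f (up_fun w))%:E) =
    (riesz_const nu s * riesz_op f z)%:E)%E.
  rewrite -(EZ _ iGf) /E /Rintegral fineK; first by apply: eq_integral => w _; rewrite EFinM.
  by apply: (integrable_fin_num measurableT); exact: (itgZ _ iGf).
have [ik Ik] := hl_weight_integrable k; have [i0 I0] := hl_weight_integrable 0.
have {}H : riesz_const nu s * riesz_op f z = Rintegral leb hl (fun u => (C k).[dot y z] * (riesz_weight nu s u * ((1 + u)^-1) ^+ k) + c * (riesz_weight nu s u * ((1 + u)^-1) ^+ 0)).
  have := congr1 fine (etrans (esym LHS) H) => /= ->.
  apply: eq_Rintegral => u /[!mem_hl] u0; have r01 := hl_radius u0.
  transitivity (riesz_weight nu s u * ((1 + u)^-1 ^+ k * (C k).[dot y z] + c)); last by rewrite expr0; ring.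
  congr (_ * _); rewrite -(E_geg_poisson k y1 z1 r01).
  have ip := itg_poisson M nu1 z1 r01.
  have iCp : itg M (fun x => (C k).[dot y x] * poisson nu (1 + u)^-1 (dot z x)).
    apply: (itg_le (G := fun x => c * poisson nu (1 + u)^-1 (dot z x))).
    - by apply: mesM => //; exact: mes_poisson.
    - exact: itgZ.
    - by move=> x x1; rewrite normrM (ger0_norm (poisson_ge0 _ _ r01)) ler_wpM2r ?poisson_ge0 ?Cc.
  have EDp := @ED R n M _ _ iCp (itgZ c ip).
  rewrite (EZ _ ip) (E_poisson M hn nu1 z1 r01) mulr1 in EDp; rewrite -EDp.
  by apply: E_eq => x _; rewrite /f; ring.
have jZ (a : R) (h : R -> R) : leb.-integrable hl (EFin \o h) -> leb.-integrable hl (EFin \o (fun u => a * h u)).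
  move=> ih; rewrite (_ : EFin \o (fun u => a * h u) = (fun u => a%:E * (EFin \o h) u)%E) //.
  by apply: integrableZl => //; exact: measurable_hl.
have j1 := jZ (C k).[dot y z] _ ik.
have j2 := jZ c _ i0.
have E1 : Rintegral leb hl (fun u => (C k).[dot y z] * (riesz_weight nu s u * ((1 + u)^-1) ^+ k)) =
  (C k).[dot y z] * Rintegral leb hl (fun u => riesz_weight nu s u * ((1 + u)^-1) ^+ k).
  by apply: RintegralZl; [exact: (@measurable_hl R)|exact: ik].
have E2 : Rintegral leb hl (fun u => c * (riesz_weight nu s u * ((1 + u)^-1) ^+ 0)) =
  c * Rintegral leb hl (fun u => riesz_weight nu s u * ((1 + u)^-1) ^+ 0).
  by apply: RintegralZl; [exact: (@measurable_hl R)|exact: i0].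
rewrite RintegralD ?E1 ?E2 in H; [|exact: measurable_hl|exact: j1|exact: j2].
rewrite Ik I0 in H.
have iC : itg M (fun x => G (dot z x) * (C k).[dot y x]) by apply: (itg_riesz_op mC (fun x x1 => Cc y x y1 x1) z1).
have [iG EG] := itg_riesz M hn nu1 s0 sn z1.
have Af : riesz_op f z = riesz_op (fun x => (C k).[dot y x]) z + c * riesz_mean nu s.
  have EDx := @ED R n M _ _ iC (itgZ c iG).
  rewrite -EG -(EZ c iG) -[riesz_op (fun x => (C k).[dot y x]) z]/(E M (fun x => G (dot z x) * (C k).[dot y x])) -EDx.
  transitivity (E M (fun x => G (dot z x) * f x)); first by [].
  by apply: E_eq => x _; rewrite /f; ring.
rewrite Af /riesz_mean mulr0n !add0r in H.
move: (riesz_op (fun x => (C k).[dot y x]) z) (riesz_const nu s) B0 H => a B B0 H.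
have Bn := lt0r_neq0 B0; apply: (mulfI Bn).
set q0 := Gamma (2 * s) * (Gamma p / Gamma beta) in H.
have {}H : B * a + c * q0 = (C k).[dot y z] * (Gamma (2 * s) * (Gamma (k%:R + p) / Gamma (k%:R + beta))) + c * q0.
  by rewrite -H; field.
by rewrite (addIr _ H); field; rewrite Bn /= lt0r_neq0 // Gamma_gt0 // ltr_wpDl //; move: s0 nu1; lra.
Qed.

(** Equal zonal coefficients give equal Poisson averages at every radius, hence equal values in the
    limit. *)
Lemma zonal_determines (u v : vec -> R) : sph_continuous u -> sph_continuous v ->
  (forall k z, dot z z = 1 -> E M (fun x => u x * (C k).[dot z x]) = E M (fun x => v x * (C k).[dot z x])) ->
  forall z, dot z z = 1 -> u z = v z.
Proof.
move=> cu cv uv z z1.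
have [B _ uB] := sph_continuous_bounded cu; have [D _ vD] := sph_continuous_bounded cv.
have L1 := poisson_approx M hn nu1 cu z1; have L2 := poisson_approx M hn nu1 cv z1.
suff H j : E M (fun x => u x * poisson nu (rad R j) (dot z x)) = E M (fun x => v x * poisson nu (rad R j) (dot z x)).
  by move: L1; under eq_fun do rewrite H; move=> L1; exact: (cvg_unique (@Rhausdorff R) L1 L2).
have S f c (mf : mes M f) (fc : forall x, dot x x = 1 -> `|f x| <= c) :=
  @zonal_series_exchange R n M nu nu1 (fun k => (k%:R + nu) / nu) (poisson nu (rad R j)) 1
    (rad R j) z f c z1 (rad_ge0_lt1 R j) (poisson_coef_le nu1)
    (fun t t1 => poisson_series nu1 t1 (rad_ge0_lt1 R j)) mf fc.
have S1 := S u B (@mes_cont R n M u cu) uB; have S2 := S v D (@mes_cont R n M v cv) vD.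
move: S1; have -> : (fun k => (k%:R + nu) / nu * rad R j ^+ k * E M (fun x => u x * (C k).[dot z x])) =
  (fun k => (k%:R + nu) / nu * rad R j ^+ k * E M (fun x => v x * (C k).[dot z x])).
  by apply/funext => k; rewrite uv.
by move=> S1; exact: (cvg_unique (@Rhausdorff R) S1 S2).
Qed.

End RieszOperator.

(** * The integral equation and its conformal covariance *)

Section GreenRepresentation.
Variables (R : realType) (n : nat) (M : uniform_point R n) (nu s : R).
Hypotheses (hn : n%:R = 2 * nu + 1) (nu1 : 1 <= nu) (s0 : 0 < s) (sn : 2 * s < 2 * nu + 1).
Local Notation vec := 'rV[R]_n.+1.
Local Notation p := (nu + 2^-1 - s).
Local Notation beta := (nu + 2^-1 + s).
Local Notation G := (riesz nu s).
Local Notation C := (geg nu).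

Let p0 : 0 < p. Proof. by move: sn; lra. Qed.

(** Normalization for which the eigenvalue from [riesz_op_geg] becomes Gamma(k+p)/Gamma(k+beta), the
    reciprocal of the multiplier of P_s. *)
Definition green_const : R := riesz_const nu s / Gamma (2 * s).

Lemma green_const_gt0 : 0 < green_const.
Proof. by apply: divr_gt0; [exact: riesz_const_gt0|apply: Gamma_gt0; move: s0; lra]. Qed.

Lemma Ps_mult_geg k : Ps_mult n s (k%:R * (k%:R + 2 * nu)) = Gamma (k%:R + beta) / Gamma (k%:R + p).
Proof.
rewrite /Ps_mult hn.
have -> : k%:R * (k%:R + 2 * nu) + ((2 * nu + 1 - 1) / 2) ^+ 2 = (k%:R + nu) ^+ 2 by field.
rewrite sqrtr_sqr ger0_norm ?addr_ge0 //; last by apply: le_trans nu1.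
by congr (Gamma _ / Gamma _); ring.
Qed.

(** Both sides are continuous, so their zonal coefficients suffice. In degree k the symmetry of the
    operator moves it onto C_k, where its eigenvalue cancels the multiplier of P_s in the weak
    equation. *)
Lemma green_representation (f : R -> R) (u : vec -> R) :
  sph_continuous u -> sph_continuous (fun x => f (u x)) -> is_solution n s f u ->
  forall z, dot z z = 1 ->
    u z = green_const * riesz_op M nu s (fun x => dns n s * u x + f (u x)) z.
Proof.
move=> cu cfu sol; set g := fun x => _.
have cg : sph_continuous g.
  by apply: sph_continuousD => //; apply: sph_continuousM => //; exact: sph_continuous_cst.
have [c c0 gc] := sph_continuous_bounded cg; have mg := @mes_cont R n M g cg.
have cA := sph_continuous_riesz_op hn nu1 s0 sn mg gc.
have cgA : sph_continuous (fun z => green_const * riesz_op M nu s g z).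
  by apply: sph_continuousM => //; exact: sph_continuous_cst.
apply: (zonal_determines (M := M) hn nu1 cu cgA) => k z z1; have [d Cd] := geg_bounded n nu1 k.
have cC : sph_continuous (fun x => (C k).[dot z x]).
  by apply: sph_continuous_app; [exact: sph_continuous_dot|move=> x _; exact: continuous_horner].
have mC := @mes_cont R n M _ cC.
have H := sol _ _ (geg_sph_eigen k hn z1).
rewrite Ps_mult_geg in H.
rewrite !(up_int M) in H; [|exact: sph_continuousM|exact: sph_continuousM].
have k0 : 0 <= k%:R :> R by rewrite ler0n.
have g1 : 0 < Gamma (k%:R + beta) by apply: Gamma_gt0; move: s0 nu1 k0; lra.
have g2 : 0 < Gamma (k%:R + p) by apply: Gamma_gt0; move: p0 k0; lra.
have g3 : 0 < Gamma (2 * s) by apply: Gamma_gt0; move: s0; lra.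
have B0 := riesz_const_gt0 s0 sn.
have iAC : itg M (fun x => (C k).[dot z x] * riesz_op M nu s g x).
  by apply: itg_cont; exact: sph_continuousM.
transitivity (green_const * E M (fun x => (C k).[dot z x] * riesz_op M nu s g x)); last first.
  by rewrite -(EZ _ iAC); apply: E_eq => x _; ring.
rewrite (riesz_op_sym hn nu1 s0 sn mg mC gc (fun x x1 => Cd z x z1 x1)).
have igC : itg M (fun x => g x * (C k).[dot z x]) by apply: itg_cont; exact: sph_continuousM.
set K := Gamma (2 * s) / riesz_const nu s * (Gamma (k%:R + p) / Gamma (k%:R + beta)).
have -> : E M (fun x => g x * riesz_op M nu s (fun y => (C k).[dot z y]) x) = K * E M (fun x => g x * (C k).[dot z x]).
  by rewrite -(EZ _ igC); apply: E_eq => x x1; rewrite (riesz_op_geg M hn nu1 s0 sn) // /K; ring.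
have {}H : Gamma (k%:R + beta) / Gamma (k%:R + p) * E M (fun x => u x * (C k).[dot z x]) = E M (fun x => g x * (C k).[dot z x]) := H.
rewrite -H /K /green_const.
move: (E M _) (Gamma _) (Gamma _) (Gamma _) (riesz_const nu s) g1 g2 g3 B0 => *.
by field; rewrite !lt0r_neq0.
Qed.

Variables (e : vec) (l : R).
Hypotheses (e1 : dot e e = 1) (l01 : 0 <= l < 1).
Local Notation rho := (inv_rho e l).
Local Notation Phi := (inversion e l).
Local Notation hh := (height e l).

Lemma riesz_inversion (z y : vec) : dot z z = 1 -> dot y y = 1 ->
  G (dot (Phi z) (Phi y)) = (rho z * rho y) `^ (- p) * G (dot z y).
Proof.
move=> z1 y1; rewrite /riesz dot_inversion2 // powRM //.
  by rewrite mulr_ge0 // ltW // inv_rho_gt0.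
by have /andP[_] := dot_le z1 y1; lra.
Qed.

(** Since Phi is an involution, the kernel at (z, Phi y) is a bounded continuous factor times the
    kernel at (Phi z, y). *)
Lemma itg_riesz_inversion (z : vec) (f : vec -> R) (c : R) : dot z z = 1 -> mes M f ->
  (forall x, dot x x = 1 -> `|f x| <= c) ->
  itg M (fun y => G (dot z (Phi y)) * f y).
Proof.
move=> z1 mf fc.
have z1' := inversion_unit e1 l01 z1.
have HG x : dot x x = 1 -> G (dot z (Phi x)) = (rho (Phi z) * rho x) `^ (- p) * G (dot (Phi z) x).
  by move=> x1; rewrite -riesz_inversion // inversionK.
have crho : sph_continuous (fun y => (rho (Phi z) * rho y) `^ (- p)).
  apply: sph_continuous_powR; first by apply: sph_continuousM; [exact: sph_continuous_cst|exact: sph_continuous_inv_rho].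
  by move=> y y1; rewrite mulr_gt0 // inv_rho_gt0.
have [D D0 HD] := sph_continuous_bounded crho.
have mrho := @mes_cont R n M _ crho.
have H := itg_rieszM hn nu1 s0 sn z1' (mesM mrho mf) (fun x x1 => eq_ind_r (fun t => t <= D * c) (ler_pM (normr_ge0 _) (normr_ge0 _) (HD x x1) (fc x x1)) (normrM _ _)).
have mG : mes M (fun y => G (dot z (Phi y)) * f y).
  apply: (@mes_eq R n M (fun x => G (dot (Phi z) x) * ((rho (Phi z) * rho x) `^ (- p) * f x))).
    by move=> x x1; rewrite HG //; ring.
  exact: (itg_mes H).
apply: (itg_le mG (itg_norm H)) => x x1.
by rewrite HG // [X in X * f x]mulrC -mulrA.
Qed.

(** [E_inversion] covers continuous integrands; the singular kernel is reached through its
    regularizations by dominated convergence on both sides. *)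
Lemma E_riesz_inversion (z : vec) (f_ : nat -> vec -> R) (f : vec -> R) (c : R) : dot z z = 1 ->
  (forall k, sph_continuous (f_ k)) -> (forall k x, dot x x = 1 -> `|f_ k x| <= c) ->
  (forall x, dot x x = 1 -> f_ k x @[k --> \oo] --> f x) ->
  E M (fun y => G (dot z (Phi y)) * (f (Phi y) * rho y `^ (2 * nu + 1))) = E M (fun y => G (dot z y) * f y).
Proof.
move=> z1 cf fc ff.
pose Kr (k : nat) t := riesz_reg nu s k.+1%:R^-1 t.
have k0 k : 0 < k.+1%:R^-1 :> R by rewrite invr_gt0.
have Kc k (y : vec) : sph_continuous (fun x => Kr k (dot y (normalize x)) : R) -> True by [].
have cK k (y : vec) : dot y y = 1 -> sph_continuous (fun x => Kr k (dot y x)).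
  move=> y1; have c2 : sph_continuous (fun x => 2 - 2 * dot y x).
    by apply: sph_continuousB; [exact: sph_continuous_cst|apply: sph_continuousM; [exact: sph_continuous_cst|exact: sph_continuous_dot]].
  apply: sph_continuousM => //; apply: sph_continuous_powR.
    by apply: sph_continuousD => //; exact: sph_continuous_cst.
  by move=> x x1; have /andP[_ h] := dot_le y1 x1; rewrite ltr_wpDl //; lra.
have Kl (t : R) : -1 <= t <= 1 -> Kr k t @[k --> \oo] --> G t.
  move=> t1; have [/andP[g0 g1] _] := gap_exp_bounds s0.
  pose B := (p + 2) * riesz nu (s - gap_exp s) t.
  apply/cvgrPdist_le => e' e'0; have [eps eps0 He] := powR_small B e'0 g0.
  have := @cvg_harmonic R => /cvgrPdist_lt /(_ _ eps0); apply: filterS => k.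
  rewrite sub0r normrN ger0_norm ?harmonic_ge0 // => ke.
  have [h1 /andP[h2 h3]] := riesz_reg_gap s0 sn t1 (k0 k).
  rewrite ger0_norm //; apply: le_trans h3 _; apply: le_trans He.
  rewrite /B -!mulrA ler_wpM2l //; first by move: p0; lra.
  rewrite mulrC ler_wpM2l ?riesz_ge0 //.
  by apply: ge0_ler_powR; rewrite ?nnegrE ?(ltW g0) ?(ltW (k0 k)) ?(ltW eps0) ?(ltW ke).
have Kle k (t : R) : -1 <= t <= 1 -> `|Kr k t| <= G t.
  move=> t1; have [h1 /andP[h2 h3]] := riesz_reg_gap s0 sn t1 (k0 k).
  by rewrite ger0_norm // -subr_ge0.
have c0 : 0 <= c by apply: le_trans (normr_ge0 _) (fc 0%N _ z1).
have crho : sph_continuous (fun x => rho x `^ (2 * nu + 1)) by exact: sph_continuous_rhoX.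
have [D D0 HD] := sph_continuous_bounded crho.
have P1 y (y1 : dot y y = 1) := inversion_unit e1 l01 y1.
have [||||_ L1] := @E_dct R n M (fun k y => Kr k (dot z y) * f_ k y) (fun y => G (dot z y) * f y) (fun y => c * G (dot z y)).
- by move=> k; apply: mes_cont; apply: sph_continuousM => //; exact: cK.
- by move=> x x1; apply: cvgM; [apply: Kl; exact: dot_le|exact: ff].
- by apply: itgZ; exact: (itg_riesz M hn nu1 s0 sn z1).1.
- by move=> k x x1; rewrite normrM mulrC ler_pM ?fc // Kle // dot_le.
have iD : itg M (fun y => G (dot z (Phi y)) * (c * D)).
  by apply: (itg_riesz_inversion (c := `|c * D|) z1); [exact: mes_cst|move=> x x1].
have [||||_ L2] := @E_dct R n M (fun k y => Kr k (dot z (Phi y)) * f_ k (Phi y) * rho y `^ (2 * nu + 1))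
   (fun y => G (dot z (Phi y)) * (f (Phi y) * rho y `^ (2 * nu + 1))) (fun y => G (dot z (Phi y)) * (c * D)).
- move=> k; apply: mes_cont; apply: sph_continuousM => //.
  by apply: (sph_continuous_inversion e1 l01 (F := fun y => Kr k (dot z y) * f_ k y)); apply: sph_continuousM => //; exact: cK.
- move=> x x1; rewrite mulrA; apply: cvgM; last exact: cvg_cst.
  by apply: cvgM; [apply: Kl; apply: dot_le => //; exact: P1|apply: ff; exact: P1].
- exact: iD.
- move=> k x x1; rewrite -mulrA normrM ler_pM ?Kle // ?dot_le ?P1 //.
  by rewrite normrM ler_pM ?fc ?P1 ?HD.
have LE : (fun k => E M (fun y => Kr k (dot z (Phi y)) * f_ k (Phi y) * rho y `^ (2 * nu + 1))) = (fun k => E M (fun y => Kr k (dot z y) * f_ k y)).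
  apply/funext => k; apply: (E_inversion M hn nu1 e1 l01 (F := fun y => Kr k (dot z y) * f_ k y)).
  by apply: sph_continuousM => //; exact: cK.
rewrite LE in L2.
exact: (cvg_unique (@Rhausdorff R) L2 L1).
Qed.

(** Under Phi the kernel gains (rho(z) rho(y))^(-p) and the measure rho(y)^n, and n - p = beta. So
    the operator intertwines the weights beta and p. *)
Lemma riesz_op_inversion (f : vec -> R) (z : vec) : dot z z = 1 -> sph_continuous f ->
  riesz_op M nu s (fun y => rho y `^ beta * f (Phi y)) z = rho z `^ p * riesz_op M nu s f (Phi z).
Proof.
move=> z1 cf; have [c c0 fc] := sph_continuous_bounded cf.
have z1' := inversion_unit e1 l01 z1.
rewrite /riesz_op -(E_riesz_inversion z1' (f_ := fun _ => f) (fun _ => cf) (fun _ => fc) (fun x _ => cvg_cst _)).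
have i1 : itg M (fun y => G (dot (Phi z) (Phi y)) * (f (Phi y) * rho y `^ (2 * nu + 1))).
  have cfr : sph_continuous (fun y => f (Phi y) * rho y `^ (2 * nu + 1)).
    by apply: sph_continuousM; [exact: sph_continuous_inversion|exact: sph_continuous_rhoX].
  have [D D0 HD] := sph_continuous_bounded cfr.
  exact: (itg_riesz_inversion z1' (@mes_cont R n M _ cfr) HD).
rewrite -(EZ _ i1); apply: E_eq => y y1; rewrite riesz_inversion //.
have rz := inv_rho_gt0 e1 l01 z1; have ry := inv_rho_gt0 e1 l01 y1.
have -> : rho y `^ (2 * nu + 1) = rho y `^ beta * rho y `^ p.
  by rewrite -powRD ?(lt0r_neq0 ry) ?implybT //; congr (_ `^ _); field.
rewrite powRM ?(ltW rz) ?(ltW ry) // !powRN.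
by field; rewrite !lt0r_neq0 ?powR_gt0.
Qed.

End GreenRepresentation.

(** * Folding the Riesz potential onto a cap *)

Section Kernels.
Variables (R : realType) (n : nat) (M : uniform_point R n) (nu s : R).
Hypotheses (hn : n%:R = 2 * nu + 1) (nu1 : 1 <= nu) (s0 : 0 < s) (sn : 2 * s < 2 * nu + 1).
Local Notation vec := 'rV[R]_n.+1.
Local Notation p := (nu + 2^-1 - s).
Local Notation beta := (nu + 2^-1 + s).
Local Notation G := (riesz nu s).
Local Notation A := (riesz_op M nu s).

Let p0 : 0 < p. Proof. by move: sn; lra. Qed.

(** The value at the pole is arbitrary; it is absorbed by a multiple of the indicator of a null
    set. *)
Lemma E_le_off (z : vec) (F H : vec -> R) : dot z z = 1 -> itg M F -> itg M H ->
  (forall x, dot x x = 1 -> dot z x != 1 -> F x <= H x) -> E M F <= E M H.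
Proof.
move=> z1 iF iH FH; pose c := `|F z - H z|.
have mi : mes M (fun x => (dot z x == 1)%:R : R).
  apply: (@mes_zonal R n M (fun t : R => (t == 1)%:R)).
  rewrite (_ : (fun t : R => (t == 1)%:R : R) = \1_[set 1]); first exact: measurable_indic.
  by apply/funext => t; rewrite indicE; congr ((nat_of_bool _)%:R); apply/eqP/idP => [->|/set_mem //]; exact/mem_set.
have ii : itg M (fun x => (dot z x == 1)%:R).
  by apply: (itg_bounded (c := 1) mi) => x _; case: eqP; rewrite ?normr1 ?normr0.
have -> : E M H = E M (fun x => H x + c * (dot z x == 1)%:R).
  by rewrite (ED iH (itgZ c ii)) (EZ c ii) (point_null M hn nu1 z1) mulr0 addr0.
apply: (E_le iF (itgD iH (itgZ c ii))) => x x1; have [zx|zx] := eqVneq (dot z x) 1.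
  rewrite -(dot_eq1 z1 x1 zx) /= mulr1n mulr1 -lerBlDl; exact: ler_norm.
by rewrite mulr0 addr0 FH.
Qed.

Lemma sph_continuous_cut (a b : vec -> R) : sph_continuous a -> sph_continuous b ->
  (forall x, dot x x = 1 -> b x = 0 -> a x = 0) ->
  sph_continuous (fun x => a x * (0 < b x)%R%:R).
Proof.
move=> ca cb ab x x0; have FF : Filter (nbhs x) := nbhs_filter x.
have x1 := dot_normalize_self x0.
apply/cvgrPdist_lt => e e0.
have /cvgrPdist_lt ha := ca x x0; have /cvgrPdist_lt hb := cb x x0.
have [b0|b0|b0] := ltrgt0P (b (normalize x)).
- have h1 := hb _ b0; have h2 := ha _ e0.
  apply: (@filterS2 _ (nbhs x) FF _ _ _ _ h1 h2) => y y1 y2.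
  have -> : 0 < b (normalize y).
    by move: y1; have := ler_norm (b (normalize x) - b (normalize y)); lra.
  by rewrite !mulr1.
- have nb0 : 0 < - b (normalize x) by rewrite oppr_gt0.
  have h1 := hb _ nb0.
  apply: (@filterS _ (nbhs x) FF _ _ _ h1) => y y1.
  have /negbTE -> : ~~ (0 < b (normalize y)).
    by rewrite -leNgt; move: y1; rewrite distrC; have := ler_norm (b (normalize y) - b (normalize x)); lra.
  by rewrite !mulr0 subrr normr0.
- have a0 := ab _ x1 b0; have h2 := ha _ e0.
  apply: (@filterS _ (nbhs x) FF _ _ _ h2) => y; rewrite a0 mul0r !sub0r !normrN => y1.
  by case: (0 < _); rewrite ?mulr1 // mulr0 normr0.
Qed.

Lemma itg_riesz_opA (f : vec -> R) (z : vec) : dot z z = 1 -> sph_continuous f -> itg M (fun x => G (dot z x) * f x).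
Proof.
move=> z1 cf; have [c c0 fc] := sph_continuous_bounded cf.
exact: (itg_riesz_op hn nu1 s0 sn (@mes_cont R n M f cf) fc z1).
Qed.

Lemma riesz_opN (f : vec -> R) (z : vec) : dot z z = 1 -> sph_continuous f -> A (fun x => - f x) z = - A f z.
Proof.
move=> z1 cf; rewrite /riesz_op -mulN1r -(EZ _ (itg_riesz_opA z1 cf)).
by apply: E_eq => x _; ring.
Qed.

Lemma riesz_opB (f g : vec -> R) (z : vec) : dot z z = 1 -> sph_continuous f -> sph_continuous g ->
  A (fun x => f x - g x) z = A f z - A g z.
Proof.
move=> z1 cf cg; rewrite /riesz_op -(EB (itg_riesz_opA z1 cf) (itg_riesz_opA z1 cg)).
by apply: E_eq => x _; ring.
Qed.

Section Fold.
Variables (e : vec) (l : R).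
Hypotheses (e1 : dot e e = 1) (l01 : 0 <= l < 1).
Local Notation rho := (inv_rho e l).
Local Notation Phi := (inversion e l).
Local Notation hh := (height e l).

Definition antisym (r : R) (f : vec -> R) : Prop :=
  forall x, dot x x = 1 -> rho x `^ r * f (Phi x) = - f x.

Lemma antisym_eq0 r f : antisym r f -> forall x, dot x x = 1 -> hh x = 0 -> f x = 0.
Proof.
move=> fa x x1 h; have [E1 E2] := inversion_fix e1 l01 x1 h.
by have := fa x x1; rewrite E1 E2 powR1 mul1r => H; lra.
Qed.

(** Kernel on the cap obtained by combining y with its image Phi y for antisymmetric densities; the
    analogue of a half-space Green function. *)
Definition fold_kernel (x y : vec) : R := G (dot x y) - rho y `^ p * G (dot x (Phi y)).
Definition gapb (x y : vec) : R := 4 * hh x * hh y / (1 - l ^+ 2).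

Lemma fold_kernelE (x y : vec) : dot x x = 1 -> dot y y = 1 -> 0 < hh x -> 0 < hh y ->
  fold_kernel x y = G (dot x y) - (2 - 2 * dot x y + gapb x y) `^ (- p).
Proof.
move=> x1 y1 hx hy; rewrite /fold_kernel; congr (_ - _).
have r0 := inv_rho_gt0 e1 l01 y1; have L0 := one_sub_sqr_gt0 l01.
rewrite /riesz (dot_inversion e1 l01 x1 y1) powRM ?(ltW r0) //; last first.
  by have /andP[_ ?] := dot_le x1 y1; rewrite addr_ge0 //; [lra|rewrite divr_ge0 ?(ltW L0) // !mulr_ge0 // ltW].
by rewrite mulrA -powRD ?(lt0r_neq0 r0) ?implybT // subrr powRr0 mul1r.
Qed.

Lemma gapb_bounds (x y : vec) : dot x x = 1 -> dot y y = 1 -> 0 < hh x -> 0 < hh y ->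
  0 < gapb x y <= 4 * hh y.
Proof.
move=> x1 y1 hx hy; have L0 := one_sub_sqr_gt0 l01; have /andP[l0 l1] := l01.
rewrite /gapb divr_gt0 ?mulr_gt0 //= ler_pdivrMr //.
have hx1 : hh x <= 1 - l by rewrite /height lerD2r; have /andP[] := dot_le e1 x1.
have : hh x <= 1 - l ^+ 2 by apply: le_trans hx1 _; rewrite expr2; nra.
move: (hh x) (hh y) (1 - l ^+ 2) hx hy => a b c a0 b0 ac; nra.
Qed.

(** By [fold_kernelE] it is a^(-p) - (a+b)^(-p) with a = |x - y|^2 and 0 < b <= 4 h(y), h being the
    height. Monotonicity gives positivity, and [pow_gap_kernel] gives smallness in thin caps. *)
Lemma fold_kernel_bounds (x y : vec) : dot x x = 1 -> dot y y = 1 -> 0 < hh x -> 0 < hh y -> dot x y != 1 ->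
  0 < fold_kernel x y /\
  fold_kernel x y <= (p + 1) * (4 * hh y) `^ (gap_exp s) * riesz nu (s - gap_exp s) (dot x y).
Proof.
move=> x1 y1 hx hy xy; have [/andP[g0 g1] _] := gap_exp_bounds s0.
have a0 : 0 < 2 - 2 * dot x y.
  by have /andP[_ h] := dot_le x1 y1; have h2 : dot x y < 1; [by rewrite lt_neqAle xy h|lra].
have /andP[b0 b1] := gapb_bounds x1 y1 hx hy.
have g01 : 0 <= gap_exp s <= 1 by rewrite ltW.
rewrite fold_kernelE // /riesz; split.
  have ab0 : 0 < 2 - 2 * dot x y + gapb x y by rewrite addr_gt0.
  rewrite subr_gt0 !powRN ltf_pV2 ?posrE ?(powR_gt0 _ a0) ?(powR_gt0 _ ab0) //.
  by apply: (gt0_ltr_powR p0); rewrite ?nnegrE ?(ltW a0) ?(ltW ab0) // ltrDl.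
have H := pow_gap_kernel a0 b0 (ltW p0) g01.
apply: (le_trans H).
have -> : - (nu + 2^-1 - (s - gap_exp s)) = - (p + gap_exp s) by ring.
apply: ler_wpM2r; first exact: powR_ge0.
apply: ler_wpM2l; first by move: p0; lra.
by apply: ge0_ler_powR; rewrite ?nnegrE ?(ltW g0) ?(ltW b0) //; apply: le_trans b1; exact: ltW.
Qed.

(** Split the density by the sign of the height and transport the lower part by [E_riesz_inversion];
    antisymmetry turns it into minus the reflected term of [fold_kernel]. *)
Lemma riesz_op_fold (f : vec -> R) (x : vec) : dot x x = 1 -> sph_continuous f -> antisym beta f ->
  itg M (fun y => fold_kernel x y * (f y * (0 < hh y)%R%:R)) /\
  A f x = E M (fun y => fold_kernel x y * (f y * (0 < hh y)%R%:R)).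
Proof.
move=> x1 cf fa; have chh : sph_continuous hh by exact: sph_continuous_height.
have f0 := antisym_eq0 fa.
have cut1 : sph_continuous (fun y => f y * (0 < hh y)%R%:R) by apply: sph_continuous_cut.
have cut2 : sph_continuous (fun y => f y * (0 < - hh y)%R%:R).
  apply: (sph_continuous_cut (b := fun y => - hh y)) => //.
    have := sph_continuousM (@sph_continuous_cst R n (-1)) chh; rewrite (_ : (fun x => -1 * hh x) = (fun y => - hh y)) //.
    by apply/funext => y; rewrite mulN1r.
  by move=> y y1 /eqP; rewrite oppr_eq0 => /eqP; exact: f0.
have [d2 _ Hd2] := sph_continuous_bounded cut2.
have i1 := itg_riesz_opA x1 cut1; have i2 := itg_riesz_opA x1 cut2.
have crho : sph_continuous (fun y => rho y `^ p * (f y * (0 < hh y)%R%:R)).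
  by apply: sph_continuousM => //; exact: sph_continuous_rhoX.
have [d d0 Hd] := sph_continuous_bounded crho.
have i3 := itg_riesz_inversion hn nu1 s0 sn e1 l01 x1 (@mes_cont R n M _ crho) Hd.
have E2 : E M (fun y => G (dot x y) * (f y * (0 < - hh y)%R%:R)) =
    - E M (fun y => G (dot x (Phi y)) * (rho y `^ p * (f y * (0 < hh y)%R%:R))).
  rewrite -(E_riesz_inversion M hn nu1 s0 sn e1 l01 x1 (f_ := fun _ => fun y => f y * (0 < - hh y)%R%:R) (fun _ => cut2)
    (fun _ => Hd2) (fun y _ => cvg_cst _)).
  rewrite -mulN1r -(EZ _ i3); apply: E_eq => y y1.
  have r0 := inv_rho_gt0 e1 l01 y1.
  rewrite (height_inversion e1 l01 y1) mulNr opprK.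
  have -> : (0 < rho y * hh y) = (0 < hh y) by rewrite pmulr_rgt0.
  have -> : rho y `^ (2 * nu + 1) = rho y `^ p * rho y `^ beta.
    by rewrite -powRD ?(lt0r_neq0 r0) ?implybT //; congr (_ `^ _); field.
  transitivity (G (dot x (Phi y)) * (rho y `^ p * ((rho y `^ beta * f (Phi y)) * (0 < hh y)%R%:R))); first by ring.
  by rewrite fa //; ring.
have KE y : fold_kernel x y * (f y * (0 < hh y)%R%:R) = G (dot x y) * (f y * (0 < hh y)%R%:R) -
   G (dot x (Phi y)) * (rho y `^ p * (f y * (0 < hh y)%R%:R)) by rewrite /fold_kernel; ring.
have -> : (fun y => fold_kernel x y * (f y * (0 < hh y)%R%:R)) = (fun y => G (dot x y) * (f y * (0 < hh y)%R%:R) -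
   G (dot x (Phi y)) * (rho y `^ p * (f y * (0 < hh y)%R%:R))) by apply/funext => y; exact: KE.
split; first exact: itgB.
rewrite (EB i1 i3) -E2 -(ED i1 i2); apply: E_eq => y y1.
have [h|h|h] := ltrgt0P (hh y); last by rewrite f0 // !mul0r !mulr0 addr0.
  by rewrite oppr_gt0 (lt_gtF h) mulr0 mulr0 addr0 mulr1.
by rewrite oppr_gt0 h mulr0 mulr0 add0r mulr1.
Qed.

Lemma riesz_op_antisym (f : vec -> R) : sph_continuous f -> antisym beta f -> antisym p (A f).
Proof.
move=> cf fa x x1.
rewrite -(riesz_op_inversion M hn nu1 s0 sn e1 l01 x1 cf) -(riesz_opN x1 cf).
by apply: E_eq => y y1; rewrite fa.
Qed.

End Fold.

Lemma E_fatou (f_ : nat -> vec -> R) (f : vec -> R) (K : R) : (forall k, itg M (f_ k)) ->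
  (forall k x, dot x x = 1 -> 0 <= f_ k x) -> (forall k, E M (f_ k) <= K) ->
  (forall x, dot x x = 1 -> f_ k x @[k --> \oo] --> f x) -> itg M f.
Proof.
move=> fi f0 fK fl.
have mf : mes M f.
  apply: (measurable_fun_cvg (h := fun k w => f_ k (up_fun w))) => [k|w _]; first exact: itg_mes.
  by apply: fl; exact: up_unit.
have ff0 x : dot x x = 1 -> 0 <= f x.
  move=> x1; have L := fl x x1; rewrite -(cvg_lim (@Rhausdorff R) L).
  by apply: limr_ge; [exact: cvgP L|apply: nearW => k; exact: f0].
apply/integrableP; split; first exact/measurable_EFinP.
apply: (@le_lt_trans _ _ K%:E); last exact: ltry.
have := @fatou _ _ R (up_prob M) setT measurableT (fun k w => (f_ k (up_fun w))%:E).
move=> /(_ (fun k => (measurable_EFinP _ _).2 (itg_mes (fi k)))).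
move=> /(_ (fun k w _ => f0 k _ (up_unit w))) H.
have {}H : (\int[up_prob M]_w (f (up_fun w))%:E <= limn_einf (fun k => \int[up_prob M]_w (f_ k (up_fun w))%:E))%E.
  apply: le_trans H; rewrite le_eqVlt; apply/orP; left; apply/eqP.
  apply: eq_integral => w _.
  have L : (f_ k (up_fun w))%:E @[k --> \oo] --> (f (up_fun w))%:E.
    by apply: cvg_EFin; [exact: nearW|apply: fl; exact: up_unit].
  by rewrite is_cvg_limn_einfE ?(cvg_lim _ L) //; exact: cvgP L.
under eq_integral do rewrite /= ger0_norm ?ff0 ?up_unit //.
apply: le_trans H _; rewrite limn_einf_lim; apply: lime_le; first exact: is_cvg_einfs.
apply: nearW => k; apply: (@le_trans _ _ (\int[up_prob M]_w (f_ k (up_fun w))%:E)%E).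
  by apply: ereal_inf_lbound; exists k => //=.
by rewrite -(fineK (integrable_fin_num measurableT (fi k))) lee_fin; exact: fK.
Qed.

End Kernels.

(** * Maximum principle for antisymmetric potentials, s <= 1 *)

Lemma half_powR (R : realType) (a m : R) : 0 < a -> (a / 2) `^ (- m) = 2 `^ m * a `^ (- m).
Proof.
by move=> a0; rewrite powRM ?invr_ge0 ?(ltW a0) // -(@powR_inv1 R 2) // -powRrM mulN1r opprK mulrC.
Qed.

Section MaximumPrinciple.
Variables (R : realType) (n : nat) (M : uniform_point R n) (nu s : R).
Hypotheses (hn : n%:R = 2 * nu + 1) (nu1 : 1 <= nu) (s0 : 0 < s) (sn : 2 * s < 2 * nu + 1).
Local Notation vec := 'rV[R]_n.+1.
Local Notation p := (nu + 2^-1 - s).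
Local Notation beta := (nu + 2^-1 + s).
Local Notation G := (riesz nu s).
Local Notation A := (riesz_op M nu s).
Local Notation mean := (riesz_mean nu s).

Let p0 : 0 < p. Proof. by move: sn; lra. Qed.

Lemma riesz_mean_gt0 : 0 < mean.
Proof.
have h1 : 0 < beta by move: s0 nu1; lra.
apply: divr_gt0; last exact: riesz_const_gt0.
by apply: mulr_gt0; [apply: Gamma_gt0; move: s0; lra|apply: divr_gt0; exact: Gamma_gt0].
Qed.

Variable x0 : vec.
Hypothesis x01 : dot x0 x0 = 1.

Section Bubble.
Variable lam : R.
Hypothesis lam01 : 0 < lam < 1.
Local Notation rl := (inv_rho x0 lam).

(** The bubble [inv_rho x0 lam] to the power p is proportional to (|x0 - y|^2 + t)^(-p) with this t,
    which tends to 0 as lam tends to 1. *)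
Definition bub_t : R := (1 - lam) ^+ 2 / lam.
Definition bub_k : R := (lam / (1 - lam ^+ 2)) `^ p.

Let lam01' : 0 <= lam < 1. Proof. by have /andP[h1 h2] := lam01; rewrite ltW. Qed.

Lemma bub_t_gt0 : 0 < bub_t.
Proof. by have /andP[h1 h2] := lam01; rewrite divr_gt0 // exprn_gt0 // subr_gt0. Qed.

Lemma bub_k_ge0 : 0 <= bub_k. Proof. exact: powR_ge0. Qed.

Lemma inv_qE (y : vec) : inv_q x0 lam y = lam * (2 - 2 * dot x0 y + bub_t).
Proof. by have /andP[h1 h2] := lam01; rewrite /inv_q /bub_t; field; exact: lt0r_neq0. Qed.

Lemma bubbleE (y : vec) : dot y y = 1 -> bub_k * rl y `^ p = (2 - 2 * dot x0 y + bub_t) `^ (- p).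
Proof.
move=> y1; have /andP[h1 h2] := lam01; have t0 := bub_t_gt0.
have a0 : 0 <= 2 - 2 * dot x0 y by have /andP[_ ?] := dot_le x01 y1; lra.
have at0 : 0 < 2 - 2 * dot x0 y + bub_t by rewrite ltr_wpDl.
have L0 := one_sub_sqr_gt0 lam01'.
rewrite /bub_k /inv_rho inv_qE -powRM ?divr_ge0 ?mulr_ge0 ?(ltW L0) ?(ltW h1) ?(ltW at0) //.
move: (2 - 2 * dot x0 y + bub_t) at0 => a at0.
have -> : lam / (1 - lam ^+ 2) * ((1 - lam ^+ 2) / (lam * a)) = a^-1.
  by field; rewrite !lt0r_neq0.
by rewrite -(powR_inv1 (ltW at0)) -powRrM mulN1r.
Qed.

Lemma sph_continuous_bubble r : sph_continuous (fun y => rl y `^ r).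
Proof. exact: sph_continuous_rhoX. Qed.

(** Conformal covariance applied to the constant 1 shows that the operator sends the bubble of
    weight beta to [riesz_mean] times the bubble of weight p; symmetry does the rest. *)
Lemma E_bubble_sym (f : vec -> R) : sph_continuous f ->
  E M (fun x => rl x `^ beta * A f x) = mean * E M (fun x => f x * rl x `^ p).
Proof.
move=> cf; have [c c0 fc] := sph_continuous_bounded cf.
have cb := @sph_continuous_bubble beta; have [d d0 bd] := sph_continuous_bounded cb.
rewrite (riesz_op_sym hn nu1 s0 sn (@mes_cont R n M f cf) (@mes_cont R n M _ cb) fc bd).
have cfr : sph_continuous (fun x => f x * rl x `^ p) by apply: sph_continuousM => //; exact: sph_continuous_bubble.
rewrite -(EZ _ (itg_cont M cfr)); apply: E_eq => x x1.
have -> : A (fun y => rl y `^ beta) x = rl x `^ p * mean.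
  have := riesz_op_inversion M hn nu1 s0 sn x01 lam01' x1 (@sph_continuous_cst R n 1).
  have -> : A (fun _ => 1) (inversion x0 lam x) = mean.
    have u1 := inversion_unit x01 lam01' x1.
    have [_ <-] := itg_riesz M hn nu1 s0 sn u1.
    by apply: E_eq => y _; rewrite mulr1.
  move=> <-; apply: E_eq => y _; by rewrite mulr1.
by ring.
Qed.

Lemma E_bubble : E M (fun x => rl x `^ beta) = E M (fun x => rl x `^ p).
Proof.
have H := E_bubble_sym (@sph_continuous_cst R n 1).
have m0 := riesz_mean_gt0; apply: (mulfI (lt0r_neq0 m0)).
have -> : E M (fun x => rl x `^ p) = E M (fun x => 1 * rl x `^ p) by apply: E_eq => x _; rewrite mul1r.
rewrite -H -(EZ _ (itg_cont M (@sph_continuous_bubble beta))); apply: E_eq => x x1.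
rewrite mulrC; congr (_ * _); have [_ <-] := itg_riesz M hn nu1 s0 sn x1.
by apply: E_eq => y _; rewrite mulr1.
Qed.

(** The Riesz kernel at x0 minus its smoothing by a bubble: a nonnegative test function (off the
    pole) concentrating at x0. *)
Definition bub_N (y : vec) : R := G (dot x0 y) - bub_k * rl y `^ p.

Lemma itg_bub_N : itg M bub_N.
Proof.
apply: itgB; first exact: (itg_riesz M hn nu1 s0 sn x01).1.
by apply: itgZ; apply: itg_cont; exact: sph_continuous_bubble.
Qed.

Lemma E_bub_N : E M bub_N = mean - bub_k * E M (fun x => rl x `^ p).
Proof.
have [iG EG] := itg_riesz M hn nu1 s0 sn x01.
have ib := itg_cont M (@sph_continuous_bubble p).
by rewrite /bub_N (EB iG (itgZ bub_k ib)) EG (EZ _ ib).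
Qed.

(** The mean value bounds for a^(-p) - (a+t)^(-p), whose derivative is monotone in a. *)
Lemma bub_N_bounds (y : vec) : dot y y = 1 -> dot x0 y != 1 ->
  [/\ 0 <= bub_N y, bub_N y <= p * bub_t * (2 - 2 * dot x0 y) `^ (- (p + 1)) &
      p * bub_t * (2 - 2 * dot x0 y + bub_t) `^ (- (p + 1)) <= bub_N y].
Proof.
move=> y1 xy; have t0 := bub_t_gt0; have /andP[_ h] := dot_le x01 y1.
have a0 : 0 < 2 - 2 * dot x0 y by have h2 : dot x0 y < 1; [by rewrite lt_neqAle xy h|lra].
rewrite /bub_N bubbleE // /riesz.
move: (2 - 2 * dot x0 y) bub_t a0 t0 => a t a0 t0.
have at0 : 0 < a + t by rewrite addr_gt0.
have e1 (b : R) : 0 < b -> b `^ (- (p + 1)) = b `^ (- p) / b.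
  move=> b0; rewrite (_ : - (p + 1) = - p + -1); last by ring.
  by rewrite powRD ?(lt0r_neq0 b0) ?implybT // powR_inv1 // ltW.
have ta : 0 <= t / a by rewrite divr_ge0 // ltW.
have up : a `^ (- p) - (a + t) `^ (- p) <= p * t * a `^ (- (p + 1)).
  have E1 : a + t = a * (1 + t / a) by field; exact: lt0r_neq0.
  rewrite {1}E1 powRM ?(ltW a0) ?addr_ge0 // e1 //.
  have := ler_wpM2l (powR_ge0 a (- p)) (bernoulli_powR ta (ltW p0)).
  by rewrite mulrBr mulr1 => H; apply: le_trans H _; rewrite le_eqVlt; apply/orP; left; apply/eqP; field; exact: lt0r_neq0.
have lo : p * t * (a + t) `^ (- (p + 1)) <= a `^ (- p) - (a + t) `^ (- p).
  have r0 : 0 < a / (a + t) by rewrite divr_gt0.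
  have E1 : a = (a + t) * (a / (a + t)) by field; exact: lt0r_neq0.
  have L1 : ln (a / (a + t)) <= - (t / (a + t)).
    have -> : a / (a + t) = 1 + (- (t / (a + t))) by field; exact: lt0r_neq0.
    apply: le_ln1Dx; rewrite ltrN2 ltr_pdivrMr // mul1r ltrDr //.
  have := expR_ge1Dx (- p * ln (a / (a + t))); rewrite -powRE // => H.
  have H2 : p * (t / (a + t)) <= (a / (a + t)) `^ (- p) - 1.
    by have := ler_wpM2l (ltW p0) L1; lra.
  rewrite {2}E1 powRM ?(ltW r0) ?(ltW at0) // e1 //.
  have := ler_wpM2l (powR_ge0 (a + t) (- p)) H2; rewrite mulrBr mulr1 => H3; apply: le_trans _ H3.
  by rewrite le_eqVlt; apply/orP; left; apply/eqP; field; exact: lt0r_neq0.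
split => //; apply: le_trans lo; rewrite !mulr_ge0 ?powR_ge0 ?(ltW p0) ?(ltW t0) //.
Qed.

End Bubble.

(** Otherwise [bub_N] divided by t would have bounded mean, and Fatou's lemma would make
    |x0-y|^(-2(p+1)) integrable. For s <= 1 that function dominates all Poisson kernels with pole
    x0, which tend to 0 off the pole; dominated convergence would contradict their mean 1. *)
Lemma blowup (K tau : R) : s <= 1 -> 0 < tau -> exists lam, [/\ 0 < lam < 1, bub_t lam <= tau & K * bub_t lam < E M (bub_N lam)].
Proof.
move=> s1 tau0; apply: contrapT => H.
have {}H lam : 0 < lam < 1 -> bub_t lam <= tau -> E M (bub_N lam) <= K * bub_t lam.
  by move=> l01 lt; rewrite leNgt; apply/negP => Hl; apply: H; exists lam.
have rad01 j : 0 < rad R j < 1.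
  by have /andP[h1 h2] := rad_bounds R j; rewrite h2 andbT; apply: lt_le_trans h1; rewrite invr_gt0.
have tj : bub_t (rad R j) @[j --> \oo] --> (0 : R).
  have L : (1 - rad R j) ^+ 2 / rad R j @[j --> \oo] --> (1 - 1) ^+ 2 / (1 : R).
    apply: cvgM; last by apply: cvgV; [exact: oner_neq0|exact: rad_cvg].
    have L1 : 1 - rad R j @[j --> \oo] --> (1 - 1 : R) by apply: cvgB; [exact: cvg_cst|exact: rad_cvg].
    rewrite !expr2; exact: cvgM.
  by move: L; rewrite subrr expr0n mul0r.
have [J _ HJ] : \forall j \near \oo, bub_t (rad R j) <= tau by have /cvgr_le := tj; apply.
pose lj j := rad R (j + J)%N; pose t j := bub_t (lj j).
have lj01 j : 0 < lj j < 1 by exact: rad01.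
have t0 j : 0 < t j by exact: bub_t_gt0.
have tl : t @ \oo --> (0 : R) by move: tj; rewrite -(cvg_shiftn J).
have HtJ j : t j <= tau by apply: HJ; rewrite /= leq_addl.
pose dl (y : vec) : R := (dot x0 y != 1)%:R.
have dl01 y : 0 <= dl y <= 1 by rewrite /dl; case: (_ != _); rewrite ?ler01 ?lexx.
have mdl : mes M dl.
  apply: (@mes_zonal R n M (fun t : R => (t != 1)%:R)).
  rewrite (_ : (fun t : R => (t != 1)%:R : R) = \1_(~` [set 1])).
    by apply: measurable_indic; exact: measurableC.
  apply/funext => y; rewrite indicE; congr ((nat_of_bool _)%:R).
  by apply/idP/idP => [/eqP h|/set_mem h]; [exact/mem_set|exact/eqP].
have cb j : sph_continuous (fun y => (2 - 2 * dot x0 y + t j) `^ (- (p + 1))).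
  apply: sph_continuous_powR.
    apply: sph_continuousD; last exact: sph_continuous_cst.
    by apply: sph_continuousB; [exact: sph_continuous_cst|apply: sph_continuousM; [exact: sph_continuous_cst|exact: sph_continuous_dot]].
  by move=> y y1; have /andP[_ ?] := dot_le x01 y1; rewrite ltr_wpDl //; lra.
have ib j : itg M (fun y => (2 - 2 * dot x0 y + t j) `^ (- (p + 1)) * dl y).
  by apply: (itgM (c := 1) (itg_cont M (cb j)) mdl) => y _; have /andP[h1 h2] := dl01 y; rewrite ger0_norm.
have Eb j : E M (fun y => (2 - 2 * dot x0 y + t j) `^ (- (p + 1)) * dl y) <= K / p.
  rewrite ler_pdivlMr // mulrC -(ler_pM2r (t0 j)); apply: le_trans (H _ (lj01 j) (HtJ j)).
  rewrite -mulrA [_ * t j]mulrC mulrA -(EZ _ (ib j)).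
  apply: (E_le_off hn nu1 x01 (itgZ _ (ib j)) (itg_bub_N (lj01 j))) => y y1 xy.
  have [_ _ h] := bub_N_bounds (lj01 j) y1 xy.
  by rewrite /dl xy /= mulr1n mulr1.
have ia : itg M (fun y => (2 - 2 * dot x0 y) `^ (- (p + 1))).
  apply: (@E_fatou R n M (fun j y => (2 - 2 * dot x0 y + t j) `^ (- (p + 1)) * dl y) _ (K / p) ib _ Eb).
    by move=> j y y1; rewrite mulr_ge0 ?powR_ge0 //; have /andP[] := dl01 y.
  move=> y y1; rewrite /dl; case: eqP => [->|/eqP xy] /=.
    rewrite mulr1 subrr powR0; last by rewrite oppr_eq0 lt0r_neq0 //; move: p0; lra.
    by under eq_fun do rewrite mulr0; exact: cvg_cst.
  under eq_fun do rewrite mulr1n mulr1.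
  have a0 : 0 < 2 - 2 * dot x0 y.
    by have /andP[_ h] := dot_le x01 y1; have h2 : dot x0 y < 1; [by rewrite lt_neqAle xy h|lra].
  have L : 2 - 2 * dot x0 y + t j @[j --> \oo] --> 2 - 2 * dot x0 y + 0 by apply: cvgD => //; exact: cvg_cst.
  rewrite addr0 in L.
  have cp : {for 2 - 2 * dot x0 y, continuous (fun u : R => u `^ (- (p + 1)))} by exact: powR_continuous.
  exact: (cvg_comp _ _ L cp).
pose Cd : R := 2 * (2 `^ (nu + 2^-1)) * 4.
have Pb j y : dot y y = 1 -> dot x0 y != 1 ->
   0 <= poisson nu (rad R j) (dot x0 y) <= Cd * (2 - 2 * dot x0 y) `^ (- (p + 1)) /\
   poisson nu (rad R j) (dot x0 y) <= (1 - rad R j ^+ 2) * ((2 - 2 * dot x0 y) / 2) `^ (- (nu + 1)).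
  move=> y1 xy; have /andP[r1 r2] := rad_bounds R j; have r01 := rad_ge0_lt1 R j.
  have /andP[tm h] := dot_le x01 y1.
  have a0 : 0 < 2 - 2 * dot x0 y by have h2 : dot x0 y < 1; [by rewrite lt_neqAle xy h|lra].
  (* qf = (1-r)^2 + r (2-2t), and the radii are at least 1/2. *)
  have qa : (2 - 2 * dot x0 y) / 2 <= qf (rad R j) (dot x0 y).
    rewrite /qf; move: (rad R j) (dot x0 y) r1 r2 tm h a0 {r01 xy} => r c r1 r2 tm h a0.
    by have := sqr_ge0 (1 - r); rewrite !expr2; nra.
  have a20 : 0 < (2 - 2 * dot x0 y) / 2 by rewrite divr_gt0.
  have q0 : 0 < qf (rad R j) (dot x0 y) by apply: lt_le_trans qa.
  have rr0 : 0 <= 1 - rad R j ^+ 2.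
    by move: (rad R j) r1 r2 => r r1 r2; rewrite expr2; nra.
  have pw (m : R) : 0 <= m -> qf (rad R j) (dot x0 y) `^ (- m) <= ((2 - 2 * dot x0 y) / 2) `^ (- m).
    move=> m0; rewrite !powRN lef_pV2 ?posrE ?powR_gt0 //.
    by apply: (ge0_ler_powR m0); rewrite ?nnegrE ?(ltW a20) ?(ltW q0).
  split; last by rewrite ler_wpM2l // pw //; move: nu1; lra.
  have pge : 0 <= poisson nu (rad R j) (dot x0 y) by exact: poisson_ge0.
  rewrite pge /=.
  have r1' : 0 < 1 - rad R j by rewrite subr_gt0.
  have -> : poisson nu (rad R j) (dot x0 y) = (1 - rad R j ^+ 2) * (qf (rad R j) (dot x0 y) `^ (- 2^-1) * qf (rad R j) (dot x0 y) `^ (- (nu + 2^-1))).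
    by rewrite /poisson -powRD ?(lt0r_neq0 q0) ?implybT //; congr (_ * _ `^ _); field.
  have b1 : qf (rad R j) (dot x0 y) `^ (- 2^-1) <= (1 - rad R j)^-1.
    rewrite -[leRHS](@powR_inv1 R _ (ltW r1')).
    have -> : (1 - rad R j) `^ (-1) = ((1 - rad R j) ^+ 2) `^ (- 2^-1).
      by rewrite -powR_mulrn ?(ltW r1') // -powRrM; congr (_ `^ _); field.
    rewrite !powRN lef_pV2 ?posrE ?powR_gt0 ?exprn_gt0 //.
    by apply: ge0_ler_powR; rewrite ?nnegrE ?invr_ge0 ?sqr_ge0 ?(ltW q0) // qf_ge ?dot_le // (le_trans _ r1) // invr_ge0.
  have nn : 0 <= nu + 2^-1 by move: nu1; lra.
  have b2 := pw _ nn.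
  have b3 : ((2 - 2 * dot x0 y) / 2) `^ (- (nu + 2^-1)) <= 2 `^ (nu + 2^-1) * 4 * (2 - 2 * dot x0 y) `^ (- (p + 1)).
    have a4 : 2 - 2 * dot x0 y <= 4 by lra.
    move: (2 - 2 * dot x0 y) a0 a4 => a a0 a4.
    rewrite half_powR // -mulrA ler_wpM2l ?powR_ge0 //.
    (* Here s <= 1 is used: n/2 = (p+1) - (1-s) with 1 - s >= 0, and a <= 4. *)
    have -> : a `^ (- (nu + 2^-1)) = a `^ (1 - s) * a `^ (- (p + 1)).
      by rewrite -powRD ?(lt0r_neq0 a0) ?implybT //; congr (_ `^ _); ring.
    rewrite ler_wpM2r ?powR_ge0 //.
    have s1' : 0 <= 1 - s by rewrite subr_ge0.
    apply: (@le_trans _ _ (4 `^ (1 - s))); first by apply: (ge0_ler_powR s1'); rewrite ?nnegrE ?(ltW a0).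
    have g4 : (1 : R) <= 4 by rewrite ler1n.
    have s1'' : 1 - s <= 1 by move: s0; lra.
    by have h4 := ler_powR g4 s1''; rewrite powRr1 // in h4.
  have b4 : (1 - rad R j ^+ 2) * (1 - rad R j)^-1 <= 2.
    by rewrite ler_pdivrMr //; move: (rad R j) r1 r2 {r01 rr0 r1'} => r r1 r2; rewrite expr2; nra.
  rewrite mulrA; apply: (@le_trans _ _ (2 * ((2 - 2 * dot x0 y) / 2) `^ (- (nu + 2^-1)))).
    apply: ler_pM; rewrite ?mulr_ge0 ?powR_ge0 //.
    by apply: le_trans b4; rewrite ler_wpM2l.
  by rewrite /Cd -!mulrA ler_wpM2l // !mulrA.
have Cd0 : 0 <= Cd by rewrite !mulr_ge0 ?powR_ge0.
have iP j : itg M (fun y => poisson nu (rad R j) (dot x0 y) * dl y).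
  by apply: (itgM (c := 1) (itg_poisson M nu1 x01 (rad_ge0_lt1 R j)) mdl) => y _; have /andP[h1 h2] := dl01 y; rewrite ger0_norm.
have [||||_ L] := @E_dct R n M (fun j y => poisson nu (rad R j) (dot x0 y) * dl y) (fun _ => 0) (fun y => Cd * (2 - 2 * dot x0 y) `^ (- (p + 1))).
- by move=> j; exact: itg_mes (iP j).
- move=> y y1; rewrite /dl; case: eqP => [_|/eqP xy] /=.
    by under eq_fun do rewrite mulr0; exact: cvg_cst.
  under eq_fun do rewrite mulr1n mulr1.
  apply: (@squeeze_cvgr _ _ _ _ (fun _ => 0) (fun j => (1 - rad R j ^+ 2) * ((2 - 2 * dot x0 y) / 2) `^ (- (nu + 1)))).
  + by apply: nearW => j; have [/andP[-> _] ->] := Pb j y y1 xy.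
  + exact: cvg_cst.
  + have L1 : (1 - rad R j ^+ 2) * ((2 - 2 * dot x0 y) / 2) `^ (- (nu + 1)) @[j --> \oo] --> (1 - 1 * 1) * ((2 - 2 * dot x0 y) / 2) `^ (- (nu + 1)).
      apply: cvgM; last exact: cvg_cst.
      by apply: cvgB; [exact: cvg_cst|under eq_fun do rewrite expr2; apply: cvgM; exact: rad_cvg].
    by move: L1; rewrite mul1r subrr mul0r.
- exact: itgZ.
- move=> j y y1; rewrite /dl; case: eqP => [_|/eqP xy] /=.
    by rewrite mulr0 normr0 mulr_ge0 ?powR_ge0.
  by rewrite mulr1n mulr1; have [/andP[h1 h2] _] := Pb j y y1 xy; rewrite ger0_norm.
rewrite E_cst in L.
have one j : 1 <= E M (fun y => poisson nu (rad R j) (dot x0 y) * dl y).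
  rewrite -(E_poisson M hn nu1 x01 (rad_ge0_lt1 R j)).
  apply: (E_le_off hn nu1 x01 (itg_poisson M nu1 x01 (rad_ge0_lt1 R j)) (iP j)) => y y1 xy.
  by rewrite /dl xy /= mulr1n mulr1.
have : 1 <= limn (fun j => E M (fun y => poisson nu (rad R j) (dot x0 y) * dl y)).
  by apply: limr_ge; [exact: cvgP L|exact: nearW].
by rewrite (cvg_lim (@Rhausdorff R) L) ler10.
Qed.

Variables (e : vec) (l : R).
Hypotheses (e1 : dot e e = 1) (l01 : 0 <= l < 1).
Local Notation rho := (inv_rho e l).
Local Notation Phi := (inversion e l).
Local Notation hh := (height e l).

(** A point of the cap is nearer to the pole x0 than its image. After division by lam the claim
    becomes t (rho - 1) <= 4 rho h(x0) h(y)/(1 - l^2), which the smallness of t against h(x0)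
    ensures. *)
Lemma bubble_inversion_le (lam : R) (y : vec) : 0 < lam < 1 -> dot y y = 1 -> 0 < hh x0 -> 0 < hh y ->
  bub_t lam <= 2 * hh x0 -> inv_rho x0 lam (Phi y) * rho y <= inv_rho x0 lam y.
Proof.
move=> lam01 y1 hx hy ht; have /andP[la0 la1] := lam01; have /andP[l0 l1] := l01.
have lam01' : 0 <= lam < 1 by rewrite ltW.
have L0 := one_sub_sqr_gt0 lam01'; have r0 := inv_rho_gt0 e1 l01 y1.
have q1 := inv_q_gt0 x01 lam01' y1; have q2 := inv_q_gt0 x01 lam01' (inversion_unit e1 l01 y1).
rewrite {1 3}/inv_rho mulrAC ler_pdivrMr // mulrAC ler_pdivlMr // -mulrA ler_wpM2l ?(ltW L0) //.
rewrite !(inv_qE lam01) (dot_inversion e1 l01 x01 y1) mulrCA ler_wpM2l ?(ltW la0) //.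
have t0 := bub_t_gt0 lam01.
have qe := inv_q_gt0 e1 l01 y1; have Le := one_sub_sqr_gt0 l01.
have r1E : rho y - 1 = 2 * l * hh y / inv_q e l y.
  by rewrite /inv_rho /height; have := lt0r_neq0 qe; rewrite /inv_q => qn; field.
have rb : rho y * (4 * hh x0 * hh y / (1 - l ^+ 2)) = 4 * hh x0 * hh y / inv_q e l y.
  by rewrite /inv_rho; field; rewrite !lt0r_neq0.
suff : bub_t lam * (rho y - 1) <= rho y * (4 * hh x0 * hh y / (1 - l ^+ 2)).
  by rewrite mulrDr; move: (rho y) (bub_t lam) (dot x0 y) (4 * hh x0 * hh y / (1 - l ^+ 2)) => a b c d; nra.
rewrite r1E rb mulrA ler_pM2r ?invr_gt0 //.
move: (bub_t lam) (hh x0) (hh y) t0 hx hy ht => t a b t0 hx hy ht.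
have h1 : t * l <= 2 * a by nra.
by have := ler_wpM2r (ltW hy) h1; nra.
Qed.

(** Evaluate E([bub_N] f) twice. Symmetry and folding bound it below by (A f(x0)/mean) E([bub_N]).
    The sign of f near x0 bounds it above by -c E([bub_N]) + K t. So (A f(x0)/mean + c) E([bub_N])
    <= K t, against [blowup]. *)
Lemma maximum_principle (f : vec -> R) (c del : R) : s <= 1 -> sph_continuous f -> antisym e l beta f ->
  0 < hh x0 -> (forall x, dot x x = 1 -> 0 < hh x -> A f x <= A f x0) -> 0 <= A f x0 ->
  0 <= c -> 0 < del -> (forall y, dot y y = 1 -> 2 - 2 * dot x0 y < del -> f y <= - c) ->
  0 < A f x0 \/ 0 < c -> False.
Proof.
move=> s1 cf fa hx Wmax W0 c0 del0 fneg pos.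
have [B B0 fB] := sph_continuous_bounded cf.
have m0 := riesz_mean_gt0.
pose m1 := A f x0 / mean + c.
have m10 : 0 < m1.
  case: pos => h; first by rewrite ltr_wpDr // divr_gt0.
  by rewrite ltr_wpDl // divr_ge0 // ltW.
(* Outside the del-neighbourhood [bub_N] <= p t del^(-(p+1)), so K t bounds [bub_N] (f + c)
   there. *)
pose K := (B + c) * p * del `^ (- (p + 1)).
have K0 : 0 <= K by apply: mulr_ge0; [apply: mulr_ge0; [exact: addr_ge0|exact: ltW]|exact: powR_ge0].
have tau0 : 0 < 2 * hh x0 by rewrite mulr_gt0.
have [lam [lam01 ht]] := blowup (K / m1) s1 tau0; rewrite ltNge => /negP; apply.
rewrite mulrAC ler_pdivlMr // mulrC.
have lam01' : 0 <= lam < 1 by have /andP[h1 h2] := lam01; rewrite ltW.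
have t0 := bub_t_gt0 lam01.
have cp : sph_continuous (fun y => inv_rho x0 lam y `^ p) by exact: sph_continuous_rhoX.
have cbe : sph_continuous (fun y => inv_rho x0 lam y `^ beta) by exact: sph_continuous_rhoX.
have cmf := @mes_cont R n M f cf.
have iN := itg_bub_N lam01.
have iNf : itg M (fun y => bub_N lam y * f y) := itgM iN cmf fB.
have cW : sph_continuous (A f) := sph_continuous_riesz_op hn nu1 s0 sn cmf fB.
have Wa := riesz_op_antisym M hn nu1 s0 sn e1 l01 cf fa.
have W00 := antisym_eq0 e1 l01 Wa.
have chh : sph_continuous hh by exact: sph_continuous_height.
have up : E M (fun y => bub_N lam y * f y) <= - c * E M (bub_N lam) + K * bub_t lam.
  rewrite -(EZ _ iN) -[X in _ + X](E_cst M) -(ED (itgZ _ iN) (itg_cst M _)).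
  apply: (E_le_off hn nu1 x01 iNf (itgD (itgZ _ iN) (itg_cst M _))) => y y1 xy.
  have [N0 N1 _] := bub_N_bounds lam01 y1 xy.
  have [ld|ld] := ltP (2 - 2 * dot x0 y) del.
    have := fneg y y1 ld; have Kt : 0 <= K * bub_t lam by rewrite mulr_ge0 // ltW.
    by move: (bub_N lam y) N0 (f y) (K * bub_t lam) Kt => N N0 fy Kt Kt0 h; nra.
  have Nd : bub_N lam y <= p * bub_t lam * del `^ (- (p + 1)).
    apply: le_trans N1 _; apply: ler_wpM2l; first exact: (mulr_ge0 (ltW p0) (ltW t0)).
    rewrite !powRN lef_pV2 ?posrE ?powR_gt0 ?(lt_le_trans del0 ld) //.
    have p10 : 0 <= p + 1 by move: p0; lra.
    by apply: (ge0_ler_powR p10); rewrite ?nnegrE ?(ltW del0) ?(le_trans (ltW del0) ld).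
  have fy : f y <= B by apply: le_trans (ler_norm _) (fB y y1).
  have h1 : bub_N lam y * (f y + c) <= bub_N lam y * (B + c) by rewrite ler_wpM2l // lerD2r.
  have h2 : bub_N lam y * (B + c) <= p * bub_t lam * del `^ (- (p + 1)) * (B + c) by rewrite ler_wpM2r // addr_ge0.
  have h3 : K * bub_t lam = p * bub_t lam * del `^ (- (p + 1)) * (B + c) by rewrite /K; ring.
  rewrite h3; lra.
have lowE : E M (fun y => bub_N lam y * f y) = A f x0 - bub_k lam * E M (fun y => f y * inv_rho x0 lam y `^ p).
  have iGf := itg_riesz_opA M hn nu1 s0 sn x01 cf.
  have ifp : itg M (fun y => f y * inv_rho x0 lam y `^ p) by apply: itg_cont; exact: sph_continuousM.
  rewrite /riesz_op -(EZ _ ifp) -(EB iGf (itgZ _ ifp)).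
  by apply: E_eq => y _; rewrite /bub_N; ring.
(* The lower cap is folded onto the upper one. By [bubble_inversion_le] the resulting weight is
   nonnegative, so the potential can be replaced by its maximum value at x0. *)
have fold : E M (fun y => inv_rho x0 lam y `^ beta * A f y) <= A f x0 * E M (fun y => inv_rho x0 lam y `^ beta).
  have cut1 : sph_continuous (fun y => A f y * (0 < hh y)%R%:R) by apply: sph_continuous_cut.
  have chhN : sph_continuous (fun y => - hh y).
    have := sph_continuousM (@sph_continuous_cst R n (-1)) chh; rewrite (_ : (fun x => -1 * hh x) = (fun y => - hh y)) //.
    by apply/funext => y; rewrite mulN1r.
  have cut2 : sph_continuous (fun y => A f y * (0 < - hh y)%R%:R).
    apply: (sph_continuous_cut (b := fun y => - hh y)) => //.
    by move=> y y1 /eqP; rewrite oppr_eq0 => /eqP; exact: W00.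
  have c1 := sph_continuousM cbe cut1; have c2 := sph_continuousM cbe cut2.
  have cphi : sph_continuous (fun y => (inv_rho x0 lam (Phi y) * rho y) `^ beta * (A f y * (0 < hh y)%R%:R)).
    apply: sph_continuousM => //; apply: sph_continuous_powR.
      apply: sph_continuousM; last exact: sph_continuous_inv_rho.
      by apply: (sph_continuous_inversion e1 l01); exact: sph_continuous_inv_rho.
    move=> y y1; rewrite mulr_gt0 // ?(inv_rho_gt0 e1 l01) //.
    by apply: (inv_rho_gt0 x01 lam01'); exact: inversion_unit.
  have i1 := itg_cont M c1; have i2 := itg_cont M c2; have i3 := itg_cont M cphi.
  have E2 : E M (fun y => inv_rho x0 lam y `^ beta * (A f y * (0 < - hh y)%R%:R)) =
     - E M (fun y => (inv_rho x0 lam (Phi y) * rho y) `^ beta * (A f y * (0 < hh y)%R%:R)).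
    rewrite -(E_inversion M hn nu1 e1 l01 c2) -mulN1r -(EZ _ i3); apply: E_eq => y y1.
    have r0 := inv_rho_gt0 e1 l01 y1.
    have rp := inv_rho_gt0 x01 lam01' (inversion_unit e1 l01 y1).
    rewrite (height_inversion e1 l01 y1) mulNr opprK.
    have -> : (0 < rho y * hh y) = (0 < hh y) by rewrite pmulr_rgt0.
    have -> : rho y `^ (2 * nu + 1) = rho y `^ p * rho y `^ beta.
      by rewrite -powRD ?(lt0r_neq0 r0) ?implybT //; congr (_ `^ _); field.
    rewrite powRM ?(ltW r0) ?(ltW rp) //.
    transitivity (inv_rho x0 lam (Phi y) `^ beta * rho y `^ beta * ((rho y `^ p * A f (Phi y)) * (0 < hh y)%R%:R)); first by ring.
    by rewrite Wa //; ring.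
  have -> : E M (fun y => inv_rho x0 lam y `^ beta * A f y) =
     E M (fun y => inv_rho x0 lam y `^ beta * (A f y * (0 < hh y)%R%:R)) + E M (fun y => inv_rho x0 lam y `^ beta * (A f y * (0 < - hh y)%R%:R)).
    rewrite -(ED i1 i2); apply: E_eq => y y1.
    have [h|h|h] := ltrgt0P (hh y); last by rewrite W00 // !mul0r !mulr0 addr0.
      by rewrite oppr_gt0 (lt_gtF h) !mulr0 addr0 mulr1.
    by rewrite oppr_gt0 h !mulr0 add0r mulr1.
  rewrite E2; have E5 := E_le (itgB i1 i3) (itgZ (A f x0) (itg_cont M cbe)).
  rewrite (EB i1 i3) (EZ (A f x0) (itg_cont M cbe)) in E5; apply: E5 => y y1.
  have b0 : 0 <= inv_rho x0 lam y `^ beta by exact: powR_ge0.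
  case: (ltP 0 (hh y)) => hy; last by rewrite !mulr0 subrr mulr_ge0.
  have be0 : 0 <= beta by move: s0 nu1; lra.
  have rp := inv_rho_gt0 x01 lam01' (inversion_unit e1 l01 y1).
  have r0 := inv_rho_gt0 e1 l01 y1; have rl0 := inv_rho_gt0 x01 lam01' y1.
  have h1 : (inv_rho x0 lam (Phi y) * rho y) `^ beta <= inv_rho x0 lam y `^ beta.
    have h0 := bubble_inversion_le lam01 y1 hx hy ht.
    apply: (ge0_ler_powR be0) h0; rewrite nnegrE; last exact: ltW.
    exact: (mulr_ge0 (ltW rp) (ltW r0)).
  have h2 := powR_ge0 (inv_rho x0 lam (Phi y) * rho y) beta.
  have h3 := Wmax y y1 hy; rewrite mulr1.
  move: (inv_rho x0 lam y `^ beta) ((inv_rho x0 lam (Phi y) * rho y) `^ beta) (A f y) (A f x0) b0 h1 h2 h3 W0 => a b w w0 b0 h1 h2 h3 W0'.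
  by nra.
have S := E_bubble_sym lam01 cf; rewrite S (E_bubble lam01) in fold.
have EN := E_bub_N lam01; have k0 := bub_k_ge0 lam.
move: fold up; rewrite lowE EN /m1.
move: (E M (fun y => f y * inv_rho x0 lam y `^ p)) (E M (fun x => inv_rho x0 lam x `^ p)) (bub_k lam) (A f x0) (K * bub_t lam) (mean) k0 m0 => X Y k w KT m k0 m0' fold up.
have h1 : k * X <= k * (w * Y / m).
  by rewrite ler_wpM2l // ler_pdivlMr // mulrC.
have h2 : (w / m + c) * (m - k * Y) = w - k * (w * Y / m) + c * (m - k * Y).
  by field; exact: lt0r_neq0.
rewrite h2; lra.
Qed.

End MaximumPrinciple.

(** * Moving planes: comparison of a solution with its reflections *)

Section MovingPlanes.
Variables (R : realType) (n : nat) (M : uniform_point R n) (nu s : R).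
Hypotheses (hn : n%:R = 2 * nu + 1) (nu1 : 1 <= nu) (s0 : 0 < s) (sn : 2 * s < 2 * nu + 1).
Local Notation vec := 'rV[R]_n.+1.
Local Notation p := (nu + 2^-1 - s).
Local Notation beta := (nu + 2^-1 + s).
Local Notation G := (riesz nu s).
Local Notation A := (riesz_op M nu s).
Local Notation q := (beta / p).

Let p0 : 0 < p. Proof. by move: sn; lra. Qed.
Let be0 : 0 < beta. Proof. by move: s0 nu1; lra. Qed.
Let q0 : 0 < q. Proof. by rewrite divr_gt0. Qed.

Variables (g : R -> R) (u : vec -> R) (c1 : R).
Hypotheses (cu : sph_continuous u) (cv : sph_continuous (fun x => g (u x)))
  (upos : forall x, dot x x = 1 -> 0 < u x) (c10 : 0 < c1)
  (hdec : forall t1 t2 : R, 0 < t1 -> t1 < t2 -> t2 `^ (- q) * g t2 < t1 `^ (- q) * g t1)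
  (gmono : 1 < s -> forall t1 t2 : R, 0 < t1 -> t1 <= t2 -> g t1 <= g t2)
  (green : forall z, dot z z = 1 -> u z = c1 * A (fun x => g (u x)) z).

Local Notation v := (fun x => g (u x)).

(** Kelvin-type transform across the slice. Weight p suits the solution, weight beta the right-hand
    side of the equation. *)
Definition reflect (r : R) (a : vec -> R) (e : vec) (l : R) (x : vec) : R :=
  inv_rho e l x `^ r * a (inversion e l x).

Lemma range_bounds : exists um UM, 0 < um /\ forall x, dot x x = 1 -> um <= u x <= UM.
Proof.
have [a a1 Ha] := sph_continuous_max cu.
have cn : sph_continuous (fun x => 0 - u x) by apply: sph_continuousB => //; exact: sph_continuous_cst.
have [b b1 Hb] := sph_continuous_max cn.
exists (u b), (u a); split; first exact: upos.
by move=> x x1; rewrite Ha // andbT; have := Hb x x1; rewrite !sub0r lerN2.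
Qed.

Lemma profile_bounded : exists2 H, 0 <= H & forall x, dot x x = 1 -> u x `^ (- q) * g (u x) <= H.
Proof.
have ch : sph_continuous (fun x => u x `^ (- q) * g (u x)).
  by apply: sph_continuousM => //; exact: sph_continuous_powR.
have [H H0 HH] := sph_continuous_bounded ch.
by exists H => // x x1; apply: le_trans (ler_norm _) (HH x x1).
Qed.

Lemma g_profile t : 0 < t -> g t = t `^ q * (t `^ (- q) * g t).
Proof. by move=> t0; rewrite mulrA -powRD ?(lt0r_neq0 t0) ?implybT // subrr powRr0 mul1r. Qed.

Lemma cut_max (D h : vec -> R) (x0 : vec) :
  (forall y, dot y y = 1 -> D y * (0 < h y)%R%:R <= D x0 * (0 < h x0)%R%:R) ->
  forall x, dot x x = 1 -> 0 < h x -> 0 < D x ->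
  [/\ 0 < h x0, D x <= D x0 & forall y, dot y y = 1 -> 0 < h y -> D y <= D x0].
Proof.
move=> Hm x x1 hx Dx; have hx0 : 0 < h x0.
  rewrite ltNge; apply/negP => h0; have := Hm x x1.
  by rewrite (le_gtF h0) hx mulr1 mulr0 leNgt Dx.
split=> [//||y y1 hy]; first by have := Hm x x1; rewrite hx0 hx !mulr1.
by have := Hm y y1; rewrite hx0 hy !mulr1.
Qed.

Lemma gt0_near (a b : R) : `|a - b| < b -> 0 < a.
Proof. by rewrite distrC => h; have := ler_norm (b - a); lra. Qed.

Lemma le_near_half (a b : R) : `|a - b| < - b / 2 -> a <= - (- b / 2).
Proof. by move=> h; have := ler_norm (a - b); lra. Qed.

Section OnePlane.
Variables (e : vec) (l : R).
Hypotheses (e1 : dot e e = 1) (l01 : 0 <= l < 1).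
Local Notation rho := (inv_rho e l).
Local Notation Phi := (inversion e l).
Local Notation hh := (height e l).
Local Notation ul := (reflect p u e l).
Local Notation vl := (reflect beta v e l).
Local Notation w := (fun x => u x - ul x).
Local Notation F := (fun x => g (u x) - vl x).

Lemma sph_continuous_reflect r a : sph_continuous a -> sph_continuous (reflect r a e l).
Proof.
move=> ca; apply: sph_continuousM; first exact: sph_continuous_rhoX.
exact: sph_continuous_inversion.
Qed.

Lemma antisym_reflect r a : antisym e l r (fun x => a x - reflect r a e l x).
Proof.
move=> x x1; have r0 := inv_rho_gt0 e1 l01 x1.
rewrite /reflect (inv_rho_inversion e1 l01 x1) (inversionK e1 l01 x1).
rewrite mulrBr mulrA -powRM ?invr_ge0 ?(ltW r0) // mulfV ?lt0r_neq0 // powR1 mul1r; ring.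
Qed.

Lemma difference_green x : dot x x = 1 -> w x = c1 * A F x.
Proof.
move=> x1; have x1' := inversion_unit e1 l01 x1.
have B := riesz_opB M hn nu1 s0 sn x1 cv (@sph_continuous_reflect beta _ cv).
have E1 : A vl x = rho x `^ p * A v (Phi x) := riesz_op_inversion M hn nu1 s0 sn e1 l01 x1 cv.
have G1 := green x1; have G2 := green x1'.
have L : w x = c1 * A v x - rho x `^ p * (c1 * A v (Phi x)).
  by congr (_ - _); [exact: G1|congr (_ * _); exact: G2].
by rewrite L B E1; move: (A v x) (A v (Phi x)) (rho x `^ p) => a b r; ring.
Qed.

Lemma reflect_pos x : dot x x = 1 -> 0 < ul x.
Proof. by move=> x1; rewrite mulr_gt0 ?powR_gt0 ?inv_rho_gt0 // upos // inversion_unit. Qed.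

(** As q = beta/p, the factor rho^beta is (rho^p)^q, so the reflected right-hand side is u_l^q times
    the profile t^(-q) g(t) taken at u(Phi x). *)
Lemma reflect_vE x : dot x x = 1 ->
  vl x = ul x `^ q * (u (Phi x) `^ (- q) * g (u (Phi x))).
Proof.
move=> x1; have x1' := inversion_unit e1 l01 x1; have r0 := inv_rho_gt0 e1 l01 x1.
rewrite /reflect {1}(g_profile (upos x1')) powRM ?powR_ge0 ?(ltW (upos x1')) // -powRrM.
by rewrite (mulrC p) divfK ?lt0r_neq0 // !mulrA.
Qed.

(** On the cap u_l = rho^p u(Phi) is at least u(Phi), so the decreasing profile is larger at u(Phi)
    than at u_l. For l > 0 the conformal factor exceeds 1 and both comparisons are strict. *)
Lemma reflect_v_ge x : dot x x = 1 -> 0 < hh x -> g (ul x) <= vl x /\ (0 < l -> g (ul x) < vl x).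
Proof.
move=> x1 hx; have x1' := inversion_unit e1 l01 x1; have r0 := inv_rho_gt0 e1 l01 x1.
have t0 := upos x1'; have ux := reflect_pos x1; have uq : 0 < ul x `^ q by rewrite powR_gt0.
rewrite reflect_vE // (g_profile ux).
have lt : 1 < rho x -> ul x `^ q * (ul x `^ (- q) * g (ul x)) < ul x `^ q * (u (Phi x) `^ (- q) * g (u (Phi x))).
  move=> r1; rewrite ltr_pM2l //; apply: hdec => //.
  rewrite /reflect ltr_pMl //.
  have := gt0_ltr_powR p0 (_ : 1 \in Num.nneg) (_ : rho x \in Num.nneg) r1.
  by rewrite powR1; apply; rewrite nnegrE ?(ltW r0).
split; last by move=> l0; apply: lt; exact: inv_rho_gt1.
have := inv_rho_ge1 e1 l01 x1 hx; rewrite le_eqVlt => /orP[/eqP r1|/lt/ltW //].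
by rewrite /reflect -r1 powR1 mul1r.
Qed.

Definition wplus x : R := Num.max (w x) 0 * (0 < hh x)%R%:R.

Lemma sph_continuous_wplus : sph_continuous wplus.
Proof.
apply: sph_continuous_cut.
- apply: sph_continuous_max2; last exact: sph_continuous_cst.
  by apply: sph_continuousB => //; exact: sph_continuous_reflect.
- exact: sph_continuous_height.
- move=> x x1 h; have H := antisym_eq0 e1 l01 (antisym_reflect p u) x1 h.
  by rewrite H maxxx.
Qed.

Lemma wplus_ge0 x : 0 <= wplus x.
Proof. by rewrite mulr_ge0 // le_max lexx orbT. Qed.

(** The antisymmetric extension of CF w^+ from the cap; [wplus] vanishes outside the cap. *)
Definition phiw (CF : R) x : R := CF * wplus x - reflect beta (fun y => CF * wplus y) e l x.

Lemma sph_continuous_phiw CF : sph_continuous (phiw CF).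
Proof.
have c : sph_continuous (fun x => CF * wplus x).
  by apply: sph_continuousM; [exact: sph_continuous_cst|exact: sph_continuous_wplus].
by apply: sph_continuousB => //; exact: sph_continuous_reflect.
Qed.

Lemma phiw_cut CF x : dot x x = 1 -> 0 < hh x -> phiw CF x = CF * wplus x.
Proof.
move=> x1 hx; have r0 := inv_rho_gt0 e1 l01 x1.
rewrite /phiw /reflect {2}/wplus (height_inversion e1 l01 x1).
have -> : (0 < - rho x * hh x) = false.
  by apply/negbTE; rewrite -leNgt mulNr oppr_le0 mulr_ge0 // ltW.
by rewrite !mulr0 subr0.
Qed.

Lemma riesz_op_phiw CF x : dot x x = 1 ->
  itg M (fun y => fold_kernel nu s e l x y * (CF * wplus y)) /\
  A (phiw CF) x = E M (fun y => fold_kernel nu s e l x y * (CF * wplus y)).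
Proof.
move=> x1; have [i Ei] := riesz_op_fold M hn nu1 s0 sn e1 l01 x1 (@sph_continuous_phiw CF) (antisym_reflect beta (fun y => CF * wplus y)).
have Eq y : dot y y = 1 -> fold_kernel nu s e l x y * (phiw CF y * (0 < hh y)%R%:R) = fold_kernel nu s e l x y * (CF * wplus y).
  move=> y1; case: (ltP 0 (hh y)) => hy; first by rewrite phiw_cut // mulr1.
  by rewrite /wplus (le_gtF hy) !mulr0.
split; last by rewrite Ei; exact: E_eq.
apply: (itg_le (mes_eq Eq (itg_mes i)) (itg_norm i)) => y y1; by rewrite Eq.
Qed.

(** For s > 1 monotonicity of g extends F <= CF w^+ to the whole cap, and the positive folded kernel
    integrates it. For s <= 1 the bound on F is available only where w > 0, and the maximum
    principle is applied to f = F - [phiw]. *)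
Lemma gap_bound CF x : (forall y, dot y y = 1 -> 0 < hh y -> 0 < w y -> F y <= CF * w y) -> 0 <= CF ->
  dot x x = 1 -> 0 < hh x -> w x <= c1 * A (phiw CF) x.
Proof.
move=> FC CF0 x1 hx.
have cF : sph_continuous F by apply: sph_continuousB => //; exact: sph_continuous_reflect.
have Fa : antisym e l beta F := antisym_reflect beta v.
have pos y : dot y y = 1 -> 0 < hh y -> 0 <= A (phiw CF) y.
  move=> y1 hy; have [i ->] := riesz_op_phiw CF y1.
  rewrite -(E_cst M 0); apply: (E_le_off hn nu1 y1 (itg_cst M 0) i) => z z1 yz.
  case: (ltP 0 (hh z)) => hz; last by rewrite /wplus (le_gtF hz) !mulr0.
  have [k0 _] := fold_kernel_bounds s0 sn e1 l01 y1 z1 hy hz yz.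
  by apply: mulr_ge0; [exact: ltW|apply: mulr_ge0 => //; exact: wplus_ge0].
have [s1|s1] := ltP 1 s.
  rewrite difference_green // ler_pM2l //.
  have [i1 ->] := riesz_op_fold M hn nu1 s0 sn e1 l01 x1 cF Fa.
  have [i2 ->] := riesz_op_phiw CF x1.
  apply: (E_le_off hn nu1 x1 i1 i2) => y y1 xy.
  case: (ltP 0 (hh y)) => hy; last by rewrite /wplus (le_gtF hy) !mulr0.
  have [k0 _] := fold_kernel_bounds s0 sn e1 l01 x1 y1 hx hy xy.
  rewrite mulr1 ler_pM2l // /wplus hy mulr1.
  have [w0|w0] := ltP 0 (w y); first exact: FC.
  rewrite mulr0 subr_le0; have [h _] := reflect_v_ge y1 hy.
  by apply: le_trans h; apply: gmono => //; [exact: upos|rewrite -subr_le0].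
pose f x := F x - phiw CF x.
have cphi := @sph_continuous_phiw CF.
have cf : sph_continuous f by exact: sph_continuousB.
have phia : antisym e l beta (phiw CF) := antisym_reflect beta (fun y => CF * wplus y).
have fa : antisym e l beta f by move=> y y1; rewrite /f mulrBr Fa // phia //; ring.
have Af y : dot y y = 1 -> A f y = A F y - A (phiw CF) y.
  by move=> y1; exact: (riesz_opB M hn nu1 s0 sn y1 cF cphi).
rewrite leNgt; apply/negP => Hx.
have Afx : 0 < A f x by rewrite Af // subr_gt0 -(ltr_pM2l c10) -difference_green.
have [c c0 fc] := sph_continuous_bounded cf.
have cA := sph_continuous_riesz_op hn nu1 s0 sn (@mes_cont R n M f cf) fc.
have Aa := riesz_op_antisym M hn nu1 s0 sn e1 l01 cf fa.
have chh : sph_continuous hh by exact: sph_continuous_height.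
have cD : sph_continuous (fun y => A f y * (0 < hh y)%R%:R).
  by apply: sph_continuous_cut => // y y1 hy; exact: (antisym_eq0 e1 l01 Aa y1 hy).
(* At a positive maximum of A f over the cap, A F is positive too because A([phiw]) >= 0. Hence w >
   0 near that point, where f <= 0: this contradicts the maximum principle with c = 0. *)
have [x0 x01 Hm] := sph_continuous_max cD.
have [hx0 Dx Hm'] := @cut_max (fun y => A f y) hh x0 Hm x x1 hx Afx.
have A0 : 0 < A f x0 by apply: lt_le_trans Dx.
have w0 : 0 < w x0.
  rewrite difference_green // mulr_gt0 //; apply: lt_le_trans A0 _; rewrite Af // gerBl; exact: pos.
have wp0 : 0 < wplus x0 by rewrite /wplus hx0 mulr1 lt_max w0.
have [del del0 Hd] := sph_continuous_near sph_continuous_wplus x01 wp0.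
have MP := @maximum_principle R n M nu s hn nu1 s0 sn x0 x01 e l e1 l01 f 0 del s1 cf fa hx0.
apply: MP (ltW A0) (lexx 0) del0 _ (or_introl A0).
- exact: Hm'.
- move=> y y1 yd; rewrite oppr0.
  have wy : 0 < wplus y.
    exact: gt0_near (Hd y y1 yd).
  have hy : 0 < hh y.
    by rewrite ltNge; apply/negP => h; move: wy; rewrite /wplus (le_gtF h) mulr0 ltxx.
  have wy' : 0 < w y by move: wy; rewrite /wplus hy mulr1 lt_max ltxx orbF.
  rewrite /f subr_le0 phiw_cut // /wplus hy mulr1 max_l ?(ltW wy') //.
  exact: FC.
Qed.

(** If s <= 1, a zero of w is a maximum of A F where F < 0, since v_l > g(u_l) = g(u) there; the
    maximum principle with c > 0 forbids it. If s > 1, monotonicity gives F < 0 on the whole cap and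
    w is the integral of F against a positive kernel. *)
Lemma strict_negative x : 0 < l -> (forall y, dot y y = 1 -> 0 < hh y -> w y <= 0) ->
  dot x x = 1 -> 0 < hh x -> w x < 0.
Proof.
move=> l0 wn x1 hx.
have cF : sph_continuous F by apply: sph_continuousB => //; exact: sph_continuous_reflect.
have Fa : antisym e l beta F := antisym_reflect beta v.
have [s1|s1] := ltP 1 s; last first.
  rewrite ltNge; apply/negP => wx.
  have wx0 : w x = 0 by apply/eqP; rewrite eq_le wn.
  have AF y : dot y y = 1 -> A F y = c1^-1 * w y by move=> y1; rewrite difference_green // mulKf // lt0r_neq0.
  have Fx : F x < 0.
    have [_ h] := reflect_v_ge x1 hx; rewrite subr_lt0; apply: le_lt_trans (h l0).
    by have -> : u x = ul x by apply/eqP; rewrite -subr_eq0 wx0.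
  pose c := - F x / 2; have c0 : 0 < c by rewrite divr_gt0 // oppr_gt0.
  have [del del0 Hd] := sph_continuous_near cF x1 c0.
  have MP := @maximum_principle R n M nu s hn nu1 s0 sn x x1 e l e1 l01 F c del s1 cF Fa hx.
  apply: MP (ltW c0) del0 _ (or_intror c0).
  - by move=> y y1 hy; rewrite !AF // wx0 mulr0 pmulr_rle0 ?invr_gt0 // wn.
  - by rewrite AF // wx0 mulr0.
  - move=> y y1 yd; exact: le_near_half (Hd y y1 yd).
have Fneg y : dot y y = 1 -> 0 < hh y -> F y < 0.
  move=> y1 hy; have [_ h] := reflect_v_ge y1 hy; rewrite subr_lt0; apply: le_lt_trans (h l0).
  by apply: gmono => //; [exact: upos|rewrite -subr_le0 wn].
rewrite difference_green // pmulr_rlt0 //.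
have [i1 ->] := riesz_op_fold M hn nu1 s0 sn e1 l01 x1 cF Fa.
have L0 := one_sub_sqr_gt0 l01.
pose b y := Num.max 0 (gapb e l x y).
have cb : sph_continuous b.
  apply: sph_continuous_max2; first exact: sph_continuous_cst.
  have c4 : sph_continuous (fun y => 4 * hh x * hh y).
    by apply: sph_continuousM; [exact: sph_continuous_cst|exact: sph_continuous_height].
  exact: (sph_continuousM c4 (@sph_continuous_cst R n (1 - l ^+ 2)^-1)).
have b0 y : 0 <= b y by rewrite le_max lexx.
have bhx y : 0 < hh y -> b y = gapb e l x y.
  by move=> hy; rewrite /b max_r // /gapb divr_ge0 ?(ltW L0) // !mulr_ge0 // ltW.
have bpos y : dot y y = 1 -> 0 < 2 - 2 * dot x y + b y / 2 /\ 0 < 2 - 2 * dot x y + b y.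
  move=> y1; have /andP[_ h] := dot_le x1 y1.
  have [xy|xy] := eqVneq (dot x y) 1.
    have -> : y = x by rewrite (dot_eq1 x1 y1 xy).
    rewrite x1 mulr1 subrr !add0r bhx // /gapb; split; rewrite ?divr_gt0 ?mulr_gt0 //.
  have h2 : dot x y < 1 by rewrite lt_neqAle xy h.
  by move: (b y) (b0 y) (dot x y) h2 => t t0 d d1; split; lra.
(* A continuous minorant of the folded kernel times -F: replacing the singular a^(-p) by (a +
   b/2)^(-p) keeps a positive gap, also at y = x, so [E_gt0] gives a strict inequality. *)
pose psi y := ((2 - 2 * dot x y + b y / 2) `^ (- p) - (2 - 2 * dot x y + b y) `^ (- p)) * Num.max 0 (0 - F y).
have cdot : sph_continuous (fun y => 2 - 2 * dot x y).
  by apply: sph_continuousB; [exact: sph_continuous_cst|apply: sph_continuousM; [exact: sph_continuous_cst|exact: sph_continuous_dot]].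
have cpsi : sph_continuous psi.
  apply: sph_continuousM.
    apply: sph_continuousB; apply: sph_continuous_powR.
    - apply: sph_continuousD => //; apply: sph_continuousM => //; exact: sph_continuous_cst.
    - by move=> y y1; have [] := bpos y y1.
    - exact: sph_continuousD.
    - by move=> y y1; have [] := bpos y y1.
  apply: sph_continuous_max2; first exact: sph_continuous_cst.
  by apply: sph_continuousB => //; exact: sph_continuous_cst.
have anti (a c : R) : 0 < a -> a <= c -> c `^ (- p) <= a `^ (- p).
  move=> a0 ac; have c0 := lt_le_trans a0 ac.
  rewrite !powRN lef_pV2 ?posrE ?powR_gt0 //.
  by apply: (ge0_ler_powR (ltW p0)); rewrite ?nnegrE ?(ltW a0) ?(ltW c0).
have psi0 y : dot y y = 1 -> 0 <= psi y.
  move=> y1; have [h1 h2] := bpos y y1; apply: mulr_ge0; last by rewrite le_max lexx.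
  by rewrite subr_ge0; apply: anti => //; move: (b y) (b0 y) => t t0; lra.
have psix : 0 < psi x.
  have Fx := Fneg x x1 hx; have [h1 h2] := bpos x x1.
  have bx : 0 < b x by rewrite bhx // /gapb divr_gt0 // !mulr_gt0.
  apply: mulr_gt0; last by rewrite lt_max sub0r oppr_gt0 Fx orbT.
  rewrite subr_gt0 !powRN ltf_pV2 ?posrE ?powR_gt0 //.
  by apply: (gt0_ltr_powR p0); rewrite ?nnegrE ?(ltW h1) ?(ltW h2) //; move: (b x) bx => t t0; lra.
have ipsi := itg_cont M cpsi.
have Epsi := E_gt0 M hn nu1 cpsi x1 psi0 psix.
suff h : E M (fun y => fold_kernel nu s e l x y * (F y * (0 < hh y)%R%:R)) <= - 1 * E M psi.
  by apply: le_lt_trans h _; rewrite mulN1r oppr_lt0.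
rewrite -(EZ (- 1) ipsi); apply: (E_le_off hn nu1 x1 i1 (itgZ _ ipsi)) => y y1 xy.
have /andP[_ h] := dot_le x1 y1.
have h2 : 0 < 2 - 2 * dot x y by have h2 : dot x y < 1; [by rewrite lt_neqAle xy h|lra].
case: (ltP 0 (hh y)) => hy; last first.
  rewrite !mulr0 /psi; have -> : b y = 0.
    by rewrite /b max_l // /gapb pmulr_lle0 ?invr_gt0 // pmulr_rle0 // mulr_gt0.
  by rewrite mul0r !addr0 subrr mul0r mulr0.
have Fy := Fneg y y1 hy.
rewrite mulr1 (fold_kernelE nu s e1 l01 x1 y1 hx hy) /psi bhx // sub0r max_r ?oppr_ge0 ?(ltW Fy) //.
have g0 : 0 < gapb e l x y by rewrite /gapb divr_gt0 // !mulr_gt0.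
have {}k1 : (2 - 2 * dot x y + gapb e l x y / 2) `^ (- p) <= riesz nu s (dot x y) by apply: anti => //; move: (gapb e l x y) g0 => t t0; lra.
move: (riesz nu s (dot x y)) ((2 - 2 * dot x y + gapb e l x y / 2) `^ (- p)) ((2 - 2 * dot x y + gapb e l x y) `^ (- p)) (F y) k1 Fy => a1 a2 a3 Fy k1 Fy0; nra.
Qed.

End OnePlane.

(** Where u > u_l one has u > u(Phi), so the profile at u is at most the profile at u(Phi), itself
    at most H. Hence F <= H (u^q - u_l^q), and Bernoulli with the bounds 0 < um <= u <= UM makes
    this linear in u - u_l, uniformly in e and l. *)
Lemma nonlinear_bound : exists2 CF, 0 <= CF & forall e l, dot e e = 1 -> 0 <= l < 1 ->
  forall x, dot x x = 1 -> 0 < height e l x -> 0 < u x - reflect p u e l x ->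
  g (u x) - reflect beta v e l x <= CF * (u x - reflect p u e l x).
Proof.
have [um [UM [um0 uB]]] := range_bounds; have [H H0 HB] := profile_bounded.
exists (H * (UM `^ q * q / um)).
  by rewrite mulr_ge0 // divr_ge0 ?(ltW um0) // mulr_ge0 ?powR_ge0 // ltW.
move=> e l e1 l01 x x1 hx wx; have x1' := inversion_unit e1 l01 x1.
have ux := upos x1; have r1 := inv_rho_ge1 e1 l01 x1 hx; have ulx := reflect_pos e1 l01 x1.
have /andP[ub1 ub2] := uB x x1; have /andP[ub3 ub4] := uB _ x1'.
have lu : reflect p u e l x < u x by rewrite -subr_gt0.
have ul_um : um <= reflect p u e l x.
  apply: le_trans ub3 _; rewrite /reflect ler_peMl ?(ltW (upos x1')) //.
  have := ge0_ler_powR (ltW p0) (_ : 1 \in Num.nneg) (_ : inv_rho e l x \in Num.nneg) r1.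
  by rewrite powR1; apply; rewrite nnegrE // (le_trans ler01 r1).
have tau_ul : u (inversion e l x) <= reflect p u e l x.
  rewrite /reflect ler_peMl ?(ltW (upos x1')) //.
  have := ge0_ler_powR (ltW p0) (_ : 1 \in Num.nneg) (_ : inv_rho e l x \in Num.nneg) r1.
  by rewrite powR1; apply; rewrite nnegrE // (le_trans ler01 r1).
rewrite reflect_vE // {1}(g_profile ux).
set hx1 := u x `^ (- q) * g (u x); set hx2 := u (inversion e l x) `^ (- q) * _.
have h12 : hx1 <= hx2 by apply: ltW; apply: hdec; [exact: upos|exact: le_lt_trans lu].
have h2H : hx2 <= H by exact: HB.
move: (reflect p u e l x) ulx lu ul_um => t t0 tu umt {wx tau_ul}.
have uq0 : 0 <= u x `^ q by exact: powR_ge0.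
have tq : t `^ q <= u x `^ q by apply: (ge0_ler_powR (ltW q0)); rewrite ?nnegrE ?(ltW t0) ?(ltW ux) ?(ltW tu).
have D : u x `^ q - t `^ q <= UM `^ q * q / um * (u x - t).
  have y0 : 0 <= (u x - t) / t by rewrite divr_ge0 ?subr_ge0 ?(ltW tu) ?(ltW t0).
  have B := bernoulli_powR y0 (ltW q0).
  have E1 : u x = t * (1 + (u x - t) / t) by field; exact: lt0r_neq0.
  have E2 : t `^ q = u x `^ q * (1 + (u x - t) / t) `^ (- q).
    have z0 : 0 < 1 + (u x - t) / t by rewrite ltr_pwDl.
    by rewrite {1}E1 powRM ?(ltW t0) ?(ltW z0) // -mulrA -powRD ?(lt0r_neq0 z0) ?implybT // subrr powRr0 mulr1.
  have -> : u x `^ q - t `^ q = u x `^ q * (1 - (1 + (u x - t) / t) `^ (- q)) by rewrite E2; ring.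
  apply: (@le_trans _ _ (UM `^ q * (q * ((u x - t) / um)))); last first.
    by rewrite le_eqVlt; apply/orP; left; apply/eqP; ring.
  apply: ler_pM => //.
  - have z1' : 1 <= 1 + (u x - t) / t by rewrite lerDl.
    have z1 := ler_powR z1' (ltW q0); rewrite powRr0 in z1.
    by rewrite subr_ge0 powRN invf_le1 // (lt_le_trans ltr01 z1).
  - by apply: (ge0_ler_powR (ltW q0)); rewrite ?nnegrE ?(ltW ux) // (le_trans (ltW ux) ub2).
  - apply: le_trans B _; rewrite ler_wpM2l ?(ltW q0) // ler_wpM2l ?subr_ge0 ?(ltW tu) //.
    by rewrite lef_pV2.
apply: (@le_trans _ _ (H * (u x `^ q - t `^ q))); last by rewrite -mulrA ler_wpM2l.
move: (u x `^ q) (t `^ q) uq0 tq (powR_ge0 t q : 0 <= t `^ q) => a b a0 ba b0.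
have k1 : a * hx1 <= a * hx2 by rewrite ler_wpM2l.
have k2 : (a - b) * hx2 <= (a - b) * H by rewrite ler_wpM2l // subr_ge0.
nra.
Qed.

(** At a maximum point of w^+ only the strip of height below eta contributes to A([phiw]). There the
    folded kernel has mass of order eta^gap_exp, so max w^+ <= (1/2) max w^+, uniformly in e and
    l. *)
Lemma narrow_region : exists2 eta, 0 < eta & forall e l, dot e e = 1 -> 0 <= l < 1 ->
  (forall x, dot x x = 1 -> eta <= height e l x -> u x <= reflect p u e l x) ->
  forall x, dot x x = 1 -> 0 < height e l x -> u x <= reflect p u e l x.
Proof.
have [CF CF0 HCF] := nonlinear_bound.
have [/andP[g0 g1] _] := gap_exp_bounds s0.
have h2 : 0 < 2^-1 :> R by rewrite invr_gt0.
have [eps eps0 He] := powR_small (c1 * CF * (p + 1) * gap_mean nu s) h2 g0.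
(* [fold_kernel_bounds] involves 4 h(y), which is below eps in the strip. *)
exists (eps / 4); first by rewrite divr_gt0.
move=> e l e1 l01 Hfar x x1 hx; rewrite leNgt; apply/negP => wx.
have [x0 x01 Hm] := sph_continuous_max (sph_continuous_wplus e1 l01).
set m := wplus e l x0 in Hm.
have m0 : 0 < m.
  by apply: lt_le_trans (Hm x x1); rewrite /wplus hx mulr1 lt_max subr_gt0 wx.
have hx0 : 0 < height e l x0.
  by rewrite ltNge; apply/negP => h; move: m0; rewrite /m /wplus (le_gtF h) mulr0 ltxx.
have mE : m = u x0 - reflect p u e l x0.
  have h : 0 < u x0 - reflect p u e l x0 by move: m0; rewrite /m /wplus hx0 mulr1 lt_max ltxx orbF.
  by rewrite /m /wplus hx0 mulr1 max_l // ltW.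
have C1 := gap_bound e1 l01 (HCF e l e1 l01) CF0 x01 hx0.
have [i Ei] := riesz_op_phiw e1 l01 CF x01.
have [ig Eg] := itg_gap M hn nu1 s0 sn x01.
have C2 : A (phiw e l CF) x0 <= CF * m * (p + 1) * eps `^ gap_exp s * gap_mean nu s.
  rewrite Ei -Eg -(EZ _ ig); apply: (E_le_off hn nu1 x01 i (itgZ _ ig)) => y y1 xy.
  have rg := riesz_ge0 nu (s - gap_exp s) (dot x0 y).
  have p10 : 0 <= p + 1 by move: p0; lra.
  have R0 : 0 <= CF * m * (p + 1) * eps `^ gap_exp s * riesz nu (s - gap_exp s) (dot x0 y).
    apply: mulr_ge0 => //; apply: mulr_ge0; last exact: powR_ge0.
    by apply: mulr_ge0 => //; apply: mulr_ge0 => //; exact: ltW.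
  case: (ltP 0 (height e l y)) => hy; last by rewrite /wplus (le_gtF hy) !mulr0.
  have [ly|ly] := leP (eps / 4) (height e l y).
    have := Hfar y y1 ly; rewrite -subr_le0 => wy.
    by rewrite /wplus max_r // mul0r !mulr0.
  have [k0 k1] := fold_kernel_bounds s0 sn e1 l01 x01 y1 hx0 hy xy.
  have k2 : (4 * height e l y) `^ gap_exp s <= eps `^ gap_exp s.
    by apply: (ge0_ler_powR (ltW g0)); rewrite ?nnegrE ?(ltW eps0) ?mulr_ge0 ?(ltW hy) //; lra.
  have wm := Hm y y1; have w0 := wplus_ge0 e l y.
  have k3 : fold_kernel nu s e l x0 y <= (p + 1) * eps `^ gap_exp s * riesz nu (s - gap_exp s) (dot x0 y).
    by apply: le_trans k1 _; rewrite ler_wpM2r // ler_wpM2l.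
  apply: (@le_trans _ _ ((p + 1) * eps `^ gap_exp s * riesz nu (s - gap_exp s) (dot x0 y) * (CF * m))).
    by apply: ler_pM; [exact: ltW|exact: mulr_ge0|exact: k3|exact: ler_wpM2l].
  by rewrite le_eqVlt; apply/orP; left; apply/eqP; ring.
have : m <= 2^-1 * m.
  rewrite {1}mE; apply: le_trans C1 _.
  apply: (@le_trans _ _ (c1 * (CF * m * (p + 1) * eps `^ gap_exp s * gap_mean nu s))); first by rewrite ler_pM2l.
  by apply: le_trans (ler_wpM2r (ltW m0) He); rewrite le_eqVlt; apply/orP; left; apply/eqP; ring.
move: m0; lra.
Qed.

End MovingPlanes.

(** * Continuation in the level and constancy of the solution *)

Section Conclusion.
Variables (R : realType) (n : nat) (M : uniform_point R n) (nu s : R).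
Hypotheses (hn : n%:R = 2 * nu + 1) (nu1 : 1 <= nu) (s0 : 0 < s) (sn : 2 * s < 2 * nu + 1).
Local Notation vec := 'rV[R]_n.+1.
Local Notation p := (nu + 2^-1 - s).
Local Notation beta := (nu + 2^-1 + s).
Local Notation A := (riesz_op M nu s).
Local Notation q := (beta / p).

Variables (g : R -> R) (u : vec -> R) (c1 : R).
Hypotheses (cu : sph_continuous u) (cv : sph_continuous (fun x => g (u x)))
  (upos : forall x, dot x x = 1 -> 0 < u x) (c10 : 0 < c1)
  (hdec : forall t1 t2 : R, 0 < t1 -> t1 < t2 -> t2 `^ (- q) * g t2 < t1 `^ (- q) * g t1)
  (gmono : 1 < s -> forall t1 t2 : R, 0 < t1 -> t1 <= t2 -> g t1 <= g t2)
  (green : forall z, dot z z = 1 -> u z = c1 * A (fun x => g (u x)) z).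

Section Direction.
Variable e : vec.
Hypothesis e1 : dot e e = 1.

(** u - u_l extended off the sphere by [normalize], so that joint continuity in the point and the
    level can be stated on the full product space. *)
Definition plane_gap (z : vec * R) : R :=
  u (normalize z.1) - inv_rho e z.2 (normalize z.1) `^ p * u (normalize (inversion e z.2 (normalize z.1))).

Lemma plane_gapE x l : dot x x = 1 -> 0 <= l < 1 -> plane_gap (x, l) = u x - reflect p u e l x.
Proof.
by move=> x1 l01; rewrite /plane_gap /= !(normalize_id x1) normalize_id //; exact: inversion_unit.
Qed.

Lemma plane_gap_continuous (x : vec) (L : R) : dot x x = 1 -> 0 <= L < 1 -> {for (x, L), continuous plane_gap}.
Proof.
move=> x1 L01; have x0 := sphere_neq0 x1.
have c1' : {for (x, L), continuous (fun z : vec * R => normalize z.1)}.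
  by apply: (@continuous_comp _ _ _ fst (@normalize R n.+1)); [exact: cvg_fst|exact: normalize_continuous].
have c2 : {for (x, L), continuous (fun z : vec * R => z.2)} by exact: cvg_snd.
have c3 : {for (x, L), continuous (fun z : vec * R => dot e (normalize z.1))}.
  by apply: (@continuous_comp _ _ _ (fun z : vec * R => normalize z.1) (dot e)); [exact: c1'|exact: dot_continuous].
have k (r : R) : {for (x, L), continuous (fun _ : vec * R => r)} by exact: cst_continuous.
have ke : {for (x, L), continuous (fun _ : vec * R => e)} by exact: cst_continuous.
have cq : {for (x, L), continuous (fun z : vec * R => inv_q e z.2 (normalize z.1))}.
  have c4 := continuousD (continuousB (k 1) (continuousM (continuousM (k 2) c2) c3)) (continuousM c2 c2).
  by rewrite (_ : (fun z : vec * R => _) = (fun z => 1 - 2 * z.2 * dot e (normalize z.1) + z.2 * z.2)) //; apply/funext => z; rewrite /inv_q expr2.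
have q0 : inv_q e L (normalize x) != 0 by rewrite normalize_id //; apply: lt0r_neq0; exact: inv_q_gt0.
have cqV : {for (x, L), continuous (fun z : vec * R => (inv_q e z.2 (normalize z.1))^-1)}.
  by apply: cvgV; [exact: q0|exact: cq].
have cr : {for (x, L), continuous (fun z : vec * R => inv_rho e z.2 (normalize z.1))}.
  have c4 := continuousM (continuousB (k 1) (continuousM c2 c2)) cqV.
  by rewrite (_ : (fun z : vec * R => _) = (fun z => (1 - z.2 * z.2) * (inv_q e z.2 (normalize z.1))^-1)) //; apply/funext => z; rewrite /inv_rho expr2.
have ch : {for (x, L), continuous (fun z : vec * R => 2 * height e z.2 (normalize z.1) / inv_q e z.2 (normalize z.1))}.
  exact: (continuousM (continuousM (k 2) (continuousB c3 c2)) cqV).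
have ci : {for (x, L), continuous (fun z : vec * R => inversion e z.2 (normalize z.1))}.
  exact: (continuousB (continuousZ cr c1') (continuousZ ch ke)).
have crp : {for (x, L), continuous (fun z : vec * R => inv_rho e z.2 (normalize z.1) `^ p)}.
  apply: (@continuous_comp _ _ _ (fun z : vec * R => inv_rho e z.2 (normalize z.1)) (fun t : R => t `^ p)); first exact: cr.
  by apply: powR_continuous; rewrite /= normalize_id //; exact: inv_rho_gt0.
have cu1 : {for (x, L), continuous (fun z : vec * R => u (normalize z.1))}.
  by apply: (@continuous_comp _ _ _ fst (fun y => u (normalize y))); [exact: cvg_fst|exact: cu].
have cu2 : {for (x, L), continuous (fun z : vec * R => u (normalize (inversion e z.2 (normalize z.1))))}.
  apply: (@continuous_comp _ _ _ (fun z : vec * R => inversion e z.2 (normalize z.1)) (fun y => u (normalize y))); first exact: ci.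
  by apply: cu; rewrite /= normalize_id //; apply: sphere_neq0; exact: inversion_unit.
exact: (continuousB cu1 (continuousM crp cu2)).
Qed.

Definition good (l : R) : Prop := forall x, dot x x = 1 -> 0 < height e l x -> u x <= reflect p u e l x.

(** A point strictly above level L stays above slightly larger levels, so the inequality passes to
    the limit by joint continuity. *)
Lemma good_closed (L : R) : 0 <= L < 1 -> (forall l, L < l < 1 -> good l) -> good L.
Proof.
move=> L01 H x x1 hx; have /andP[L0 L1] := L01; have /andP[_ ex1] := dot_le e1 x1.
rewrite leNgt; apply/negP; rewrite -subr_gt0 -plane_gapE // => W0.
have /cvgrPdist_lt /(_ _ W0) /nbhs_ballP[d /= d0 Hd] := plane_gap_continuous x1 L01.
move: hx; rewrite /height => hx.
pose t := Num.min (d / 2) ((dot e x - L) / 2).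
have t0 : 0 < t by rewrite lt_min !divr_gt0.
have td : t <= d / 2 by rewrite ge_min lexx.
have te : t <= (dot e x - L) / 2 by rewrite ge_min lexx orbT.
have lL : L < L + t < 1 by apply/andP; split; lra.
have l01 : 0 <= L + t < 1 by apply/andP; split; lra.
have hl : 0 < height e (L + t) x by rewrite /height; lra.
have := H _ lL x x1 hl; rewrite -subr_le0 -plane_gapE // => W1.
have B : ball L d (L + t) by rewrite /ball /= opprD addNKr normrN ger0_norm ?(ltW t0) //; lra.
have := Hd (x, L + t) (conj (ballxx _ d0) B) => /= h.
have := ler_norm (plane_gap (x, L) - plane_gap (x, L + t)).
by move: (plane_gap (x, L)) (plane_gap (x, L + t)) h W1 => a b; lra.
Qed.

(** Strict negativity at level L persists for nearby levels on the compact part away from the slice;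
    the remaining strip is covered by [narrow_region]. *)
Lemma good_open (L : R) : 0 < L < 1 -> good L -> exists2 d, 0 < d & forall l, 0 <= l < 1 -> `|L - l| < d -> good l.
Proof.
move=> /andP[L0 L1] gL; have L01 : 0 <= L < 1 by rewrite ltW.
have [eta eta0 Heta] := narrow_region hn nu1 s0 sn cu cv upos c10 hdec gmono green.
(* Points at height at least eta/2 above level L; for |L - l| < eta/2 it contains every point at
   height at least eta above level l. *)
pose K := (sphere n : set vec) `&` (dot e @^-1` [set y | eta / 2 + L <= y]).
have cK : compact K.
  apply: compact_closedI; first exact: sphere_compact.
  apply: preimage_closed; last exact: closed_ge.
  by move=> x _; exact: dot_continuous.
have aux (a b : R) : `|a - b| < - a -> b < 0.
  by rewrite distrC => h; have := ler_norm (b - a); lra.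
have Kn x : K x -> \forall x' \near x & l \near L, plane_gap (x', l) < 0.
  move=> [/sphereP x1 /= hx].
  have W0 : plane_gap (x, L) < 0.
    rewrite plane_gapE //.
    apply: (strict_negative hn nu1 s0 sn cv upos c10 hdec gmono green e1 L01 L0) => //.
      by move=> y y1 hy; rewrite subr_le0; exact: gL.
    by rewrite /height; move: (dot e x) hx => t; lra.
  have W0' : 0 < - plane_gap (x, L) by rewrite oppr_gt0.
  have /cvgrPdist_lt /(_ _ W0') /nbhs_ballP[d /= d0 Hd] := plane_gap_continuous x1 L01.
  exists (ball x d, ball L d); first by split; exact: nbhsx_ballx.
  by move=> [y l] [/= By Bl]; exact: aux (Hd (y, l) (conj By Bl)).
have HN : nbhs L (fun l => K `<=` (fun x => plane_gap (x, l) < 0)) :=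
  (compact_near_coveringP K).1 cK _ (nbhs L) (fun l x => plane_gap (x, l) < 0) (nbhs_filter L) Kn.
have [d /= d0 Hd] : exists2 d : R, 0 < d & ball L d `<=` (fun l => K `<=` (fun x => plane_gap (x, l) < 0)).
  by have [d d0 Hd] := (@nbhs_ballP R R^o L _).1 HN; exists d.
exists (Num.min d (eta / 2)); first by rewrite lt_min d0 divr_gt0.
move=> l l01; rewrite lt_min => /andP[ld le]; apply: Heta => // x x1 hx.
have Kx : K x.
  split; first exact/sphereP.
  have h := ler_norm (L - l); rewrite /=; move: hx; rewrite /height; move: (dot e x) => t; lra.
by have := Hd l ld x Kx; rewrite plane_gapE // subr_lt0 => /ltW.
Qed.

(** Let L be the supremum of the bad levels. For l > 1 - eta no point of the sphere has height eta
    above l, so [narrow_region] gives L <= 1 - eta. L is good by closedness, hence so are all levels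
    near it, contradicting the choice of L. *)
Lemma good_all (l : R) : 0 < l < 1 -> good l.
Proof.
move=> l01; apply: contrapT => nl.
have [eta eta0 Heta] := narrow_region hn nu1 s0 sn cu cv upos c10 hdec gmono green.
pose B := [set l : R | 0 < l < 1 /\ ~ good l].
have Bn : B !=set0 by exists l.
have Bub : ubound B (1 - eta).
  move=> t [/andP[t0 t1] nt]; rewrite leNgt; apply/negP => th; apply: nt.
  have t01 : 0 <= t < 1 by rewrite ltW.
  apply: Heta => // x x1 hx; have /andP[_ ex] := dot_le e1 x1.
  by move: hx; rewrite /height; lra.
have hB : has_sup B by split => //; exists (1 - eta).
pose L := sup B.
have Ll : l <= L by apply: ub_le_sup => //; exists (1 - eta).
have Le : L <= 1 - eta by apply: ge_sup.
have /andP[l0 l1] := l01.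
have L01 : 0 < L < 1 by apply/andP; split; lra.
have L01' : 0 <= L < 1 by have /andP[h1 h2] := L01; rewrite ltW.
have gL : good L.
  apply: good_closed => // t /andP[t0 t1]; apply: contrapT => nt.
  have : t <= L by apply: ub_le_sup; [exists (1 - eta)|split => //; apply/andP; split; lra].
  lra.
have [d d0 Hd] := good_open L01 gL.
have [t [/andP[t0 t1] nt] tL] := sup_adherent d0 hB.
have tL' : t <= L by apply: ub_le_sup; [exists (1 - eta)|split => //; apply/andP].
apply: nt; apply: Hd; first by rewrite ltW.
rewrite ger0_norm ?subr_ge0 //; move: tL; rewrite -/L; lra.
Qed.

Lemma good0 : good 0.
Proof. by apply: good_closed; [rewrite lexx ltr01|exact: good_all]. Qed.

End Direction.

(** At level 0 with e in the direction of x - y, the inversion is the reflection exchanging x and y,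
    with conformal factor 1, and x lies in the upper cap. *)
Lemma reflection_swap (x y : vec) : dot x x = 1 -> dot y y = 1 -> x != y -> u x <= u y.
Proof.
move=> x1 y1 xy; have xy0 : x - y != 0 by rewrite subr_eq0.
have d0 := dot_gt0 xy0; set e := normalize (x - y).
have e1 : dot e e = 1 by exact: dot_normalize_self.
have N0 := enorm_gt0 xy0; have NE := enorm_sqr (x - y).
have DE : dot (x - y) (x - y) = 2 * (1 - dot x y).
  by rewrite !(dotBl, dotBr) x1 y1 (dotC y x); ring.
have ex : dot e x = (1 - dot x y) / enorm (x - y).
  by rewrite dotC dot_normalize dotBr x1.
have ex0 : 0 < dot e x by rewrite ex divr_gt0 //; move: d0; rewrite DE; lra.
have l01 : 0 <= (0 : R) < 1 by rewrite lexx ltr01.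
have hx : 0 < height e 0 x by rewrite /height subr0.
have := good0 e1 x1 hx; rewrite /reflect.
have q1 : inv_q e 0 x = 1 by rewrite /inv_q; ring.
have r1 : inv_rho e 0 x = 1 by rewrite /inv_rho q1; field.
have -> : inversion e 0 x = y.
  rewrite /inversion r1 q1 scale1r /height subr0 divr1 ex.
  rewrite /e /normalize scalerA.
  rewrite [X in X *: _](_ : _ = 1); first by rewrite scale1r opprB addrC subrK.
  have En := lt0r_neq0 N0.
  have -> : 2 * ((1 - dot x y) / enorm (x - y)) * (enorm (x - y))^-1 = (2 * (1 - dot x y)) / enorm (x - y) ^+ 2.
    by field.
  by rewrite NE DE mulfV // -DE lt0r_neq0.
by rewrite r1 powR1 mul1r.
Qed.

Lemma solution_constant : exists c, forall x, dot x x = 1 -> u x = c.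
Proof.
have e1 := dot_ebasis R (ord0 : 'I_n.+1); exists (u (ebasis R ord0)) => x x1.
have [->//|xe] := eqVneq x (ebasis R ord0).
by apply/eqP; rewrite eq_le reflection_swap //= reflection_swap // eq_sym.
Qed.

End Conclusion.

(** * Constancy for the given equation and the power nonlinearity *)

Section MainTheorem.
Variables (R : realType) (n : nat) (s : R).
Hypotheses (n3 : (3 <= n)%N) (s0 : 0 < s) (sn : s < n%:R / 2).
Local Notation nu := ((n%:R - 1) / 2 : R).
Local Notation q := ((n%:R + 2 * s) / (n%:R - 2 * s)).

Let hn : n%:R = 2 * nu + 1. Proof. by field. Qed.
Let nu1 : 1 <= nu.
Proof. have h : (3%:R : R) <= n%:R by rewrite ler_nat. by rewrite ler_pdivlMr //; lra. Qed.
Let sn' : 2 * s < 2 * nu + 1. Proof. by rewrite -hn; move: sn; lra. Qed.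

Lemma positive_solution_constant (f : R -> R) (u : 'rV[R]_n.+1 -> R) :
  (forall t : R, 0 < t -> {for t, continuous f}) ->
  (forall t1 t2 : R, 0 < t1 -> t1 < t2 ->
     t2 `^ (- q) * (f t2 + dns n s * t2) < t1 `^ (- q) * (f t1 + dns n s * t1)) ->
  (1 < s -> forall t1 t2 : R, 0 < t1 -> t1 <= t2 ->
     f t1 + dns n s * t1 <= f t2 + dns n s * t2) ->
  pos_cont_solution n s f u -> exists c, forall x, dot x x = 1 -> u x = c.
Proof.
move=> cf hdec gmono [cu [upos sol]].
have [M _] := uniform_point_exists R n.
have {}cu := within_sph_continuous cu.
have {}upos x : dot x x = 1 -> 0 < u x by move=> /sphereP; exact: upos.
have cfu : sph_continuous (fun x => f (u x)).
  by apply: sph_continuous_app => // x x1; apply: cf; exact: upos.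
pose g t := dns n s * t + f t.
have cgu : sph_continuous (fun x => g (u x)).
  by apply: sph_continuousD => //; apply: sph_continuousM => //; exact: sph_continuous_cst.
have gr := green_representation M hn nu1 s0 sn' cu cfu sol.
have c10 := green_const_gt0 s0 sn'.
have qE : (nu + 2^-1 + s) / (nu + 2^-1 - s) = q.
  by field; apply: lt0r_neq0; move: sn; lra.
apply: (@solution_constant R n M nu s hn nu1 s0 sn' g u _ cu cgu upos c10 _ _ gr).
- by move=> t1 t2 h1 h2; rewrite qE /g ![dns n s * _ + _]addrC; exact: hdec.
- by move=> s1 t1 t2 h1 h2; rewrite /g ![dns n s * _ + _]addrC; exact: gmono.
Qed.

(** Test against the zonal function of degree 0, the constant 1 with eigenvalue 0. Its multiplier is
    d_{n,s}, so the linear terms cancel and f(c) remains. *)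
Lemma constant_solution_root (f : R -> R) (u : 'rV[R]_n.+1 -> R) (c : R) :
  (forall t : R, 0 < t -> {for t, continuous f}) ->
  pos_cont_solution n s f u -> (forall x, dot x x = 1 -> u x = c) -> f c = 0.
Proof.
move=> cf [cu [upos sol]] uc; have [M _] := uniform_point_exists R n.
have {}cu := within_sph_continuous cu.
have cfu : sph_continuous (fun x => f (u x)).
  by apply: sph_continuous_app => // x x1; apply: cf; apply: upos; exact/sphereP.
have cgu : sph_continuous (fun x => dns n s * u x + f (u x)).
  by apply: sph_continuousD => //; apply: sph_continuousM => //; exact: sph_continuous_cst.
set z := ebasis R (ord0 : 'I_n.+1); have z1 : dot z z = 1 := dot_ebasis R ord0.
have g1 x : (geg nu 0).[dot z x] = 1 by rewrite geg0 hornerC.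
have I1 : sphere_int (fun x => u x * (geg nu 0).[dot z x]) = c.
  rewrite (_ : (fun x => _) = u); last by apply/funext => x; rewrite g1 mulr1.
  by rewrite (up_int M cu) -[LHS]/(E M u) (@E_eq R n M u (fun=> c)) ?E_cst.
have I2 : sphere_int (fun x => (dns n s * u x + f (u x)) * (geg nu 0).[dot z x]) = dns n s * c + f c.
  rewrite (_ : (fun x => _) = fun x => dns n s * u x + f (u x)); last by apply/funext => x; rewrite g1 mulr1.
  rewrite (up_int M cgu) -[LHS]/(E M (fun x => dns n s * u x + f (u x))).
  by rewrite (@E_eq R n M _ (fun=> dns n s * c + f c)) ?E_cst // => x x1; rewrite uc.
have := sol _ _ (geg_sph_eigen 0 hn z1).
rewrite I1 I2 (Ps_mult_geg s hn nu1).
have -> : 0%:R + (nu + 2^-1 + s) = n%:R / 2 + s by rewrite mulr0n; field.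
have -> : 0%:R + (nu + 2^-1 - s) = n%:R / 2 - s by rewrite mulr0n; field.
by rewrite -/(dns n s) => /eqP; rewrite -[X in X == _]addr0 (inj_eq (addrI _)) eq_sym => /eqP.
Qed.

End MainTheorem.

Lemma powRN_anti (R : realType) (b t1 t2 : R) : 0 <= b -> 0 < t1 -> t1 < t2 ->
  t2 `^ (- b) <= t1 `^ (- b) /\ (0 < b -> t2 `^ (- b) < t1 `^ (- b)).
Proof.
move=> b0 t10 t12; have t20 := lt_trans t10 t12; rewrite !powRN.
split=> [|b1].
  rewrite lef_pV2 ?posrE ?powR_gt0 //.
  by apply: (ge0_ler_powR b0); rewrite ?nnegrE ?(ltW t10) ?(ltW t20) ?(ltW t12).
rewrite ltf_pV2 ?posrE ?powR_gt0 //.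
by apply: (gt0_ltr_powR b1); rewrite ?nnegrE ?(ltW t10) ?(ltW t20).
Qed.

Theorem theorem1p5 (R : realType) (n : nat) (s : R) :
  (3 <= n)%N -> 0 < s -> s < n%:R / 2 ->
  let q := (n%:R + 2 * s) / (n%:R - 2 * s) in
  (forall f : R -> R,
     {within `]0, +oo[%classic, continuous f} ->
     (forall t1 t2 : R, 0 < t1 -> t1 < t2 ->
        t2 `^ (- q) * (f t2 + dns n s * t2) < t1 `^ (- q) * (f t1 + dns n s * t1)) ->
     (1 < s -> forall t1 t2 : R, 0 < t1 -> t1 <= t2 ->
        f t1 + dns n s * t1 <= f t2 + dns n s * t2) ->
     forall u : 'rV[R]_(n.+1) -> R, pos_cont_solution n s f u ->
       exists c : R, forall x, sphere n x -> u x = c) /\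
  (forall p lambda : R, 1 < p -> 0 < lambda -> p <= q -> lambda <= dns n s ->
     (p < q \/ lambda < dns n s) ->
     forall u : 'rV[R]_(n.+1) -> R,
       pos_cont_solution n s (fun t => t `^ p - lambda * t) u ->
       forall x, sphere n x -> u x = lambda `^ (1 / (p - 1))).
Proof.
move=> n3 s0 sn q; split.
  move=> f cf hdec gm u hu.
  have cf' t : 0 < t -> {for t, continuous f}.
    move=> t0; move: cf; rewrite continuous_open_subspace; last exact: interval_open.
    by apply; rewrite inE /= in_itv /= t0.
  have [c hc] := positive_solution_constant n3 s0 sn cf' hdec gm hu.
  by exists c => x /sphereP; exact: hc.
move=> p la p1 la0 pq ld st u hu x /sphereP x1.
pose f t := t `^ p - la * t.
have cf t : 0 < t -> {for t, continuous f}.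
  move=> t0; apply: continuousB; first exact: powR_continuous.
  by apply: continuousM; [exact: cst_continuous|exact: cvg_id].
have q1 : 1 < q by rewrite /q ltr_pdivlMr; move: sn s0; lra.
(* A sum of two nonincreasing powers with nonnegative coefficients; whichever of p < q and lambda <
   d_{n,s} holds makes one of them strictly decreasing. *)
have fE t : 0 < t -> t `^ (- q) * (f t + dns n s * t) = t `^ (- (q - p)) + (dns n s - la) * t `^ (- (q - 1)).
  move=> t0; rewrite !opprB !powRD ?(lt0r_neq0 t0) ?implybT // powRr1 ?(ltW t0) // /f.
  by move: (t `^ (- q)) (t `^ p) => a b; ring.
have hdec t1 t2 : 0 < t1 -> t1 < t2 ->
    t2 `^ (- q) * (f t2 + dns n s * t2) < t1 `^ (- q) * (f t1 + dns n s * t1).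
  move=> t10 t12; rewrite !fE // ?(lt_trans t10) //.
  have qp0 : 0 <= q - p by rewrite subr_ge0.
  have qm0 : 0 < q - 1 by rewrite subr_gt0.
  have dl0 : 0 <= dns n s - la by rewrite subr_ge0.
  have [A1 A2] := powRN_anti qp0 t10 t12; have [_ B] := powRN_anti (ltW qm0) t10 t12.
  case: st => h.
    by apply: ltr_leD; [apply: A2; rewrite subr_gt0|rewrite ler_wpM2l // ltW // B].
  by apply: ler_ltD => //; rewrite ltr_pM2l ?subr_gt0 // B.
have gm : 1 < s -> forall t1 t2 : R, 0 < t1 -> t1 <= t2 -> f t1 + dns n s * t1 <= f t2 + dns n s * t2.
  move=> _ t1 t2 t10 t12; have t20 := lt_le_trans t10 t12.
  have E t : f t + dns n s * t = t `^ p + (dns n s - la) * t by rewrite /f; ring.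
  rewrite !E lerD // ?ler_wpM2l ?subr_ge0 //.
  by apply: (ge0_ler_powR (ltW (lt_trans ltr01 p1))); rewrite ?nnegrE ?(ltW t10) ?(ltW t20).
have [c hc] := positive_solution_constant n3 s0 sn cf hdec gm hu.
have c0 : 0 < c by rewrite -(hc x x1); case: hu => _ [h _]; apply: h; exact/sphereP.
have fc : f c = 0 := constant_solution_root n3 cf hu hc.
(* The root equation c^p = lambda c, divided by c > 0. *)
have cp : la = c `^ (p - 1).
  rewrite powRD ?(lt0r_neq0 c0) ?implybT // powR_inv1 ?(ltW c0) //.
  by move/eqP: fc; rewrite /f subr_eq0 => /eqP ->; rewrite mulfK ?lt0r_neq0.
have p10 : p - 1 != 0 by rewrite subr_eq0 gt_eqF.
by rewrite (hc x x1) cp -powRrM mul1r mulfV // powRr1 // ltW.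
Qed.
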